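(* Assume that (A1), (A2) are satisfied and that there is $c>0$ such that $\Psi^-(x)\le c(1+|x|)$ for $x\in D$. Then there is at most one variational solution $v$ of the problem $$\begin{cases}L_{BS}v=rv-\Phi(\cdot,v),\quad v\ge\psi\quad\text{in }D,\\ \lim_{t\to\infty}e^{-rt}P_tv(x)=0,\quad x\in D,\end{cases}$$ that is, at most one $v\in H^1_\varrho(D)$ that is a variational solution of the first line (in the sense defined in the context) and satisfies the condition in the second line.
   Context: Setting. Fix $d\ge1$, $r>0$, $\delta_1,\dots,\delta_d\ge0$ and a real $d\times d$ matrix $\sigma$ such that $a=\sigma\sigma^*$ is strictly positive definite. Let $D=\{x\in\mathbb R^d: x_i>0,\ i=1,\dots,d\}$. Let $X$ be the canonical process on $\Omega=C([0,\infty);\mathbb R^d)$ and, for $x\in\mathbb R^d$, let $P_x$ (expectation $E_x$) be the law of the process with components $x_i\exp\big((r-\delta_i-a_{ii}/2)t+\sum_{j=1}^d\sigma_{ij}W^j_t\big)$, $t\ge0$, with $W$ a standard $d$-dimensional Wiener process. $(P_t)_{t>0}$ is the semigroup of $X$: $P_tv(x)=E_xv(X_t)$. (A1): $\psi:\mathbb R^d\to\mathbb R$ is nonnegative, convex and Lipschitz continuous. The functions $\Psi$, $\Phi$. By Alexandrov's theorem there is a Lebesgue-null set $N$ such that the convex function $\psi$ has pointwise first and second order derivatives $\nabla_i\psi(x)$, $\nabla^2_{ij}\psi(x)$ at all $x\in\mathbb R^d\setminus N$. Put $\Psi(x)=-r\psi(x)+\sum_{i=1}^d(r-\delta_i)x_i\nabla_i\psi(x)+\frac12\sum_{i,j=1}^da_{ij}x_ix_j\nabla^2_{ij}\psi(x)$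 for $x\in D\setminus N$ and $\Psi(x)=0$ for $x\in D\cap N$; $\Psi^-=\max\{-\Psi,0\}$; and $\Phi(x,y)=\Psi^-(x)\mathbf 1_{(-\infty,\psi(x)]}(y)$ for $x\in D$, $y\in\mathbb R$. (A2): for every $x\in D$, $\lim_{t\to\infty}E_xe^{-rt}\psi(X_t)=0$ and $E_x\int_0^\infty e^{-rt}\Psi^-(X_t)\,dt<\infty$. Operator and function spaces. $L_{BS}=\sum_{i=1}^d(r-\delta_i)x_i\partial_{x_i}+\frac12\sum_{i,j=1}^da_{ij}x_ix_j\partial^2_{x_ix_j}$ with derivatives in the distribution sense. Fix $\gamma>(2+d)/4$ and let $\varrho(x)=(1+|x|^2)^{-\gamma}$. $L^2_\varrho(D)=L^2(D;\varrho^2\,dx)$ and $H^1_\varrho(D)=\{u\in L^2_\varrho(D):\ \sum_{j=1}^d\sigma_{ji}x_ju_{x_j}\in L^2_\varrho(D),\ i=1,\dots,d\}$ (equivalently, since $\sigma$ is invertible, $x_ju_{x_j}\in L^2_\varrho(D)$ for all $j$), with its natural Hilbert norm. For $\phi,\varphi\in C_0^\infty(D)$, $$B^{BS}_\varrho(\phi,\varphi)=\sum_{i=1}^d\int_D(r-\delta_i)x_i\partial_{x_i}\phi\,\varphi\,\varrho^2\,dx-\frac12\sum_{i,j=1}^d\int_Da_{ij}\partial_{x_i}\phi\,\partial_{x_j}(x_ix_j\varphi\varrho^2)\,dx;$$ this form is bounded in the $H^1_\varrho(D)$ norm and $B^{BS}_\varrho$ also denotes its extension to a bounded bilinear form on $H^1_\varrho(D)\times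 H^1_\varrho(D)$. Variational solution. $v\in H^1_\varrho(D)$ is a variational solution of $L_{BS}v=rv-\Phi(\cdot,v)$, $v\ge\psi$, if $v(x)\ge\psi(x)$ for $x\in D$, $\Phi(\cdot,v)\in L^2_\varrho(D)$, and $B^{BS}_\varrho(v,\varphi)=(rv-\Phi(\cdot,v),\varphi)_{L^2_\varrho(D)}$ for every $\varphi\in H^1_\varrho(D)$. As usual, elements of $H^1_\varrho(D)$ are identified when equal a.e. *)

(* Defs.v *)
From HB Require Import structures.
From mathcomp Require Import all_boot all_order all_algebra.
From mathcomp Require Import all_classical all_reals all_analysis.
From mathcomp Require Import measurable_realfun.

Set Implicit Arguments.
Unset Strict Implicit.
Unset Printing Implicit Defensive.

Import Order.TTheory GRing.Theory Num.Theory.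
Import numFieldNormedType.Exports.

Local Open Scope classical_set_scope.
Local Open Scope ring_scope.

(* Row vectors carry the Borel sigma-algebra, generated by the coordinates,
   and the n-dimensional Lebesgue measure, built by iterating binary products;
   lebesgue_rV_box checks that it is the expected product measure. *)

Definition rV_display : measure_display := default_measure_display.

Section rV_measurable.
Context {R : realType} {n : nat}.

Let coord (i : 'I_n) (x : 'rV[R]_n) : R := x 0 i.

Let rV_set0 : g_sigma_preimage coord set0.
Proof. exact: sigma_algebra0. Qed.

Let rV_setC A : g_sigma_preimage coord A -> g_sigma_preimage coord (~` A).
Proof. exact: sigma_algebraC. Qed.

Let rV_bigcup (F : (set 'rV[R]_n)^nat) :
  (forall i, g_sigma_preimage coord (F i)) ->
  g_sigma_preimage coord (\bigcup_i (F i)).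
Proof. exact: sigma_algebra_bigcup. Qed.

HB.instance Definition _ := @isMeasurable.Build rV_display 'rV[R]_n
  (g_sigma_preimage coord) rV_set0 rV_setC rV_bigcup.

End rV_measurable.

Lemma measurable_coord (R : realType) n (i : 'I_n) :
  measurable_fun [set: 'rV[R]_n] (fun x => x 0 i).
Proof.
move=> _ Y mY; rewrite setTI; apply: sub_sigma_algebra => /=.
rewrite -bigcup_seq/=; exists i => /=; first by rewrite mem_index_enum.
by exists Y => //; rewrite setTI.
Qed.

Lemma measurable_fun_rVP d (T : measurableType d) (R : realType) n
    (f : T -> 'rV[R]_n) :
  (forall i, measurable_fun [set: T] (fun t => f t 0 i)) ->
  measurable_fun [set: T] f.
Proof.
move=> mf _ A mA; rewrite setTI.
suff : [set B | measurable (f @^-1` B)] A by [].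
apply: (smallest_sub _ _ mA).
  split => /=; first by rewrite preimage_set0.
  - by move=> B /= mB; rewrite setTD preimage_setC; exact: measurableC.
  - by move=> F mF /=; rewrite preimage_bigcup; exact: bigcup_measurable.
rewrite -bigcup_seq; apply: bigcup_sub => i _ _ [B mB <-] /=.
by rewrite setTI -[X in measurable X]setTI; exact: (mf i).
Qed.

Section lebesgue_rV.
Context {R : realType}.

Definition rV_cons n (p : R * 'rV[R]_n) : 'rV[R]_n.+1 :=
  row_mx (const_mx p.1 : 'rV_1) p.2.

Lemma measurable_rV_cons n : measurable_fun setT (@rV_cons n).
Proof.
apply: measurable_fun_rVP => i.
have -> : (fun p : R * 'rV[R]_n => rV_cons p 0 i) =
    (fun p => if fintype.split (i : 'I_(1 + n)) is inr j then p.2 0 j else p.1).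
  by apply/funext => p; rewrite /rV_cons mxE; case: fintype.split => j; rewrite ?mxE.
case: fintype.split => [_|j]; first exact: measurable_fst.
exact: (measurableT_comp (measurable_coord j) measurable_snd).
Qed.

Definition lebesgue_rV_step n (m : {measure set 'rV[R]_n -> \bar R}) :
    set 'rV[R]_n.+1 -> \bar R :=
  pushforward (lebesgue_measure \x^ m)%E (@rV_cons n).

Section lebesgue_rV_step.
Variables (n : nat) (m : {measure set 'rV[R]_n -> \bar R}).

Let mpre A : measurable A -> measurable (@rV_cons n @^-1` A).
Proof. by rewrite -[X in _ -> measurable X]setTI; exact: measurable_rV_cons. Qed.

Let step0 : lebesgue_rV_step m set0 = 0%E.
Proof. by rewrite /lebesgue_rV_step /pushforward preimage_set0 measure0. Qed.

Let step_ge0 A : (0 <= lebesgue_rV_step m A)%E.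
Proof. by rewrite /lebesgue_rV_step /pushforward; exact: measure_ge0. Qed.

Let step_sigma_additive : semi_sigma_additive (lebesgue_rV_step m).
Proof.
move=> F mF tF mUF; rewrite /lebesgue_rV_step /pushforward preimage_bigcup.
apply: measure_semi_sigma_additive.
- by move=> k; exact: mpre.
- apply/trivIsetP => /= i j _ _ ij; rewrite -preimage_setI.
  by move/trivIsetP : tF => /(_ _ _ _ _ ij) ->//; rewrite preimage_set0.
- by rewrite -preimage_bigcup; exact: mpre.
Qed.

HB.instance Definition _ := isMeasure.Build _ _ _
  (lebesgue_rV_step m) step0 step_ge0 step_sigma_additive.

End lebesgue_rV_step.

Fixpoint lebesgue_rV n : {measure set 'rV[R]_n -> \bar R} :=
  match n with
  | 0 => \d_(0 : 'rV[R]_0)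
  | m.+1 => lebesgue_rV_step (lebesgue_rV m)
  end.

Lemma lebesgue_rV_box n (A : 'I_n -> set R) :
  (forall i, measurable (A i)) ->
  lebesgue_rV n [set x | forall i, A i (x 0 i)] =
  (\prod_(i < n) lebesgue_measure (A i))%E.
Proof.
elim: n A => [|n IH] A mA.
  rewrite big_ord0 /= diracE mem_set//=.
  by case.
set B := [set x : 'rV[R]_n | forall i, A (lift ord0 i) (x 0 i)].
have mB : measurable B.
  have -> : B = \bigcap_(i in [set: 'I_n])
      ((fun x : 'rV[R]_n => x 0 i) @^-1` A (lift ord0 i)).
    by apply/seteqP; split => x /= xA i; [move=> _|]; exact: xA.
  apply: fin_bigcap_measurable => // i _.
  by rewrite -[X in measurable X]setTI; exact: measurable_coord.
rewrite big_ord_recl -(IH (fun i => A (lift ord0 i)))//.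
apply: etrans (product_measure2E lebesgue_measure (lebesgue_rV n) (mA ord0) mB).
rewrite /= /lebesgue_rV_step /pushforward; congr (_ _); apply/seteqP; split => -[a x] /= H.
  split; first by have := H 0; rewrite /rV_cons mxE; case: splitP => // j _; rewrite mxE.
  move=> i; have := H (lift ord0 i); rewrite /rV_cons mxE.
  case: splitP => j /=; first by rewrite ord1.
  by rewrite /bump => -[/ord_inj ->].
move=> i; rewrite /rV_cons mxE; case: splitP => j ij.
  by rewrite mxE (_ : i = ord0)//; [exact: H.1|apply/val_inj => /=; rewrite ij ord1].
by have := H.2 j; rewrite (_ : lift ord0 j = i)//; apply/val_inj; rewrite /= ij.
Qed.

End lebesgue_rV.

(* C([0,oo); R^n), with the sigma-algebra generated by the canonical process.
   canonical_process takes a real time t, truncated to max 0 t. *)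

Definition path_space (R : realType) (n : nat) : Type :=
  continuousType (`[0, +oo[%classic : set R) 'rV[R]_n.

Section path_space.
Context {R : realType} {n : nat}.

Definition nonneg_time (t : R) : (`[0, +oo[%classic : set R).
Proof.
exists (Num.max 0 t).
by rewrite inE/= in_itv/= andbT le_max lexx.
Defined.

Definition canonical_process (t : R) (w : path_space R n) : 'rV[R]_n :=
  (w : continuousType _ _) (nonneg_time t).

Let path_cst0 : continuous
  ((fun=> 0) : (`[0, +oo[%classic : set R) -> 'rV[R]_n).
Proof. exact: cst_continuous. Qed.

HB.instance Definition _ := gen_eqMixin (path_space R n).
HB.instance Definition _ := gen_choiceMixin (path_space R n).
HB.instance Definition _ := isPointed.Build (path_space R n)
  (mkcts path_cst0).

Definition cylinders : set (set (path_space R n)) :=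
  [set A | exists t, preimage_set_system setT (canonical_process t) measurable A].

Let path_set0 : <<s cylinders >> set0.
Proof. exact: sigma_algebra0. Qed.

Let path_setC A : <<s cylinders >> A -> <<s cylinders >> (~` A).
Proof. exact: sigma_algebraC. Qed.

Let path_bigcup (F : (set (path_space R n))^nat) :
  (forall i, <<s cylinders >> (F i)) -> <<s cylinders >> (\bigcup_i (F i)).
Proof. exact: sigma_algebra_bigcup. Qed.

HB.instance Definition _ := @isMeasurable.Build default_measure_display
  (path_space R n) <<s cylinders >> path_set0 path_setC path_bigcup.

End path_space.

Lemma measurable_canonical_process (R : realType) n (t : R) :
  measurable_fun [set: path_space R n] (canonical_process t).
Proof.
move=> _ Y mY; apply: sub_sigma_algebra; exists t.
by exists Y.
Qed.

Lemma measurable_fun_pathP d (T : measurableType d) (R : realType) n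
    (f : T -> path_space R n) :
  (forall t, measurable_fun [set: T] (canonical_process t \o f)) ->
  measurable_fun [set: T] f.
Proof.
move=> mf _ A mA; rewrite setTI.
suff : [set B | measurable (f @^-1` B)] A by [].
apply: (smallest_sub _ _ mA).
  split => /=; first by rewrite preimage_set0.
  - by move=> B /= mB; rewrite setTD preimage_setC; exact: measurableC.
  - by move=> F mF /=; rewrite preimage_bigcup; exact: bigcup_measurable.
move=> _ [t [B mB <-]] /=; rewrite setTI -comp_preimage.
by rewrite -[X in measurable X]setTI; exact: (mf t).
Qed.

(* Standard n-dimensional Wiener process, seen as a random element W of the
   path space. The last clause is the joint independence of the increments,
   over disjoint time intervals and over the coordinates; normal_prob takes
   the standard deviation. *)
Definition wiener_process d (T : measurableType d) (R : realType)
    (P : probability T R) (n : nat) (W : {RV P >-> path_space R n}) : Prop :=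
  let incr j s t w := canonical_process t (W w) 0 j
                      - canonical_process s (W w) 0 j in
  [/\ {ae P, forall w, canonical_process 0 (W w) = 0},
      forall (j : 'I_n) (s t : R) (B : set R), 0 <= s -> s < t -> measurable B ->
        P [set w | B (incr j s t w)] = normal_prob 0 (Num.sqrt (t - s)) B &
      forall (m : nat) (t : nat -> R) (B : 'I_m -> 'I_n -> set R),
        0 <= t 0%N -> {homo t : k l / (k <= l)%N >-> k <= l} ->
        (forall k j, measurable (B k j)) ->
        P [set w | forall k j, B k j (incr j (t k) (t k.+1) w)] =
        (\prod_(k < m) \prod_(j < n)
           P [set w | B k j (incr j (t k) (t k.+1) w)])%E].

Section geometric_brownian_motion.
Context {R : realType} {n : nat}.
Variables (r : R) (delta : 'I_n -> R) (sigma : 'M[R]_n).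
Local Notation a := (sigma *m sigma^T).

(* b stands for the position of the Wiener process at time t. *)
Definition gbm_val (x : 'rV[R]_n) (t : R) (b : 'rV[R]_n) : 'rV[R]_n :=
  \row_i (x 0 i * expR ((r - delta i - a i i / 2) * t
                        + \sum_j sigma i j * b 0 j)).

Definition gbm_fun (x : 'rV[R]_n) (w : path_space R n)
    (s : (`[0, +oo[%classic : set R)) : 'rV[R]_n :=
  gbm_val x (set_val s) ((w : continuousType _ _) s).

Lemma continuous_gbm_val (X : topologicalType) (tau : X -> R)
    (b : X -> 'rV[R]_n) x :
  continuous tau -> continuous b ->
  continuous (fun u => gbm_val x (tau u) (b u)).
Proof.
move=> ctau cb s; apply/cvg_ballP => e e0.
have coordc i : {for s, continuous (fun u => gbm_val x (tau u) (b u) 0 i)}.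
  have -> : (fun u => gbm_val x (tau u) (b u) 0 i) = (fun u => x 0 i *
      expR ((r - delta i - a i i / 2) * tau u + \sum_j sigma i j * b u 0 j)).
    by apply/funext => u; rewrite mxE.
  apply: cvgM; first exact: cvg_cst.
  apply: continuous_cvg; first exact: continuous_expR.
  apply: cvgD; first by apply: cvgM; [exact: cvg_cst|exact: ctau].
  apply: cvg_big => [|j _]; first exact: add_continuous.
  apply: cvgM; first exact: cvg_cst.
  apply: (@continuous_comp _ _ _ b (fun y : 'rV[R]_n => y 0 j)); first exact: cb.
  exact: coord_continuous.
have : \forall u \near s, forall i,
    ball (gbm_val x (tau s) (b s) 0 i) e (gbm_val x (tau u) (b u) 0 i).
  by apply: filter_forall => i; move: (coordc i) => /cvg_ballP; exact.
by apply: filterS => u H; split => // j i; rewrite (ord1 j); exact: H.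
Qed.

Lemma continuous_gbm_fun x w : continuous (gbm_fun x w).
Proof.
apply: continuous_gbm_val; first exact: initial_continuous.
exact: cts_fun.
Qed.

Definition gbm (x : 'rV[R]_n) (w : path_space R n) : path_space R n :=
  mkcts (@continuous_gbm_fun x w).

Lemma measurable_gbm x : measurable_fun setT (gbm x).
Proof.
apply: measurable_fun_pathP => t; apply: measurable_fun_rVP => i.
have mW j : measurable_fun [set: path_space R n]
    (fun w => canonical_process t w 0 j).
  exact: (measurableT_comp (measurable_coord j)
                           (measurable_canonical_process t)).
have -> : (fun w => (canonical_process t \o gbm x) w 0 i) = (fun w => x 0 i *
    expR ((r - delta i - a i i / 2) * Num.max 0 t
          + \sum_j sigma i j * canonical_process t w 0 j)).
  by apply/funext => w; rewrite /= /canonical_process /gbm/= mxE.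
apply: measurable_funM => //; apply: measurableT_comp => //.
apply: measurable_funD => //; apply: measurable_sum => j.
exact: measurable_funM.
Qed.

HB.instance Definition _ x := isMeasurableFun.Build _ _ _ _ (gbm x)
  (@measurable_gbm x).

End geometric_brownian_motion.

(* gbm_law x is P_x, and semigroup t v x is E_x v(X_t). *)
Definition gbm_law d (T : measurableType d) (R : realType)
    (P : probability T R) (n : nat) (W : {RV P >-> path_space R n})
    (r : R) (delta : 'I_n -> R) (sigma : 'M[R]_n) (x : 'rV[R]_n) :
    probability (path_space R n) R :=
  distribution P (gbm r delta sigma x \o W).

Definition semigroup (R : realType) n
    (Px : 'rV[R]_n -> probability (path_space R n) R)
    (t : R) (v : 'rV[R]_n -> R) (x : 'rV[R]_n) : \bar R :=
  ('E_(Px x)[fun w => v (canonical_process t w)])%E.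

Section payoff.
Context {R : realType} {n : nat}.

Definition enorm (x : 'rV[R]_n) : R := Num.sqrt (\sum_i x 0 i ^+ 2).

Definition orthant : set 'rV[R]_n := [set x | forall i, 0 < x 0 i].

(* p and H are the gradient and the Hessian of psi at x in the sense of
   Alexandrov's theorem. *)
Definition alexandrov_derivatives (psi : 'rV[R]_n -> R) (x p : 'rV[R]_n)
    (H : 'M[R]_n) : Prop :=
  H^T = H /\
  (psi (x + h) - psi x - (\sum_i p 0 i * h 0 i)
     - 2^-1 * (\sum_i \sum_j H i j * h 0 i * h 0 j)) / enorm h ^+ 2
    @[h --> (0 : 'rV[R]_n)^'] --> (0 : R).

Definition assumption_A1 (psi : 'rV[R]_n -> R) : Prop :=
  [/\ forall x, 0 <= psi x,
      convex_function (setT : set (convex_lmodType 'rV[R]_n)) psi &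
      lipschitz (psi : 'rV[R]_n -> R^o)].

Variables (r : R) (delta : 'I_n -> R) (sigma : 'M[R]_n).
Local Notation a := (sigma *m sigma^T).

Variables (psi : 'rV[R]_n -> R) (N : set 'rV[R]_n)
  (Dpsi : 'rV[R]_n -> 'rV[R]_n) (D2psi : 'rV[R]_n -> 'M[R]_n).

Definition Psi (x : 'rV[R]_n) : R :=
  if x \in N then 0 else
  - r * psi x + (\sum_i (r - delta i) * x 0 i * Dpsi x 0 i)
  + 2^-1 * (\sum_i \sum_j a i j * x 0 i * x 0 j * D2psi x i j).

Definition Psi_minus (x : 'rV[R]_n) : R := Num.max (- Psi x) 0.

Definition Phi (x : 'rV[R]_n) (y : R) : R :=
  Psi_minus x * \1_`]-oo, psi x] y.

Definition assumption_A2
    (Px : 'rV[R]_n -> probability (path_space R n) R) : Prop :=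
  forall x, orthant x ->
    ('E_(Px x)[fun w =>
       (expR (- r * t) * psi (canonical_process t w))%R])%E @[t --> +oo] --> 0%E /\
    (\int[Px x]_w \int[lebesgue_measure]_(t in `[0%R, +oo[)
       (expR (- r * t) * Psi_minus (canonical_process t w))%:E < +oo)%E.

End payoff.

Section weighted_spaces.
Context {R : realType} {n : nat}.
Local Notation leb := (@lebesgue_rV R n).
Local Notation D := (@orthant R n).

Definition iter_partial (s : seq 'I_n) (f : 'rV[R]_n -> R) : 'rV[R]_n -> R :=
  foldr (fun i g => 'D_'e_i g) f s.

Definition smooth (f : 'rV[R]_n -> R) : Prop :=
  forall s x, differentiable (iter_partial s f) x.

(* C_0^oo(D), the functions being extended by zero outside D. *)
Definition test_function (f : 'rV[R]_n -> R) : Prop :=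
  let K := closure [set x | f x != 0] in
  [/\ smooth f, compact K & K `<=` D].

Variable gamma : R.

Definition rho (x : 'rV[R]_n) : R := (1 + enorm x ^+ 2) `^ (- gamma).

(* Elements of the function spaces are represented by functions, to be
   identified when they agree almost everywhere on D; g allows f to be
   Lebesgue measurable only. *)
Definition L2rho (f : 'rV[R]_n -> R) : Prop :=
  exists g, [/\ measurable_fun D g, ae_eq leb D f g &
    (\int[leb]_(x in D) (g x ^+ 2 * rho x ^+ 2)%:E < +oo)%E].

Definition ip_rho (f g : 'rV[R]_n -> R) : R :=
  \int[leb]_(x in D) (f x * g x * rho x ^+ 2).

Variables (r : R) (delta : 'I_n -> R) (sigma : 'M[R]_n).
Local Notation a := (sigma *m sigma^T).

(* h i represents the distribution \sum_j sigma_ji x_j u_(x_j) on D. *)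
Definition sigma_gradient (u : 'rV[R]_n -> R) (h : 'I_n -> 'rV[R]_n -> R) :
    Prop :=
  forall i, L2rho (h i) /\
    forall phi, test_function phi ->
      \int[leb]_(x in D) (h i x * phi x) =
      - \int[leb]_(x in D)
          (u x * \sum_j sigma j i *
             'D_'e_j (fun y : 'rV[R]_n => y 0 j * phi y) x).

Definition H1rho (u : 'rV[R]_n -> R) : Prop :=
  L2rho u /\ exists h, sigma_gradient u h.

Definition H1rho_norm (u : 'rV[R]_n -> R) (h : 'I_n -> 'rV[R]_n -> R) : R :=
  Num.sqrt (ip_rho u u + \sum_i ip_rho (h i) (h i)).

Definition BBS_test (phi varphi : 'rV[R]_n -> R) : R :=
  (\sum_i \int[leb]_(x in D)
     ((r - delta i) * x 0 i * 'D_'e_i phi x * varphi x * rho x ^+ 2))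
  - 2^-1 * (\sum_i \sum_j \int[leb]_(x in D)
     (a i j * 'D_'e_i phi x *
      'D_'e_j
        (fun y : 'rV[R]_n => y 0 i * y 0 j * varphi y * rho y ^+ 2) x)).

(* B is the extension of BBS_test to a bounded bilinear form on H^1_rho(D);
   boundedness forces B to depend on almost-everywhere classes only. *)
Definition is_BBS (B : ('rV[R]_n -> R) -> ('rV[R]_n -> R) -> R) : Prop :=
  [/\ forall phi varphi, test_function phi -> test_function varphi ->
        B phi varphi = BBS_test phi varphi,
      forall c u v w, H1rho u -> H1rho v -> H1rho w ->
        B (fun x => c * u x + v x) w = c * B u w + B v w,
      forall c u v w, H1rho u -> H1rho v -> H1rho w ->
        B w (fun x => c * u x + v x) = c * B w u + B w v &
      exists C : R, forall u hu v hv,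
        L2rho u -> sigma_gradient u hu -> L2rho v -> sigma_gradient v hv ->
        `|B u v| <= C * H1rho_norm u hu * H1rho_norm v hv].

Definition variational_solution
    (B : ('rV[R]_n -> R) -> ('rV[R]_n -> R) -> R) (psi : 'rV[R]_n -> R)
    (F : 'rV[R]_n -> R -> R) (v : 'rV[R]_n -> R) : Prop :=
  [/\ H1rho v,
      {ae leb, forall x, D x -> psi x <= v x},
      L2rho (fun x => F x (v x)) &
      forall varphi, H1rho varphi ->
        B v varphi = ip_rho (fun x => r * v x - F x (v x)) varphi].

End weighted_spaces.

(* Main.v *)
(* In the coordinates x = Theta z = exp (sigma z) the process is a Brownian
   motion with drift beta, and the variational equation, tested with densities
   divided by the weight, says that w = v o Theta satisfies
   (1/2 Lap + beta . grad) w = r w - f in the distribution sense, f being Phi(., v)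
   o Theta. Testing with the heat kernel killed at rate r gives
     P_s w - P_t w = int_s^t P_u f du,
   the limit condition kills P_t w, and letting s -> 0 shows w = U_0 f, the
   potential of f.
   For two solutions, f_1 > f_2 forces w_1 < w_2, as Phi(x, .) is nonincreasing.
   A maximum principle for the resolvent U_l turns this into w_1 <= w_2: with g = (w_1 - w_2)^+ and e_l = (f_1 - f_2 - l (w_2 - w_1))^+
   on {w_1 < w_2}, g <= U_l (l g + e_l), whence g <= U_0 e_l, which vanishes as
   l -> oo. *)

Require Import Defs.
From HB Require Import structures.
From mathcomp Require Import all_boot all_order all_algebra.
From mathcomp Require Import all_classical all_reals all_analysis.
From mathcomp Require Import measurable_realfun.
From mathcomp Require Import ring lra.
Set Implicit Arguments.
Unset Strict Implicit.
Unset Printing Implicit Defensive.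
Import Order.TTheory GRing.Theory Num.Theory.
Import numFieldNormedType.Exports HBNNSimple.
Local Open Scope classical_set_scope.
Local Open Scope ring_scope.

(** * Lebesgue measure on row vectors *)

Section lebesgue_rV_facts.
Context {R : realType}.

(** The form [B] is known only as a bounded extension, so its value on a solution is reached by
    approximating the solution, in the norm of H^1_rho, by smooth functions of compact support; this
    is the purpose of the translation and mollification theory. In the coordinates z the inverse of
    the weight grows at most exponentially, hence is absorbed by any Gaussian: this licenses the
    heat kernel, cut off at infinity, as a test function. A solution is neither continuous nor
    bounded a priori, so statements about w and f hold almost everywhere and potentials take values
    in the extended reals. The passage s -> 0 is made on bounded truncations of w and yields w <=
    U_0 f only; equality follows because both have the same finite heat transform. In the maximum
    principle U_0 g may be infinite, which forbids subtracting at parameter 0: the subtraction is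
    done at small c > 0, where c U_c g <= c U_c w_1 <= w_1 is finite, and c is sent to 0 afterwards.
    The Jacobian of [Theta] comes from the fact that translations of z are dilations of x. *)

Definition leb n : set 'rV[R]_n -> \bar R := lebesgue_rV n.
Arguments leb n A : clear implicits.

(** Instances attach to a named set function: [leb] carries the structure of [lebesgue_rV], and
    further down the sigma-finiteness required by Tonelli. *)
HB.instance Definition _ n := Measure.copy (leb n) (lebesgue_rV n).

Definition box n (A : 'I_n -> set R) : set 'rV[R]_n :=
  [set x | forall i, A i (x 0 i)].

Lemma measurable_box n (A : 'I_n -> set R) :
  (forall i, measurable (A i)) -> measurable (box A).
Proof.
move=> mA; have -> : box A = \bigcap_(i in [set: 'I_n])
    ((fun x : 'rV[R]_n => x 0 i) @^-1` A i).
  by apply/seteqP; split => x xA i; [move=> _|]; exact: xA.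
apply: fin_bigcap_measurable => // i _.
by rewrite -[X in measurable X]setTI; exact: measurable_coord.
Qed.

Definition cube n (k : R) : set 'rV[R]_n := box (fun=> `[-k, k]%classic).
Arguments cube n k : clear implicits.

Lemma measurable_cube n k : measurable (cube n k).
Proof. by apply: measurable_box => i. Qed.

Lemma bigcup_cube n : \bigcup_k cube n k%:R = setT.
Proof.
apply/seteqP; split => // x _.
exists (\max_(i < n) Num.truncn `|x ord0 i|)%N.+1 => //= i /=.
rewrite in_itv/= -ler_norml (le_trans (ltW (truncnS_gt _)))//.
by rewrite ler_nat ltnS (@leq_bigmax _ (fun i => Num.truncn `|x ord0 i|)).
Qed.

Lemma rV_measurableE n : @measurable _ 'rV[R]_n =
  <<s [set B | exists2 A, (forall i, measurable (A i)) & B = box A] >>.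
Proof.
apply/seteqP; split.
  apply: smallest_sub; first exact: smallest_sigma_algebra.
  rewrite -bigcup_seq; apply: bigcup_sub => i _ _ [B mB <-] /=.
  apply: sub_sigma_algebra; exists (fun j => if j == i then B else setT).
    by move=> j; case: ifP.
  rewrite setTI; apply/seteqP; split => x /=.
    by move=> xB j; case: eqP => // ->.
  by move=> /(_ i); rewrite eqxx.
apply: smallest_sub; first exact: sigma_algebra_measurable.
by move=> _ [A mA ->]; exact: measurable_box.
Qed.

(** Boxes form a generating class stable under intersection, and cubes exhaust the space. Affine
    images of Lebesgue measure and the marginals of the Wiener process are both identified through
    this lemma, one coordinate at a time. *)
Lemma rV_measure_unique n (m1 m2 : {measure set 'rV[R]_n -> \bar R}) :
  (forall A, (forall i, measurable (A i)) -> m1 (box A) = m2 (box A)) ->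
  (forall k, m1 (cube n k%:R) < +oo)%E ->
  forall A, measurable A -> m1 A = m2 A.
Proof.
move=> m12 m1oo A mA.
apply: (measure_unique _ (fun k => cube n k%:R) (rV_measurableE n)) => //.
- move=> _ _ [A1 mA1 ->] [A2 mA2 ->]; exists (fun i => A1 i `&` A2 i).
    by move=> i; exact: measurableI.
  by apply/seteqP; split => [x [x1 x2] i //|x x12]; split=> i; have [] := x12 i.
- by move=> k; exists (fun=> `[- k%:R, k%:R]%classic).
- exact: bigcup_cube.
- by move=> _ [B mB ->]; exact: m12.
Qed.

Lemma leb_box n (A : 'I_n -> set R) : (forall i, measurable (A i)) ->
  leb n (box A) = (\prod_(i < n) lebesgue_measure (A i))%E.
Proof. exact: lebesgue_rV_box. Qed.

Lemma leb_cube_lty n k : (leb n (cube n k) < +oo)%E.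
Proof.
rewrite leb_box// -ge0_fin_numE; last by apply: prode_ge0 => i _; exact: measure_ge0.
elim/big_ind : _ => [//|x y|i _]; first exact: fin_numM.
by rewrite /= lebesgue_measure_itv/=; case: ifP.
Qed.

Lemma sigma_finite_leb n : sigma_finite setT (leb n).
Proof.
exists (fun k => cube n k%:R); first by rewrite bigcup_cube.
by move=> k; split; [exact: measurable_cube|exact: leb_cube_lty].
Qed.

HB.instance Definition _ n :=
  Measure_isSigmaFinite.Build _ _ _ (leb n) (sigma_finite_leb n).

Lemma leb_integral_cons n (f : 'rV[R]_n.+1 -> \bar R) :
  measurable_fun setT f -> (forall x, 0 <= f x)%E ->
  (\int[leb n.+1]_x f x =
   \int[lebesgue_measure]_a \int[leb n]_x f (rV_cons (a, x)))%E.
Proof.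
move=> mf f0.
pose phi (p : (measurableTypeR R * 'rV[R]_n)%type) : 'rV[R]_n.+1 := rV_cons p.
have mphi : measurable_fun setT phi := @measurable_rV_cons R n.
have mfc : measurable_fun setT (f \o phi) by exact: measurableT_comp.
transitivity (\int[(lebesgue_measure \x^ leb n)%E]_y (f \o phi) y)%E.
  have := ge0_integral_pushforward mphi
    (lebesgue_measure \x^ lebesgue_rV n : measure _ R)%E measurableT mf.
  by rewrite preimage_setT; apply => x _.
(* [lebesgue_rV_step] is built on the product [\x^], while Tonelli is used for [\x]; the two
   products coincide by uniqueness. *)
transitivity (\int[(lebesgue_measure \x leb n)%E]_y (f \o phi) y)%E.
  apply: eq_measure_integral => A mA _; apply/esym/product_measure_unique => //.
  by move=> A1 A2 mA1 mA2; exact: product_measure2E.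
exact: (fubini_tonelli1 _ mfc (fun x => f0 (phi x))).
Qed.

Lemma leb_integral0 (f : 'rV[R]_0 -> \bar R) :
  measurable_fun setT f -> (\int[leb 0]_x f x)%E = f 0.
Proof.
move=> mf; rewrite [LHS](_ : _ = \int[\d_(0%R : 'rV[R]_0)]_x f x)%E //.
by rewrite integral_dirac// diracT mul1e.
Qed.

Lemma leb_integral_prod n (g : 'I_n -> R -> R) :
  (forall i, measurable_fun setT (g i)) -> (forall i x, 0 <= g i x) ->
  (\int[leb n]_x (\prod_i g i (x 0 i))%:E =
   \prod_i \int[lebesgue_measure]_x (g i x)%:E)%E.
Proof.
elim: n g => [|n IH] g mg g0.
  have -> : (fun x : 'rV[R]_0 => (\prod_i g i (x 0 i))%:E) = cst 1%E.
    by apply/funext => x; rewrite big_ord0.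
  by rewrite leb_integral0// big_ord0.
have mprod m (h : 'I_m -> R -> R) : (forall i, measurable_fun setT (h i)) ->
    measurable_fun [set: 'rV[R]_m] (fun x : 'rV[R]_m => \prod_i h i (x 0 i)).
  move=> mh; apply: measurable_prod => i _.
  by apply: measurableT_comp => //; exact: measurable_coord.
have mprodE m (h : 'I_m -> R -> R) : (forall i, measurable_fun setT (h i)) ->
    measurable_fun [set: 'rV[R]_m] (fun x : 'rV[R]_m => (\prod_i h i (x 0 i))%:E).
  by move=> mh; apply/measurable_EFinP; exact: mprod.
rewrite leb_integral_cons; [|exact: mprodE|by move=> x; rewrite lee_fin prodr_ge0].
rewrite big_ord_recl -IH//.
have -> : (fun a => \int[leb n]_x (\prod_i g i (rV_cons (a, x) 0 i))%:E)%E =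
    (fun a => (g ord0 a)%:E *
       \int[leb n]_x (\prod_i g (lift ord0 i) (x 0 i))%:E)%E.
  apply/funext => a; rewrite -ge0_integralZl_EFin//; last 2 first.
  - by move=> x _; rewrite lee_fin prodr_ge0.
  - by apply: (mprodE n (fun i => g (lift ord0 i))).
  apply: eq_integral => x _; rewrite big_ord_recl -EFinM; congr (_ * _)%:E.
    by congr (g _ _); rewrite /rV_cons mxE; case: splitP => // j _; rewrite mxE.
  apply: eq_bigr => i _; congr (g _ _); rewrite /rV_cons mxE.
  case: splitP => j /=; first by rewrite ord1.
  by rewrite /bump => -[/ord_inj ->].
rewrite ge0_integralZr//.
- by apply/measurable_EFinP; exact: mg.
- by move=> x _; rewrite lee_fin.
- by apply: integral_ge0 => x _; rewrite lee_fin prodr_ge0.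
Qed.

End lebesgue_rV_facts.
Arguments leb {R} n A.
Arguments cube {R} n k.

(** * Affine changes of variables *)

Section affine_change_of_variables.
Context {R : realType}.

(** [t] times the image of Lebesgue measure under x -> t x + c gives each half-open interval its
    length, so it is Lebesgue measure. *)
Lemma lebesgue_measure_affine (t c : R) (A : set R) : 0 < t -> measurable A ->
  lebesgue_measure ((fun x => t * x + c) @^-1` A) =
  (t^-1%:E * lebesgue_measure A)%E.
Proof.
move=> t0 mA.
pose phi (x : measurableTypeR R) : measurableTypeR R := t * x + c.
have mphi : measurable_fun setT phi.
  have : measurable_fun [set: R] (fun x : R => t * x + c).
    by apply: measurable_funD => //; exact: measurable_funM.
  by [].
pose k := NngNum (ltW t0).
pose mu0 : measure (measurableTypeR R) R :=
  mscale k (pushforward lebesgue_measure phi).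
pose mu := mu0 mphi.
have E : lebesgue_measure A = mu A.
  apply: lebesgue_measure_unique => // X /ocitvP[->|[[a b] /= ab ->]].
    by rewrite !measure0.
  rewrite /mu /= /mscale/= /pushforward /phi /=.
  have -> : (fun x => t * x + c) @^-1` `]a, b]%classic =
      `](a - c) / t, (b - c) / t]%classic.
    apply/seteqP; split => x /=; rewrite !in_itv/= ltr_pdivrMr// ler_pdivlMr//
      ltrBlDr lerBrDr mulrC//.
  rewrite !lebesgue_measure_itv/= !lte_fin ab ltr_pM2r ?invr_gt0// ltrD2r ab.
  by rewrite -!EFinD -EFinM; congr EFin; field; rewrite gt_eqF.
rewrite E /mu /= /mscale/= /pushforward muleA -EFinM mulVf ?mul1e// gt_eqF//.
Qed.

(** Diagonal linear parts suffice: translating z by c multiplies the i-th coordinate of [Theta z] by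
    that of [Theta c], and the Jacobian of [Theta] is derived from this. *)
Definition affine n (t c : 'rV[R]_n) (x : 'rV[R]_n) : 'rV[R]_n :=
  \row_i (t 0 i * x 0 i + c 0 i).

Lemma measurable_affine n (t c : 'rV[R]_n) : measurable_fun setT (affine t c).
Proof.
apply: measurable_fun_rVP => i.
under eq_fun do rewrite mxE.
by apply: measurable_funD => //; apply: measurable_funM => //;
  exact: measurable_coord.
Qed.

Lemma leb_affine n (t c : 'rV[R]_n) (A : set 'rV[R]_n) :
  (forall i, 0 < t 0 i) -> measurable A ->
  leb n A = ((\prod_i t 0 i)%:E * leb n (affine t c @^-1` A))%E.
Proof.
move=> t0 mA.
have p0 : 0 <= \prod_i t 0 i by apply: prodr_ge0 => i _; rewrite ltW.
pose m0 : {measure set 'rV[R]_n -> \bar R} :=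
  mscale (NngNum p0) (pushforward (leb n) (affine t c)).
pose m := m0 (measurable_affine t c).
rewrite [RHS](_ : _ = m A)//.
apply: rV_measure_unique => //; last by move=> k; exact: leb_cube_lty.
move=> B mB; rewrite /m /= /mscale/= /pushforward.
have -> : affine t c @^-1` box B =
    box (fun i => (fun x => t 0 i * x + c 0 i) @^-1` B i).
  by apply/seteqP; split => x /= xB i; move: (xB i); rewrite mxE.
rewrite leb_box// leb_box; last first.
  move=> i; have : measurable_fun [set: R] (fun x => t 0 i * x + c 0 i).
    by apply: measurable_funD => //; exact: measurable_funM.
  by move=> /(_ measurableT _ (mB i)); rewrite setTI.
rewrite -prodEFin -big_split; apply: eq_bigr => i _.
rewrite lebesgue_measure_affine//.
transitivity ((t 0 i)%:E * ((t 0 i)^-1%:E * lebesgue_measure (B i)))%E => //.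
by rewrite muleA -EFinM mulfV ?mul1e// gt_eqF.
Qed.

Lemma integral_affine n (t c : 'rV[R]_n) (f : 'rV[R]_n -> \bar R) :
  (forall i, 0 < t 0 i) -> measurable_fun setT f -> (forall x, 0 <= f x)%E ->
  (\int[leb n]_x f x = (\prod_i t 0 i)%:E * \int[leb n]_x f (affine t c x))%E.
Proof.
move=> t0 mf f0.
have p0 : 0 <= \prod_i t 0 i by apply: prodr_ge0 => i _; rewrite ltW.
pose nu0 : {measure set 'rV[R]_n -> \bar R} := pushforward (leb n) (affine t c).
pose nu := nu0 (measurable_affine t c).
pose m : {measure set 'rV[R]_n -> \bar R} := mscale (NngNum p0) nu.
have -> : (\int[leb n]_x f x = \int[m]_x f x)%E.
  by apply: eq_measure_integral => A mA _; exact: leb_affine.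
rewrite [LHS]ge0_integral_mscale//; congr (_ * _)%E.
have := ge0_integral_pushforward (measurable_affine t c) (leb n) measurableT mf.
by rewrite preimage_setT; apply => x _.
Qed.

Lemma measurable_addr n (c : 'rV[R]_n) :
  measurable_fun setT (fun x : 'rV[R]_n => x + c).
Proof.
apply: measurable_fun_rVP => i; under eq_fun do rewrite mxE.
by apply: measurable_funD => //; exact: measurable_coord.
Qed.

Lemma ge0_integral_translation n (c : 'rV[R]_n) (f : 'rV[R]_n -> \bar R) :
  measurable_fun setT f -> (forall x, 0 <= f x)%E ->
  (\int[leb n]_x f (x + c)%R = \int[leb n]_x f x)%E.
Proof.
move=> mf f0; rewrite [RHS](@integral_affine _ (const_mx 1) c)//.
  rewrite big1 ?mul1e => [|i _]; last by rewrite mxE.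
  by apply: eq_integral => x _; congr f; apply/rowP => i; rewrite !mxE mul1r.
by move=> i; rewrite mxE.
Qed.

Lemma integral_translation n (c : 'rV[R]_n) (f : 'rV[R]_n -> \bar R) :
  measurable_fun setT f ->
  (\int[leb n]_x f (x + c)%R = \int[leb n]_x f x)%E.
Proof.
move=> mf; rewrite integralE [RHS]integralE; congr (_ - _)%E.
- rewrite -[RHS](ge0_integral_translation c (measurable_funepos mf) (funepos_ge0 f)).
  by apply: eq_integral => x _; rewrite ?(funeposE, funenegE).
- rewrite -[RHS](ge0_integral_translation c (measurable_funeneg mf) (funeneg_ge0 f)).
  by apply: eq_integral => x _; rewrite ?(funeposE, funenegE).
Qed.

End affine_change_of_variables.

(** * Logarithmic coordinates on the orthant *)

Section logarithmic_coordinates.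
Context {R : realType} {n : nat}.
Variable sigma : 'M[R]_n.
Hypothesis sigmaU : sigma \in unitmx.

Local Notation E := 'rV[R]_n.

(* Theta maps R^n onto the open orthant; in these coordinates the vector fields
   \sum_j sigma_ji x_j d/dx_j are the coordinate fields. *)
Definition slin (z : E) : E := z *m sigma^T.

Definition Theta (z : E) : E := \row_i expR (slin z 0 i).

Definition logT (x : E) : E := (\row_i ln (x 0 i)) *m (invmx sigma)^T.

Lemma slinD y z : slin (y + z) = slin y + slin z.
Proof. exact: mulmxDl. Qed.

Lemma slinN z : slin (- z) = - slin z.
Proof. exact: mulNmx. Qed.

Lemma Theta_orthant z : orthant (Theta z).
Proof. by move=> i; rewrite mxE expR_gt0. Qed.

Lemma slin_logT x : slin (logT x) = \row_i ln (x 0 i).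
Proof. by rewrite /slin /logT -mulmxA -trmx_mul mulmxV// trmx1 mulmx1. Qed.

Lemma ThetaK z : logT (Theta z) = z.
Proof.
rewrite /logT; have -> : \row_i ln (Theta z 0 i) = slin z.
  by apply/rowP => i; rewrite !mxE expRK.
by rewrite /slin -mulmxA -trmx_mul mulVmx// trmx1 mulmx1.
Qed.

Lemma logTK x : orthant x -> Theta (logT x) = x.
Proof.
by move=> Dx; apply/rowP => i; rewrite mxE slin_logT mxE lnK// posrE Dx.
Qed.

Lemma measurable_orthant : measurable (@orthant R n).
Proof.
rewrite [X in measurable X](_ : _ = box (fun=> `]0, +oo[%classic)).
  exact: measurable_box.
by apply/seteqP; split => x xD i; have := xD i; rewrite /= in_itv/= andbT.
Qed.

Lemma measurable_mulmx m k (A : 'M[R]_(m, k)) :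
  measurable_fun setT (fun x : 'rV[R]_m => x *m A).
Proof.
apply: measurable_fun_rVP => i; under eq_fun do rewrite mxE.
by apply: measurable_sum => j; apply: measurable_funM => //; exact: measurable_coord.
Qed.

Lemma measurable_slin : measurable_fun setT slin.
Proof. exact: measurable_mulmx. Qed.

Lemma measurable_Theta : measurable_fun setT Theta.
Proof.
apply: measurable_fun_rVP => i; under eq_fun do rewrite mxE.
apply: measurableT_comp => //.
exact: (measurableT_comp (measurable_coord i) measurable_slin).
Qed.

Lemma measurable_logT : measurable_fun setT logT.
Proof.
apply: (measurableT_comp (@measurable_mulmx _ _ _)).
apply: measurable_fun_rVP => i; under eq_fun do rewrite mxE.
by apply: measurableT_comp => //; exact: measurable_coord.
Qed.

Definition sumslin (z : E) : R := \sum_i slin z 0 i.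

Lemma measurable_sumslin : measurable_fun setT sumslin.
Proof.
apply: measurable_sum => i.
exact: (measurableT_comp (measurable_coord i) measurable_slin).
Qed.

Lemma sumslinN z : sumslin (- z) = - sumslin z.
Proof. by rewrite /sumslin slinN -sumrN; apply: eq_bigr => i _; rewrite mxE. Qed.

(** Integration against the image under [logT] of Lebesgue measure on the orthant. By
    [L_translation] this image is relatively invariant under translations, exactly as
    [exp (sumslin z) dz] is; [haar] proves that the two are proportional. *)
Let L (f : E -> \bar R) := (\int[leb n]_x ((\1_(@orthant R n) x)%:E * f (logT x)))%E.

Let mD (f : E -> \bar R) : measurable_fun setT f ->
  measurable_fun setT (fun x => (\1_(@orthant R n) x)%:E * f (logT x))%E.
Proof.
move=> mf; apply: emeasurable_funM.
  by apply/measurable_EFinP; apply: measurable_indic; exact: measurable_orthant.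
exact: measurableT_comp measurable_logT.
Qed.

(** In the variable x, the translation of [logT x] by [c] is the dilation by [Theta c], of
    determinant [exp (sumslin c)]. *)
Let L_translation (f : E -> \bar R) c : measurable_fun setT f ->
  (forall x, 0 <= f x)%E ->
  L f = ((expR (sumslin c))%:E * L (fun x => f (x + c)%R))%E.
Proof.
move=> mf f0; rewrite {1}/L (@integral_affine _ _ (Theta c) 0)//; last 3 first.
- by move=> i; exact: Theta_orthant.
- exact: mD.
- by move=> x; rewrite mule_ge0.
congr (_ * _)%E.
  by rewrite expR_sum; congr (EFin _); apply: eq_bigr => i _; exact: mxE.
apply: eq_integral => x _; have [xD|xD] := pselect (orthant x); last first.
  rewrite !indicE !memNset ?mul0e// => /(_ _)/= xD'; apply: xD => i.
  by have := xD' i; rewrite !mxE addr0 pmulr_rgt0 ?expR_gt0.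
have xD' : orthant (affine (Theta c) 0 x).
  by move=> i; rewrite !mxE addr0 mulr_gt0 ?expR_gt0// xD.
rewrite !indicE !mem_set//; congr (_ * f _)%E.
rewrite /logT -[in RHS](ThetaK c) -mulmxDl; congr (_ *m _).
apply/rowP => i; rewrite !mxE addr0 lnM ?posrE ?expR_gt0//.
  by rewrite addrC.
Qed.

(** The function 1_U J0 reflected at the origin; in [haar] its translate by [y] is what multiplies
    [f y] once the integrals are exchanged. *)
Let k (z : E) : \bar R :=
  ((\1_(box (fun=> `[0, 1]%classic) : set E) (- z) * expR (sumslin (- z)))%:E)%E.

Let U : set E := box (fun=> `[0, 1]%classic).
Let J0 (z : E) : R := expR (sumslin z).
Let c0 := L k.

Let mU : measurable U. Proof. exact: measurable_box. Qed.
Let mJ0 : measurable_fun setT J0.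
Proof. by apply: measurableT_comp => //; exact: measurable_sumslin. Qed.

Let mopp : measurable_fun setT (fun x : E => - x).
Proof.
apply: measurable_fun_rVP => i; under eq_fun do rewrite mxE.
by apply: measurableT_comp => //; exact: measurable_coord.
Qed.

Let mUJ : measurable_fun setT (fun z : E => (\1_U z * J0 z)%:E).
Proof.
by apply/measurable_EFinP/measurable_funM => //; exact: measurable_indic.
Qed.

Let mk : measurable_fun setT k.
Proof. exact: (measurableT_comp mUJ mopp). Qed.

Let k0 z : (0 <= k z)%E.
Proof. by rewrite lee_fin mulr_ge0 ?expR_ge0. Qed.

(** The uniqueness argument for Haar measure. [L f] is averaged over the translations [y] in the
    cube [U], of volume 1; after the substitution y -> y - logT x and an exchange of integrals, the
    integral in x is [L] of the translate of [k] by [y], from which [L_translation] extracts [J0 y]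
    and leaves [c0]. *)
Let haar (f : E -> \bar R) : measurable_fun setT f -> (forall x, 0 <= f x)%E ->
  L f = (c0 * \int[leb n]_z (f z * (J0 z)%:E))%E.
Proof.
move=> mf f0.
have mDx : measurable_fun [set: (E * E)%type]
    (fun p : E * E => (\1_(@orthant R n) p.1)%:E : \bar R).
  apply/measurable_EFinP.
  have m1 := @measurable_indic _ _ R _ _ measurable_orthant.
  exact: (measurableT_comp (m1 setT) measurable_fst).
have mV1 : measurable_fun [set: (E * E)%type] (fun p : E * E => logT p.1).
  exact: (measurableT_comp measurable_logT measurable_fst).
have mc (i : 'I_n) (g : E * E -> E) : measurable_fun setT g ->
    measurable_fun [set: (E * E)%type] (fun p => g p 0 i).
  by move=> mg; exact: (measurableT_comp (measurable_coord i) mg).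
have madd : measurable_fun [set: (E * E)%type] (fun p : E * E => logT p.1 + p.2).
  apply: measurable_fun_rVP => i; under eq_fun do rewrite mxE.
  by apply: measurable_funD; apply: mc => //; exact: measurable_snd.
have msub : measurable_fun [set: (E * E)%type] (fun p : E * E => p.2 - logT p.1).
  apply: measurable_fun_rVP => i; under eq_fun do rewrite mxE.
  apply: measurable_funD; first by apply: mc; exact: measurable_snd.
  exact: (mc _ (fun p => - logT p.1) (measurableT_comp mopp mV1)).
transitivity (\int[leb n]_y ((\1_U y)%:E * L f))%E.
  rewrite ge0_integralZr//; last 2 first.
  - by apply/measurable_EFinP; exact: measurable_indic.
  - by apply: integral_ge0 => x _; rewrite mule_ge0.
  rewrite integral_indic// setIT [X in (X * _)%E](_ : _ = 1%E) ?mul1e//.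
  apply: etrans (leb_box _) _ => //; rewrite big1// => i _.
  by rewrite lebesgue_measure_itv/= lte01 oppr0 adde0.
transitivity (\int[leb n]_y \int[leb n]_x
    ((\1_(@orthant R n) x)%:E * ((\1_U y * J0 y)%:E * f (logT x + y)%R)))%E.
  apply: eq_integral => y _; rewrite (@L_translation f y)// muleA -EFinM.
  rewrite /L -ge0_integralZl_EFin//; last 2 first.
  - by move=> x _; rewrite mule_ge0.
  - exact: (mD (measurableT_comp mf (measurable_addr y))).
  by apply: eq_integral => x _; rewrite muleCA.
have mUJ2 : measurable_fun [set: (E * E)%type]
    (fun p : E * E => (\1_U p.2 * J0 p.2)%:E).
  exact: (measurableT_comp mUJ measurable_snd).
rewrite -(@fubini_tonelli _ _ _ _ _ (leb n) (leb n) (fun p =>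
  ((\1_(@orthant R n) p.1)%:E * ((\1_U p.2 * J0 p.2)%:E * f (logT p.1 + p.2)%R)))%E);
  last 2 first.
- apply: emeasurable_funM => //; apply: emeasurable_funM => //.
  exact: measurableT_comp.
- by move=> p; rewrite mule_ge0 ?mule_ge0// lee_fin mulr_ge0 ?expR_ge0.
transitivity (\int[leb n]_x \int[leb n]_y
    ((\1_(@orthant R n) x)%:E *
       ((\1_U (y - logT x)%R * J0 (y - logT x)%R)%:E * f y)))%E.
  apply: eq_integral => x _ /=.
  rewrite -[RHS](@ge0_integral_translation _ _ (logT x)); last 2 first.
  - apply: emeasurable_funM => //; apply: emeasurable_funM => //.
    apply: (measurableT_comp mUJ); exact: measurable_addr.
  - by move=> y; rewrite mule_ge0 ?mule_ge0// lee_fin mulr_ge0 ?expR_ge0.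
  by apply: eq_integral => y _; rewrite addrK [logT x + y]addrC.
rewrite (@fubini_tonelli _ _ _ _ _ (leb n) (leb n) (fun p =>
  ((\1_(@orthant R n) p.1)%:E *
     ((\1_U (p.2 - logT p.1)%R * J0 (p.2 - logT p.1)%R)%:E * f p.2)))%E);
  last 2 first.
- apply: emeasurable_funM => //; apply: emeasurable_funM.
    exact: (measurableT_comp mUJ msub).
  exact: (measurableT_comp mf measurable_snd).
- by move=> p; rewrite mule_ge0 ?mule_ge0// lee_fin mulr_ge0 ?expR_ge0.
rewrite -ge0_integralZl//; last 3 first.
- by apply: emeasurable_funM => //; apply/measurable_EFinP.
- by move=> y _; rewrite mule_ge0// lee_fin expR_ge0.
- by apply: integral_ge0 => x _; rewrite mule_ge0.
apply: eq_integral => y _ /=.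
transitivity (f y * L (fun z => k (z - y)%R))%E.
  rewrite /L -ge0_integralZl//; last 2 first.
  - exact: (mD (measurableT_comp mk (measurable_addr (- y)))).
  - by move=> x _; rewrite mule_ge0.
  apply: eq_integral => x _; rewrite [RHS]muleCA /k opprB.
  by congr (_ * _)%E; exact: muleC.
rewrite (@L_translation (fun z => k (z - y)%R) y)//; last first.
  by apply: (measurableT_comp mk); exact: measurable_addr.
have -> : (fun x => k (x + y - y)) = k by apply/funext => x; rewrite addrK.
by rewrite muleA [RHS]muleC.
Qed.

(** Where [k (logT x)] is nonzero, every coordinate of [x] is at most [expR S]: the integrand is
    bounded and lives on a cube. *)
Let c0_lty : (c0 < +oo)%E.
Proof.
pose S : R := \sum_i \sum_j `|sigma i j|.
have bz z : U (- z) -> forall i, `|slin z 0 i| <= S.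
  move=> Uz i; rewrite mxE (le_trans (ler_norm_sum _ _ _))//.
  rewrite /S [leRHS](bigD1 i)//= ler_wpDr//; first by apply: sumr_ge0 => j _; apply: sumr_ge0.
  apply: ler_sum => j _; rewrite normrM mxE ler_piMl//.
  by have := Uz j; rewrite /= in_itv/= mxE => /andP[z0 z1]; rewrite -normrN ger0_norm.
apply: (@le_lt_trans _ _ (\int[leb n]_x ((expR (S *+ n))%:E * (\1_(cube n (expR S)) x)%:E))%E).
  apply: ge0_le_integral => //.
  - by move=> x _; rewrite mule_ge0.
  - exact: mD.
  - apply: emeasurable_funM => //; apply/measurable_EFinP; apply: measurable_indic.
    exact: measurable_cube.
  move=> x _; have [xD|xD] := pselect (orthant x); last first.
    by rewrite [in leLHS]indicE memNset// mul0e lee_fin mulr_ge0 ?expR_ge0.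
  rewrite [in leLHS]indicE mem_set// mul1e /k.
  have [Ux|Ux] := pselect (U (- logT x)); last first.
    by rewrite indicE memNset// mul0r lee_fin mulr_ge0 ?expR_ge0.
  have xS := bz _ Ux.
  rewrite [in leLHS]indicE mem_set// mul1r indicE mem_set ?mulr1.
    rewrite mule1 lee_fin ler_expR sumslinN -sumrN -[n in leRHS]card_ord -sumr_const.
    by apply: ler_sum => i _; rewrite (le_trans (ler_norm _))// normrN.
  move=> i /=; rewrite in_itv/= -ler_norml.
  have -> : x 0 i = expR (slin (logT x) 0 i) by rewrite -{1}(logTK xD) mxE.
  by rewrite ger0_norm ?expR_ge0// ler_expR (le_trans (ler_norm _)).
rewrite ge0_integralZl_EFin//; last first.
  apply/measurable_EFinP; apply: measurable_indic; exact: measurable_cube.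
rewrite integral_indic ?setIT//; last exact: measurable_cube.
by rewrite lte_mul_pinfty ?lee_fin ?expR_ge0//; exact: leb_cube_lty.
Qed.

(** If [c0] vanished, [haar] would make [L (cst 1)] vanish as well; but this is the volume of the
    orthant, which contains a cube of volume 1. *)
Let c0_gt0 : (0 < c0)%E.
Proof.
have c00 : (0 <= c0)%E by apply: integral_ge0 => x _; rewrite mule_ge0.
rewrite lt_neqAle c00 andbT eq_sym; apply/eqP => c0E.
have := haar (measurable_cst 1%E) (fun=> lee01); rewrite c0E mul0e.
suff : (1 <= L (cst 1))%E by move=> + E; rewrite E leNgt lte01.
have mbox : measurable (box (fun=> `[1, 2]%classic) : set E) by exact: measurable_box.
apply: (@le_trans _ _ (\int[leb n]_x (\1_(box (fun=> `[1, 2]%classic) : set E) x)%:E)%E).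
  rewrite integral_indic// setIT [leRHS](_ : _ = 1%E)//; apply: etrans (leb_box _) _ => //.
  rewrite big1// => i _; rewrite lebesgue_measure_itv/= lte_fin ltr1n -EFinB.
  by rewrite /=; congr EFin; ring.
apply: ge0_le_integral => //.
- by apply/measurable_EFinP; exact: measurable_indic.
- exact: mD.
move=> x _; rewrite /= mule1 lee_fin; have [xb|xb] := pselect (box (fun=> `[1, 2]%classic) x).
  rewrite !indicE !mem_set// => i; have := xb i; rewrite /= in_itv/= => /andP[+ _].
  exact: lt_le_trans.
by rewrite indicE memNset.
Qed.

(* The Jacobian of Theta, up to the constant produced by the uniqueness of the
   Haar measure; its value is irrelevant. *)
Lemma integral_Theta : exists2 C : R, 0 < C &
  forall F : E -> \bar R, measurable_fun (@orthant R n) F ->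
    (forall x, orthant x -> 0 <= F x)%E ->
    (\int[leb n]_(x in @orthant R n) F x =
     \int[leb n]_z (F (Theta z) * (C * expR (sumslin z))%:E))%E.
Proof.
have c0f : c0 \is a fin_num by rewrite ge0_fin_numE; [exact: c0_lty|exact: ltW c0_gt0].
exists (fine c0); first by rewrite fine_gt0// c0_gt0 c0_lty.
move=> F mF F0.
have mFT : measurable_fun setT (F \o Theta).
  apply: (measurable_comp measurable_orthant) => //; last exact: measurable_Theta.
  by move=> _ [z _ <-]; exact: Theta_orthant.
rewrite integral_mkcond; transitivity (L (F \o Theta)).
  apply: eq_integral => x _; rewrite patchE; case: ifPn => xD.
    by rewrite indicE xD mul1e /= logTK//; exact: set_mem.
  by rewrite indicE (negbTE xD) mul0e.
rewrite haar//; last by move=> z; apply: F0; exact: Theta_orthant.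
rewrite -ge0_integralZl//; last 3 first.
- by apply: emeasurable_funM => //; apply/measurable_EFinP.
- by move=> z _; rewrite mule_ge0 ?lee_fin ?expR_ge0//; apply: F0; exact: Theta_orthant.
- exact: ltW c0_gt0.
by apply: eq_integral => z _; rewrite EFinM fineK// muleCA.
Qed.

End logarithmic_coordinates.

(** * Measurability of continuous functions *)

Section continuous_measurable.
Context {R : realType}.

(** The sigma-algebra is generated by the coordinates rather than by the open sets. With [r k] the
    rounding down to the grid of mesh 1/(k+1), [f \o r k] is constant on each of countably many
    boxes and tends to [f] by continuity. *)
Lemma continuous_rV_measurable n (f : 'rV[R]_n -> R) :
  continuous f -> measurable_fun setT f.
Proof.
move=> cf.
pose r (k : nat) (x : 'rV[R]_n) : 'rV[R]_n :=
  \row_i ((Num.floor (k.+1%:R * x 0 i))%:~R / k.+1%:R).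
apply: (@measurable_fun_cvg _ _ _ _ (fun k => f \o r k)).
  move=> k _ Y mY; rewrite setTI.
  pose F (z : 'rV[int]_n) : set 'rV[R]_n :=
    if f (\row_i ((z 0 i)%:~R / k.+1%:R)) \in Y then
      box (fun i => `[(z 0 i)%:~R / k.+1%:R, (z 0 i + 1)%:~R / k.+1%:R[%classic)
    else set0.
  have -> : (f \o r k) @^-1` Y = \bigcup_z F z.
    apply/seteqP; split => [x /= Yx|x [z _]].
      exists (\row_i Num.floor (k.+1%:R * x 0 i)) => //; rewrite /F.
      have -> : \row_i (((\row_i0 Num.floor (k.+1%:R * x 0 i0)) 0 i)%:~R / k.+1%:R)
        = r k x by apply/rowP => i; rewrite !mxE.
      rewrite mem_set// => i /=; rewrite !mxE in_itv/= ler_pdivrMr// ltr_pdivlMr//.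
      by rewrite (mulrC (x 0 i)) floor_itv.
    rewrite /F; case: ifPn => // /set_mem Yz xz /=.
    suff -> : r k x = \row_i ((z 0 i)%:~R / k.+1%:R) by [].
    apply/rowP => i; rewrite !mxE; congr (_%:~R / _); apply: floor_def.
    have /= := xz i; rewrite in_itv/= ler_pdivrMr// ltr_pdivlMr//.
    by rewrite (mulrC (x 0 i)).
  apply: countable_bigcupT_measurable; first exact: countableP.
  move=> z; rewrite /F; case: ifPn => // _; exact: measurable_box.
move=> x _; apply: (@continuous_cvg _ _ _ _ _ _ f); first exact: cf.
apply/cvg_ballP => e e0.
near=> k; split => // j i; rewrite ord1 /ball/= mxE.
have /andP[f1 f2] := floor_itv (k.+1%:R * x 0 i).
rewrite ger0_norm; last by rewrite subr_ge0 ler_pdivrMr// [x 0 i * _]mulrC.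
rewrite ltrBlDr -ltrBlDl ltr_pdivlMr// mulrBl [x 0 i * _]mulrC.
rewrite ltrBlDr (lt_le_trans f2)// intrD lerD2l.
rewrite -ler_pdivrMl// mulr1.
by rewrite (@le_trans _ _ k%:R) ?ler_nat//; near: k; exact: nbhs_infty_ger.
Unshelve. all: by end_near. Qed.

End continuous_measurable.

(** * Smooth functions and cut-offs *)

Section smooth_functions.
Context {R : realType}.

Lemma near_eq_differentiable (V W : normedModType R) (f g : V -> W) (x : V) :
  (\forall y \near x, f y = g y) -> differentiable g x -> differentiable f x.
Proof.
move=> fg /diff_locallyP[dc /eqaddoP dg].
have H : f \o shift x = cst (f x) + 'd g x +o_ 0 id.
  apply/eqaddoP => e e0; have := dg _ e0.
  have : \forall h \near (0 : V), f (h + x) = g (h + x).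
    by move: fg; rewrite (near_shift 0 x)/= subr0; apply: filterS => h.
  apply: filterS2 => h /= E; rewrite /= -![(_ - _ : V -> W) _]/(_ - _) /=.
  by rewrite /= -![(_ + _ : V -> W) _]/(_ + _) /= E (nbhs_singleton fg).
by apply/diff_locallyP; rewrite (diff_unique dc H).
Qed.

Section smoothn.
Context {n : nat}.
Local Notation E := 'rV[R]_n.
Implicit Types f g : E -> R.

Definition pd (i : 'I_n) f : E -> R := 'D_'e_i f.

(** The innermost derivative is peeled off first, so that induction on [k] runs over all functions;
    in [iter_partial] the head of the list is the outermost derivative. *)
Fixpoint smoothn (k : nat) f : Prop :=
  (forall x, differentiable f x) /\
  if k is k'.+1 then forall i, smoothn k' (pd i f) else True.

Lemma smoothn_diff k f x : smoothn k f -> differentiable f x.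
Proof. by case: k => [|k] []. Qed.

Lemma smoothP f : smooth f <-> forall k, smoothn k f.
Proof.
split=> [sf k|sf s].
  elim: k f sf => [|k IH] f sf; split=> //=; try exact: (sf [::]).
  move=> i; apply: IH => s x; have := sf (rcons s i) x.
  by rewrite /iter_partial foldr_rcons.
elim/last_ind: s f sf => [|s i IH] f sf x; first exact: smoothn_diff (sf 0%N).
rewrite /iter_partial foldr_rcons; apply: IH => k.
by have [_] := sf k.+1; exact.
Qed.

Lemma smooth_diff f x : smooth f -> differentiable f x.
Proof. by move/(_ [::]). Qed.

Lemma smooth_pd i f : smooth f -> smooth (pd i f).
Proof. by move/smoothP => sf; apply/smoothP => k; have [_] := sf k.+1; exact. Qed.

Lemma smooth_continuous f : smooth f -> continuous f.
Proof. by move=> sf x; apply: differentiable_continuous; exact: smooth_diff. Qed.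

Lemma pd_cst i (c : R) : pd i (fun=> c) = fun=> 0.
Proof. by apply/funext => x; exact: derive_cst. Qed.

Lemma pdD i f g x : differentiable f x -> differentiable g x ->
  pd i (fun y => f y + g y) x = pd i f x + pd i g x.
Proof. by move=> df dg; apply: deriveD; exact: diff_derivable. Qed.

Lemma pdM i f g x : differentiable f x -> differentiable g x ->
  pd i (fun y => f y * g y) x = pd i f x * g x + f x * pd i g x.
Proof.
move=> df dg; rewrite /pd [LHS](deriveM (diff_derivable df) (diff_derivable dg)).
by rewrite addrC; congr (_ + _); rewrite /GRing.scale/= mulrC.
Qed.

Lemma diff_comp1 (g : R -> R) dg f x : is_derive (f x) 1 g dg ->
  differentiable f x -> differentiable (fun y => g (f y)) x.
Proof.
move=> dgx df; apply: differentiable_comp => //.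
by apply/derivable1_diffP; exact: ex_derive.
Qed.

Lemma pd_comp i (g : R -> R) dg f x : is_derive (f x) 1 g dg ->
  differentiable f x -> pd i (fun y => g (f y)) x = dg * pd i f x.
Proof.
move=> dgx df; have dg' : differentiable g (f x).
  by apply/derivable1_diffP; exact: ex_derive.
rewrite /pd deriveE; last exact: differentiable_comp.
have -> := congr1 (fun h => h 'e_i) (diff_comp df dg'); rewrite /= deriveE// diff1E//.
by rewrite derive1E derive_val /GRing.scale/= mulrC.
Qed.

Lemma smoothn_cst k (c : R) : smoothn k (fun=> c).
Proof.
by elim: k c => [|k IH] c; split=> // i; rewrite pd_cst.
Qed.

Lemma smoothnD k f g : smoothn k f -> smoothn k g -> smoothn k (fun x => f x + g x).
Proof.
elim: k f g => [|k IH] f g [df sf] [dg sg]; split=> //.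
- by move=> x; exact: differentiableD.
- by move=> x; exact: differentiableD.
move=> i; rewrite (_ : pd i _ = fun x => pd i f x + pd i g x); first by apply: IH; [exact: sf|exact: sg].
by apply/funext => x; exact: pdD.
Qed.

Lemma smoothnW k f : smoothn k.+1 f -> smoothn k f.
Proof.
elim: k f => [|k IH] f [df sf]; split=> // i; exact: IH (sf i).
Qed.

Lemma smoothnM k f g : smoothn k f -> smoothn k g -> smoothn k (fun x => f x * g x).
Proof.
elim: k f g => [|k IH] f g sf sg.
  by case: sf => df _; case: sg => dg _; split=> // x; exact: differentiableM.
have sfk := smoothnW sf; have sgk := smoothnW sg.
case: sf => df sf; case: sg => dg sg; split=> [x|i]; first exact: differentiableM.
rewrite (_ : pd i _ = fun x => pd i f x * g x + f x * pd i g x).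
  by apply: smoothnD; apply: IH => //; [exact: sf|exact: sg].
by apply/funext => x; exact: pdM.
Qed.

(** To induct on the order of smoothness one needs a family [G] of functions of one variable stable
    under differentiation up to linear combinations of two members. It is applied to exp alone, to
    the powers, and to the functions [flat k]; [A] is the set on which the derivation rule holds. *)
Lemma smoothn_comp (I : Type) (G : I -> R -> R) (A : set R)
    (c1 c2 : I -> R) (j1 j2 : I -> I) :
  (forall i y, A y ->
     is_derive y 1 (G i) (c1 i * G (j1 i) y + c2 i * G (j2 i) y)) ->
  forall k i f, (forall x, A (f x)) -> smoothn k f ->
    smoothn k (fun x => G i (f x)).
Proof.
move=> dG; elim=> [|k IH] i f Af sf.
  by case: sf => df _; split=> // x; exact: diff_comp1 (dG i _ (Af x)) (df x).
have sfk := smoothnW sf; case: sf => df sf; split=> [x|l].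
  exact: diff_comp1 (dG i _ (Af x)) (df x).
rewrite (_ : pd l _ =
    fun x => (c1 i * G (j1 i) (f x) + c2 i * G (j2 i) (f x)) * pd l f x).
  apply: smoothnM; last exact: sf.
  by apply: smoothnD; apply: smoothnM; [exact: smoothn_cst|exact: IH|exact: smoothn_cst|exact: IH].
by apply/funext => x; exact: pd_comp (dG i _ (Af x)) (df x).
Qed.

Lemma smooth_cst (c : R) : smooth (fun _ : E => c).
Proof. by apply/smoothP => k; exact: smoothn_cst. Qed.

Lemma smoothD f g : smooth f -> smooth g -> smooth (fun x => f x + g x).
Proof. by move=> /smoothP sf /smoothP sg; apply/smoothP => k; exact: smoothnD. Qed.

Lemma smoothM f g : smooth f -> smooth g -> smooth (fun x => f x * g x).
Proof. by move=> /smoothP sf /smoothP sg; apply/smoothP => k; exact: smoothnM. Qed.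

Lemma smoothN f : smooth f -> smooth (fun x => - f x).
Proof.
move=> sf; rewrite (_ : (fun x => _) = fun x => -1 * f x); last first.
  by apply/funext => x; rewrite mulN1r.
exact: smoothM (smooth_cst _) sf.
Qed.

Lemma smooth_sum (I : Type) (s : seq I) (h : I -> E -> R) :
  (forall i, smooth (h i)) -> smooth (fun x => \sum_(i <- s) h i x).
Proof.
move=> sh; elim: s => [|i s IH].
  rewrite (_ : (fun x => _) = fun=> 0); first exact: smooth_cst.
  by apply/funext => x; rewrite big_nil.
rewrite (_ : (fun x => _) = fun x => h i x + \sum_(j <- s) h j x).
  exact: smoothD.
by apply/funext => x; rewrite big_cons.
Qed.

Lemma smooth_prod (I : Type) (s : seq I) (h : I -> E -> R) :
  (forall i, smooth (h i)) -> smooth (fun x => \prod_(i <- s) h i x).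
Proof.
move=> sh; elim: s => [|i s IH].
  rewrite (_ : (fun x => _) = fun=> 1); first exact: smooth_cst.
  by apply/funext => x; rewrite big_nil.
rewrite (_ : (fun x => _) = fun x => h i x * \prod_(j <- s) h j x).
  exact: smoothM.
by apply/funext => x; rewrite big_cons.
Qed.

Lemma pd_coord i j x : pd i (fun x : E => x 0 j) x = (i == j)%:R.
Proof.
have @f : {linear E -> R}.
  by exists (fun N : E => N 0 j); do 2![eexists]; do ?[constructor];
     rewrite ?mxE// => ? *; rewrite ?mxE//; move=> ?; rewrite !mxE.
rewrite /pd deriveE; last exact: differentiable_coord.
rewrite (_ : (fun x : E => x 0 j) = f)// diff_lin; last exact: coord_continuous.
by rewrite /f /= mxE eqxx eq_sym.
Qed.

Lemma smooth_coord j : smooth (fun x : E => x 0 j).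
Proof.
apply/smoothP => -[|k]; split=> //; try by move=> x; exact: differentiable_coord.
move=> i; rewrite (_ : pd i _ = fun=> (i == j)%:R); first exact: smoothn_cst.
by apply/funext => x; exact: pd_coord.
Qed.

Lemma smooth_exp f : smooth f -> smooth (fun x => expR (f x)).
Proof.
move=> /smoothP sf; apply/smoothP => k.
apply: (@smoothn_comp unit (fun=> expR) setT (fun=> 1) (fun=> 0) id id) => //.
by move=> _ y _; rewrite mul1r mul0r addr0; exact: is_derive_expR.
Qed.

Lemma smooth_powR f (p : R) : (forall x, 0 < f x) -> smooth f ->
  smooth (fun x => f x `^ p).
Proof.
move=> f0 /smoothP sf; apply/smoothP => k.
apply: (@smoothn_comp R (fun a y => y `^ a) [set y | 0 < y] id (fun=> 0)
  (fun a => a - 1) id) => //.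
by move=> a y /= y0; rewrite mul0r addr0; exact: is_derive1_powR.
Qed.

End smoothn.

(** [flat 0] is the classical smooth function that is flat at 0; the factor [y ^- k] makes the
    family stable under differentiation. *)
Definition flat (k : nat) (y : R) : R :=
  if 0 < y then y ^- k * expR (- y^-1) else 0.

(** From exp u >= u^(k+1)/(k+1)! at u = 1/y. Used with [k.+1], it bounds the difference quotient of
    [flat k] at 0, which equals [flat k.+1]. *)
Lemma flat_le (k : nat) (y : R) : 0 < y -> `|flat k y| <= k.+1`!%:R * y.
Proof.
move=> y0; rewrite /flat y0 ger0_norm; last first.
  by rewrite mulr_ge0 ?expR_ge0// invr_ge0 exprn_ge0// ltW.
have := expR_ge1Dxn k (ltW (_ : 0 < y^-1)); rewrite invr_gt0 => /(_ y0) H.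
have {}H : y^-1 ^+ k.+1 / k.+1`!%:R <= expR y^-1 by rewrite (le_trans _ H)// ler_wpDl.
have f0 : 0 < k.+1`!%:R :> R by rewrite ltr0n fact_gt0.
rewrite expRN ler_pdivrMr ?expR_gt0//.
apply: le_trans (ler_wpM2l _ H); last by rewrite mulr_ge0// ltW.

suff -> : k.+1`!%:R * y * (y^-1 ^+ k.+1 / k.+1`!%:R) = y ^- k by [].
by rewrite exprS exprVn; field; rewrite !gt_eqF// exprn_gt0.
Qed.

Lemma is_derive_inv (y : R) : 0 < y -> is_derive y 1 (fun z : R => z^-1) (- y^-1 ^+ 2).
Proof.
move=> y0; have yn0 : id y != 0 by rewrite gt_eqF.
apply: DeriveDef; first exact: (derivableV yn0 (@derivable_id _ _ _ _)).
rewrite (deriveV yn0 (@derivable_id _ _ _ _)) derive_id /GRing.scale/= mulr1.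
by rewrite exprVn.
Qed.

Lemma is_derive_flat (k : nat) (y : R) :
  is_derive y 1 (flat k) (- k%:R * flat k.+1 y + 1 * flat k.+2 y).
Proof.
case: (ltgtP y 0) => y0.
- rewrite /flat ltNge (ltW y0)/= mulr0 mul1r addr0.
  apply: (@near_eq_is_derive _ _ _ (cst (0 : R))).
    have : \forall z \near y, z < 0 by exact: lt_nbhsl.
    by apply: filterS => z z0; rewrite ltNge (ltW z0).
- pose q (u : R) : R := u ^+ k * expR (- u).
  have dq : is_derive y^-1 1 q (y^-1 ^+ k * - expR (- y^-1) +
      expR (- y^-1) * (k%:R * y^-1 ^+ k.-1)).
    have de : is_derive y^-1 1 (fun u => expR (- u)) (- expR (- y^-1)).
      have := @is_derive1_comp _ expR (-%R) y^-1 _ _ (is_derive_expR _) (is_deriveNid _ _).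
      by rewrite mulrN1.
    have dx : is_derive y^-1 1 (fun u : R => u ^+ k) (k%:R * y^-1 ^+ k.-1).
      apply: DeriveDef; first exact: exprn_derivable.
      by rewrite exp_derive /GRing.scale/= mulr1.
    exact: (is_deriveM dx de).
  have := @is_derive1_comp _ q (fun z => z^-1) y _ _ dq (is_derive_inv y0).
  set D := (X in is_derive _ _ _ X).
  have -> : D = - k%:R * flat k.+1 y + 1 * flat k.+2 y.
    rewrite /D /flat y0 -!exprVn mul1r; case: (k) => [|m].
      by rewrite expr0; ring.
    by rewrite -pred_Sn !exprS; ring.
  apply: near_eq_is_derive.
  have : \forall z \near y, 0 < z by exact: lt_nbhsr.
  by apply: filterS => z z0; rewrite /flat z0 /q /= -exprVn.
- rewrite y0 /flat ltxx mulr0 mul1r addr0.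
  have H : h^-1 *: ((flat k \o shift 0) (h *: 1) - flat k 0) @[h --> (0 : R)^'] --> (0 : R).
    apply/cvgr0Pnorm_le => e e0; near=> h.
    rewrite /= addr0 /GRing.scale/= mulr1 [flat k 0]/flat ltxx subr0.
    have [h0|h0] := ltP 0 h; last by rewrite /flat ltNge h0/= mulr0 normr0 ltW.
    have -> : h^-1 * flat k h = flat k.+1 h.
      by rewrite /flat h0 mulrA -!exprVn exprS.
    rewrite (le_trans (flat_le _ h0))// mulrC -ler_pdivlMr ?ltr0n ?fact_gt0//.
    rewrite (le_trans (ler_norm _))//; near: h.
    have f0 : 0 < e / k.+2`!%:R by rewrite divr_gt0// ltr0n fact_gt0.
    exact: dnbhs0_le.
  by apply: DeriveDef; [exact: cvgP H|exact: cvg_lim H].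
Unshelve. all: by end_near. Qed.

Lemma smooth_flat n k (f : 'rV[R]_n -> R) : smooth f -> smooth (fun x => flat k (f x)).
Proof.
move=> /smoothP sf; apply/smoothP => m.
apply: (@smoothn_comp _ nat flat setT (fun k => - k%:R) (fun=> 1) S (fun k => k.+2)) => //.
by move=> j y _; exact: is_derive_flat.
Qed.

(** The factor [expR 2] normalises the value at 0 to 1, so that rescaled bumps tend to 1
    pointwise. *)
Definition bump1 (y : R) : R := flat 0 (1 + y) * flat 0 (1 - y) * expR 2.

Lemma flat_ge0 k y : 0 <= flat k y.
Proof.
rewrite /flat; case: ifP => // y0.
by rewrite mulr_ge0 ?expR_ge0// invr_ge0 exprn_ge0// ltW.
Qed.

Lemma bump1_ge0 y : 0 <= bump1 y.
Proof. by rewrite !mulr_ge0 ?flat_ge0 ?expR_ge0. Qed.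

Lemma bump1_0 : bump1 0 = 1.
Proof.
rewrite /bump1 subr0 addr0 /flat ltr01 expr0 invr1 !mul1r -!expRD.
by rewrite (_ : _ + _ = 0) ?expR0//; ring.
Qed.

Lemma bump1_supp y : bump1 y != 0 -> `|y| <= 1.
Proof.
apply: contraNT; rewrite -ltNge /bump1 /flat.
have [y0|y0] := leP 0 y.
  rewrite ger0_norm// => y1; rewrite [in X in _ * X * _]ifF ?mulr0 ?mul0r//.
  by apply/negbTE; rewrite -leNgt subr_le0 ltW.
rewrite ltr0_norm// => y1; rewrite ifF ?mul0r//.
by apply/negbTE; rewrite -leNgt -[y]opprK subr_le0 ltW.
Qed.

Definition mbump n (x : 'rV[R]_n) : R := \prod_i bump1 (x 0 i).

Lemma smooth_mbump n : smooth (@mbump n).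
Proof.
apply: smooth_prod => i; apply: smoothM; last exact: smooth_cst.
have sc := @smooth_coord n i.
apply: smoothM; apply: smooth_flat; apply: smoothD => //; try exact: smooth_cst.
exact: smoothN.
Qed.

Lemma mbump_ge0 n (x : 'rV[R]_n) : 0 <= mbump x.
Proof. by apply: prodr_ge0 => i _; exact: bump1_ge0. Qed.

Lemma mbump0 n : mbump (0 : 'rV[R]_n) = 1.
Proof. by rewrite /mbump big1// => i _; rewrite mxE bump1_0. Qed.

Lemma mbump_supp n (x : 'rV[R]_n) : mbump x != 0 -> cube n 1 x.
Proof.
move=> bx i /=; rewrite in_itv/= -ler_norml; apply: bump1_supp.
by apply: contra_neq bx => b0; rewrite /mbump (bigD1 i)//= b0 mul0r.
Qed.

End smooth_functions.

(** * Compact supports and integrals of derivatives *)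

Section compact_support.
Context {R : realType} {n : nat}.
Local Notation E := 'rV[R]_n.

Lemma compact_cube (k : R) : compact (cube n k : set E).
Proof.
rewrite (_ : cube n k = [set v : E | forall i, `[-k, k]%classic (v ord0 i)])//.
by apply: (rV_compact (A := fun=> `[-k, k]%classic)) => i; exact: segment_compact.
Qed.

Lemma closed_cube (k : R) : closed (cube n k : set E).
Proof. by apply: compact_closed; [exact: norm_hausdorff|exact: compact_cube]. Qed.

Definition supported (k : R) (f : E -> R) := forall z, f z != 0 -> cube n k z.

Lemma supportedP k f z : supported k f -> ~ cube n k z -> f z = 0.
Proof. by move=> sf; apply: contra_notP => /eqP/sf. Qed.

Lemma subset_cube (k l : R) : k <= l -> cube n k `<=` (cube n l : set E).
Proof.
move=> kl z zk i; have := zk i; rewrite /= !in_itv/= => /andP[a b].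
by rewrite (le_trans b kl) (le_trans _ a)// lerN2.
Qed.

Lemma cubeD (k l : R) (y z : E) : cube n k y -> cube n l z -> cube n (k + l) (y + z).
Proof.
move=> yk zl i; have := yk i; have := zl i; rewrite /= !in_itv/= mxE.
by move=> /andP[? ?] /andP[? ?]; rewrite opprD !lerD.
Qed.

Lemma cubeN (k : R) (z : E) : cube n k z -> cube n k (- z).
Proof.
move=> zk i; have := zk i; rewrite /= !in_itv/= mxE => /andP[? ?].
by rewrite lerN2 lerNl; apply/andP.
Qed.

Lemma supported_pd k f i : supported k f -> supported k (pd i f).
Proof.
move=> sf z; apply: contraNP => zk.
have oC : \forall y \near z, ~ cube n k y.
  by apply: open_nbhs_nbhs; split => //; apply: closed_openC; exact: closed_cube.
apply/eqP; rewrite /pd (_ : 0 = 'D_'e_i (cst (0 : R)) z); last by rewrite derive_cst.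
apply: near_eq_derive; move: oC; apply: filterS => y yk; exact: supportedP yk.
Qed.

Lemma supported_bounded k (f : E -> R) : continuous f -> supported k f ->
  exists M : R, forall z, `|f z| <= M.
Proof.
move=> cf sf.
have /compact_bounded[M [_ HM]] : compact (f @` cube n k).
  apply: continuous_compact; last exact: compact_cube.
  exact: continuous_subspaceT.
exists (`|M| + 1) => z; have [fz|fz] := eqVneq (f z) 0.
  by rewrite fz normr0 addr_ge0.
apply: (HM (`|M| + 1)); first by rewrite (le_lt_trans (ler_norm _))// ltrDl.
by exists z => //; exact: sf.
Qed.

Lemma integrable_cst_cube (k M : R) :
  (leb n).-integrable setT (fun z : E => (M * \1_(cube n k) z)%:E).
Proof.
have mc : measurable_fun setT (\1_(cube n k) : E -> R).
  by apply: measurable_indic; exact: measurable_cube.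
apply/integrableP; split.
  by apply/measurable_EFinP; exact: measurable_funM.
rewrite (eq_integral (fun z => `|M|%:E * (\1_(cube n k) z)%:E)%E); last first.
  by move=> z _; rewrite /= normrM [X in _ * X]ger0_norm// EFinM.
rewrite ge0_integralZl_EFin//; last exact/measurable_EFinP.
rewrite integral_indic//; last exact: measurable_cube.
by rewrite setIT lte_mul_pinfty ?lee_fin//; exact: leb_cube_lty.
Qed.

Lemma supported_integrable (k M : R) (f : E -> R) : measurable_fun setT f ->
  (forall z, `|f z| <= M) -> supported k f -> (leb n).-integrable setT (EFin \o f).
Proof.
move=> mf fM sf.
have mc := @measurable_indic _ _ R setT _ (@measurable_cube R n k).
apply: (@le_integrable _ _ _ _ _ _ _ (fun z => (`|M| * \1_(cube n k) z)%:E)) => //.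
- exact/measurable_EFinP.
- move=> z _; rewrite /= lee_fin [leRHS]ger0_norm ?mulr_ge0//.
  have [zk|zk] := pselect (cube n k z).
    by rewrite indicE mem_set// mulr1 (le_trans (fM z))// ler_norm.
  by rewrite (supportedP sf)// normr0 mulr_ge0.
- exact: integrable_cst_cube.
Qed.

Lemma continuous_supported_integrable k (f : E -> R) : continuous f -> supported k f ->
  (leb n).-integrable setT (EFin \o f).
Proof.
move=> cf sf; have [M fM] := supported_bounded cf sf.
by apply: supported_integrable sf; [exact: continuous_rV_measurable|exact: fM].
Qed.

Lemma is_derive_line (F : E -> R) i x (t : R) : differentiable F (t *: 'e_i + x) ->
  is_derive t 1 (fun s : R => F (s *: 'e_i + x)) (pd i F (t *: 'e_i + x)).
Proof.
move=> dF; have dF' : derivable F (t *: 'e_i + x) 'e_i := diff_derivable dF.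
have E1 : (fun h : R => h^-1 *: (((fun s : R => F (s *: 'e_i + x)) \o shift t) (h *: 1) -
    F (t *: 'e_i + x))) = (fun h : R => h^-1 *: ((F \o shift (t *: 'e_i + x)) (h *: 'e_i) -
    F (t *: 'e_i + x))).
  apply/funext => h /=; congr (_ *: (F _ - _)).
  by rewrite addrA -scalerDl /GRing.scale/= mulr1.
by apply: DeriveDef; rewrite /derivable /derive E1.
Qed.

(** The difference quotients have integral 0 by translation invariance. They are bounded by the mean
    value theorem and supported in a cube one unit larger, the steps [h m] being at most 1, so
    dominated convergence applies. *)
Lemma integral_pd (F : E -> R) i k : (forall x, differentiable F x) ->
  continuous (pd i F) -> supported k F -> (\int[leb n]_x (pd i F x)%:E = 0)%E.
Proof.
move=> dF cpF sF; have cF : continuous F.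
  by move=> x; apply: differentiable_continuous.
have [M HM] := supported_bounded cpF (supported_pd (i := i) sF).
have iF := continuous_supported_integrable cF sF.
have mF := continuous_rV_measurable cF.
pose h (m : nat) : R := m.+1%:R^-1.
have h0 m : 0 < h m by rewrite invr_gt0.
have h1 m : h m <= 1 by rewrite invf_le1// ler1n.
pose u m x : R := (h m)^-1 * (F (h m *: 'e_i + x) - F x).
have mtr m : measurable_fun setT (fun x => F (h m *: 'e_i + x)).
  rewrite (_ : (fun x => _) = F \o (fun x => x + h m *: 'e_i)).
    by apply: measurableT_comp => //; exact: measurable_addr.
  by apply/funext => x; rewrite /= addrC.
have mu m : measurable_fun setT (u m).
  by apply: measurable_funM => //; exact: measurable_funB.
have ei m : cube n 1 (h m *: 'e_i : E).
  move=> j /=; rewrite in_itv/= !mxE eqxx /=; case: eqP => _ /=; rewrite ?mulr1 ?mulr0.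
    by rewrite h1 (le_trans _ (ltW (h0 m))) ?oppr_le0.
  by rewrite oppr_le0 ler01.
have sF1 m : supported (k + 1) (fun x => F (h m *: 'e_i + x)).
  move=> z /sF zk; rewrite -[z](addKr (h m *: 'e_i)) addrC.
  by apply: cubeD => //; exact/cubeN/ei.
have su m : supported (k + 1) (u m).
  move=> z; apply: contraNP => zk; rewrite /u (supportedP (sF1 m) zk).
  rewrite (supportedP sF) ?subrr ?mulr0// => zk'; apply: zk.
  by apply: subset_cube zk'; rewrite lerDl.
have uM m x : `|u m x| <= M.
  have [|||c _ Hc] := @MVT R (fun s => F (s *: 'e_i + x))
      (fun s => pd i F (s *: 'e_i + x)) 0 (h m).
  - exact: h0.
  - by move=> t _; exact: is_derive_line.
  - apply: derivable_within_continuous => t _.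
    by have [] := is_derive_line (dF (t *: 'e_i + x)).
  move: Hc; rewrite scale0r add0r subr0 /u => ->.
  by rewrite mulrC mulfK ?gt_eqF// HM.
have ucv x : u m x @[m --> \oo] --> pd i F x.
  have dFx : derivable F x 'e_i := diff_derivable (dF x).
  have hcv : h m @[m --> \oo] --> (0 : R)^'.
    move=> A A0; have {}A0 : \forall y \near (0 : R), y != 0 -> A y by exact: A0.
    have H : \forall m \near \oo, h m != 0 -> A (h m) := @cvg_harmonic R _ A0.
    by apply: filterS H => m; apply; rewrite gt_eqF.
  exact: (cvg_comp _ _ hcv dFx).
have [|||||_ _] := @dominated_convergence _ _ _ (leb n) setT measurableT
  (fun m x => (u m x)%:E) (fun x => (pd i F x)%:E)
  (fun x => (M * \1_(cube n (k + 1)) x)%:E).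
- by move=> m; apply/measurable_EFinP.
- by apply/measurable_EFinP; exact: continuous_rV_measurable.
- by apply: aeW => x _; apply/cvg_EFin; [exact: nearW|exact: ucv].
- exact: integrable_cst_cube.
- apply: aeW => x m _; rewrite /= lee_fin.
  have [xk|xk] := pselect (cube n (k + 1) x).
    by rewrite indicE mem_set// mulr1.
  by rewrite (supportedP (su m))// normr0 indicE memNset// mulr0.
have -> : (fun m => \int[leb n]_x (u m x)%:E)%E = cst 0%E.
  apply/funext => m; rewrite /u.
  under eq_integral do rewrite EFinM.
  have iF1 : (leb n).-integrable setT (fun x => (F (h m *: 'e_i + x))%:E).
    have [N HN] := supported_bounded cF sF.
    exact: (supported_integrable (mtr m) (fun z => HN _) (sF1 m)).
  have -> : (\int[leb n]_x ((h m)^-1%:E * (F (h m *: 'e_i + x) - F x)%:E) =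
     (h m)^-1%:E * (\int[leb n]_x (F (h m *: 'e_i + x))%:E - \int[leb n]_x (F x)%:E))%E.
    rewrite -integralB//; rewrite -integralZl//; exact: integrableB.
  rewrite (_ : \int[leb n]_x (F (h m *: 'e_i + x))%:E = \int[leb n]_x (F x)%:E)%E.
    by rewrite subee ?mule0//; exact: integrable_fin_num.
  rewrite -[RHS](integral_translation (h m *: 'e_i)); last exact/measurable_EFinP.
  by apply: eq_integral => x _; rewrite addrC.
by move=> /cvg_lim <- //; rewrite lim_cst.
Qed.

End compact_support.

(** * Functions on the orthant lifted from logarithmic coordinates *)

Section xlift.
Context {R : realType} {n : nat}.
Local Notation E := 'rV[R]_n.
Local Notation D := (@orthant R n).
Variable sigma : 'M[R]_n.
Hypothesis sigmaU : sigma \in unitmx.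
Local Notation Th := (Theta sigma).
Local Notation lg := (logT sigma).

Definition csmooth (f : E -> R) := smooth f /\ exists k, supported k f.

Lemma csmooth_pd i f : csmooth f -> csmooth (pd i f).
Proof.
by move=> [sf [k kf]]; split; [exact: smooth_pd|exists k; exact: supported_pd].
Qed.

Lemma csmoothM f g : csmooth f -> smooth g -> csmooth (fun x => f x * g x).
Proof.
move=> [sf [k kf]] sg; split; first exact: smoothM.
by exists k => z fg; apply: kf; apply: contra_neq fg => ->; rewrite mul0r.
Qed.

Lemma csmoothMr f g : smooth f -> csmooth g -> csmooth (fun x => f x * g x).
Proof.
move=> sf sg; rewrite (_ : (fun x => _) = (fun x => g x * f x)); first exact: csmoothM.
by apply/funext => x; rewrite mulrC.
Qed.

Lemma csmoothD f g : csmooth f -> csmooth g -> csmooth (fun x => f x + g x).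
Proof.
move=> [sf [k kf]] [sg [l lg]]; split; first exact: smoothD.
exists (Num.max k l) => z; apply: contraNP => zkl.
rewrite (supportedP kf) ?(supportedP lg) ?addr0//; apply: contra_not zkl.
  by apply: subset_cube; rewrite le_max lexx orbT.
by apply: subset_cube; rewrite le_max lexx.
Qed.

Lemma csmooth_cst0 : csmooth (fun=> 0).
Proof. by split; [exact: smooth_cst|exists 0 => z; rewrite eqxx]. Qed.

Lemma csmooth_sum (I : Type) (s : seq I) (h : I -> E -> R) :
  (forall i, csmooth (h i)) -> csmooth (fun x => \sum_(i <- s) h i x).
Proof.
move=> sh; elim: s => [|i s IH].
  rewrite (_ : (fun x => _) = fun=> 0); first exact: csmooth_cst0.
  by apply/funext => x; rewrite big_nil.
rewrite (_ : (fun x => _) = fun x => h i x + \sum_(j <- s) h j x).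
  exact: csmoothD.
by apply/funext => x; rewrite big_cons.
Qed.

(** For [F] smooth of compact support the extension by 0 is a test function on the orthant; the test
    functions put into the variational equation are all of this form. *)
Definition xlift (F : E -> R) (x : E) : R :=
  if `[< D x >] then F (lg x) else 0.

Lemma lift_Theta F z : xlift F (Th z) = F z.
Proof. by rewrite /xlift asboolT ?ThetaK//; exact: Theta_orthant. Qed.

Lemma liftE F x : D x -> xlift F x = F (lg x).
Proof. by move=> Dx; rewrite /xlift asboolT. Qed.

Lemma liftN F x : ~ D x -> xlift F x = 0.
Proof. by move=> Dx; rewrite /xlift asboolF. Qed.

Lemma slinE (z : E) i : slin sigma z 0 i = \sum_k z 0 k * sigma i k.
Proof. by rewrite mxE; apply: eq_bigr => k _; rewrite mxE. Qed.

Lemma smooth_slin i : smooth (fun z : E => slin sigma z 0 i).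
Proof.
rewrite (_ : (fun z => _) = fun z : E => \sum_k z 0 k * sigma i k).
  by apply: smooth_sum => k; apply: smoothM; [exact: smooth_coord|exact: smooth_cst].
by apply/funext => z; rewrite slinE.
Qed.

Lemma pdZr k (f : E -> R) c z : differentiable f z ->
  pd k (fun x => f x * c) z = pd k f z * c.
Proof.
move=> df; rewrite (pdM k df (differentiable_cst c z)).
by rewrite [X in _ + _ * X](_ : _ = 0) ?mulr0 ?addr0//; exact: derive_cst.
Qed.

Lemma pd_sum (I : Type) (s : seq I) k (h : I -> E -> R) z :
  (forall i, differentiable (h i) z) ->
  differentiable (fun x => \sum_(i <- s) h i x) z /\
  pd k (fun x => \sum_(i <- s) h i x) z = \sum_(i <- s) pd k (h i) z.
Proof.
move=> dh; elim: s => [|i s [IH1 IH2]].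
  rewrite (_ : (fun x => _) = fun=> 0); last by apply/funext => x; rewrite big_nil.
  by rewrite big_nil; split; [exact: differentiable_cst|exact: derive_cst].
rewrite (_ : (fun x => _) = fun x => h i x + \sum_(j <- s) h j x); last first.
  by apply/funext => x; rewrite big_cons.
by rewrite big_cons pdD// IH2; split=> //; exact: differentiableD.
Qed.

Lemma pd_slin k i (z : E) : pd k (fun z : E => slin sigma z 0 i) z = sigma i k.
Proof.
rewrite (_ : (fun z => _) = fun z : E => \sum_l z 0 l * sigma i l); last first.
  by apply/funext => y; rewrite slinE.
have dc l : differentiable (fun z : E => z 0 l) z by exact: differentiable_coord.
rewrite (pd_sum _ _ _).2 => [|l]; last by apply: differentiableM => //.
rewrite (bigD1 k)//= big1 ?addr0 => [|l lk]; rewrite pdZr// pd_coord.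
  by rewrite eqxx mul1r.
by rewrite eq_sym (negbTE lk) mul0r.
Qed.

Lemma continuous_Theta : continuous Th.
Proof.
have -> : Th = fun u => gbm_val 0 (fun=> 0) sigma (const_mx 1) 0 u.
  apply/funext => z; apply/rowP => i; rewrite !mxE mul1r mulr0 add0r.
  by congr expR; apply: eq_bigr => k _; rewrite mxE mulrC.
exact: (@continuous_gbm_val R n 0 (fun=> 0) sigma E (fun=> 0) id (const_mx 1)
  (@cst_continuous _ _ 0) (fun=> cvg_id)).
Qed.

Lemma logT_sum x : lg x = \sum_i ln (x 0 i) *: row i (invmx sigma)^T.
Proof.
by rewrite /logT mulmx_sum_row; apply: eq_bigr => i _; rewrite mxE.
Qed.

Lemma diff_logT x : D x -> differentiable lg x.
Proof.
move=> Dx; have -> : lg = \sum_i (fun y : E => ln (y 0 i) *: row i (invmx sigma)^T).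
  by apply/funext => y; rewrite logT_sum fct_sumE.
apply: differentiable_sum => i; apply: differentiableZl.
exact: (diff_comp1 (is_derive1_ln (Dx i)) (differentiable_coord x 0 i)).
Qed.

Lemma derive_logT x j : D x ->
  'D_'e_j lg x = (x 0 j)^-1 *: row j (invmx sigma)^T.
Proof.
move=> Dx.
have dln i : differentiable (fun y : E => ln (y 0 i)) x.
  exact: (diff_comp1 (is_derive1_ln (Dx i)) (differentiable_coord x 0 i)).
have -> : lg = \sum_i (fun y : E => ln (y 0 i) *: row i (invmx sigma)^T).
  by apply/funext => y; rewrite logT_sum fct_sumE.
have pdln i : 'D_'e_j (fun y : E => ln (y 0 i)) x = (x 0 i)^-1 * (j == i)%:R.
  have := pd_comp j (is_derive1_ln (Dx i)) (differentiable_coord x 0 i).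
  by rewrite pd_coord; exact.
rewrite derive_sum => [|i]; last first.
  by apply: diff_derivable; exact: differentiableZl.
have dZ i (w : E) : 'D_'e_j (fun y : E => ln (y 0 i) *: w) x =
    'D_'e_j (fun y : E => ln (y 0 i)) x *: w.
  rewrite deriveE; last exact: differentiableZl.
  by rewrite (diffZl _ (dln i))/= -deriveE.
rewrite (bigD1 j)//= big1 ?addr0 => [|i ij]; rewrite dZ pdln.
  by rewrite eqxx mulr1.
by rewrite eq_sym (negbTE ij) mulr0 scale0r.
Qed.

(** The field d/dx_j in the coordinates z: the exponential is 1/x_j, and [invmx sigma k j] is the
    derivative of z_k with respect to ln x_j. *)
Definition xpd (j : 'I_n) (F : E -> R) (z : E) : R :=
  expR (- slin sigma z 0 j) * \sum_k invmx sigma k j * pd k F z.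

Lemma near_orthant x : D x -> \forall y \near x, D y.
Proof.
move=> Dx; have : \forall y \near x, forall i, 0 < (y : E) 0 i.
  have Fx : Filter (nbhs x) by exact: nbhs_filter.
  apply: (@filter_forall _ _ (fun i (y : E) => 0 < y 0 i) _ Fx) => i.
  have := @coord_continuous R 1 n 0 i x => /(_ [set t | 0 < t]); apply.
  exact: lt_nbhsr.
exact: filterS.
Qed.

(** The support of the lift lies in the image of a cube under [Theta], a compact subset of the open
    orthant; its complement is a neighbourhood of every point outside the orthant. *)
Lemma lift_near0 k F x : supported k F -> ~ D x -> \forall y \near x, xlift F y = 0.
Proof.
move=> sF Dx; have oC : \forall y \near x, (~` (Th @` cube n k)) y.
  apply: open_nbhs_nbhs; split.
    apply: closed_openC; apply: compact_closed; first exact: norm_hausdorff.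
    apply: continuous_compact; last exact: compact_cube.
    exact/continuous_subspaceT/continuous_Theta.
  by move=> [z _ zx]; apply: Dx; rewrite -zx; exact: Theta_orthant.
move: oC; apply: filterS => y yC; have [Dy|Dy] := pselect (D y); last exact: liftN.
rewrite liftE//; apply: (supportedP sF) => yk; apply: yC.
by exists (lg y) => //; rewrite logTK.
Qed.

Lemma diff_lift k F x : (forall z, differentiable F z) -> supported k F ->
  differentiable (xlift F) x.
Proof.
move=> dF sF; have [Dx|Dx] := pselect (D x).
  apply: (@near_eq_differentiable _ _ _ _ (F \o lg)).
    have := near_orthant Dx; apply: filterS => y Dy; exact: liftE.
  by apply: differentiable_comp; [exact: diff_logT|exact: dF].
apply: (@near_eq_differentiable _ _ _ _ (cst (0 : R))); last exact: differentiable_cst.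
exact: lift_near0 sF Dx.
Qed.

Lemma pd_lift k j F : (forall z, differentiable F z) -> supported k F ->
  pd j (xlift F) = xlift (xpd j F).
Proof.
move=> dF sF; apply/funext => x; have [Dx|Dx] := pselect (D x); last first.
  rewrite liftN// /pd.
  have -> : 'D_'e_j (xlift F) x = 'D_'e_j (cst (0 : R)) x.
    by apply: near_eq_derive; exact: lift_near0 sF Dx.
  exact: derive_cst.
rewrite liftE// /pd; have -> : 'D_'e_j (xlift F) x = 'D_'e_j (F \o lg) x.
  apply: near_eq_derive.
  by have := near_orthant Dx; apply: filterS => y Dy; exact: liftE.
have dlg := diff_logT Dx.
rewrite deriveE; last exact: differentiable_comp.
have -> := congr1 (fun h => h 'e_j) (diff_comp dlg (dF (lg x))).
rewrite /= -[X in 'd F _ X]deriveE// derive_logT// linearZ /= /xpd slin_logT// mxE expRN lnK ?posrE//; congr (_ * _).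
rewrite [row j _]row_sum_delta linear_sum; apply: eq_bigr => k' _.
by rewrite linearZ /= -deriveE// !mxE.
Qed.

Lemma csmooth_xpd j F : csmooth F -> csmooth (xpd j F).
Proof.
move=> cF; apply: csmoothMr.
  by apply: smooth_exp; apply: smoothN; exact: smooth_slin.
apply: csmooth_sum => k; apply: csmoothMr; first exact: smooth_cst.
exact: csmooth_pd.
Qed.

(** By [pd_lift] a partial derivative of a lift is again a lift, so smoothness follows by induction
    on the order with [F] varying. *)
Lemma test_function_lift F : csmooth F -> test_function (xlift F).
Proof.
move=> cF; have [sF [k kF]] := cF.
have cT : compact (Th @` cube n k).
  apply: continuous_compact; last exact: compact_cube.
  exact/continuous_subspaceT/continuous_Theta.
have clT : closure [set x | xlift F x != 0] `<=` Th @` cube n k.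
  rewrite closureE => x; apply; split.
    by apply: compact_closed; [exact: norm_hausdorff|exact: cT].
  move=> y /= ; have [Dy|Dy] := pselect (D y); last by rewrite liftN// eqxx.
  by rewrite liftE// => /kF yk; exists (lg y) => //; rewrite logTK.
split.
- apply/smoothP => m; elim: m F cF {sF kF cT clT} => [|m IH] F [sF [l lF]];
    (split=> //; first by move=> x; apply: diff_lift lF => z; exact: smooth_diff).
  move=> j; rewrite (pd_lift _ _ lF); last by move=> z; exact: smooth_diff.
  by apply: IH; apply: csmooth_xpd; split=> //; exists l.
- by apply: subclosed_compact cT _ => //; exact: closed_closure.
- by move=> x /clT[z _ <-]; exact: Theta_orthant.
Qed.

End xlift.

(** * Integrals and null sets *)

Section integral_ae.
Context d (T : measurableType d) (R : realType) (mu : {measure set T -> \bar R}).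
Local Open Scope ereal_scope.

(** The integral of a nonnegative function, measurable or not, is a supremum over the simple
    functions below it, and each of these can be set to 0 on a measurable null set without changing
    its integral. *)
Lemma ge0_le_integral_ae (f g : T -> \bar R) :
  (forall x, 0 <= f x) -> (forall x, 0 <= g x) ->
  {ae mu, forall x, f x <= g x} -> \int[mu]_x f x <= \int[mu]_x g x.
Proof.
move=> f0 g0 [A [mA A0 Afg]]; rewrite (ge0_integralTE _ f0) (ge0_integralTE _ g0).
apply: ge_ereal_sup => _ [h /= hf <-].
have mC : measurable (~` A) by exact: measurableC.
pose h' := mul_nnsfun h (indic_nnsfun R mC).
have -> : sintegral mu h = sintegral mu h'.
  rewrite -!integralT_nnsfun; apply: ge0_ae_eq_integral => //.
  - exact/measurable_EFinP.
  - exact/measurable_EFinP.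
  - by move=> x _; rewrite lee_fin.
  - by move=> x _; rewrite lee_fin.
  exists A; split => // x /= hx; apply: contrapT => Ax; apply: hx => _.
  by rewrite /h' /= mindicE mem_set ?mulr1.
apply: ereal_sup_ubound; exists h' => // x /=.
have [Ax|Ax] := pselect (A x).
  by rewrite /h' /= mindicE memNset ?mulr0//=; apply.
rewrite /h' /= mindicE mem_set//= mulr1 (le_trans (hf x))//.
by apply: contrapT => fg; apply: Ax; exact: Afg.
Qed.

(* No measurability is required: the exceptional null set may hide a
   nonmeasurable difference. *)
Lemma ae_eq_integral_nonmeas (D : set T) (f g : T -> \bar R) :
  {ae mu, forall x, D x -> f x = g x} ->
  \int[mu]_(x in D) f x = \int[mu]_(x in D) g x.
Proof.
move=> fg; rewrite integral_mkcond [RHS]integral_mkcond integralE [RHS]integralE.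
have fgD : {ae mu, forall x, (f \_ D) x = (g \_ D) x}.
  apply: filterS fg => x fg; rewrite !patchE; case: ifPn => // /set_mem; exact: fg.
congr (_ - _); apply/eqP; rewrite eq_le; apply/andP; split;
  apply: ge0_le_integral_ae; do ?[by move=> x; exact: funepos_ge0|
  by move=> x; exact: funeneg_ge0];
  by apply: filterS fgD => x E; rewrite ?funeposE ?funenegE E.
Qed.

End integral_ae.

(** * Transfer of integrals and null sets along [Theta] *)

Section transfer.
Context {R : realType} {n : nat}.
Local Notation E := 'rV[R]_n.
Local Notation D := (@orthant R n).
Variables (sigma : 'M[R]_n) (C : R).
Hypothesis sigmaU : sigma \in unitmx.
Hypothesis C0 : 0 < C.
Hypothesis intTh : forall F : E -> \bar R, measurable_fun D F ->
    (forall x, D x -> 0 <= F x)%E ->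
    (\int[leb n]_(x in D) F x =
     \int[leb n]_z (F (Theta sigma z) * (C * expR (sumslin sigma z))%:E))%E.
Local Notation Th := (Theta sigma).
Local Notation lg := (logT sigma).

Definition jac (z : E) : R := C * expR (sumslin sigma z).

Lemma jac_gt0 z : 0 < jac z. Proof. by rewrite mulr_gt0 ?expR_gt0. Qed.

Lemma measurable_jac : measurable_fun setT jac.
Proof.
apply: measurable_funM => //; apply: measurableT_comp => //.
exact: measurable_sumslin.
Qed.

(** The left-hand measure is the integral of the positive function [jac] over the preimage of [A].
    Hence statements holding almost everywhere on the orthant and on the whole space correspond to
    each other ([ae_Theta]). *)
Lemma null_Theta (A : set E) : measurable A ->
  (leb n (A `&` D) = 0 <-> leb n (Th @^-1` A) = 0)%E.
Proof.
move=> mA; have mTA : measurable (Th @^-1` A).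
  by rewrite -[X in measurable X]setTI; exact: measurable_Theta.
have -> : leb n (A `&` D) = (\int[leb n]_z ((\1_A (Th z))%:E * (jac z)%:E))%E.
  rewrite -(intTh (F := fun x => (\1_A x)%:E))//.
  - by rewrite integral_indic//; exact: measurable_orthant.
  - by apply/measurable_EFinP; exact: measurable_indic.
have mF : measurable_fun setT (fun z => (\1_A (Th z))%:E * (jac z)%:E)%E.
  apply: emeasurable_funM; apply/measurable_EFinP; last exact: measurable_jac.
  apply: (measurableT_comp (@measurable_indic _ _ R setT _ mA)).
  exact: measurable_Theta.
have := ae_eq_integral_abs (leb n) measurableT mF.
under eq_integral do rewrite gee0_abs ?mule_ge0 ?lee_fin ?(ltW (jac_gt0 _))//.
move=> ->; split.
  move=> [B [mB B0 HB]]; apply/eqP; rewrite eq_le measure_ge0 andbT -B0.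
  rewrite le_measure ?inE// => z /= Az; apply: HB => /= /(_ Logic.I).
  rewrite indicE mem_set// mul1e => -[] /eqP; apply/negP.
  by rewrite gt_eqF// jac_gt0.
move=> TA0; exists (Th @^-1` A); split => // z /= H; apply: contrapT => nA.
by apply: H => _; rewrite indicE memNset ?mul0e.
Qed.

Lemma ae_Theta (P : E -> Prop) :
  {ae leb n, forall x, D x -> P x} <-> {ae leb n, forall z, P (Th z)}.
Proof.
split.
  move=> [A [mA A0 HA]]; exists (Th @^-1` A); split.
  - by rewrite -[X in measurable X]setTI; exact: measurable_Theta.
  - apply/null_Theta => //; apply/eqP; rewrite eq_le measure_ge0 andbT -A0.
    have mAD : measurable (A `&` D).
      by apply: measurableI => //; exact: measurable_orthant.
    by apply: (le_measure _ _ _ (@subIsetl _ A D)); rewrite inE.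
  - move=> z /= Pz; apply: HA => /= H; apply: Pz; apply: H; exact: Theta_orthant.
move=> [A [mA A0 HA]]; have mlA : measurable (lg @^-1` A).
  by rewrite -[X in measurable X]setTI; exact: measurable_logT.
exists (lg @^-1` A `&` D); split.
- by apply: measurableI => //; exact: measurable_orthant.
- apply/null_Theta => //; rewrite (_ : _ @^-1` _ = A)//.
  by apply/seteqP; split => z /=; rewrite ThetaK.
- move=> x /= Px; have Dx : D x by apply: contrapT => Dx; apply: Px.
  split=> //; apply: HA => /= H; apply: Px => _; by rewrite -(logTK sigmaU Dx).
Qed.

Lemma integral_transfer (F G : E -> R) : measurable_fun setT G ->
  {ae leb n, forall z, F (Th z) = G z} ->
  (\int[leb n]_(x in D) (F x)%:E = \int[leb n]_z (G z * jac z)%:E)%E.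
Proof.
move=> mG FG.
rewrite (@ae_eq_integral_nonmeas _ _ _ _ _ _ (fun x => (G (lg x))%:E)); last first.
  by apply/ae_Theta; apply: filterS FG => z ->; rewrite ThetaK.
have mGl : measurable_fun setT (G \o lg).
  by apply: measurableT_comp => //; exact: measurable_logT.
have mGlD : measurable_fun D (fun x => (G (lg x))%:E).
  by apply: measurable_funTS; exact/measurable_EFinP.
rewrite integralE [RHS]integralE; congr (_ - _)%E.
- rewrite intTh//; last exact: measurable_funepos.
  apply: eq_integral => z _; rewrite !funeposE ThetaK// -!EFin_max -EFinM; congr EFin.
  by rewrite -/(jac z) mulrC maxr_pMr ?(ltW (jac_gt0 _))// mulr0 mulrC.
- rewrite intTh//; last exact: measurable_funeneg.
  apply: eq_integral => z _; rewrite !funenegE ThetaK// -!EFinN -!EFin_max -EFinM; congr EFin.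
  by rewrite -/(jac z) mulrC maxr_pMr ?(ltW (jac_gt0 _))// mulr0 mulrN mulrC.
Qed.

Lemma Rintegral_transfer (F G : E -> R) : measurable_fun setT G ->
  {ae leb n, forall z, F (Th z) = G z} ->
  \int[leb n]_(x in D) F x = \int[leb n]_z (G z * jac z).
Proof. by move=> mG FG; rewrite /Rintegral (integral_transfer mG FG). Qed.

Section ypd.

(* The vector field x_j d/dx_j in logarithmic coordinates. *)
Definition ypd (j : 'I_n) (F : E -> R) (z : E) : R :=
  \sum_k invmx sigma k j * pd k F z.

Lemma ypdM j (F G : E -> R) z : differentiable F z -> differentiable G z ->
  ypd j (fun z => F z * G z) z = ypd j F z * G z + F z * ypd j G z.
Proof.
move=> dF dG; rewrite /ypd mulr_suml mulr_sumr -big_split; apply: eq_bigr => k _.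
by rewrite pdM//=; ring.
Qed.

Lemma sumT_invmx i j : \sum_k invmx sigma k j * sigma i k = (i == j)%:R.
Proof.
have /matrixP /(_ i j) := mulmxV sigmaU; rewrite !mxE => <-.
by apply: eq_bigr => k _; rewrite mulrC.
Qed.

Lemma sum_invmxT k i : \sum_j sigma j i * invmx sigma k j = (k == i)%:R.
Proof.
have /matrixP /(_ k i) := mulVmx sigmaU; rewrite !mxE => <-.
by apply: eq_bigr => j _; rewrite mulrC.
Qed.

Lemma ypd_exp j (f : E -> R) z : differentiable f z ->
  ypd j (fun z => expR (f z)) z = expR (f z) * ypd j f z.
Proof.
move=> df; rewrite /ypd mulr_sumr; apply: eq_bigr => k _.
by rewrite (pd_comp k (is_derive_expR _) df) mulrCA.
Qed.

Lemma diff_slin i z : differentiable (fun z : E => slin sigma z 0 i) z.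
Proof. exact: smooth_diff (smooth_slin sigma i). Qed.

Lemma ypd_slin j i z : ypd j (fun z : E => slin sigma z 0 i) z = (i == j)%:R.
Proof. by rewrite -sumT_invmx; apply: eq_bigr => k _; rewrite pd_slin. Qed.

Lemma smooth_sumslin : smooth (sumslin sigma).
Proof. by apply: smooth_sum => i; exact: smooth_slin. Qed.

Lemma ypd_sumslin j z : ypd j (sumslin sigma) z = 1.
Proof.
transitivity (\sum_k \sum_i invmx sigma k j * sigma i k).
  apply: eq_bigr => k _; rewrite -mulr_sumr; congr (_ * _).
  rewrite (pd_sum _ _ _).2 => [|i]; last exact: diff_slin.
  by apply: eq_bigr => i _; exact: pd_slin.
rewrite exchange_big /= (bigD1 j)//= sumT_invmx eqxx big1 ?addr0// => i ij.
by rewrite sumT_invmx (negbTE ij).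
Qed.

Definition ijac (z : E) : R := C^-1 * expR (- sumslin sigma z).

Lemma ijacE z : ijac z = (jac z)^-1.
Proof. by rewrite /ijac /jac invfM expRN. Qed.

Lemma smooth_ijac : smooth ijac.
Proof.
apply: smoothM; first exact: smooth_cst.
by apply: smooth_exp; apply: smoothN; exact: smooth_sumslin.
Qed.

Lemma ypd_ijac j z : ypd j ijac z = - ijac z.
Proof.
have ds : differentiable (sumslin sigma) z by exact: smooth_diff smooth_sumslin.
have de : differentiable (fun z => expR (- sumslin sigma z)) z.
  apply: smooth_diff; apply: smooth_exp; apply: smoothN; exact: smooth_sumslin.
rewrite /ijac ypdM//; rewrite ypd_exp; last exact: differentiableN.
have -> : ypd j (fun=> C^-1) z = 0.
  by rewrite /ypd big1// => k _; rewrite pd_cst mulr0.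
have -> : ypd j (fun z => - sumslin sigma z) z = - 1.
  rewrite -(ypd_sumslin j z) /ypd -sumrN; apply: eq_bigr => k _.
  by rewrite -mulrN; congr (_ * _); rewrite /pd deriveN//; exact: diff_derivable.
by rewrite mul0r add0r mulrN1 mulrN.
Qed.

End ypd.

End transfer.

(** * Translations and mollification in the mean-square sense *)

Section translation_continuity.
Context {R : realType} {n : nat}.
Local Notation E := 'rV[R]_n.
Local Notation lam := (leb n).

(** The square of the L^2 distance, which explains the factors 2 in its triangle inequality. *)
Definition sqdist (u v : E -> R) : \bar R := (\int[lam]_z ((u z - v z) ^+ 2)%:E)%E.

Lemma sqdist_ge0 u v : (0 <= sqdist u v)%E.
Proof. by apply: integral_ge0 => z _; rewrite lee_fin sqr_ge0. Qed.

Lemma measurable_sqB (u v : E -> R) : measurable_fun setT u -> measurable_fun setT v ->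
  measurable_fun setT (fun z => ((u z - v z) ^+ 2)%:E).
Proof.
by move=> mu mv; apply/measurable_EFinP/measurable_funX/measurable_funB.
Qed.

Lemma sqdist_triangle u v w : measurable_fun setT u -> measurable_fun setT v ->
  measurable_fun setT w -> (sqdist u w <= 2%:E * sqdist u v + 2%:E * sqdist v w)%E.
Proof.
move=> mu mv mw.
have m2 (f g : E -> R) : measurable_fun setT f -> measurable_fun setT g ->
    measurable_fun setT (fun z => (2%:E * ((f z - g z) ^+ 2)%:E)%E).
  by move=> mf mg; apply: emeasurable_funM => //; exact: measurable_sqB.
rewrite /sqdist -!ge0_integralZl_EFin//;
  do ?[by move=> z _; rewrite lee_fin sqr_ge0]; do ?[exact: measurable_sqB].
rewrite -ge0_integralD//; last 4 first.
- by move=> z _; rewrite mule_ge0// lee_fin sqr_ge0.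
- exact: m2.
- by move=> z _; rewrite mule_ge0// lee_fin sqr_ge0.
- exact: m2.
apply: ge0_le_integral => //.
- by move=> z _; rewrite lee_fin sqr_ge0.
- exact: measurable_sqB.
- by apply: emeasurable_funD; exact: m2.
move=> z _; rewrite -!EFinM -EFinD lee_fin.
by have := sqr_ge0 (u z - v z - (v z - w z)); nra.
Qed.

Definition transl (y : E) (u : E -> R) : E -> R := fun z => u (z + y).

Lemma measurable_transl y u : measurable_fun setT u -> measurable_fun setT (transl y u).
Proof. by move=> mu; apply: (measurableT_comp mu); exact: measurable_addr. Qed.

Lemma sqdist_transl y u v : measurable_fun setT u -> measurable_fun setT v ->
  sqdist (transl y u) (transl y v) = sqdist u v.
Proof.
move=> mu mv; rewrite /sqdist /transl.
rewrite -[RHS](ge0_integral_translation y)//; first exact: measurable_sqB.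
by move=> z; rewrite lee_fin sqr_ge0.
Qed.

Definition trcont (u : E -> R) : Prop := measurable_fun setT u /\
  forall e : R, 0 < e -> exists2 dl, 0 < dl &
    forall y, cube n dl y -> (sqdist (transl y u) u <= e%:E)%E.

Lemma trcont_comb c u v : trcont u -> trcont v -> trcont (fun z => c * u z + v z).
Proof.
move=> [mu cu] [mv cv]; split.
  by apply: measurable_funD => //; exact: measurable_funM.
move=> e e0; have K0 : 0 < 2 * (c ^+ 2 + 1) :> R.
  by rewrite mulr_gt0// ltr_wpDl// sqr_ge0.
have [d1 d10 H1] := cu (e / 2 / (2 * (c ^+ 2 + 1))) (divr_gt0 (divr_gt0 e0 (ltr0n _ 2)) K0).
have [d2 d20 H2] := cv (e / 2 / 2) (divr_gt0 (divr_gt0 e0 (ltr0n _ 2)) (ltr0n _ 2)).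
exists (Num.min d1 d2); first by rewrite lt_min d10.
move=> y yd.
have {}H1 : (sqdist (transl y u) u <= (e / 2 / (2 * (c ^+ 2 + 1)))%:E)%E.
  by apply: H1; apply: subset_cube yd; rewrite ge_min lexx.
have {}H2 : (sqdist (transl y v) v <= (e / 2 / 2)%:E)%E.
  by apply: H2; apply: subset_cube yd; rewrite ge_min lexx orbT.
have m1 := measurable_sqB (measurable_transl y mu) mu.
have m2 := measurable_sqB (measurable_transl y mv) mv.
apply: (@le_trans _ _ ((2 * (c ^+ 2 + 1))%:E * sqdist (transl y u) u +
   2%:E * sqdist (transl y v) v)%E); last first.
  apply: (@le_trans _ _ ((e / 2)%:E + (e / 2)%:E)%E); last by rewrite -EFinD -splitr.
  apply: leeD.
    apply: (le_trans (lee_pmul _ _ (lexx _) H1)); rewrite ?sqdist_ge0 ?lee_fin ?(ltW K0)//.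
    by rewrite mulrCA divff ?mulr1// gt_eqF.
  apply: (le_trans (lee_pmul _ _ (lexx _) H2)); rewrite ?sqdist_ge0//.
  by rewrite -EFinM lee_fin mulrCA divff ?mulr1.
rewrite /sqdist -!ge0_integralZl_EFin//; do ?[by move=> z _; rewrite lee_fin sqr_ge0];
  last exact: ltW.
rewrite -ge0_integralD//; last 4 first.
- by move=> z _; rewrite mule_ge0 ?lee_fin ?sqr_ge0// ltW.
- exact: emeasurable_funM.
- by move=> z _; rewrite mule_ge0 ?lee_fin ?sqr_ge0.
- exact: emeasurable_funM.
apply: ge0_le_integral => //.
- by move=> z _; rewrite lee_fin sqr_ge0.
- apply: measurable_sqB; first apply: measurable_transl;
    by apply: measurable_funD => //; exact: measurable_funM.
- by apply: emeasurable_funD; exact: emeasurable_funM.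
move=> z _; rewrite -!EFinM -EFinD lee_fin /transl.
set a := u (z + y); set b := u z; set p := v (z + y); set q := v z.
have := sqr_ge0 (c * (a - b) - (p - q)); have := sqr_ge0 (a - b); nra.
Qed.

Lemma trcont_closed u : measurable_fun setT u ->
  (forall e : R, 0 < e -> exists2 v, trcont v & (sqdist u v <= e%:E)%E) -> trcont u.
Proof.
move=> mu Hu; split=> // e e0.
(* Two uses of [sqdist_triangle] cost 2 (2 + 2) + 2 = 10 times the basic error. *)
have e8 : 0 < e / 10 by rewrite divr_gt0.
have [v [mv cv] uv] := Hu _ e8; have [dl dl0 Hdl] := cv _ e8.
exists dl => // y yd.
have mty := measurable_transl y.
have := sqdist_triangle (mty _ mu) mv mu.
have := sqdist_triangle (mty _ mu) (mty _ mv) mv.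
rewrite sqdist_transl//.
have sym : sqdist v u = sqdist u v.
  by apply: eq_integral => z _; rewrite -sqrrN opprB.
rewrite sym => A B; apply: (le_trans B).
apply: (@le_trans _ _ (2%:E * (2%:E * (e / 10)%:E + 2%:E * (e / 10)%:E) + 2%:E * (e / 10)%:E)%E).
  apply: leeD; last by rewrite lee_pmul ?sqdist_ge0.
  apply: lee_pmul; rewrite ?sqdist_ge0//; apply: (le_trans A).
  by apply: leeD; rewrite lee_pmul ?sqdist_ge0//; exact: Hdl.
by rewrite -!(EFinM, EFinD) lee_fin; lra.
Qed.

(** The whole line is added to the half-open intervals so that cylinders over a single coordinate
    are among the boxes ([raybox_measurable]). *)
Definition rayset : set (set R) := [set A | A = setT \/ ocitv A].

Lemma rayset_measurable A : rayset A -> measurable A.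
Proof.
move=> [->|/ocitvP [->|[[a b] /= _ ->]]]; first exact: measurableT.
  exact: measurable0.
exact: measurable_itv.
Qed.

Lemma raysetI : setI_closed rayset.
Proof.
move=> A B [->|oA] [->|oB]; rewrite ?setIT ?setTI; do ?[by left|by right].
by right; exact: ocitvI.
Qed.

Definition raybox : set (set E) :=
  [set B | exists2 A, (forall i, rayset (A i)) & B = box A].

Lemma raybox_measurable : @measurable _ E `<=` <<s raybox >>.
Proof.
apply: smallest_sub; first exact: smallest_sigma_algebra.
rewrite -bigcup_seq; apply: bigcup_sub => i _ _ [B mB <-] /=; rewrite setTI.
pose H := [set B : set R | <<s raybox >> ((fun x : E => x 0 i) @^-1` B)].
suff : <<s @ocitv R >> `<=` H by apply; exact: mB.
apply: smallest_sub.
  have sg := @smallest_sigma_algebra E setT raybox.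
  split; rewrite /H/=.
  - by rewrite preimage_set0; case: sg.
  - by move=> A HA; rewrite setTD preimage_setC -setTD; case: sg => _ + _; apply.
  - by move=> F HF; rewrite preimage_bigcup; case: sg => _ _; apply.
move=> A oA; apply: sub_sigma_algebra.
exists (fun j => if j == i then A else setT).
  by move=> j; case: ifP; [right|left].
apply/seteqP; split => x /=; first by move=> xA j; case: eqP => // ->.
by move=> /(_ i); rewrite eqxx.
Qed.

Definition slab k (i : 'I_n) (c dl : R) : set E :=
  box (fun j => if j == i then `[c - dl, c + dl]%classic else `[- k, k]%classic).

Lemma measurable_slab k i c dl : measurable (slab k i c dl).
Proof. by apply: measurable_box => j; case: ifP. Qed.

Lemma leb_slab k i c dl : 0 <= k -> 0 <= dl ->
  (lam (slab k i c dl) <= (2 * dl * (2 * k) ^+ n.-1)%:E)%E.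
Proof.
move=> k0 dl0; rewrite leb_box; last by move=> j; case: ifP.
have itvE (a b : R) : a <= b -> lebesgue_measure (`[a, b]%classic : set R) = (b - a)%:E.
  rewrite le_eqVlt => /predU1P[->|ab]; rewrite lebesgue_measure_itv/= lte_fin.
    by rewrite ltxx subrr.
  by rewrite ab EFinB.
rewrite (bigD1 i)//= eqxx itvE ?lerD2l ?lerBlDr ?addrA; last by lra.
rewrite (eq_bigr (fun=> (2 * k)%:E)); last first.
  by move=> j /negbTE ->; rewrite itvE; [congr EFin; ring|lra].
rewrite prodEFin -EFinM lee_fin prodr_const cardC1 card_ord.
by rewrite (_ : c + dl - (c - dl) = 2 * dl)//; ring.
Qed.

(** Membership in an interval can change between t and t + s only if an endpoint lies between them;
    [cs] lists the endpoints, those of [-k, k] included. *)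
Lemma raybox_crossing (A : 'I_n -> set R) (k : R) : (forall i, rayset (A i)) ->
  exists cs : 'I_n -> seq R, forall i (s t : R),
    ~ ((A i t /\ `|t| <= k) <-> (A i (t + s) /\ `|t + s| <= k)) ->
    exists2 c, c \in cs i & `|t - c| <= `|s|.
Proof.
move=> rA.
suff H i : exists cs : seq R, forall s t : R,
    ~ ((A i t /\ `|t| <= k) <-> (A i (t + s) /\ `|t + s| <= k)) ->
    exists2 c, c \in cs & `|t - c| <= `|s|.
  by exists (fun i => sval (cid (H i))) => i; exact: svalP (cid (H i)).
have cross (c s t : R) : (t <= c) != (t + s <= c) -> `|t - c| <= `|s|.
  by case: (leP t c); case: (leP (t + s) c) => // h1 h2 _; rewrite ler_norml;
    case: (leP 0 s) => s0; rewrite ?(ger0_norm s0) ?(ltr0_norm s0); lra.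
have cross' (c s t : R) : (c <= t) != (c <= t + s) -> `|t - c| <= `|s|.
  by case: (leP c t); case: (leP c (t + s)) => // h1 h2 _; rewrite ler_norml;
    case: (leP 0 s) => s0; rewrite ?(ger0_norm s0) ?(ltr0_norm s0); lra.
have knorm (t : R) : (`|t| <= k) = (- k <= t) && (t <= k) by rewrite ler_norml.
case: (rA i) => [AE|/ocitvP [AE|[[a b] /= _ AE]]]; rewrite AE.
- exists [:: - k; k] => s t; rewrite !knorm => H.
  have [e1|/cross' ?] := eqVneq (- k <= t) (- k <= t + s); last first.
    by exists (- k) => //; rewrite !inE eqxx.
  have [e2|/cross ?] := eqVneq (t <= k) (t + s <= k); last first.
    by exists k => //; rewrite !inE eqxx orbT.
  by exfalso; apply: H; rewrite e1 e2.
- by exists [::] => s t H; exfalso; apply: H; split=> -[].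
- exists [:: - k; k; a; b] => s t; rewrite !knorm /= !in_itv/= !ltNge => H.
  have [e1|/cross' ?] := eqVneq (- k <= t) (- k <= t + s); last first.
    by exists (- k) => //; rewrite !inE eqxx.
  have [e2|/cross ?] := eqVneq (t <= k) (t + s <= k); last first.
    by exists k => //; rewrite !inE eqxx orbT.
  have [e3|/cross ?] := eqVneq (t <= a) (t + s <= a); last first.
    by exists a => //; rewrite !inE eqxx !orbT.
  have [e4|/cross ?] := eqVneq (t <= b) (t + s <= b); last first.
    by exists b => //; rewrite !inE eqxx !orbT.
  by exfalso; apply: H; rewrite e1 e2 e3 e4.
Qed.

(** The indicator and its translate differ only near the faces of the truncated box, that is, inside
    finitely many slabs of thickness [2 * dl]. *)
Lemma trcont_raybox (B : set E) (k : R) : 0 < k -> raybox B ->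
  trcont (\1_(B `&` cube n k)).
Proof.
move=> k0 [A rA ->].
have mAk : measurable (box A `&` cube n k).
  by apply: measurableI; [apply: measurable_box => i; exact: rayset_measurable|exact: measurable_cube].
have mI : measurable_fun setT (\1_(box A `&` cube n k) : E -> R) by exact: measurable_indic.
split => // e e0.
have [cs Hcs] := raybox_crossing k rA.
(* [K * dl] bounds the total volume of the slabs. Their other sides have length 2 (k + 1), since
   translations by a vector of the unit cube enlarge the support by 1. *)
pose K := (\sum_i (size (cs i))%:R) * (2 * (2 * (k + 1)) ^+ n.-1) : R.
have K0 : 0 <= K.
  by rewrite mulr_ge0 ?sumr_ge0// mulr_ge0// exprn_ge0// mulr_ge0// addr_ge0// ltW.
exists (Num.min 1 (e / (K + 1))).
  by rewrite lt_min ltr01 divr_gt0// ltr_wpDl.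
set dl := Num.min _ _ => y yd.
have dl0 : 0 < dl by rewrite lt_min ltr01 divr_gt0// ltr_wpDl.
pose S z : \bar R := (\sum_i \sum_(c <- cs i) (\1_(slab (k + 1) i c dl) z)%:E)%E.
have mS i c : measurable_fun setT (fun z : E => (\1_(slab (k + 1) i c dl) z)%:E : \bar R).
  by apply/measurable_EFinP; apply: measurable_indic; exact: measurable_slab.
have mSi i : measurable_fun setT (fun z : E => (\sum_(c <- cs i) (\1_(slab (k + 1) i c dl) z)%:E)%E : \bar R).
  exact: emeasurable_sum.
have S0 i z : (0 <= \sum_(c <- cs i) (\1_(slab (k + 1) i c dl) z)%:E :> \bar R)%E.
  by apply: sume_ge0 => c _; rewrite lee_fin.
apply: (@le_trans _ _ (\int[lam]_z S z)%E).
  apply: ge0_le_integral => //.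
  - by move=> z _; rewrite lee_fin sqr_ge0.
  - by apply: measurable_sqB => //; exact: measurable_transl.
  - exact: emeasurable_sum.
  move=> z _; rewrite /transl.
  have [/eqP E0|NE] := boolP (\1_(box A `&` cube n k) (z + y) == \1_(box A `&` cube n k) z :> R).
    by rewrite E0 subrr expr0n/=; apply: sume_ge0 => i _; exact: S0.
  have [i Hi] : exists i, ~ ((A i (z 0 i) /\ `|z 0 i| <= k) <->
      (A i (z 0 i + y 0 i) /\ `|z 0 i + y 0 i| <= k)).
    apply/not_existsP => H; move/negP: NE; apply; apply/eqP.
    have bE (x : E) : (box A `&` cube n k) x <-> forall i, A i (x 0 i) /\ `|x 0 i| <= k.
      split=> [[xA xk] i|xH]; first by split=> //; have := xk i; rewrite /= in_itv/= -ler_norml.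
      by split=> i; have [] := xH i => // _; rewrite /= in_itv/= -ler_norml.
    rewrite !indicE; congr ((_ : bool)%:R); apply/idP/idP => /set_mem/bE xH; apply/mem_set/bE => i;
      have /contrapT := H i; have := xH i; rewrite ?mxE; tauto.
  have [c cc zc] := Hcs i _ _ Hi.
  have zk1 : cube n (k + 1) z.
    have yd1 : cube n 1 y by apply: subset_cube yd; rewrite ge_min lexx.
    have [zB|zB] := pselect ((box A `&` cube n k) z).
      by apply: subset_cube zB.2; rewrite lerDl.
    have [yB|yB] := pselect ((box A `&` cube n k) (z + y)).
      by rewrite -[z](addrK y); apply: cubeD; [exact: yB.2|exact: cubeN].
    by move/negP: NE; case; rewrite !indicE !memNset.
  have le1 : ((\1_(box A `&` cube n k) (z + y) - \1_(box A `&` cube n k) z : R) ^+ 2 <= 1).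
    by rewrite !indicE; case: (_ \in _); case: (_ \in _); rewrite /=; nra.
  apply: (@le_trans _ _ 1%E); first by rewrite lee_fin.
  rewrite /S (bigD1 i)//= (le_trans _ (leeDl _ _))//; last first.
    by apply: sume_ge0 => j _; exact: S0.
  rewrite (big_rem c)//= (le_trans _ (leeDl _ _))//; last first.
    by apply: sume_ge0 => j _; rewrite lee_fin.
  rewrite indicE mem_set// => j; case: eqP => [->|ji].
    rewrite /= in_itv/=; have := yd i; rewrite /= in_itv/= -ler_norml => ydi.
    by have := le_trans zc ydi; rewrite ler_norml => /andP[? ?]; apply/andP; split; lra.
  by have /= := zk1 j; rewrite /= in_itv.
rewrite ge0_integral_sum//.
apply: (@le_trans _ _ (\sum_i (\sum_(c <- cs i) (2 * dl * (2 * (k + 1)) ^+ n.-1)%:E))%E).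
  apply: lee_sum => i _; rewrite ge0_integral_sum//.
  apply: lee_sum => c _; rewrite integral_indic//; last exact: measurable_slab.
  by rewrite setIT; apply: leb_slab; [rewrite addr_ge0// ltW|exact: ltW].
rewrite (eq_bigr (fun i => ((size (cs i))%:R * (2 * dl * (2 * (k + 1)) ^+ n.-1))%:E)); last first.
  move=> i _; elim: (cs i) => [|c s IH]; first by rewrite big_nil mul0r.
  by rewrite big_cons IH -EFinD /= -natr1; congr EFin; ring.
rewrite sumEFin -mulr_suml lee_fin.
apply: (@le_trans _ _ (K * dl)); first by rewrite /K le_eqVlt; apply/orP; left; apply/eqP; ring.
apply: (@le_trans _ _ (K * (e / (K + 1)))); first by rewrite ler_wpM2l// ge_min lexx orbT.
by rewrite mulrA ler_pdivrMr ?ltr_wpDl// mulrDr mulr1 mulrC lerDl ltW.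
Qed.

Lemma sqdist_indic (A B : set E) : measurable A -> measurable B -> B `<=` A ->
  sqdist (\1_A) (\1_B) = lam (A `\` B).
Proof.
move=> mA mB BA; rewrite /sqdist -[X in lam X]setIT -integral_indic//; last exact: measurableD.
apply: eq_integral => z _; congr EFin; rewrite !indicE.
have [zA|zA] := boolP (z \in A); have [zB|zB] := boolP (z \in B); rewrite /=.
- by rewrite subrr expr0n memNset//= => -[_]; apply; exact: set_mem.
- rewrite subr0 expr1n mem_set//; split; first exact: set_mem.
  by move=> /mem_set; rewrite (negbTE zB).
- by have := BA _ (set_mem zB) => /mem_set; rewrite (negbTE zA).
- by rewrite subrr expr0n memNset//= => -[/mem_set]; rewrite (negbTE zA).
Qed.

(** Dynkin's argument: the sets with this property form a lambda-system containing the boxes. The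
    intersection with a cube keeps all measures finite, so that convergence of the measures of an
    increasing sequence makes the missing part small in mean square. *)
Lemma trcont_indic (A : set E) (k : R) : 0 < k -> measurable A ->
  trcont (\1_(A `&` cube n k)).
Proof.
move=> k0 mA.
pose H := [set B : set E | measurable B /\ trcont (\1_(B `&` cube n k))].
suff : <<s raybox >> `<=` H by move=> /(_ A (raybox_measurable mA)) [].
have rbT : raybox setT.
  by exists (fun=> setT); [by left|apply/seteqP; split].
have mIk B : measurable B -> measurable (B `&` cube n k).
  by move=> mB; apply: measurableI => //; exact: measurable_cube.
have mi B : measurable B -> measurable_fun setT (\1_(B `&` cube n k) : E -> R).
  by move=> mB; apply: measurable_indic; exact: mIk.
apply: lambda_system_subset => //.
- move=> _ _ [A1 r1 ->] [A2 r2 ->]; exists (fun i => A1 i `&` A2 i).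
    by move=> i; exact: raysetI.
  by apply/seteqP; split => [x [x1 x2] i //|x x12]; split=> i; have [] := x12 i.
- split => //.
  + by split; [exact: measurableT|exact: trcont_raybox].
  + move=> B1 B2 B21 [mB1 t1] [mB2 t2]; split; first exact: measurableD.
    rewrite (_ : \1__ = fun z => -1 * \1_(B2 `&` cube n k) z + \1_(B1 `&` cube n k) z).
      exact: trcont_comb.
    apply/funext => z; rewrite !indicE.
    have [zk|zk] := pselect (cube n k z); last by rewrite !memNset ?mulr0 ?addr0// => -[].
    have [z2|z2] := pselect (B2 z).
      by rewrite (memNset (A := (B1 `\` B2) `&` _)) => [|[[]]]//; rewrite !mem_set//=; [ring|split => //; exact: B21].
    have [z1|z1] := pselect (B1 z).
      by rewrite (memNset (A := B2 `&` _)) => [|[]]//; rewrite !mem_set//=; ring.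
    by rewrite !memNset => [|[]|[]|[[]]]//=; ring.
  + move=> F ndF HF; have mF i : measurable (F i) by have [] := HF i.
    have mUF : measurable (\bigcup_i F i) by exact: bigcup_measurable.
    split => //; apply: trcont_closed; first exact: mi.
    move=> e e0.
    have ndk : {homo (fun i => F i `&` cube n k) : i j / (i <= j)%N >-> (i <= j)%O}.
      by move=> i j ij; apply/subsetPset; apply: setSI; apply/subsetPset; exact: ndF.
    have := nondecreasing_cvg_mu (mu := lam) (fun i => mIk _ (mF i)).
    rewrite -setI_bigcupl => /(_ (mIk _ mUF) ndk).
    have fk : (lam (\bigcup_i F i `&` cube n k) < +oo)%E.
      apply: le_lt_trans (leb_cube_lty n k).
      by apply: (le_measure _ _ _ (@subIsetr _ _ _)); rewrite inE//; [exact: mIk|exact: measurable_cube].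
    have ffin : lam (\bigcup_i F i `&` cube n k) \is a fin_num by rewrite ge0_fin_numE.
    move=> HC.
    have {}HC : (lam \o (fun i => F i `&` cube n k)) x @[x --> \oo] -->
        (fine (lam (\bigcup_i F i `&` cube n k)))%:E by rewrite fineK.
    have /fine_cvgP[_ /cvgrPdist_le /(_ _ e0) [N _ HN]] := HC.
    exists (\1_(F N `&` cube n k)); first by have [] := HF N.
    rewrite sqdist_indic//; [|exact: mIk|exact: mIk|by apply: setSI; exact: bigcup_sup].
    have sub : F N `&` cube n k `<=` \bigcup_i F i `&` cube n k.
      by apply: setSI; exact: bigcup_sup.
    have fN : (lam (F N `&` cube n k) < +oo)%E.
      by apply: le_lt_trans fk; apply: (le_measure _ _ _ sub); rewrite inE//; exact: mIk.
    rewrite measureD//; [|exact: mIk|exact: mIk].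
    rewrite (setIidr sub).
    have fNfin : lam (F N `&` cube n k) \is a fin_num by rewrite ge0_fin_numE.
    have /= := HN N (leqnn N); rewrite -lee_fin => /(le_trans _); apply.
    by rewrite -[in leLHS](fineK ffin) -[in leLHS](fineK fNfin) -EFinB lee_fin ler_norm.
- by move=> B rB; split; [|exact: trcont_raybox];
    case: rB => A' rA' ->; apply: measurable_box => i; exact: rayset_measurable.
Qed.

Lemma trcont0 : trcont (fun=> 0).
Proof.
split=> // e e0; exists 1 => // y _; rewrite /sqdist /transl.
by rewrite integral0_eq ?lee_fin ?ltW// => z _; rewrite subrr expr0n.
Qed.

Lemma trcont_sum (I : Type) (s : seq I) (c : I -> R) (h : I -> E -> R) :
  (forall i, trcont (h i)) -> trcont (fun z => \sum_(i <- s) c i * h i z).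
Proof.
move=> th; elim: s => [|i s IH].
  rewrite (_ : (fun z => _) = fun=> 0); first exact: trcont0.
  by apply/funext => z; rewrite big_nil.
rewrite (_ : (fun z => _) = fun z => c i * h i z + \sum_(j <- s) c j * h j z).
  exact: trcont_comb.
by apply/funext => z; rewrite big_cons.
Qed.

Lemma supportedI k (f : E -> R) : (forall z, ~ cube n k z -> f z = 0) -> supported k f.
Proof. by move=> H z /eqP fz; apply: contrapT => /H. Qed.

(** A nonnegative [u] is the increasing limit of simple functions, also in mean square since u^2
    dominates; these vanish off the cube because they lie below [u]. The general case takes positive
    and negative parts. *)
Lemma trcont_L2 (u : E -> R) (k : R) : 0 < k -> measurable_fun setT u -> supported k u ->
  (\int[lam]_z (u z ^+ 2)%:E < +oo)%E -> trcont u.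
Proof.
move=> k0 mu su u2.
suff pos (v : E -> R) : measurable_fun setT v -> supported k v -> (forall z, 0 <= v z) ->
    (\int[lam]_z (v z ^+ 2)%:E < +oo)%E -> trcont v.
  rewrite (_ : u = fun z => -1 * Num.max (- u z) 0 + Num.max (u z) 0).
    have le2 (v : E -> R) : measurable_fun setT v -> (forall z, `|v z| <= `|u z|) ->
        (\int[lam]_z (v z ^+ 2)%:E < +oo)%E.
      move=> mv vu; apply: le_lt_trans u2; apply: ge0_le_integral => //.
      - by move=> z _; rewrite lee_fin sqr_ge0.
      - by apply/measurable_EFinP; exact: measurable_funX.
      - by apply/measurable_EFinP; exact: measurable_funX.
      by move=> z _; rewrite lee_fin -[u z ^+ 2]real_normK ?num_real// -[v z ^+ 2]real_normK ?num_real// lerXn2r ?nnegrE.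
    have m1 : measurable_fun setT (fun z => Num.max (- u z) 0).
      by apply: measurable_maxr => //; exact: measurableT_comp.
    have m2 : measurable_fun setT (fun z => Num.max (u z) 0) by exact: measurable_maxr.
    apply: trcont_comb; apply: pos => //.
    - by apply: supportedI => z zk; rewrite (supportedP su)// oppr0 maxxx.
    - by move=> z; rewrite le_max lexx orbT.
    - apply: le2 => // z; case: (leP (- u z) 0) => _; rewrite ?normr0 ?normrN//.
    - by apply: supportedI => z zk; rewrite (supportedP su)// maxxx.
    - by move=> z; rewrite le_max lexx orbT.
    - apply: le2 => // z; case: (leP (u z) 0) => _; rewrite ?normr0 ?normrN//.
  by apply/funext => z; case: (leP (u z) 0); case: (leP (- u z) 0) => *; lra.
move=> mv sv v0 v2; apply: trcont_closed => // e e0.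
have mvE : measurable_fun setT (EFin \o v) by exact/measurable_EFinP.
have [g [ndg gv]] := approximation measurableT mvE (fun z _ => v0 z).
have {}gv z : g m z @[m --> \oo] --> v z.
  by have /fine_cvgP[_] := gv z Logic.I.
have gle m z : g m z <= v z.
  have -> : v z = limn (fun m => g m z) by apply/esym/cvg_lim => //; exact: gv.
  apply: (nondecreasing_cvgn_le (u_ := fun m => g m z)); last exact: cvgP (gv z).
  by move=> i j ij; have /lefP := ndg _ _ ij; exact.
have tg m : trcont (g m).
  have -> : (g m : E -> R) = fun z => \sum_(y <- finmap.enum_fset (fset_set (range (g m))))
      y * \1_((g m @^-1` [set y]) `&` cube n k) z.
    apply/funext => z; rewrite [LHS]fimfunE fsbig_finite//=.
    have [zk|zk] := pselect (cube n k z).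
      apply: eq_bigr => y _; congr (_ * _); rewrite !indicE classical_sets.in_setI.
      by rewrite (mem_set zk) andbT.
    have gz : g m z = 0.
      by apply/eqP; rewrite eq_le fun_ge0 andbT -(supportedP sv zk) gle.
    rewrite !big1// => y _.
      by rewrite indicE memNset ?mulr0// => -[].
    rewrite indicE; have [zy|zy] := boolP (z \in _); rewrite ?mulr0//.
    by have /= := set_mem zy; rewrite gz => <-; rewrite mul0r.
  by apply: trcont_sum => y; apply: trcont_indic.
have [|||||_ _] := @dominated_convergence _ _ _ lam setT measurableT
  (fun m z => ((v z - g m z) ^+ 2)%:E) (cst 0%E) (fun z => (v z ^+ 2)%:E).
- by move=> m; apply: measurable_sqB.
- by [].
- apply: aeW => z _; rewrite -[X in _ --> X]/((0 : R)%:E).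
  apply/cvg_EFin; first exact: nearW.
  rewrite [X in _ --> X](_ : _ = (v z - v z) ^+ 2); last by rewrite subrr expr0n.
  by rewrite [X in X @ _](_ : _ = fun m => (v z - g m z) * (v z - g m z))//;
    apply: cvgM; apply: cvgB => //; exact: cvg_cst.
- apply/integrableP; split; first by apply/measurable_EFinP; exact: measurable_funX.
  by under eq_integral do rewrite gee0_abs ?lee_fin ?sqr_ge0//.
- apply: aeW => z m _; rewrite gee0_abs ?lee_fin ?sqr_ge0//.
  by rewrite lerXn2r ?nnegrE ?subr_ge0// lerBlDr lerDl fun_ge0.
rewrite integral0 => /fine_cvgP[fg /cvgr0Pnorm_le/(_ _ e0) ng].
have [N _ HN] : \forall m \near \oo, sqdist v (g m) \is a fin_num /\
    `|fine (sqdist v (g m))| <= e by exact: filterI.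
have [fN leN] := HN N (leqnn N); exists (g N) => //.
by rewrite -(fineK fN) lee_fin (le_trans (ler_norm _)).
Qed.

End translation_continuity.

(** * Real integrable functions and means *)

Section real_integrable.
Context d (T : measurableType d) (R : realType) (mu : {measure set T -> \bar R}).
Implicit Types f g : T -> R.
Local Notation intb f := (mu.-integrable setT (EFin \o f)).

Lemma integrableDR f g : intb f -> intb g -> intb (fun x => f x + g x).
Proof. by move=> fi gi; have := integrableD measurableT fi gi. Qed.

Lemma integrableBR f g : intb f -> intb g -> intb (fun x => f x - g x).
Proof. by move=> fi gi; have := integrableB measurableT fi gi. Qed.

Lemma integrableZR (c : R) f : intb f -> intb (fun x => c * f x).
Proof. by move=> fi; have := integrableZl measurableT c fi. Qed.

Lemma integrableR_meas f : intb f -> measurable_fun setT f.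
Proof. by move=> fi; apply/measurable_EFinP; exact: measurable_int fi. Qed.

Lemma integrableR_ge0 f : measurable_fun setT f -> (forall x, 0 <= f x) ->
  (\int[mu]_x (f x)%:E < +oo)%E -> intb f.
Proof.
move=> mf f0 fi; apply/integrableP; split; first exact/measurable_EFinP.
by rewrite (eq_integral (fun x => (f x)%:E))// => x _; rewrite /= ger0_norm.
Qed.

Lemma integrableR_le f g : measurable_fun setT f -> (forall x, `|f x| <= g x) ->
  intb g -> intb f.
Proof.
move=> mf fg gi; apply: le_integrable gi => //; first exact/measurable_EFinP.
by move=> x _; rewrite /= lee_fin (le_trans (fg x))// ler_norm.
Qed.

Lemma integrableR_ltoo f : intb f -> (\int[mu]_x (f x)%:E < +oo)%E.
Proof. by move=> fi; have /fin_numPlt/andP[] := integrable_fin_num measurableT fi. Qed.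

Lemma RintegralK f : intb f -> (\int[mu]_x (f x)%:E)%E = (\int[mu]_x f x)%:E.
Proof. by move=> fi; rewrite /Rintegral fineK//; exact: (integrable_fin_num measurableT fi). Qed.

Lemma integrable_sqr_weight (k a : T -> R) :
  measurable_fun setT k -> measurable_fun setT a -> (forall y, 0 <= k y) ->
  (\int[mu]_y (k y)%:E < +oo)%E -> (\int[mu]_y (a y ^+ 2 * k y)%:E < +oo)%E ->
  [/\ intb k, intb (fun y => a y ^+ 2 * k y) & intb (fun y => a y * k y)].
Proof.
move=> mk ma k0 k1 fin.
have i2 : intb (fun y => a y ^+ 2 * k y).
  apply: integrableR_ge0 => //.
    by apply: measurable_funM => //; exact: measurable_funX.
  by move=> y; rewrite mulr_ge0// sqr_ge0.
have ik := integrableR_ge0 mk k0 k1.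
split=> //; apply: integrableR_le (integrableDR i2 ik).
  exact: measurable_funM.
move=> y; rewrite normrM (ger0_norm (k0 y)) -{3}[k y]mul1r -mulrDl ler_wpM2r//.
rewrite -[a y ^+ 2]real_normK ?num_real//.
by have := sqr_ge0 (`|a y| - 1); nra.
Qed.

(** Nonnegativity of the variance under the density [k]; if the second moment is infinite the bound
    is trivial. *)
Lemma prob_mean_sqr (k a : T -> R) : measurable_fun setT k -> measurable_fun setT a ->
  (forall y, 0 <= k y) -> (\int[mu]_y (k y)%:E = 1)%E ->
  (((\int[mu]_y (a y * k y)) ^+ 2)%:E <= \int[mu]_y (a y ^+ 2 * k y)%:E)%E.
Proof.
move=> mk ma k0 k1.
have [fin|] := ltP (\int[mu]_y (a y ^+ 2 * k y)%:E)%E +oo%E; last first.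
  by move=> H; apply: le_trans H; rewrite leey.
have [|ik i2 i1] := integrable_sqr_weight mk ma k0 _ fin; first by rewrite k1 ltry.
set m := \int[mu]_y (a y * k y).
have K1 : \int[mu]_y k y = 1 by rewrite /Rintegral k1.
have : 0 <= \int[mu]_y ((a y - m) ^+ 2 * k y).
  by apply: Rintegral_ge0 => y _; rewrite mulr_ge0// sqr_ge0.
have -> : \int[mu]_y ((a y - m) ^+ 2 * k y) =
    \int[mu]_y ((a y ^+ 2 * k y) + ((- (2 * m)) * (a y * k y) + m ^+ 2 * k y)).
  by apply: eq_Rintegral => y _; ring.
have iA := integrableZR (- (2 * m)) i1; have iB := integrableZR (m ^+ 2) ik.
rewrite RintegralD//; last exact: integrableDR.
by rewrite RintegralD// !RintegralZl// -/m K1 RintegralK// lee_fin; lra.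
Qed.

End real_integrable.

(** * Differentiation of convolutions *)

Section convolution.
Context {R : realType} {n : nat}.
Local Notation E := 'rV[R]_n.
Local Notation lam := (leb n).

Lemma diff_pd (f : E -> R) x h : differentiable f x ->
  'd f x h = \sum_i h 0 i * pd i f x.
Proof.
move=> df; rewrite {1}[h]row_sum_delta raddf_sum; apply: eq_bigr => i _.
rewrite /pd deriveE//; have L := linearZZ ('d f x) (h 0 i) ('e_i : E).
exact: L.
Qed.

Lemma pd_line (f : E -> R) x h (t : R) : (forall y, differentiable f y) ->
  is_derive t 1 (fun s : R => f (s *: h + x)) (\sum_i h 0 i * pd i f (t *: h + x)).
Proof.
move=> df; rewrite -diff_pd// -deriveE//.
have dF' : derivable f (t *: h + x) h by exact: diff_derivable.
have E1 : (fun e : R => e^-1 *: (((fun s : R => f (s *: h + x)) \o shift t) (e *: 1) -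
    f (t *: h + x))) = (fun e : R => e^-1 *: ((f \o shift (t *: h + x)) (e *: h) -
    f (t *: h + x))).
  apply/funext => e /=; congr (_ *: (f _ - _)).
  by rewrite addrA -scalerDl /GRing.scale/= mulr1.
by apply: DeriveDef; rewrite /derivable /derive E1.
Qed.

Lemma MVT_rV (f : E -> R) x h : (forall y, differentiable f y) ->
  exists t : R, f (h + x) - f x = \sum_i h 0 i * pd i f (t *: h + x) /\ 0 <= t <= 1.
Proof.
move=> df; pose g s := f (s *: h + x).
have [|||c c01 Hc] := @MVT R g (fun s => \sum_i h 0 i * pd i f (s *: h + x)) 0 1.
- exact: ltr01.
- by move=> t _; exact: pd_line.
- by apply: derivable_within_continuous => t _; apply: (@ex_derive _ _ _ _ _ _ _ (pd_line x h t df)).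
exists c; split; last by move: c01; rewrite in_itv/= => /andP[/ltW -> /ltW ->].
by move: Hc; rewrite /g scale1r scale0r add0r subr0 mulr1.
Qed.

Lemma coord_le_norm (h : E) i : `|h 0 i| <= `|h|.
Proof.
rewrite [leRHS](mx_normrE h); exact: (le_bigmax 0 (fun ij => `|h ij.1 ij.2|) (ord0, i)).
Qed.

Lemma csmooth_lipschitz (f : E -> R) : csmooth f ->
  exists2 L : R, 0 <= L & forall x h, `|f (h + x) - f x| <= L * `|h|.
Proof.
move=> cf; have H i : exists M : R, forall z, `|pd i f z| <= M.
  have [sf [k kf]] := csmooth_pd i cf.
  by apply: supported_bounded kf; exact: smooth_continuous.
pose M i := sval (cid (H i)); have HM i z : `|pd i f z| <= M i := svalP (cid (H i)) z.
exists (\sum_i M i) => [|x h].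
  by apply: sumr_ge0 => i _; exact: le_trans (HM i 0).
have [|t [-> _]] := MVT_rV x h (f := f); first by move=> y; apply: smooth_diff; case: cf.
apply: (le_trans (ler_norm_sum _ _ _)); rewrite mulr_suml; apply: ler_sum => i _.
rewrite normrM mulrC ler_pM//.
exact: coord_le_norm.
Qed.

(** The remainder is uniform in [x], so it can be integrated against [u]: this is what
    differentiates [mollify u k] under the integral sign. *)
Lemma csmooth_taylor (f : E -> R) : csmooth f ->
  exists2 C : R, 0 <= C &
    forall x h, `|f (h + x) - f x - \sum_i h 0 i * pd i f x| <= C * `|h| ^+ 2.
Proof.
move=> cf; have H i : exists L : R, 0 <= L /\ forall x h, `|pd i f (h + x) - pd i f x| <= L * `|h|.
  by have [L L0 HL] := csmooth_lipschitz (csmooth_pd i cf); exists L.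
pose L i := sval (cid (H i)); have [L0 HL] : (forall i, 0 <= L i) /\
    forall i x h, `|pd i f (h + x) - pd i f x| <= L i * `|h|.
  by split=> i; have [] := svalP (cid (H i)).
exists (\sum_i L i) => [|x h]; first exact: sumr_ge0.
have [|t [-> /andP[t0 t1]]] := MVT_rV x h (f := f); first by move=> y; apply: smooth_diff; case: cf.
rewrite -sumrB (le_trans (ler_norm_sum _ _ _))// mulr_suml; apply: ler_sum => i _.
rewrite -mulrBr normrM expr2 mulrA mulrC ler_pM//.
  rewrite (le_trans (HL i _ _))// ler_wpM2l// normrZ ger0_norm//.
  by rewrite ler_piMl.
exact: coord_le_norm.
Qed.

Lemma integrable_bigsum (I : Type) (s : seq I) (h : I -> E -> R) :
  (forall i, lam.-integrable setT (EFin \o h i)) ->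
  lam.-integrable setT (fun z => (\sum_(i <- s) h i z)%:E) /\
  \int[lam]_z (\sum_(i <- s) h i z) = \sum_(i <- s) (\int[lam]_z h i z).
Proof.
move=> ih; elim: s => [|i s [IH1 IH2]].
  split; first by under eq_fun do rewrite big_nil; exact: integrable0.
  rewrite big_nil /Rintegral integral0_eq// => z _; by rewrite big_nil.
have E1 : (fun z => (\sum_(j <- i :: s) h j z)%:E) = ((EFin \o h i) \+ (fun z => (\sum_(j <- s) h j z)%:E))%E.
  by apply/funext => z; rewrite big_cons EFinD.
split; first by rewrite E1; exact: integrableD.
rewrite big_cons -IH2 -RintegralD//; apply: eq_Rintegral => z _; by rewrite big_cons.
Qed.

(** The kernel is [k (y - z)] and not [k (z - y)]: differentiating in z brings a minus sign, which
    later cancels the one in [weak_grad]. *)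
Definition mollify (u k : E -> R) (z : E) : R := \int[lam]_y (u y * k (y - z)).

Lemma mollify_integrable (u k : E -> R) z : lam.-integrable setT (EFin \o u) ->
  csmooth k -> lam.-integrable setT (fun y => (u y * k (y - z))%:E).
Proof.
move=> iu [sk [l kl]]; have ck := smooth_continuous sk.
have [M HM] := supported_bounded ck kl.
have mk : measurable_fun setT (fun y : E => k (y - z)).
  by apply: (measurableT_comp (continuous_rV_measurable ck)); exact: measurable_addr.
have mu : measurable_fun setT u by apply/measurable_EFinP; exact: measurable_int iu.
apply: (@le_integrable _ _ _ _ _ _ _ (fun y => (M%:E * (u y)%:E)%E)) => //.
- by apply/measurable_EFinP; exact: measurable_funM.
- move=> y _; rewrite /= !lee_fin !normrM mulrC ler_wpM2r//.
  by rewrite (le_trans (HM _))// ler_norm.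
- exact: integrableZl.
Qed.

Lemma differentiable_of_taylor (F : E -> R) (x : E) (p : 'I_n -> R) (C : R) :
  (forall h, `|F (h + x) - F x - \sum_i h 0 i * p i| <= C * `|h| ^+ 2) ->
  differentiable F x /\ forall i, pd i F x = p i.
Proof.
move=> HF.
have @L : {linear E -> R}.
  exists (fun h : E => \sum_i h 0 i * p i).
  do 2![eexists]; do ?[constructor].
  - by rewrite big1// => i _; rewrite mxE mul0r.
  - by move=> a b; rewrite -big_split; apply: eq_bigr => i _ /=; rewrite mxE mulrDl.
  - by move=> a b; rewrite scaler_sumr; apply: eq_bigr => i _ /=; rewrite mxE -mulrA.
have cL : continuous L.
  have : continuous (fun h : E => \sum_i h 0 i * p i).
    have : smooth (fun h : E => \sum_i h 0 i * p i).
      apply: (@smooth_sum _ _ _ _ (fun i (h : E) => h 0 i * p i)) => i.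
      by apply: smoothM; [exact: smooth_coord|exact: smooth_cst].
    exact: smooth_continuous.
  by [].
have o : F \o shift x = cst (F x) + L +o_ (0 : E) id.
  apply/eqaddoP => e e0.
  have C1 : 0 < `|C| + 1 by rewrite ltr_wpDl.
  near=> h; rewrite /= !fctE opprD addrA (le_trans (HF h))// expr2 mulrA ler_wpM2r//.
  have : `|h| <= e / (`|C| + 1).
    by near: h; apply: (@nbhs0_le R E); exact: divr_gt0.
  rewrite ler_pdivlMr// mulrC; apply: le_trans; rewrite ler_wpM2r//.
  by rewrite (le_trans (ler_norm C))// lerDl.
have dL := diff_unique cL o.
have dF : differentiable F x by apply/diff_locallyP; rewrite dL; split.
split=> // i; rewrite /pd deriveE// dL /= (bigD1 i)//= mxE !eqxx mul1r big1 ?addr0//.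
by move=> j /negbTE ji; rewrite mxE eqxx ji mul0r.
Unshelve. all: by end_near.
Qed.

Lemma mollify_diff (u k : E -> R) : lam.-integrable setT (EFin \o u) -> csmooth k ->
  forall x, differentiable (mollify u k) x /\
    forall i, pd i (mollify u k) x = - mollify u (pd i k) x.
Proof.
move=> iu ck x; have [C C0 HC] := csmooth_taylor ck.
apply: (@differentiable_of_taylor _ _ _ (C * (\int[lam]_y `|u y|))) => h.
have ic z := mollify_integrable z iu ck.
have icp i : lam.-integrable setT (fun y => (u y * pd i k (y - x))%:E).
  exact: mollify_integrable (csmooth_pd i ck).
rewrite /mollify -(RintegralB _ (ic _) (ic _))//.
have -> : (\sum_i h 0 i * - (\int[lam]_y (u y * pd i k (y - x)))) =
   \int[lam]_y (\sum_i (- h 0 i) * (u y * pd i k (y - x))).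
  have [|_ ->] := @integrable_bigsum _ (index_enum _) (fun i y => - h 0 i * (u y * pd i k (y - x))).
    by move=> i; exact: (integrableZl measurableT (- h 0 i) (icp i)).
  by apply: eq_bigr => i _; rewrite (RintegralZl (- h 0 i) measurableT (icp i)) mulrN mulNr.
have isum : lam.-integrable setT (EFin \o (fun y => \sum_i (- h 0 i) * (u y * pd i k (y - x)))).
  have [|//] := @integrable_bigsum _ (index_enum _) (fun i y => - h 0 i * (u y * pd i k (y - x))).
  by move=> i; exact: (integrableZl measurableT (- h 0 i) (icp i)).
have iB : lam.-integrable setT (EFin \o (fun y => u y * k (y - (h + x)) - u y * k (y - x))).
  exact: (integrableBR (ic _) (ic _)).
have iu1 : lam.-integrable setT (EFin \o (fun y => `|u y|)) by exact: integrable_norm.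
rewrite -RintegralB//.
apply: (le_trans (le_normr_Rintegral _ _)) => //; first exact: (integrableBR iB isum).
rewrite mulrAC -RintegralZl//.
apply: le_Rintegral => //.
- by apply: integrable_norm => //; exact: (integrableBR iB isum).
- exact: integrableZR.
move=> y _; have := HC (y - x) (- h); rewrite normrN.
rewrite (_ : - h + (y - x) = y - (h + x)); last by rewrite opprD addrCA addrA.
have -> : u y * k (y - (h + x)) - u y * k (y - x) - (\sum_i - h 0 i * (u y * pd i k (y - x))) =
  u y * (k (y - (h + x)) - k (y - x) - (\sum_i (- h) 0 i * pd i k (y - x))).
  rewrite !mulrBr mulr_sumr; congr (_ - _); apply: eq_bigr => i _; rewrite mxE; ring.
by move=> H; rewrite normrM [leRHS]mulrC ler_wpM2l.
Qed.

Lemma mollify_supported (u k : E -> R) a b : supported a u -> supported b k ->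
  supported (a + b) (mollify u k).
Proof.
move=> ua kb; apply: supportedI => z zab; rewrite /mollify.
rewrite /Rintegral integral0_eq// => y _; congr EFin.
have [ya|ya] := pselect (cube n a y); last by rewrite (supportedP ua ya) mul0r.
rewrite (supportedP kb) ?mulr0// => yz; apply: zab.
by rewrite -[z](subKr y) ; apply: cubeD => //; exact: cubeN.
Qed.

Lemma csmoothN (k : E -> R) : csmooth k -> csmooth (fun x => - k x).
Proof.
move=> [sk [l kl]]; split; first exact: smoothN.
by exists l => z; rewrite oppr_eq0; exact: kl.
Qed.

Lemma csmooth_mollify (u k : E -> R) a : lam.-integrable setT (EFin \o u) ->
  supported a u -> csmooth k -> csmooth (mollify u k).
Proof.
move=> iu ua ck; split; last by case: ck => _ [b kb]; exists (a + b); exact: mollify_supported.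
apply/smoothP => m; elim: m k ck => [|m IH] k ck.
  by split=> // x; have [] := mollify_diff iu ck x.
split=> [x|i]; first by have [] := mollify_diff iu ck x.
rewrite (_ : pd i _ = mollify u (fun y => - pd i k y)).
  by apply: IH; apply: csmoothN; exact: csmooth_pd.
apply/funext => x; have [_ ->] := mollify_diff iu ck x.
rewrite /mollify -mulN1r -RintegralZl//; last exact: mollify_integrable (csmooth_pd i ck).
by apply: eq_Rintegral => y _; rewrite mulN1r mulrN.
Qed.

End convolution.

(** * Averages of translates *)

Section mollification.
Context {R : realType} {n : nat}.
Local Notation E := 'rV[R]_n.
Local Notation lam := (leb n).

(** [mollify] after the substitution y -> y + z, as an average of translates; it also serves with
    Gaussian kernels, which have no compact support. *)
Definition tconv (u k : E -> R) (z : E) : R := \int[lam]_y (u (z + y) * k y).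

Lemma measurable_addp : measurable_fun setT (fun p : E * E => p.1 + p.2).
Proof.
apply: measurable_fun_rVP => i.
rewrite (_ : (fun p => _) = fun p : E * E => p.1 0 i + p.2 0 i); last first.
  by apply/funext => p; rewrite mxE.
apply: measurable_funD.
  exact: (measurableT_comp (measurable_coord i) measurable_fst).
exact: (measurableT_comp (measurable_coord i) measurable_snd).
Qed.

(** The inequality [prob_mean_sqr] at each [z], then Tonelli: averaging translates displaces [u] by
    no more than the mean of the squared displacements. *)
Lemma sqdist_tconv (u k : E -> R) : measurable_fun setT u -> measurable_fun setT k ->
  (forall y, 0 <= k y) -> (\int[lam]_y (k y)%:E = 1)%E ->
  (\int[lam]_z (u z ^+ 2)%:E < +oo)%E -> (exists M, forall y, k y <= M) ->
  (sqdist (tconv u k) u <= \int[lam]_y (sqdist (transl y u) u * (k y)%:E))%E.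
Proof.
move=> mu mk k0 k1 u2 [M kM].
have mp2 : measurable_fun setT (fun p : E * E => ((u (p.1 + p.2) - u p.1) ^+ 2 * k p.2)%:E).
  apply/measurable_EFinP; apply: measurable_funM; last exact: measurableT_comp.
  apply: measurable_funX; apply: measurable_funB; last exact: measurableT_comp.
  by apply: measurableT_comp => //; exact: measurable_addp.
have ik : lam.-integrable setT (EFin \o k).
  apply/integrableP; split; first exact/measurable_EFinP.
  by under eq_integral do rewrite /= ger0_norm//; rewrite k1 ltry.
have mt z : measurable_fun setT (fun y : E => u (z + y)).
  have := measurable_transl z mu; rewrite /transl; apply: eq_measurable_fun => y _.
  by rewrite addrC.
apply: (@le_trans _ _ (\int[lam]_z \int[lam]_y ((u (z + y) - u z) ^+ 2 * k y)%:E)%E).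
  apply: ge0_le_integral_ae.
  - by move=> z; rewrite lee_fin sqr_ge0.
  - by move=> z; apply: integral_ge0 => y _; rewrite lee_fin mulr_ge0 ?sqr_ge0.
  apply: aeW => z.
  have M0 : 0 <= M by rewrite (le_trans (k0 0)).
  have iu : lam.-integrable setT (EFin \o (fun y => u (z + y) * k y)).
    have [||_ _ //] := integrable_sqr_weight (mu := lam) mk (mt z) k0; first by rewrite k1 ltry.
    apply: (@le_lt_trans _ _ (\int[lam]_y (M * u (y + z) ^+ 2)%:E)%E).
      apply: ge0_le_integral => //.
      - by move=> y _; rewrite lee_fin mulr_ge0 ?sqr_ge0.
      - by apply/measurable_EFinP; apply: measurable_funM => //; exact: measurable_funX.
      - apply/measurable_EFinP; apply: measurable_funM => //; apply: measurable_funX.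
        exact: measurable_transl.
      - by move=> y _; rewrite lee_fin mulrC addrC ler_wpM2r ?sqr_ge0.
    under eq_integral do rewrite EFinM.
    rewrite ge0_integralZl_EFin//; last 2 first.
    - by move=> y _; rewrite lee_fin sqr_ge0.
    - by apply/measurable_EFinP; apply: measurable_funX; exact: measurable_transl.
    rewrite lte_mul_pinfty//.
    rewrite (ge0_integral_translation z (f := fun y => (u y ^+ 2)%:E))//.
      by apply/measurable_EFinP; exact: measurable_funX.
    by move=> y; rewrite lee_fin sqr_ge0.
  have -> : tconv u k z - u z = \int[lam]_y ((u (z + y) - u z) * k y).
    have K1 : \int[lam]_y k y = 1 by rewrite /Rintegral k1.
    transitivity (\int[lam]_y (u (z + y) * k y - u z * k y)).
      rewrite RintegralB//; last exact: integrableZR.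
      by rewrite RintegralZl// K1 mulr1.
    by apply: eq_Rintegral => y _; rewrite mulrBl.
  by apply: prob_mean_sqr => //; apply: measurable_funB.
rewrite (fubini_tonelli (fun p : E * E => ((u (p.1 + p.2) - u p.1) ^+ 2 * k p.2)%:E))//; last first.
  by move=> p; rewrite lee_fin mulr_ge0 ?sqr_ge0.
apply: ge0_le_integral_ae.
- by move=> y; apply: integral_ge0 => z _; rewrite lee_fin mulr_ge0 ?sqr_ge0.
- by move=> y; rewrite mule_ge0 ?sqdist_ge0 ?lee_fin.
apply: aeW => y; rewrite /sqdist muleC -ge0_integralZl_EFin//; last 2 first.
- by move=> z _; rewrite lee_fin sqr_ge0.
- by apply: measurable_sqB => //; exact: measurable_transl.
by rewrite le_eqVlt; apply/orP; left; apply/eqP; apply: eq_integral => z _; rewrite -EFinM mulrC.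
Qed.

Lemma mollifyE (u k : E -> R) z : measurable_fun setT u -> measurable_fun setT k ->
  mollify u k z = tconv u k z.
Proof.
move=> mu mk; rewrite /mollify /tconv /Rintegral; congr fine.
have mf : measurable_fun setT (fun y : E => (u y * k (y - z))%:E).
  apply/measurable_EFinP; apply: measurable_funM => //.
  by apply: measurableT_comp => //; exact: measurable_addr.
rewrite -(integral_translation z mf).
by apply: eq_integral => y _; rewrite addrK addrC.
Qed.

Lemma mbump_scale_smooth (c : R) : smooth (fun x : E => mbump (c *: x)).
Proof.
apply: (@smooth_prod R n _ _ (fun i (x : E) => bump1 ((c *: x) 0 i))) => i.
have sc : smooth (fun x : E => (c *: x) 0 i).
  rewrite (_ : (fun x : E => _) = fun x => c * x 0 i); last by apply/funext => x; rewrite mxE.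
  by apply: smoothM; [exact: smooth_cst|exact: smooth_coord].
apply: smoothM; last exact: smooth_cst.
apply: smoothM; apply: smooth_flat; apply: smoothD => //; try exact: smooth_cst.
exact: smoothN.
Qed.

Lemma mbump_scale_supp (c : R) : 0 < c -> supported c^-1 (fun x : E => mbump (c *: x)).
Proof.
move=> c0 x /mbump_supp H i; have := H i; rewrite /= !in_itv/= mxE -!ler_norml.
by rewrite normrM (gtr0_norm c0) => ?; rewrite -[leRHS]mulr1 ler_pdivlMl.
Qed.

Lemma mbump_scale_csmooth (c : R) : 0 < c -> csmooth (fun x : E => mbump (c *: x)).
Proof.
by move=> c0; split; [exact: mbump_scale_smooth|exists c^-1; exact: mbump_scale_supp].
Qed.

Lemma csmooth_integrable (k : E -> R) : csmooth k -> lam.-integrable setT (EFin \o k).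
Proof.
by move=> [sk [l kl]]; apply: continuous_supported_integrable kl; exact: smooth_continuous.
Qed.

Lemma mbump_scale_int (c : R) : 0 < c -> 0 < \int[lam]_x mbump (c *: x).
Proof.
move=> c0; have cs := mbump_scale_csmooth c0.
have : \forall x \near (0 : E), 2^-1 < mbump (c *: x).
  have cb := smooth_continuous cs.1; have /cvgr_gt := cb (0 : E); apply.
  by rewrite scaler0 mbump0 invf_lt1// ltr1n.
move=> /nbhs_ballP [e /= e0 He].
have sub : cube n (e / 2) `<=` (ball (0 : E) e).
  move=> x xe; split => // i j; rewrite (ord1 i) /ball/= mxE sub0r normrN.
  have := xe j; rewrite /= in_itv/= -ler_norml => /le_lt_trans; apply.
  by rewrite ltr_pdivrMr// ltr_pMr// ltr1n.
have e2 : 0 < e / 2 by rewrite divr_gt0.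
apply: (@lt_le_trans _ _ (2^-1 * fine (lam (cube n (e / 2))))).
  rewrite mulr_gt0 ?invr_gt0//.
  rewrite /cube leb_box//.
  rewrite (eq_bigr (fun=> e%:E)); last first.
    move=> i _; rewrite lebesgue_measure_itv/= lte_fin ifT; last by lra.
    by rewrite -EFinB; congr EFin; lra.
  by rewrite prodEFin /= prodr_gt0.
have cfin : lam (cube n (e / 2)) \is a fin_num by rewrite ge0_fin_numE// leb_cube_lty.
have fint : (\int[lam]_x (mbump (c *: x))%:E)%E \is a fin_num.
  exact: integrable_fin_num (csmooth_integrable cs).
rewrite -lee_fin EFinM fineK// /Rintegral fineK//.
have mc := @measurable_cube R n (e / 2).
rewrite -[X in lam X]setIT -(@integral_indic _ E R lam setT)// -ge0_integralZl_EFin//; last first.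
  by apply/measurable_EFinP; exact: measurable_indic.
apply: ge0_le_integral => //.
- by apply/measurable_EFinP; apply: measurable_funM => //; exact: measurable_indic.
- by apply/measurable_EFinP; apply: continuous_rV_measurable; exact: smooth_continuous cs.1.
move=> x _; rewrite -EFinM lee_fin indicE.
have [xe|xe] := pselect (cube n (e / 2) x); last by rewrite memNset// mulr0 mbump_ge0.
by rewrite mem_set// mulr1 ltW//; apply: He; exact: sub.
Qed.

End mollification.

(** * Translated and rescaled test functions, mollifiers *)

Section test_functions.
Context {R : realType} {n : nat}.
Local Notation E := 'rV[R]_n.
Local Notation lam := (leb n).

Lemma near_natSinv_le (e : R) : 0 < e -> \forall m \near \oo, m.+1%:R^-1 <= e.
Proof.
move=> e0; have /cvgrPdist_le/(_ _ e0) := @cvg_harmonic R; apply: filterS => m /=.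
by rewrite sub0r normrN ger0_norm// invr_ge0.
Qed.

Lemma continuousMf (X : topologicalType) (f g : X -> R) :
  continuous f -> continuous g -> continuous (fun x => f x * g x).
Proof. by move=> cf cg x; apply: cvgM; [exact: cf|exact: cg]. Qed.

Lemma continuousVf (X : topologicalType) (f : X -> R) :
  (forall x, f x != 0) -> continuous f -> continuous (fun x => (f x)^-1).
Proof. by move=> f0 cf x; apply: cvgV; [exact: f0|exact: cf]. Qed.

Lemma cube_bounded (f : E -> R) k : continuous f ->
  exists M : R, forall z, cube n k z -> `|f z| <= M.
Proof.
move=> cf; have /compact_bounded[M [_ HM]] : compact (f @` cube n k).
  apply: continuous_compact; last exact: compact_cube.
  exact: continuous_subspaceT.
exists (`|M| + 1) => z zk; apply: (HM (`|M| + 1)).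
  by rewrite (le_lt_trans (ler_norm _))// ltrDl.
by exists z.
Qed.

Lemma pd_translate i (f : E -> R) (c x : E) : pd i (fun y => f (y + c)) x = pd i f (x + c).
Proof.
rewrite /pd /derive; congr (lim _); rewrite (_ : (fun h : R => _) =
  (fun h : R => h^-1 *: ((f \o shift (x + c)) (h *: 'e_i) - f (x + c))))//.
by apply/funext => h /=; rewrite addrA.
Qed.

Lemma smooth_translate (f : E -> R) (c : E) : smooth f -> smooth (fun y => f (y + c)).
Proof.
move=> /smoothP sf; apply/smoothP => m; have {}sf := sf m.
have dsh x : differentiable (fun y : E => y + c) x by exact: differentiableD.
elim: m f sf => [|m IH] f [df sf].
  split=> // x; exact: (@differentiable_comp _ _ _ _ (fun y => y + c) f).
split=> [x|i]; first exact: (@differentiable_comp _ _ _ _ (fun y => y + c) f).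
rewrite (_ : pd i _ = fun y => pd i f (y + c)); first exact: IH (sf i).
by apply/funext => x; exact: pd_translate.
Qed.

Lemma csmooth_translate (f : E -> R) (c : E) : csmooth f -> csmooth (fun y => f (y + c)).
Proof.
move=> [sf [k fk]]; split; first exact: smooth_translate.
exists (k + `|c|) => z /fk zk; rewrite -[z](addrK c); apply: cubeD => //.
move=> i; rewrite /= in_itv/= -ler_norml mxE normrN; exact: coord_le_norm.
Qed.

Lemma pd_scale i (f : E -> R) (c : R) x : (forall y, differentiable f y) ->
  pd i (fun y => f (c *: y)) x = c * pd i f (c *: x).
Proof.
move=> df.
have dF : differentiable (fun y : E => f (c *: y)) x.
  by apply: (@differentiable_comp _ _ _ _ (fun y => c *: y) f) => //; exact: differentiableZ.
have := pd_line (c *: x) (c *: 'e_i) 0 df.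
rewrite (bigD1 i)//= big1 ?addr0; last first.
  by move=> j /negbTE ji; rewrite !mxE eqxx ji mulr0 mul0r.
rewrite !mxE !eqxx mulr1 scale0r add0r => H1.
have H2 : is_derive (0 : R) 1 (fun s : R => f (c *: (s *: 'e_i + x)))
    (pd i (fun y => f (c *: y)) x).
  have := @is_derive_line R n (fun y => f (c *: y)) i x 0.
  by rewrite scale0r add0r => /(_ dF).
have E2 : (fun s : R => f (c *: (s *: 'e_i + x))) = (fun s : R => f (s *: (c *: 'e_i) + c *: x)).
  by apply/funext => s; rewrite scalerDr !scalerA mulrC.
rewrite E2 in H2.
by rewrite -(@derive_val _ _ _ _ _ _ _ H2) (@derive_val _ _ _ _ _ _ _ H1).
Qed.

Definition mollifier (m : nat) (x : E) : R :=
  mbump (m.+1%:R *: x) * (\int[lam]_x mbump (m.+1%:R *: x))^-1.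

Lemma csmooth_mollifier m : csmooth (mollifier m).
Proof. by apply: csmoothM; [exact: mbump_scale_csmooth|exact: smooth_cst]. Qed.

Lemma mollifier_ge0 m x : 0 <= mollifier m x.
Proof.
rewrite mulr_ge0 ?mbump_ge0// invr_ge0 ltW//; exact: mbump_scale_int.
Qed.

Lemma mollifier_supp m : supported m.+1%:R^-1 (mollifier m).
Proof.
move=> x; rewrite mulf_eq0 negb_or => /andP[+ _]; exact: mbump_scale_supp.
Qed.

Lemma mollifier_int m : (\int[lam]_x (mollifier m x)%:E = 1)%E.
Proof.
rewrite RintegralK; last exact: csmooth_integrable (csmooth_mollifier m).
congr EFin; rewrite /mollifier.
under eq_Rintegral do rewrite mulrC.
rewrite RintegralZl//; last by apply: csmooth_integrable; exact: mbump_scale_csmooth.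
by rewrite mulVf// gt_eqF// mbump_scale_int.
Qed.

Lemma csmooth_bounded (k : E -> R) : csmooth k -> exists M, forall y, k y <= M.
Proof.
move=> [sk [l kl]]; have [M HM] := supported_bounded (smooth_continuous sk) kl.
by exists M => y; exact: le_trans (ler_norm _) (HM y).
Qed.

(** By [sqdist_tconv] the error is a mean of the displacements of [u] over the support of the
    mollifier, which shrinks to 0. *)
Lemma mollify_cvg (u : E -> R) k : 0 < k -> measurable_fun setT u -> supported k u ->
  (\int[lam]_z (u z ^+ 2)%:E < +oo)%E ->
  forall e : R, 0 < e -> \forall m \near \oo, (sqdist (mollify u (mollifier m)) u <= e%:E)%E.
Proof.
move=> k0 mu uk u2 e e0; have [_ tu] := trcont_L2 k0 mu uk u2.
have [dl dl0 Hdl] := tu e e0.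
near=> m.
have cm := csmooth_mollifier m.
have mm : measurable_fun setT (mollifier m) := integrableR_meas (csmooth_integrable cm).
rewrite (_ : mollify u _ = tconv u (mollifier m)); last by apply/funext => z; exact: mollifyE.
apply: (le_trans (sqdist_tconv mu mm _ _ u2 _)).
- exact: mollifier_ge0.
- exact: mollifier_int.
- exact: csmooth_bounded.
apply: (@le_trans _ _ (\int[lam]_y (e%:E * (mollifier m y)%:E))%E); last first.
  rewrite ge0_integralZl_EFin//.
  - by rewrite mollifier_int mule1.
  - by move=> y _; rewrite lee_fin mollifier_ge0.
  - exact/measurable_EFinP.
  - exact: ltW.
apply: ge0_le_integral_ae.
- by move=> y; rewrite mule_ge0 ?sqdist_ge0// lee_fin mollifier_ge0.
- by move=> y; rewrite mule_ge0 ?lee_fin ?mollifier_ge0 ?ltW.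
apply: aeW => y; have [->|my] := eqVneq (mollifier m y) 0; first by rewrite !mule0.
rewrite lee_pmul ?sqdist_ge0 ?lee_fin ?mollifier_ge0//; apply: Hdl.
apply: subset_cube (mollifier_supp my).
by near: m; apply: near_natSinv_le.
Unshelve. all: by end_near.
Qed.

End test_functions.

(** * Density of smooth functions in a weighted Sobolev space *)

Section density.
Context {R : realType} {n : nat}.
Local Notation E := 'rV[R]_n.
Local Notation lam := (leb n).
Variable om : E -> R.
Hypothesis om_cont : continuous om.
Hypothesis om_gt0 : forall z, 0 < om z.

Definition omdist (u v : E -> R) : \bar R := (\int[lam]_z ((u z - v z) ^+ 2 * om z)%:E)%E.

Definition L2om (u : E -> R) : Prop :=
  measurable_fun setT u /\ (\int[lam]_z (u z ^+ 2 * om z)%:E < +oo)%E.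

Definition weak_grad (w : E -> R) (h : 'I_n -> E -> R) : Prop :=
  forall i k, csmooth k -> \int[lam]_z (h i z * k z) = - \int[lam]_z (w z * pd i k z).

Lemma om_contV : continuous (fun z => (om z)^-1).
Proof. by apply: (continuousVf _ om_cont) => z; exact: lt0r_neq0. Qed.

Let mom : measurable_fun setT om.
Proof. exact: continuous_rV_measurable. Qed.

Lemma measurable_om2 (u : E -> R) : measurable_fun setT u ->
  measurable_fun setT (fun z => u z ^+ 2 * om z).
Proof. by move=> mu; apply: measurable_funM => //; exact: measurable_funX. Qed.

Lemma om2_ge0 (u : E -> R) z : 0 <= u z ^+ 2 * om z.
Proof. by rewrite mulr_ge0 ?sqr_ge0// ltW. Qed.

Lemma L2om_integrable2 u : L2om u -> lam.-integrable setT (EFin \o (fun z => u z ^+ 2 * om z)).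
Proof.
by move=> [mu u2]; apply: integrableR_ge0 => //; [exact: measurable_om2|exact: om2_ge0].
Qed.

Lemma L2om_le (u v : E -> R) : measurable_fun setT u -> L2om v -> (forall z, `|u z| <= `|v z|) -> L2om u.
Proof.
move=> mu [mv v2] uv; split=> //; apply: le_lt_trans v2; apply: ge0_le_integral => //.
- by move=> z _; rewrite lee_fin om2_ge0.
- by apply/measurable_EFinP; exact: measurable_om2.
- by apply/measurable_EFinP; exact: measurable_om2.
move=> z _; rewrite lee_fin ler_wpM2r ?(ltW (om_gt0 _))//.
by rewrite -[leLHS]real_normK ?num_real// -[leRHS]real_normK ?num_real// lerXn2r ?nnegrE.
Qed.

Lemma L2om_scale (c : R) u : L2om u -> L2om (fun z => c * u z).
Proof.
move=> [mu u2]; split; first exact: measurable_funM.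
rewrite (eq_integral (fun z => ((c ^+ 2)%:E * (u z ^+ 2 * om z)%:E)%E)); last first.
  by move=> z _; rewrite -EFinM mulrA exprMn.
rewrite ge0_integralZl_EFin ?sqr_ge0//.
- by rewrite lte_mul_pinfty// lee_fin sqr_ge0.
- by move=> z _; rewrite lee_fin om2_ge0.
- by apply/measurable_EFinP; exact: measurable_om2.
Qed.

Lemma L2omD u v : L2om u -> L2om v -> L2om (fun z => u z + v z).
Proof.
move=> Lu Lv; have mD : measurable_fun setT (fun z => u z + v z).
  by apply: measurable_funD; [exact: Lu.1|exact: Lv.1].
split=> //; apply: integrableR_ltoo.
apply: integrableR_le (integrableDR (integrableZR 2 (L2om_integrable2 Lu))
   (integrableZR 2 (L2om_integrable2 Lv))); first exact: measurable_om2.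
move=> z /=; rewrite (ger0_norm (om2_ge0 (fun z => u z + v z) z)) !mulrA -mulrDl.
rewrite ler_wpM2r ?(ltW (om_gt0 _))//.
by have := sqr_ge0 (u z - v z); nra.
Qed.

Lemma L2omB u v : L2om u -> L2om v -> L2om (fun z => u z - v z).
Proof.
move=> Lu Lv; rewrite (_ : (fun z => _) = fun z => u z + (-1) * v z).
  by apply: L2omD => //; exact: L2om_scale.
by apply/funext => z; rewrite mulN1r.
Qed.

Lemma omdist_triangle u v w : L2om u -> L2om v -> L2om w ->
  (omdist u w <= 2%:E * omdist u v + 2%:E * omdist v w)%E.
Proof.
move=> Lu Lv Lw.
have i1 := L2om_integrable2 (L2omB Lu Lv); have i2 := L2om_integrable2 (L2omB Lv Lw).
have i3 := L2om_integrable2 (L2omB Lu Lw).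
rewrite /omdist !RintegralK// -!EFinM -EFinD lee_fin -!RintegralZl// -RintegralD//;
  [|exact: integrableZR|exact: integrableZR].
apply: le_Rintegral => //; first by apply: integrableDR; exact: integrableZR.
move=> z _; rewrite !mulrA -mulrDl ler_wpM2r ?(ltW (om_gt0 _))//.
by have := sqr_ge0 (u z - v z - (v z - w z)); nra.
Qed.

(** By |u k| <= u^2 om + k^2 / om, where 1/om is continuous. *)
Lemma L2om_mul_csupp (u k : E -> R) l : L2om u -> continuous k -> supported l k ->
  lam.-integrable setT (EFin \o (fun z => u z * k z)).
Proof.
move=> Lu ck kl; have mk := continuous_rV_measurable ck.
have ik : lam.-integrable setT (EFin \o (fun z => k z ^+ 2 * (om z)^-1)).
  apply: (@continuous_supported_integrable _ _ l).
    exact: (continuousMf (continuousMf ck ck) om_contV).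
  by move=> z; rewrite mulf_eq0 sqrf_eq0 negb_or => /andP[/kl].
apply: integrableR_le (integrableDR (L2om_integrable2 Lu) ik).
  by apply: measurable_funM => //; case: Lu.
move=> z; rewrite normrM -[u z ^+ 2]real_normK ?num_real// -[k z ^+ 2]real_normK ?num_real//.
have o0 := om_gt0 z; rewrite -(@ler_pM2r _ (om z))// mulrDl mulfVK ?gt_eqF//.
by have := sqr_ge0 (`|u z| * om z - `|k z|); have := normr_ge0 (k z); have := normr_ge0 (u z); nra.
Qed.

Lemma L2om_mul_csmooth (u k : E -> R) : L2om u -> csmooth k ->
  lam.-integrable setT (EFin \o (fun z => u z * k z)).
Proof. by move=> Lu [sk [l kl]]; apply: L2om_mul_csupp kl; [|exact: smooth_continuous]. Qed.

Lemma L2om_supported u l : L2om u -> supported l u -> (\int[lam]_z (u z ^+ 2)%:E < +oo)%E.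
Proof.
move=> Lu ul; have [M HM] := cube_bounded l om_contV.
apply: integrableR_ltoo; apply: integrableR_le (integrableZR M (L2om_integrable2 Lu)).
  by apply: measurable_funX; case: Lu.
move=> z; rewrite ger0_norm ?sqr_ge0//.
have [zl|zl] := pselect (cube n l z); last by rewrite (supportedP ul zl) expr0n/= mul0r mulr0.
have := HM z zl; rewrite ger0_norm ?invr_ge0 ?(ltW (om_gt0 z))// => /(ler_wpM2r (om2_ge0 u z)).
by apply: le_trans; rewrite mulrCA mulVf ?gt_eqF// mulr1.
Qed.

Lemma L2om_supported_integrable u l : L2om u -> supported l u ->
  lam.-integrable setT (EFin \o u).
Proof.
move=> Lu ul; have u2 := L2om_supported Lu ul.
have i2 : lam.-integrable setT (EFin \o (fun z => u z ^+ 2)).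
  by apply: integrableR_ge0 => //; [apply: measurable_funX; case: Lu|move=> z; exact: sqr_ge0].
apply: integrableR_le (integrableDR i2 (integrable_cst_cube l 1)); first by case: Lu.
move=> z; rewrite mul1r indicE; have [zl|zl] := pselect (cube n l z).
  rewrite mem_set//= -[u z ^+ 2]real_normK ?num_real//.
  by have := sqr_ge0 (`|u z| - 1); nra.
by rewrite (supportedP ul zl) memNset// normr0 expr0n/= addr0.
Qed.

Lemma supported_L2om u l : measurable_fun setT u -> supported l u ->
  (\int[lam]_z (u z ^+ 2)%:E < +oo)%E -> L2om u /\ exists2 M, 0 <= M & 
   forall v, measurable_fun setT v -> supported l v -> (omdist u v <= M%:E * sqdist u v)%E.
Proof.
move=> mu ul u2; have [M HM] := cube_bounded l om_cont.
have H v : measurable_fun setT v -> supported l v ->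
    (omdist u v <= `|M|%:E * sqdist u v)%E.
  move=> mv vl; rewrite /sqdist -ge0_integralZl_EFin//; last first.
  - exact: measurable_sqB.
  - by move=> z _; rewrite lee_fin sqr_ge0.
  apply: ge0_le_integral => //.
  - by move=> z _; rewrite lee_fin mulr_ge0 ?sqr_ge0 ?(ltW (om_gt0 _)).
  - apply/measurable_EFinP; apply: measurable_funM => //; apply: measurable_funX.
    exact: measurable_funB.
  - by apply: emeasurable_funM => //; exact: measurable_sqB.
  move=> z _; rewrite -EFinM lee_fin.
  have [zl|zl] := pselect (cube n l z).
    rewrite mulrC ler_wpM2r ?sqr_ge0// (le_trans _ (ler_norm M))//.
    by rewrite (le_trans (ler_norm _))// HM.
  by rewrite (supportedP ul zl) (supportedP vl zl) subrr expr0n/= mul0r mulr0.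
split; last by exists `|M|.
split=> //; have := H (fun=> 0) (measurable_cst _); move/(_ _)/wrap => [].
  by move=> z; rewrite eqxx.
rewrite /omdist /sqdist; under eq_integral do rewrite subr0.
move/le_lt_trans; apply.
by under eq_integral do rewrite subr0; rewrite lte_mul_pinfty.
Qed.

(** It is not equal to 1 on a ball: it tends to 1 pointwise and boundedly, with first derivatives of
    order 1/(m+1). *)
Definition cutoff (m : nat) (z : E) : R := mbump (m.+1%:R^-1 *: z).

Lemma csmooth_cutoff m : csmooth (cutoff m).
Proof. by apply: mbump_scale_csmooth; rewrite invr_gt0. Qed.

Lemma csmooth_mbump : csmooth (@mbump R n).
Proof.
by rewrite (_ : @mbump R n = (fun x : E => mbump (1 *: x))); [exact: mbump_scale_csmooth|
  apply/funext => x; rewrite scale1r].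
Qed.

Lemma cutoff_bounded : exists2 M : R, 0 <= M & forall m z, `|cutoff m z| <= M.
Proof.
have [s [l kl]] := csmooth_mbump; have [M HM] := supported_bounded (smooth_continuous s) kl.
by exists M => [|m z]; [exact: le_trans (HM 0)|exact: HM].
Qed.

Lemma pd_cutoff m i z : pd i (cutoff m) z = m.+1%:R^-1 * pd i (@mbump R n) (m.+1%:R^-1 *: z).
Proof. by apply: pd_scale => y; apply: smooth_diff; exact: smooth_mbump. Qed.

Lemma cutoff_cvg z : cutoff m z @[m --> \oo] --> (1 : R).
Proof.
rewrite -(@mbump0 R n) /cutoff.
have cb : continuous (@mbump R n) by apply: smooth_continuous; exact: smooth_mbump.
have g0 : (m.+1%:R^-1 : R) *: z @[m --> \oo] --> (0 : E).
  by rewrite -[X in _ --> X](scale0r z); apply: cvgZr_tmp; exact: cvg_harmonic.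
exact: (cvg_comp _ _ g0 (cb 0)).
Qed.

Lemma cutoff_L2 w : L2om w -> forall e : R, 0 < e ->
  \forall m \near \oo, (omdist w (fun z => (cutoff m z * w z)%R) <= e%:E)%E.
Proof.
move=> Lw e e0; have [M M0 HM] := cutoff_bounded.
have mc m : measurable_fun setT (cutoff m) := integrableR_meas (csmooth_integrable (csmooth_cutoff m)).
have mw := Lw.1.
have mD m : measurable_fun setT (fun z => (w z - cutoff m z * w z) ^+ 2 * om z).
  by apply: (measurable_om2 (u := fun z => w z - cutoff m z * w z));
    apply: measurable_funB => //; exact: measurable_funM.
have [|||||_ _] := @dominated_convergence _ _ _ lam setT measurableT
  (fun m z => ((w z - cutoff m z * w z) ^+ 2 * om z)%:E) (cst 0%E)
  (fun z => ((1 + M) ^+ 2 * (w z ^+ 2 * om z))%:E).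
- by move=> m; exact/measurable_EFinP.
- by [].
- apply: aeW => z _; rewrite -[X in _ --> X]/((0 : R)%:E).
  apply/cvg_EFin; first exact: nearW.
  have H : (w z - cutoff m z * w z) @[m --> \oo] --> 0.
    have H0 : cutoff m z * w z @[m --> \oo] --> 1 * w z.
      by apply: cvgM; [exact: cutoff_cvg|exact: cvg_cst].
    rewrite -[X in _ --> X](subrr (w z)); apply: cvgB; first exact: cvg_cst.
    by rewrite -{2}[w z]mul1r.
  rewrite [X in _ --> X](_ : _ = 0 * 0 * om z); last by rewrite !mul0r.
  by apply: cvgM; [apply: cvgM; exact: H|exact: cvg_cst].
- exact: integrableZR (L2om_integrable2 Lw).
- apply: aeW => z m _; rewrite gee0_abs; last first.
    by rewrite lee_fin mulr_ge0 ?sqr_ge0// ltW.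
  rewrite lee_fin.
  rewrite mulrA ler_wpM2r ?(ltW (om_gt0 _))// -{1}[w z]mul1r -mulrBl exprMn ler_wpM2r ?sqr_ge0//.
  rewrite -[leLHS]real_normK ?num_real// lerXn2r ?nnegrE ?addr_ge0//.
  by rewrite (le_trans (ler_normB _ _))// normr1 lerD2l.
rewrite integral0 => /fine_cvgP[fg /cvgr0Pnorm_le/(_ _ e0) ng].
near=> m.
have fN : omdist w (fun z => cutoff m z * w z) \is a fin_num by near: m; exact: fg.
rewrite -(fineK fN) lee_fin (le_trans (ler_norm _))//.
by near: m; exact: ng.
Unshelve. all: by end_near.
Qed.

Lemma cutoff_pd_L2 w i : L2om w -> forall e : R, 0 < e ->
  \forall m \near \oo, (omdist (fun z => (w z * pd i (cutoff m) z)%R) (fun=> 0%R) <= e%:E)%E.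
Proof.
move=> Lw e e0.
have [s [l kl]] := csmooth_pd i csmooth_mbump.
have [M HM] := supported_bounded (smooth_continuous s) kl.
have iw := L2om_integrable2 Lw; set I := \int[lam]_z (w z ^+ 2 * om z).
have I0 : 0 <= I by apply: Rintegral_ge0 => z _; exact: om2_ge0.
have M0 : 0 <= M := le_trans (normr_ge0 _) (HM 0).
have K0 : 0 < M ^+ 2 * I + 1 by rewrite ltr_wpDl// mulr_ge0 ?sqr_ge0.
near=> m.
apply: (@le_trans _ _ ((m.+1%:R^-1 * M ^+ 2 * I)%:E)).
  rewrite EFinM /I -RintegralK// -ge0_integralZl_EFin//; last 3 first.
  - by move=> z _; rewrite lee_fin om2_ge0.
  - by apply/measurable_EFinP; apply: measurable_om2; case: Lw.
  - by rewrite mulr_ge0 ?sqr_ge0// invr_ge0.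
  apply: ge0_le_integral_ae.
  - by move=> z; rewrite lee_fin mulr_ge0 ?sqr_ge0 ?(ltW (om_gt0 _)).
  - by move=> z; rewrite mule_ge0 ?lee_fin ?om2_ge0// mulr_ge0 ?sqr_ge0// invr_ge0.
  apply: aeW => z; rewrite -EFinM lee_fin subr0 mulrA ler_wpM2r ?(ltW (om_gt0 _))//.
  rewrite exprMn mulrC ler_wpM2r ?sqr_ge0// pd_cutoff exprMn.
  rewrite ler_pM ?sqr_ge0//.
    by rewrite expr2 ler_piMl ?invr_ge0// invf_le1// ler1n.
  by rewrite -[leLHS]real_normK ?num_real// lerXn2r ?nnegrE.
rewrite lee_fin -mulrA.
apply: (@le_trans _ _ (e / (M ^+ 2 * I + 1) * (M ^+ 2 * I))).
  rewrite ler_wpM2r ?mulr_ge0 ?sqr_ge0//.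
  by near: m; apply: near_natSinv_le; rewrite divr_gt0.
by rewrite mulrAC ler_pdivrMr// ler_wpM2l ?(ltW e0)// lerDl.
Unshelve. all: by end_near.
Qed.

Lemma weak_grad_cutoff w h m : L2om w -> (forall i, L2om (h i)) -> weak_grad w h ->
  weak_grad (fun z => cutoff m z * w z) (fun i z => cutoff m z * h i z + w z * pd i (cutoff m) z).
Proof.
move=> Lw Lh wh i k ck; have cc := csmooth_cutoff m.
have cck : csmooth (fun z => cutoff m z * k z) by apply: csmoothM cc _; case: ck.
have H := wh i _ cck.
have dpd z : pd i (fun z => cutoff m z * k z) z = pd i (cutoff m) z * k z + cutoff m z * pd i k z.
  by apply: pdM; apply: smooth_diff; [exact: cc.1|exact: ck.1].
have i1 := L2om_mul_csmooth (Lh i) cck.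
have c2 : csmooth (fun z => pd i (cutoff m) z * k z).
  by apply: csmoothM; [exact: csmooth_pd|exact: ck.1].
have i2 := L2om_mul_csmooth Lw c2.
have c3 : csmooth (fun z => cutoff m z * pd i k z).
  by apply: csmoothM => //; case: (csmooth_pd i ck).
have i3 := L2om_mul_csmooth Lw c3.
transitivity (\int[lam]_z (h i z * (cutoff m z * k z) + w z * (pd i (cutoff m) z * k z))).
  by apply: eq_Rintegral => z _; ring.
rewrite (RintegralD measurableT i1 i2) [X in X + _]H.
have -> : \int[lam]_z (w z * pd i (fun z0 => cutoff m z0 * k z0) z) =
  \int[lam]_z (w z * (pd i (cutoff m) z * k z) + w z * (cutoff m z * pd i k z)).
  by apply: eq_Rintegral => z _; rewrite dpd mulrDr.
rewrite (RintegralD measurableT i2 i3) opprD addrAC addNr add0r; congr (- _).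
by apply: eq_Rintegral => z _; ring.
Qed.

Lemma pd_mollify_weak_grad (w : E -> R) h (k : E -> R) i : lam.-integrable setT (EFin \o w) -> weak_grad w h -> csmooth k ->
  pd i (mollify w k) = mollify (h i) k.
Proof.
move=> iw wh ck; apply/funext => z; have [_ ->] := mollify_diff iw ck z.
pose kz : E -> R := fun y => k (y + - z).
have H := wh i kz (csmooth_translate (- z) ck).
have A : mollify (h i) k z = \int[lam]_y (h i y * kz y) by apply: eq_Rintegral.
have B : mollify w (pd i k) z = \int[lam]_y (w y * pd i kz y).
  by apply: eq_Rintegral => y _; rewrite pd_translate.
by rewrite A H B.
Qed.

(** Cut off, then mollify. Cutting off changes the weak gradient by [w * pd i (cutoff m)], which is
    small; the gradient of the mollification is the mollification of the weak gradient; and on the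
    support, now compact, [supported_L2om] reduces everything to the unweighted distance. *)
Lemma density w h : L2om w -> (forall i, L2om (h i)) -> weak_grad w h ->
  forall e : R, 0 < e -> exists k, [/\ csmooth k, (omdist w k <= e%:E)%E &
    forall i, (omdist (h i) (pd i k) <= e%:E)%E].
Proof.
move=> Lw Lh wh e e0.
(* The gradient is the costliest: reaching the cut-off gradient takes 2/16 + 2/16, and the
   mollification makes it 2 (4/16) + 2/16 < 1. *)
have e80 : 0 < e / 16 by rewrite divr_gt0.
have [m [Hw Hh Hg]] : exists m, [/\ (omdist w (fun z => (cutoff m z * w z)%R) <= (e / 16)%:E)%E,
    forall i, (omdist (h i) (fun z => (cutoff m z * h i z)%R) <= (e / 16)%:E)%E &
    forall i, (omdist (fun z => (w z * pd i (cutoff m) z)%R) (fun=> 0%R) <= (e / 16)%:E)%E].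
  have : \forall m \near \oo, [/\ (omdist w (fun z => (cutoff m z * w z)%R) <= (e / 16)%:E)%E,
    forall i, (omdist (h i) (fun z => (cutoff m z * h i z)%R) <= (e / 16)%:E)%E &
    forall i, (omdist (fun z => (w z * pd i (cutoff m) z)%R) (fun=> 0%R) <= (e / 16)%:E)%E].
    near=> m; split; near: m; first exact: cutoff_L2.
      by apply: filter_forall => i; exact: cutoff_L2.
    by apply: filter_forall => i; exact: cutoff_pd_L2.
  by move=> [N _ HN]; exists N; exact: (HN N (leqnn N)).
pose W z := cutoff m z * w z; pose H i z := cutoff m z * h i z + w z * pd i (cutoff m) z.
have cc := csmooth_cutoff m; have [scc [l kl]] := cc.
have [M M0 HM] := cutoff_bounded.
have mc : measurable_fun setT (cutoff m) := integrableR_meas (csmooth_integrable cc).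
have L2c u : L2om u -> L2om (fun z => cutoff m z * u z).
  move=> Lu; apply: (L2om_le _ (L2om_scale M Lu)).
    by apply: measurable_funM => //; case: Lu.
  by move=> z; rewrite !normrM ler_wpM2r// (le_trans (HM m z))// ler_norm.
have L2p i : L2om (fun z => w z * pd i (cutoff m) z).
  have [sp [lp klp]] := csmooth_pd i cc.
  have [Mp HMp] := supported_bounded (smooth_continuous sp) klp.
  apply: (L2om_le _ (L2om_scale Mp Lw)).
    apply: measurable_funM; first by case: Lw.
    by apply: integrableR_meas; apply: csmooth_integrable; exact: csmooth_pd.
  by move=> z; rewrite !normrM mulrC ler_wpM2r// (le_trans (HMp z))// ler_norm.
have LW : L2om W by exact: L2c.
have LH i : L2om (H i) by apply: L2omD; [exact: L2c|exact: L2p].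
have HwH := weak_grad_cutoff m Lw Lh wh.
pose l1 := `|l| + 1.
have l1gt : 0 < l1 by rewrite ltr_wpDl.
have sup1 (u : E -> R) : supported l u -> supported l1 u.
  by move=> ul z /ul; apply: subset_cube; rewrite (le_trans (ler_norm l))// lerDl.
have sW : supported l1 W.
  by apply: sup1 => z; rewrite mulf_eq0 negb_or => /andP[/kl].
have sH i : supported l1 (H i).
  apply: sup1; apply: supportedI => z zl.
  by rewrite /H (supportedP kl zl) (supportedP (supported_pd (i := i) kl) zl) mul0r mulr0 addr0.
have key u : L2om u -> supported l1 u -> \forall N \near \oo,
    (omdist u (mollify u (mollifier N)) <= (e / 16)%:E)%E.
  move=> Lu su; have u2 := L2om_supported Lu su.
  have su2 : supported (l1 + 1) u by move=> z /su; apply: subset_cube; rewrite lerDl.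
  have [_ [K K0 HK]] := supported_L2om Lu.1 su2 u2.
  have eK : 0 < e / 16 / (K + 1) by rewrite divr_gt0// ltr_wpDl.
  have := mollify_cvg l1gt Lu.1 su u2 eK; apply: filterS => N HN.
  have iu : lam.-integrable setT (EFin \o u).
    exact: L2om_supported_integrable Lu su.
  have cm := csmooth_mollify iu su (csmooth_mollifier N).
  apply: (le_trans (HK _ _ _)).
  - exact: integrableR_meas (csmooth_integrable cm).
  - move=> z /(mollify_supported su (@mollifier_supp _ _ N)); apply: subset_cube.
    by rewrite lerD2l invf_le1// ler1n.
  rewrite (_ : sqdist u _ = sqdist (mollify u (mollifier N)) u); last first.
    by apply: eq_integral => z _; rewrite -sqrrN opprB.
  apply: (@le_trans _ _ (K%:E * (e / 16 / (K + 1))%:E)%E).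
    by rewrite lee_pmul ?sqdist_ge0.
  by rewrite -EFinM lee_fin mulrCA ler_piMr ?(ltW e80)// ler_pdivrMr ?ltr_wpDl// mul1r lerDl.
have [N [NW NH]] : exists N, (omdist W (mollify W (mollifier N)) <= (e / 16)%:E)%E /\
    forall i, (omdist (H i) (mollify (H i) (mollifier N)) <= (e / 16)%:E)%E.
  have : \forall N \near \oo, (omdist W (mollify W (mollifier N)) <= (e / 16)%:E)%E /\
    forall i, (omdist (H i) (mollify (H i) (mollifier N)) <= (e / 16)%:E)%E.
    near=> N; split; near: N; first exact: key.
    by apply: filter_forall => i; exact: key.
  by move=> [N _ HN]; exists N; exact: (HN N (leqnn N)).
exists (mollify W (mollifier N)).
have ck := csmooth_mollify (L2om_supported_integrable LW sW) sW (csmooth_mollifier N).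
have L2k k : csmooth k -> L2om k.
  move=> ck1; split; first exact: integrableR_meas (csmooth_integrable ck1).
  apply: integrableR_ltoo; have [sk [lk klk]] := ck1.
  apply: (@continuous_supported_integrable _ _ lk).
    exact: (continuousMf (continuousMf (smooth_continuous sk) (smooth_continuous sk)) om_cont).
  by move=> z; rewrite mulf_eq0 sqrf_eq0 negb_or => /andP[/klk].
have tri u v t : L2om u -> L2om v -> L2om t -> (omdist u v <= (e / 2 / 2)%:E)%E ->
    (omdist v t <= (e / 16)%:E)%E -> (omdist u t <= e%:E)%E.
  move=> Lu Lv Lt H1 H2; apply: (le_trans (omdist_triangle Lu Lv Lt)).
  apply: (@le_trans _ _ (2%:E * (e / 2 / 2)%:E + 2%:E * (e / 16)%:E)%E).
    by apply: leeD; rewrite lee_pmul2l.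
  by rewrite -!EFinM -EFinD lee_fin; lra.
split=> //.
  apply: (tri _ W) => //; first exact: L2k.
  by apply: (le_trans Hw); rewrite lee_fin; lra.
move=> i; have pdE := pd_mollify_weak_grad i (L2om_supported_integrable LW sW) HwH (csmooth_mollifier N).
have Lm : L2om (mollify (H i) (mollifier N)) by rewrite -pdE; apply: L2k; exact: csmooth_pd.
rewrite pdE; apply: (tri _ (H i) _ (Lh i) (LH i) Lm _ (NH i)).
apply: (le_trans (omdist_triangle (Lh i) (L2c _ (Lh i)) (LH i))).
apply: (@le_trans _ _ (2%:E * (e / 16)%:E + 2%:E * (e / 16)%:E)%E).
  apply: leeD; first by rewrite lee_pmul2l.
  rewrite lee_pmul2l// (le_trans _ (Hg i))// le_eqVlt; apply/orP; left; apply/eqP.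
  by apply: eq_integral => z _; congr (EFin (_ * _)); rewrite /H; ring.
by rewrite -!EFinM -EFinD lee_fin; lra.
Unshelve. all: by end_near.
Qed.

End density.

(** * The variational equation in logarithmic coordinates *)

Section weighted_transfer.
Context {R : realType} {n : nat}.
Local Notation E := 'rV[R]_n.
Local Notation D := (@orthant R n).
Local Notation lam := (leb n).
Variables (sigma : 'M[R]_n) (C gamma : R).
Hypothesis sigmaU : sigma \in unitmx.
Hypothesis C0 : 0 < C.
Hypothesis intTh : forall F : E -> \bar R, measurable_fun D F ->
    (forall x, D x -> 0 <= F x)%E ->
    (\int[leb n]_(x in D) F x =
     \int[leb n]_z (F (Theta sigma z) * (C * expR (sumslin sigma z))%:E))%E.
Local Notation Th := (Theta sigma).
Local Notation lg := (logT sigma).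
Local Notation jac := (jac sigma C).
Local Notation ijac := (ijac sigma C).
Local Notation ypd := (ypd sigma).

Lemma lebesgue_rV_leb : @lebesgue_rV R n = (leb n : {measure set E -> \bar R}).
Proof. exact: eq_measure. Qed.

Let transfer := Rintegral_transfer sigmaU C0 intTh.
Let aeTh := ae_Theta sigmaU C0 intTh.

Let sq1 (x : E) : R := 1 + \sum_i x 0 i ^+ 2.

Let sq1_gt0 x : 0 < sq1 x.
Proof. by rewrite ltr_wpDr// sumr_ge0// => i _; exact: sqr_ge0. Qed.

Lemma rhoE x : rho gamma x = sq1 x `^ (- gamma).
Proof.
rewrite /rho /enorm sqr_sqrtr//; by apply: sumr_ge0 => i _; exact: sqr_ge0.
Qed.

Let smooth_sq1 : smooth sq1.
Proof.
apply: smoothD; first exact: smooth_cst.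
apply: (@smooth_sum R n _ _ (fun i (x : E) => x 0 i ^+ 2)) => i.
by apply: smoothM; exact: smooth_coord.
Qed.

Lemma smooth_rho : smooth (@rho R n gamma).
Proof.
rewrite (_ : rho gamma = fun x => sq1 x `^ (- gamma)).
  exact: smooth_powR.
by apply/funext => x; exact: rhoE.
Qed.

Lemma rho_gt0 (x : E) : 0 < rho gamma x :> R.
Proof. by rewrite rhoE powR_gt0. Qed.

Let Thsq (z : E) : R := 1 + \sum_i expR (slin sigma z 0 i) ^+ 2.

Let sq1_Theta z : sq1 (Th z) = Thsq z.
Proof. by congr (1 + _); apply: eq_bigr => i _; rewrite mxE. Qed.

Let smooth_Thsq : smooth Thsq.
Proof.
apply: smoothD; first exact: smooth_cst.
apply: (@smooth_sum R n _ _ (fun i (z : E) => expR (slin sigma z 0 i) ^+ 2)) => i.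
by apply: smoothM; apply: smooth_exp; exact: smooth_slin.
Qed.

Let Thsq_gt0 z : 0 < Thsq z. Proof. by rewrite -sq1_Theta. Qed.

Definition irho2 (z : E) : R := Thsq z `^ (2 * gamma).

Lemma smooth_irho2 : smooth irho2.
Proof. exact: smooth_powR. Qed.

Lemma irho2K z : rho gamma (Th z) ^+ 2 * irho2 z = 1.
Proof.
rewrite rhoE sq1_Theta /irho2 expr2 -!powRD ?(gt_eqF (Thsq_gt0 z)) ?implybT//.
by rewrite (_ : - gamma - gamma + 2 * gamma = 0) ?powRr0//; ring.
Qed.

(** The weight of L^2_rho(D) with the Jacobian included: [L2rho] in the variable z is [L2om om]. *)
Definition om (z : E) : R := rho gamma (Th z) ^+ 2 * jac z.

Lemma om_gt0 z : 0 < om z.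
Proof. by apply: mulr_gt0; [rewrite exprn_gt0 ?rho_gt0|exact: jac_gt0]. Qed.

Lemma smooth_om : smooth om.
Proof.
rewrite (_ : om = fun z => (Thsq z `^ (- gamma) * Thsq z `^ (- gamma)) * jac z).
  apply: smoothM; first by apply: smoothM; exact: smooth_powR.
  by apply: smoothM; [exact: smooth_cst|apply: smooth_exp; exact: smooth_sumslin].
by apply/funext => z; rewrite /om rhoE sq1_Theta.
Qed.

Lemma om_cont : continuous om. Proof. exact: smooth_continuous smooth_om. Qed.

Let mTh : measurable_fun setT Th. Proof. exact: measurable_Theta. Qed.

Let mrhoT : measurable_fun setT (fun z => rho gamma (Th z) : R).
Proof.
apply: (measurableT_comp _ mTh); apply: continuous_rV_measurable.
exact: smooth_continuous smooth_rho.
Qed.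

(** A representative [u] may be Lebesgue measurable only; [w] is a measurable version of
    [u \o Theta]. *)
Definition rep (u w : E -> R) : Prop :=
  measurable_fun setT w /\ {ae lam, forall z, u (Th z) = w z}.

Lemma L2rho_rep u : L2rho gamma u -> exists w, rep u w /\ L2om om w.
Proof.
move=> [g [mg ug g2]]; exists (g \o Th).
have mw : measurable_fun setT (g \o Th).
  apply: (measurable_comp _ _ mg mTh); first exact: measurable_orthant.
  by move=> _ [z _ <-]; exact: Theta_orthant.
rewrite lebesgue_rV_leb in ug g2.
split; first by split=> //; apply/(aeTh (fun x => u x = g x)).
split=> //; move: g2.
rewrite (integral_transfer sigmaU C0 intTh (G := fun z => (g (Th z)) ^+ 2 * rho gamma (Th z) ^+ 2)).
- by under eq_integral do rewrite -mulrA.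
- by apply: measurable_funM; exact: measurable_funX.
- exact: aeW.
Qed.

Lemma ip_rho_rep u v w w' : rep u w -> rep v w' ->
  ip_rho gamma u v = \int[lam]_z (w z * w' z * om z).
Proof.
move=> [mw uw] [mw' vw']; rewrite /ip_rho lebesgue_rV_leb (transfer (G := fun z => w z * w' z * rho gamma (Th z) ^+ 2)).
- by apply: eq_Rintegral => z _; rewrite -mulrA.
- by apply: measurable_funM; [exact: measurable_funM|exact: measurable_funX].
- by apply: filterS2 uw vw' => z -> ->.
Qed.

Lemma csmooth_measurable (k : E -> R) : csmooth k -> measurable_fun setT k.
Proof. by move=> ck; apply: integrableR_meas (csmooth_integrable ck). Qed.

Lemma rep_xlift k : csmooth k -> rep (xlift sigma k) k.
Proof.
move=> ck; split; first exact: csmooth_measurable.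
by apply: aeW => z; exact: lift_Theta.
Qed.

Lemma csmooth_L2om k : csmooth k -> L2om om k.
Proof.
move=> ck1; split; first exact: csmooth_measurable.
apply: integrableR_ltoo; have [sk [lk klk]] := ck1.
apply: (@continuous_supported_integrable _ _ lk).
  exact: (continuousMf (continuousMf (smooth_continuous sk) (smooth_continuous sk)) om_cont).
by move=> z; rewrite mulf_eq0 sqrf_eq0 negb_or => /andP[/klk].
Qed.

Lemma test_function_csmooth (f : E -> R) : test_function f -> csmooth f.
Proof.
move=> [sf cK KD]; split=> //.
have [M [_ HM]] := compact_bounded cK.
exists (`|M| + 1) => z fz.
have : `|z| <= `|M| + 1.
  apply: (HM (`|M| + 1)); first by rewrite (le_lt_trans (ler_norm _))// ltrDl.
  exact: subset_closure.
move=> H i; rewrite /= in_itv/= -ler_norml; exact: le_trans (coord_le_norm z i) H.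
Qed.

Lemma test_function_orthant (f : E -> R) x : test_function f -> ~ D x -> f x = 0.
Proof.
move=> [_ _ KD] Dx; apply/eqP; apply: contrapT => /negP fx; apply: Dx.
by apply: KD; exact: subset_closure.
Qed.

Lemma xlift_L2rho k : csmooth k -> L2rho gamma (xlift sigma k).
Proof.
move=> ck; have tk := test_function_csmooth (test_function_lift sigmaU ck).
exists (xlift sigma k); split.
- by apply: measurable_funTS; exact: csmooth_measurable.
- exact: aeW.
- rewrite lebesgue_rV_leb (integral_transfer sigmaU C0 intTh (G := fun z => k z ^+ 2 * rho gamma (Th z) ^+ 2)).
  + by have [_] := csmooth_L2om ck; under eq_integral do rewrite mulrA.
  + apply: measurable_funM; apply: measurable_funX => //; exact: csmooth_measurable.
  + by apply: aeW => z; rewrite lift_Theta.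
Qed.

(** The derivative of the exponential cancels that of [ijac] ([ypd_ijac]). Hence, for functions
    divided by the Jacobian, d/dx_j applied to x_j times the function leaves the bare field
    [ypd j]. *)
Lemma ypdM_ijac j (k : E -> R) z : differentiable k z ->
  ypd j (fun z => expR (slin sigma z 0 j) * (k z * ijac z)) z =
  expR (slin sigma z 0 j) * (ijac z * ypd j k z).
Proof.
move=> dk; have di : differentiable ijac z by apply: smooth_diff; exact: smooth_ijac.
have ds := diff_slin sigma j z.
have de : differentiable (fun z => expR (slin sigma z 0 j)) z.
  by apply: smooth_diff; apply: smooth_exp; exact: smooth_slin.
rewrite ypdM//; last exact: differentiableM.
by rewrite ypd_exp// ypd_slin// eqxx ypdM// ypd_ijac// mulr1; ring.
Qed.

Lemma sum_sigma_ypd i (k : E -> R) z : \sum_j sigma j i * ypd j k z = pd i k z.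
Proof.
transitivity (\sum_l (\sum_j sigma j i * invmx sigma l j) * pd l k z).
  under eq_bigr do rewrite /ypd mulr_sumr.
  rewrite exchange_big; apply: eq_bigr => l _; rewrite mulr_suml.
  by apply: eq_bigr => j _; rewrite mulrA.
rewrite (bigD1 i)//= (sum_invmxT sigmaU) eqxx mul1r big1 ?addr0// => l li.
by rewrite (sum_invmxT sigmaU) (negbTE li) mul0r.
Qed.

Lemma pd_lift_Theta j F z : csmooth F ->
  pd j (xlift sigma F) (Th z) = expR (- slin sigma z 0 j) * ypd j F z.
Proof.
move=> [sF [l Fl]].
have := congr1 (fun f => f (Th z)) (pd_lift sigmaU j (fun z => smooth_diff z sF) Fl).
by rewrite lift_Theta.
Qed.

(** The equation is tested with the lift of [k / jac]: the Jacobian disappears and the fields of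
    [sigma_gradient] become the coordinate derivatives ([sum_sigma_ypd]). *)
Lemma weak_grad_rep u h w g : rep u w -> (forall i, rep (h i) (g i)) ->
  sigma_gradient gamma sigma u h -> weak_grad w g.
Proof.
move=> [mw uw] hg sg i k ck; have [_ H] := sg i.
have ckj : csmooth (fun z => k z * ijac z) by apply: csmoothM => //; exact: smooth_ijac.
have cej j : csmooth (fun z => expR (slin sigma z 0 j) * (k z * ijac z)).
  by apply: csmoothMr => //; apply: smooth_exp; exact: smooth_slin.
have tf := test_function_lift sigmaU ckj.
have {}H := H _ tf.
have [mg hgi] := hg i.
have mk := csmooth_measurable ckj.
have ij z : ijac z * jac z = 1 by rewrite ijacE mulVf// gt_eqF// jac_gt0.
move: H; rewrite lebesgue_rV_leb (transfer (G := fun z => g i z * (k z * ijac z))); last 2 first.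
- exact: measurable_funM.
- by apply: filterS hgi => z ->; rewrite lift_Theta.
rewrite (transfer (G := fun z => w z * (ijac z * pd i k z))); last 2 first.
- apply: measurable_funM => //; apply: csmooth_measurable; apply: csmoothMr.
    exact: smooth_ijac.
  exact: csmooth_pd.
- apply: filterS uw => z ->; congr (_ * _).
  transitivity (\sum_j sigma j i * (ijac z * ypd j k z)).
    apply: eq_bigr => j _; congr (_ * _).
    have -> : (fun y : E => y 0 j * xlift sigma (fun z0 => k z0 * ijac z0) y) =
        xlift sigma (fun z => expR (slin sigma z 0 j) * (k z * ijac z)).
      apply/funext => y; have [Dy|Dy] := pselect (D y); last by rewrite !liftN// mulr0.
      by rewrite !liftE// slin_logT// mxE lnK//; exact: Dy.
    rewrite -[LHS]/(pd j _ (Th z)) pd_lift_Theta//.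
    rewrite ypdM_ijac; last by apply: smooth_diff; case: ck.
    by rewrite mulrA -expRD addNr expR0 mul1r.
  under eq_bigr do rewrite mulrCA.
  by rewrite -mulr_sumr sum_sigma_ypd.
move=> H; transitivity (\int[lam]_z (g i z * (k z * ijac z) * jac z)).
  by apply: eq_Rintegral => z _; rewrite mulrA -[RHS]mulrA ij mulr1.
rewrite H; congr (- _); apply: eq_Rintegral => z _.
by have := ij z; set a := ijac z; set b := jac z => ab; rewrite -[pd i k z in RHS]mul1r -ab; ring.
Qed.

(** Here [phi] is an arbitrary test function, so the integration by parts is carried out in the
    variable x, both functions being smooth of compact support in the whole space. *)
Lemma sigma_gradient_xlift k : csmooth k ->
  sigma_gradient gamma sigma (xlift sigma k) (fun i => xlift sigma (pd i k)).
Proof.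
move=> ck i; split; first by apply: xlift_L2rho; exact: csmooth_pd.
move=> phi tphi; rewrite lebesgue_rV_leb.
have cphi := test_function_csmooth tphi.
have cl := test_function_csmooth (test_function_lift sigmaU ck).
have cy j : csmooth (fun y : E => y 0 j * phi y).
  by apply: csmoothMr => //; exact: smooth_coord.
have intD (f : E -> R) : (forall x, ~ D x -> f x = 0) ->
    \int[lam]_(x in D) f x = \int[lam]_x f x.
  move=> fD; rewrite /Rintegral [in RHS]integral_mkcond/= [in LHS]integral_mkcond.
  congr fine; apply: eq_integral => x _; rewrite !patchE in_setT.
  by case: ifPn => // /negP xD; rewrite fD// => Dx; apply: xD; rewrite inE.
rewrite !intD; last 2 first.
- by move=> x Dx; rewrite liftN// mul0r.
- by move=> x Dx; rewrite liftN// mul0r.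
have pdj j x : pd j (fun y => xlift sigma k y * (y 0 j * phi y)) x =
    pd j (xlift sigma k) x * (x 0 j * phi x) + xlift sigma k x * pd j (fun y : E => y 0 j * phi y) x.
  by apply: pdM; apply: smooth_diff; [case: cl|case: (cy j)].
have i1 j : lam.-integrable setT (EFin \o (fun x => pd j (xlift sigma k) x * (x 0 j * phi x))).
  apply: csmooth_integrable; apply: csmoothM; first exact: csmooth_pd.
  by case: (cy j).
have i2 j : lam.-integrable setT (EFin \o (fun x => xlift sigma k x * pd j (fun y : E => y 0 j * phi y) x)).
  apply: csmooth_integrable; apply: csmoothM => //.
  by case: (csmooth_pd j (cy j)).
have ibp j : \int[lam]_x (xlift sigma k x * pd j (fun y : E => y 0 j * phi y) x) =
    - \int[lam]_x (pd j (xlift sigma k) x * (x 0 j * phi x)).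
  have cp : csmooth (fun y => xlift sigma k y * (y 0 j * phi y)).
    by apply: csmoothM => //; case: (cy j).
  have [sp [l pl]] := cp.
  have := integral_pd (fun x => smooth_diff x sp) (smooth_continuous (smooth_pd j sp)) pl.
  rewrite (eq_integral (fun x => (pd j (xlift sigma k) x * (x 0 j * phi x) +
     xlift sigma k x * pd j (fun y : E => y 0 j * phi y) x)%:E)); last first.
    by move=> x _; rewrite pdj.
  rewrite RintegralK; last exact: integrableDR.
  by rewrite RintegralD// => -[] /eqP; rewrite addrC addr_eq0 => /eqP.
have -> : \int[lam]_x (xlift sigma k x * (\sum_j sigma j i * 'D_'e_j (fun y : E => y 0 j * phi y) x)) =
    \int[lam]_x (\sum_j sigma j i * (xlift sigma k x * pd j (fun y : E => y 0 j * phi y) x)).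
  by apply: eq_Rintegral => x _; rewrite mulr_sumr; apply: eq_bigr => j _; rewrite mulrCA.
have [|_ ->] := @integrable_bigsum _ _ _ (index_enum _)
    (fun j x => sigma j i * (xlift sigma k x * pd j (fun y : E => y 0 j * phi y) x)).
  by move=> j; apply: integrableZR; exact: i2.
have -> : \int[lam]_x (xlift sigma (pd i k) x * phi x) =
    \int[lam]_x (\sum_j sigma j i * (pd j (xlift sigma k) x * (x 0 j * phi x))).
  apply: eq_Rintegral => x _; have [Dx|Dx] := pselect (D x); last first.
    rewrite liftN// mul0r big1// => j _.
    by rewrite (test_function_orthant tphi Dx) !mulr0.
  rewrite -(logTK sigmaU Dx) lift_Theta//; set z := lg x.
  rewrite -sum_sigma_ypd mulr_suml; apply: eq_bigr => j _.
  rewrite pd_lift_Theta// -!mulrA; congr (_ * _).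
  rewrite [Th z 0 j]mxE; set a := slin sigma z 0 j.
  have aE : expR (- a) * expR a = 1 by rewrite -expRD addNr expR0.
  by rewrite -[LHS]mul1r -aE; ring.
have [|_ ->] := @integrable_bigsum _ _ _ (index_enum _)
    (fun j x => sigma j i * (pd j (xlift sigma k) x * (x 0 j * phi x))).
  by move=> j; apply: integrableZR; exact: i1.
rewrite -sumrN; apply: eq_bigr => j _.
rewrite (RintegralZl _ measurableT (i1 j)) (RintegralZl _ measurableT (i2 j)).
by rewrite ibp mulrN opprK.
Qed.

Lemma H1rho_xlift k : csmooth k -> H1rho gamma sigma (xlift sigma k).
Proof.
move=> ck; split; first exact: xlift_L2rho.
by exists (fun i => xlift sigma (pd i k)); exact: sigma_gradient_xlift.
Qed.

Lemma rep_comb c u w v w' : rep u w -> rep v w' ->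
  rep (fun x => c * u x + v x) (fun z => c * w z + w' z).
Proof.
move=> [mw uw] [mw' vw']; split.
  by apply: measurable_funD => //; exact: measurable_funM.
by apply: filterS2 uw vw' => z -> ->.
Qed.

Lemma L2rho_comb c (u v : E -> R) : L2rho gamma u -> L2rho gamma v -> L2rho gamma (fun x => c * u x + v x).
Proof.
move=> [g [mg ug g2]] [h [mh vh h2]].
exists (fun x => c * g x + h x); split.
- by apply: measurable_funD => //; exact: measurable_funM.
- by apply: filterS2 ug vh => x H1 H2 Dx; rewrite H1// H2.
- have mr : measurable_fun D (fun x : E => rho gamma x ^+ 2 : R).
    apply: measurable_funX; apply: measurable_funTS; apply: continuous_rV_measurable.
    exact: smooth_continuous smooth_rho.
  have mi (f : E -> R) : measurable_fun D f ->
      (\int[lam]_(x in D) (f x ^+ 2 * rho gamma x ^+ 2)%:E < +oo)%E ->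
      lam.-integrable D (fun x => (f x ^+ 2 * rho gamma x ^+ 2)%:E).
    move=> mf f2; apply/integrableP; split.
      by apply/measurable_EFinP; apply: measurable_funM => //; exact: measurable_funX.
    rewrite (eq_integral (fun x => (f x ^+ 2 * rho gamma x ^+ 2)%:E))// => x _.
    by rewrite gee0_abs// lee_fin mulr_ge0 ?sqr_ge0.
  rewrite lebesgue_rV_leb in g2 h2 *.
  have mD := @measurable_orthant R n.
  have iD := integrableD mD (integrableZl mD (2 * c ^+ 2) (mi _ mg g2)) (integrableZl mD 2 (mi _ mh h2)).
  have /fin_numPlt/andP[_] := integrable_fin_num mD iD; apply: le_lt_trans.
  apply: ge0_le_integral => //.
  + by move=> x _; rewrite lee_fin mulr_ge0 ?sqr_ge0.
  + apply/measurable_EFinP; apply: measurable_funM => //; apply: measurable_funX.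
    by apply: measurable_funD => //; exact: measurable_funM.
  + by case/integrableP : iD.
  move=> x _; rewrite /= -!EFinM -EFinD lee_fin; set q := rho gamma x ^+ 2.
  rewrite [2 * c ^+ 2 * _]mulrA [2 * (_ * q)]mulrA -mulrDl ler_wpM2r ?sqr_ge0//.
  by have := sqr_ge0 (c * g x - h x); nra.
Qed.

(** Additivity of the integral asks for measurable functions; [u] and [v] are first exchanged for
    the measurable versions provided by [L2rho]. *)
Lemma L2rho_csmooth_comb c (u v k : E -> R) : L2rho gamma u -> L2rho gamma v -> csmooth k ->
  \int[lam]_(x in D) ((c * u x + v x) * k x) =
  c * (\int[lam]_(x in D) (u x * k x)) + \int[lam]_(x in D) (v x * k x).
Proof.
move=> Lu Lv ck.
have mD := @measurable_orthant R n.
have mk : measurable_fun D k by apply: measurable_funTS; exact: csmooth_measurable.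
have mr : measurable_fun D (fun x : E => rho gamma x ^+ 2 : R).
  apply: measurable_funX; apply: measurable_funTS; apply: continuous_rV_measurable.
  exact: smooth_continuous smooth_rho.
have kr : lam.-integrable D (fun x => (k x ^+ 2 * (rho gamma x ^+ 2)^-1)%:E).
  apply: (integrableS measurableT) => //.
  have [sk [l kl]] := ck; apply: (@continuous_supported_integrable _ _ l).
    have cr := smooth_continuous smooth_rho.
    apply: (continuousMf (continuousMf (smooth_continuous sk) (smooth_continuous sk))).
    by apply: (continuousVf _ (continuousMf cr cr)) => x; rewrite mulf_eq0 negb_or gt_eqF ?rho_gt0.
  by move=> z; rewrite mulf_eq0 sqrf_eq0 negb_or => /andP[/kl].
have H f : L2rho gamma f -> exists g, [/\ measurable_fun D g, {ae lam, forall x, D x -> f x = g x} &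
    lam.-integrable D (fun x => (g x * k x)%:E)].
  rewrite /L2rho lebesgue_rV_leb => -[g [mg fg g2]]; exists g; split=> //.
  have ig : lam.-integrable D (fun x => (g x ^+ 2 * rho gamma x ^+ 2)%:E).
    apply/integrableP; split.
      by apply/measurable_EFinP; apply: measurable_funM => //; exact: measurable_funX.
    rewrite (eq_integral (fun x => (g x ^+ 2 * rho gamma x ^+ 2)%:E))// => x _.
    by rewrite gee0_abs// lee_fin mulr_ge0 ?sqr_ge0.
  apply: (le_integrable mD _ _ (integrableD mD ig kr)).
    by apply/measurable_EFinP; exact: measurable_funM.
  move=> x _; rewrite /= lee_fin [leRHS]ger0_norm; last first.
    by apply: addr_ge0; apply: mulr_ge0; rewrite ?invr_ge0 sqr_ge0.
  have r0 : 0 < rho gamma x ^+ 2 :> R by rewrite exprn_gt0// rho_gt0.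
  rewrite normrM -[g x ^+ 2]real_normK ?num_real// -[k x ^+ 2]real_normK ?num_real//.
  rewrite -(ler_pM2r r0) mulrDl mulfVK ?gt_eqF//.
  have := sqr_ge0 (`|g x| * rho gamma x ^+ 2 - `|k x|).
  by have := normr_ge0 (g x); have := normr_ge0 (k x); nra.
have [g [mg ug ig]] := H u Lu; have [h [mh vh ih]] := H v Lv.
have eqR (f1 f2 : E -> R) : {ae lam, forall x, D x -> f1 x = f2 x} ->
    \int[lam]_(x in D) f1 x = \int[lam]_(x in D) f2 x.
  move=> f12; rewrite /Rintegral; congr fine; apply: ae_eq_integral_nonmeas.
  by apply: filterS f12 => x E Dx; rewrite E.
rewrite (eqR _ (fun x => c * (g x * k x) + h x * k x)); last first.
  by apply: filterS2 ug vh => x H1 H2 Dx; rewrite H1// H2//; ring.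
rewrite (eqR (fun x => u x * k x) (fun x => g x * k x)); last first.
  by apply: filterS ug => x H1 Dx; rewrite H1.
rewrite (eqR (fun x => v x * k x) (fun x => h x * k x)); last first.
  by apply: filterS vh => x H1 Dx; rewrite H1.
rewrite RintegralD//; last exact: (integrableZl mD c ig).
by rewrite RintegralZl.
Qed.

Lemma sigma_gradient_comb c u hu v hv : L2rho gamma u -> L2rho gamma v ->
  sigma_gradient gamma sigma u hu -> sigma_gradient gamma sigma v hv ->
  sigma_gradient gamma sigma (fun x => c * u x + v x) (fun i x => c * hu i x + hv i x).
Proof.
move=> Lu Lv su sv i; have [Lhu Hu] := su i; have [Lhv Hv] := sv i.
split; first exact: L2rho_comb.
move=> phi tphi; have cphi := test_function_csmooth tphi.
have := Hu _ tphi; have := Hv _ tphi; rewrite lebesgue_rV_leb => {}Hv {}Hu.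
rewrite L2rho_csmooth_comb// Hu Hv L2rho_csmooth_comb//; first by ring.
apply: csmooth_sum => j; apply: csmoothMr; first exact: smooth_cst.
apply: (csmooth_pd j (f := fun y : E => y 0 j * phi y)).
by apply: csmoothMr => //; exact: smooth_coord.
Qed.

Section generator.
Variables (r : R) (delta : 'I_n -> R).
Local Notation a := (sigma *m sigma^T).

(** The drift of the process in the coordinates z. The correction - a_ii / 2 arises, on the diagonal
    i = j, from the derivative of x_i in d/dx_j (x_i x_j ...), as seen in [BBS_dual2]. *)
Definition beta (l : 'I_n) : R := \sum_i invmx sigma l i * (r - delta i - a i i / 2).

Definition dual_test (k : E -> R) : E -> R := xlift sigma (fun z => k z * (irho2 z * ijac z)).

Lemma csmooth_dual k : csmooth k -> csmooth (fun z => k z * (irho2 z * ijac z)).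
Proof.
by move=> ck; apply: csmoothM => //; apply: smoothM; [exact: smooth_irho2|exact: smooth_ijac].
Qed.

Lemma BBS_dual1 k1 k2 i : csmooth k1 -> csmooth k2 ->
  \int[lebesgue_rV n]_(x in D) ((r - delta i) * x 0 i * 'D_'e_i (xlift sigma k1) x *
     dual_test k2 x * rho gamma x ^+ 2) =
  (r - delta i) * \int[lam]_z (ypd i k1 z * k2 z).
Proof.
move=> c1 c2; rewrite lebesgue_rV_leb.
have cy : csmooth (ypd i k1).
  by apply: csmooth_sum => l; apply: csmoothMr; [exact: smooth_cst|exact: csmooth_pd].
rewrite (transfer (G := fun z => (r - delta i) * (ypd i k1 z * k2 z) * ijac z)).
- rewrite -RintegralZl//; last by apply: csmooth_integrable; apply: csmoothM => //; case: c2.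
  apply: eq_Rintegral => z _; rewrite ijacE -mulrA mulVf ?mulr1// gt_eqF//; exact: jac_gt0.
- apply: csmooth_measurable; apply: csmoothM; last exact: smooth_ijac.
  by apply: csmoothMr; [exact: smooth_cst|apply: csmoothM => //; case: c2].
- apply: aeW => z; rewrite -/(pd i _ (Th z)) pd_lift_Theta// /dual_test lift_Theta// [Th z 0 i]mxE.
  set b := slin sigma z 0 i; have bE : expR (- b) * expR b = 1 by rewrite -expRD addNr expR0.
  have rE := irho2K z; rewrite -[RHS]mul1r -bE -[RHS]mul1r -rE; ring.
Qed.

Lemma BBS_dual2 k1 k2 i j : csmooth k1 -> csmooth k2 ->
  \int[lebesgue_rV n]_(x in D) (a i j * 'D_'e_i (xlift sigma k1) x *
      'D_'e_j (fun y : E => y 0 i * y 0 j * dual_test k2 y * rho gamma y ^+ 2) x) =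
  a i j * \int[lam]_z (ypd i k1 z * ((i == j)%:R * k2 z + ypd j k2 z)).
Proof.
move=> c1 c2; rewrite lebesgue_rV_leb.
have cy l k : csmooth k -> csmooth (ypd l k).
  by move=> ck; apply: csmooth_sum => m; apply: csmoothMr; [exact: smooth_cst|exact: csmooth_pd].
have se l : smooth (fun z : E => expR (slin sigma z 0 l)).
  by apply: smooth_exp; exact: smooth_slin.
have ci : csmooth (fun z => k2 z * ijac z) by apply: csmoothM => //; exact: smooth_ijac.
have cj : csmooth (fun z => expR (slin sigma z 0 j) * (k2 z * ijac z)) by exact: csmoothMr.
have cij : csmooth (fun z => expR (slin sigma z 0 i) *
    (expR (slin sigma z 0 j) * (k2 z * ijac z))) by exact: csmoothMr.
have E1 : (fun y : E => y 0 i * y 0 j * dual_test k2 y * rho gamma y ^+ 2) =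
    xlift sigma (fun z => expR (slin sigma z 0 i) * (expR (slin sigma z 0 j) * (k2 z * ijac z))).
  apply/funext => y; have [Dy|Dy] := pselect (D y); last first.
    by rewrite /dual_test !liftN// mulr0 mul0r.
  rewrite /dual_test -(logTK sigmaU Dy) !lift_Theta//; set z := lg y.
  rewrite [Th z 0 i]mxE [Th z 0 j]mxE; have rE := irho2K z.
  by rewrite -[RHS]mul1r -rE; ring.
have cs : csmooth (fun z => (i == j)%:R * k2 z + ypd j k2 z).
  by apply: csmoothD; [apply: csmoothMr => //; exact: smooth_cst|exact: cy].
rewrite (transfer (G := fun z => a i j * (ypd i k1 z * ((i == j)%:R * k2 z + ypd j k2 z)) * ijac z)).
- rewrite -RintegralZl//; last first.
    by apply: csmooth_integrable; apply: csmoothMr => //; case: (cy i k1 c1).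
  apply: eq_Rintegral => z _; rewrite ijacE -mulrA mulVf ?mulr1// gt_eqF//; exact: jac_gt0.
- apply: csmooth_measurable; apply: csmoothM; last exact: smooth_ijac.
  by apply: csmoothMr; [exact: smooth_cst|apply: csmoothMr => //; case: (cy i k1 c1)].
- apply: aeW => z; rewrite E1 -!/(pd _ _ (Th z)) !pd_lift_Theta//.
  rewrite ypdM; [|exact: smooth_diff (se i)|by apply: smooth_diff; case: cj].
  rewrite ypdM_ijac; last by apply: smooth_diff; case: c2.
  rewrite ypd_exp; last exact: diff_slin.
  rewrite ypd_slin//.
  set b := slin sigma z 0 i; set b' := slin sigma z 0 j.
  have bE : expR (- b) * expR b = 1 by rewrite -expRD addNr expR0.
  have bE' : expR (- b') * expR b' = 1 by rewrite -expRD addNr expR0.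
  by rewrite -[RHS]mul1r -bE -[RHS]mul1r -bE'; ring.
Qed.

(** In the coordinates z the matrix a becomes the identity, so the second-order part of the form is
    that of half the Laplacian. *)
Lemma invmx_a l m : \sum_i \sum_j invmx sigma l i * a i j * invmx sigma m j = (l == m)%:R.
Proof.
have /matrixP/(_ l m) : invmx sigma *m a *m (invmx sigma)^T = 1%:M.
  by rewrite mulmxA mulVmx// mul1mx -trmx_mul mulVmx// trmx1.
rewrite !mxE => <-; rewrite exchange_big; apply: eq_bigr => j _ /=.
by rewrite [(invmx sigma *m a) l j]mxE [_^T j m]mxE mulr_suml.
Qed.

Lemma BBS_dual k1 k2 : csmooth k1 -> csmooth k2 ->
  BBS_test gamma r delta sigma (xlift sigma k1) (dual_test k2) =
  (\sum_l beta l * \int[lam]_z (pd l k1 z * k2 z)) -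
  2^-1 * \sum_l \int[lam]_z (pd l k1 z * pd l k2 z).
Proof.
move=> c1 c2; rewrite /BBS_test.
under eq_bigr do rewrite BBS_dual1//.
under [X in _ - _ * X]eq_bigr do under eq_bigr do rewrite BBS_dual2//.
have s2 := c2.1.
have ip l : lam.-integrable setT (EFin \o (fun z => pd l k1 z * k2 z)).
  by apply: csmooth_integrable; apply: csmoothM => //; exact: csmooth_pd.
have ipp l m : lam.-integrable setT (EFin \o (fun z => pd l k1 z * pd m k2 z)).
  by apply: csmooth_integrable; apply: csmoothM; [exact: csmooth_pd|case: (csmooth_pd m c2)].
pose P l := \int[lam]_z (pd l k1 z * k2 z).
pose Q l m := \int[lam]_z (pd l k1 z * pd m k2 z).
have Y1 i : \int[lam]_z (ypd i k1 z * k2 z) = \sum_l invmx sigma l i * P l.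
  transitivity (\int[lam]_z (\sum_l invmx sigma l i * (pd l k1 z * k2 z))).
    by apply: eq_Rintegral => z _; rewrite mulr_suml; apply: eq_bigr => l _; rewrite mulrA.
  have [|_ ->] := @integrable_bigsum _ _ _ (index_enum _)
       (fun l z => invmx sigma l i * (pd l k1 z * k2 z)).
    by move=> l; apply: integrableZR; exact: ip.
  by apply: eq_bigr => l _; rewrite (RintegralZl _ measurableT (ip l)).
have i1 i : lam.-integrable setT (EFin \o (fun z => ypd i k1 z * k2 z)).
  apply: csmooth_integrable; apply: csmoothM => //; apply: csmooth_sum => m.
  by apply: csmoothMr; [exact: smooth_cst|exact: csmooth_pd].
have Y2 i j : \int[lam]_z (ypd i k1 z * ypd j k2 z) =
    \sum_l \sum_m invmx sigma l i * invmx sigma m j * Q l m.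
  transitivity (\int[lam]_z (\sum_l \sum_m (invmx sigma l i * invmx sigma m j) *
     (pd l k1 z * pd m k2 z))); last first.
    have i2 l m : lam.-integrable setT (EFin \o (fun z => (invmx sigma l i * invmx sigma m j) *
      (pd l k1 z * pd m k2 z))) by apply: integrableZR; exact: ipp.
    have i3 l := @integrable_bigsum _ _ _ (index_enum _) _ (i2 l).
    have [|_ ->] := @integrable_bigsum _ _ _ (index_enum _)
       (fun l z => \sum_m (invmx sigma l i * invmx sigma m j) * (pd l k1 z * pd m k2 z)).
      by move=> l; have [] := i3 l.
    apply: eq_bigr => l _; have [_ ->] := i3 l.
    by apply: eq_bigr => m _; rewrite (RintegralZl _ measurableT (ipp l m)).
  apply: eq_Rintegral => z _; rewrite mulr_suml; apply: eq_bigr => l _; rewrite mulr_sumr.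
  by apply: eq_bigr => m _; ring.
have i4 i j : lam.-integrable setT (EFin \o (fun z => ypd i k1 z * ypd j k2 z)).
  apply: csmooth_integrable; apply: csmoothM; first apply: csmooth_sum => m.
    by apply: csmoothMr; [exact: smooth_cst|exact: csmooth_pd].
  apply: smooth_sum => m; apply: smoothM; first exact: smooth_cst.
  by case: (csmooth_pd m c2).
have Y3 i j : \int[lam]_z (ypd i k1 z * ((i == j)%:R * k2 z + ypd j k2 z)) =
   (i == j)%:R * (\sum_l invmx sigma l i * P l) + \sum_l \sum_m invmx sigma l i * invmx sigma m j * Q l m.
  rewrite -Y1 -Y2 -RintegralZl// -RintegralD//; last exact: integrableZR.
  by apply: eq_Rintegral => z _; ring.
under eq_bigr do rewrite Y1.
under [X in _ - _ * X]eq_bigr do under eq_bigr do rewrite Y3.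
have S1 : \sum_i \sum_j a i j * ((i == j)%:R * (\sum_l invmx sigma l i * P l) +
      \sum_l \sum_m invmx sigma l i * invmx sigma m j * Q l m) =
    (\sum_i a i i * (\sum_l invmx sigma l i * P l)) + \sum_l Q l l.
  transitivity (\sum_i (\sum_j a i j * ((i == j)%:R * (\sum_l invmx sigma l i * P l))) +
      \sum_i \sum_j \sum_l \sum_m a i j * (invmx sigma l i * invmx sigma m j * Q l m)).
    rewrite -big_split; apply: eq_bigr => i _; rewrite -big_split; apply: eq_bigr => j _ /=.
    rewrite mulrDr; congr (_ + _); rewrite mulr_sumr; apply: eq_bigr => l _.
    by rewrite mulr_sumr.
  congr (_ + _).
    apply: eq_bigr => i _; set X := \sum_l invmx sigma l i * P l.
    rewrite (bigD1 i)//= eqxx mul1r big1 ?addr0// => j ji.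
    by rewrite eq_sym (negbTE ji) mul0r mulr0.
  transitivity (\sum_l \sum_m (\sum_i \sum_j invmx sigma l i * a i j * invmx sigma m j) * Q l m).
    under eq_bigr do rewrite exchange_big.
    rewrite exchange_big; apply: eq_bigr => l _ /=.
    under eq_bigr do rewrite exchange_big.
    rewrite exchange_big; apply: eq_bigr => m _ /=.
    rewrite mulr_suml; apply: eq_bigr => i _; rewrite mulr_suml; apply: eq_bigr => j _; ring.
  apply: eq_bigr => l _; rewrite (bigD1 l)//= invmx_a eqxx mul1r big1 ?addr0// => m ml.
  by rewrite invmx_a eq_sym (negbTE ml) mul0r.
rewrite S1 mulrDr opprD addrA; congr (_ - _).
rewrite mulr_sumr -sumrB.
transitivity (\sum_i \sum_l (r - delta i - a i i / 2) * (invmx sigma l i * P l)).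
  by apply: eq_bigr => i _; rewrite -mulr_sumr; ring.
rewrite exchange_big; apply: eq_bigr => l _ /=; rewrite mulr_suml; apply: eq_bigr => i _.
by rewrite /P; ring.
Qed.

(** In place of Cauchy-Schwarz, |x k| <= x^2 om / e + e k^2 / om: a squared distance at most e^2
    then produces an error linear in [e]. *)
Lemma sqr_pairing (u k : E -> R) : L2om om u -> csmooth k ->
  exists2 K, 0 <= K & forall e : R, 0 < e ->
   forall k', csmooth k' -> (omdist om u k' <= (e ^+ 2)%:E)%E ->
   `|\int[lam]_z (u z * k z) - \int[lam]_z (k' z * k z)| <= e * K.
Proof.
move=> Lu ck.
have oc := om_cont; have og := om_gt0.
have iu := L2om_mul_csmooth oc og Lu ck.
have ik : lam.-integrable setT (EFin \o (fun z => k z ^+ 2 * (om z)^-1)).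
  have [sk [l kl]] := ck; apply: (@continuous_supported_integrable _ _ l).
    exact: (continuousMf (continuousMf (smooth_continuous sk) (smooth_continuous sk)) (om_contV oc og)).
  by move=> z; rewrite mulf_eq0 sqrf_eq0 negb_or => /andP[/kl].
exists (1 + \int[lam]_z (k z ^+ 2 * (om z)^-1)).
  by rewrite addr_ge0// Rintegral_ge0// => z _; rewrite mulr_ge0 ?sqr_ge0// invr_ge0 ltW.
move=> e e0 k' ck' H.
have ik' : lam.-integrable setT (EFin \o (fun z => k' z * k z)).
  by apply: csmooth_integrable; apply: csmoothM => //; case: ck.
have LB := L2omB oc og Lu (csmooth_L2om ck').
have iB := L2om_integrable2 oc og LB.
rewrite -RintegralB//; apply: (le_trans (le_normr_Rintegral _ _)) => //; first exact: integrableBR.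
apply: (@le_trans _ _ (\int[lam]_z (e^-1 * ((u z - k' z) ^+ 2 * om z) + e * (k z ^+ 2 * (om z)^-1)))).
  apply: le_Rintegral => //.
  - by apply: integrable_norm => //; exact: integrableBR.
  - by apply: integrableDR; exact: integrableZR.
  move=> z _; rewrite -mulrBl normrM.
  set x := u z - k' z; rewrite -[x ^+ 2]real_normK ?num_real// -[k z ^+ 2]real_normK ?num_real//.
  have o0 := og z; have eo : 0 < e * om z by rewrite mulr_gt0.
  rewrite -(ler_pM2r eo) mulrDl.
  have -> : e^-1 * (`|x| ^+ 2 * om z) * (e * om z) = (`|x| * om z) ^+ 2.
    by field; rewrite gt_eqF.
  have -> : e * (`|k z| ^+ 2 / om z) * (e * om z) = (e * `|k z|) ^+ 2.
    by field; rewrite gt_eqF.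
  have := sqr_ge0 (`|x| * om z - e * `|k z|); have := normr_ge0 x; have := normr_ge0 (k z).
  have p := mulr_ge0 (mulr_ge0 (normr_ge0 x) (normr_ge0 (k z))) (ltW eo); nra.
rewrite RintegralD//; [|exact: integrableZR|exact: integrableZR].
rewrite !RintegralZl// mulrDr mulr1 lerD2r.
have {}H : \int[lam]_z ((u z - k' z) ^+ 2 * om z) <= e ^+ 2 by rewrite -lee_fin -RintegralK.
by rewrite ler_pdivrMl// -expr2.
Qed.

Variable B : (E -> R) -> (E -> R) -> R.
Hypothesis hB : is_BBS gamma r delta sigma B.

(** [B] is explicit on test functions only. By [density] the solution lies within order [e] of the
    lift of a smooth [k'], for which [BBS_dual] gives the formula; boundedness of [B] on one side
    and [sqr_pairing] on the other bound the discrepancy by [e * M] with [M] independent of [e]. *)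
Lemma B_dual v w g h k : csmooth k -> rep v w -> L2om om w -> L2rho gamma v ->
  sigma_gradient gamma sigma v h ->
  (forall i, rep (h i) (g i)) -> (forall i, L2om om (g i)) ->
  B v (dual_test k) = (\sum_l beta l * \int[lam]_z (g l z * k z)) -
  2^-1 * \sum_l \int[lam]_z (g l z * pd l k z).
Proof.
move=> ck vw Lw Lv sg hg Lg.
have oc := om_cont; have og := om_gt0.
set phi := dual_test k; have cd := csmooth_dual ck.
have tphi : test_function phi by exact: test_function_lift.
have H1phi : H1rho gamma sigma phi by exact: H1rho_xlift.
have [Lphi [hphi sphi]] := H1phi.
have H1v : H1rho gamma sigma v by split=> //; exists h.
have [Btest Bl _ [C1 HC1]] := hB.
set Nphi := H1rho_norm gamma phi hphi.
have Nphi0 : 0 <= Nphi by exact: sqrtr_ge0.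
have HK l : exists K, 0 <= K /\ forall e : R, 0 < e ->
   forall k', csmooth k' -> (omdist om (g l) k' <= (e ^+ 2)%:E)%E ->
   `|\int[lam]_z (g l z * k z) - \int[lam]_z (k' z * k z)| <= e * K.
  by have [K ? ?] := sqr_pairing (Lg l) ck; exists K.
have HK' l : exists K, 0 <= K /\ forall e : R, 0 < e ->
   forall k', csmooth k' -> (omdist om (g l) k' <= (e ^+ 2)%:E)%E ->
   `|\int[lam]_z (g l z * pd l k z) - \int[lam]_z (k' z * pd l k z)| <= e * K.
  by have [K ? ?] := sqr_pairing (Lg l) (csmooth_pd l ck); exists K.
pose K l := sval (cid (HK l)); pose K' l := sval (cid (HK' l)).
set A := \sum_l _; set A' := \sum_l _.
pose M := `|C1| * n.+1%:R * Nphi + (\sum_l `|beta l| * K l) + 2^-1 * \sum_l K' l.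
have M0 : 0 <= M.
  rewrite !addr_ge0 ?mulr_ge0 ?sumr_ge0// => l _.
    by rewrite mulr_ge0//; have [] := svalP (cid (HK l)).
  by have [] := svalP (cid (HK' l)).
suff bound (e : R) : 0 < e -> `|B v phi - (A - 2^-1 * A')| <= e * M.
  apply/eqP; rewrite -subr_eq0 -normr_le0; apply/ler_addgt0Pr => e e0.
  rewrite add0r (le_trans (bound (e / (M + 1)) _))//; first by rewrite divr_gt0// ltr_wpDl.
  by rewrite mulrAC ler_pdivrMr ?ltr_wpDl// ler_wpM2l ?(ltW e0)// lerDl.
move=> e0.
have wg := weak_grad_rep vw hg sg.
(* The precision is e^2 because [omdist] is a squared distance. *)
have [k' [ck' Hk' Hpd]] := density oc og Lw Lg wg (exprn_gt0 2 e0).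
have ckl l := csmooth_pd l ck'.
have H1k' := H1rho_xlift ck'.
have Bk' := Btest _ _ (test_function_lift sigmaU ck') tphi.
have sk' := sigma_gradient_xlift ck'; have Lk' := xlift_L2rho ck'.
have Ldiff := L2rho_comb (-1) Lk' Lv.
have sdiff := sigma_gradient_comb (-1) Lk' Lv sk' sg.
have := HC1 _ _ _ _ Ldiff sdiff Lphi sphi.
rewrite (Bl _ _ _ _ H1k' H1v H1phi) Bk' -/Nphi.
have normle : H1rho_norm gamma (fun x => -1 * xlift sigma k' x + v x)
    (fun i x => -1 * xlift sigma (pd i k') x + h i x) <= n.+1%:R * e.
  have omd (u c' : E -> R) : L2om om u -> csmooth c' -> (omdist om u c' <= (e ^+ 2)%:E)%E ->
      \int[lam]_z ((-1 * c' z + u z) * (-1 * c' z + u z) * om z) <= e ^+ 2.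
    move=> Lu cc; rewrite /omdist RintegralK; last first.
      exact: (L2om_integrable2 oc og (L2omB oc og Lu (csmooth_L2om cc))).
    rewrite lee_fin => H; apply: le_trans H; rewrite le_eqVlt; apply/orP; left; apply/eqP.
    by apply: eq_Rintegral => z _; ring.
  rewrite /H1rho_norm -[leRHS]ger0_norm ?mulr_ge0 ?(ltW e0)// -sqrtr_sqr ler_wsqrtr//.
  rewrite (ip_rho_rep (rep_comb (-1) (rep_xlift ck') vw) (rep_comb (-1) (rep_xlift ck') vw)).
  (* The squared norm has n + 1 terms, the function and its n derivatives, and sqrt (n + 1) <= n +
     1. *)
  apply: (@le_trans _ _ (e ^+ 2 + \sum_(i < n) e ^+ 2)).
    apply: lerD; first exact: omd.
    apply: ler_sum => i _.
    rewrite (ip_rho_rep (rep_comb (-1) (rep_xlift (ckl i)) (hg i)) (rep_comb (-1) (rep_xlift (ckl i)) (hg i))).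
    exact: omd.
  rewrite sumr_const card_ord -mulrS exprMn -[leLHS]mulr_natl ler_wpM2r ?sqr_ge0//.
  by rewrite expr2 ler_peMl// ler1n.
move=> HB1.
have {}HB1 : `|-1 * BBS_test gamma r delta sigma (xlift sigma k') phi + B v phi| <=
    e * (`|C1| * n.+1%:R * Nphi).
  apply: (le_trans HB1); set t := H1rho_norm _ _ _ in normle *.
  have t0 : 0 <= t by exact: sqrtr_ge0.
  apply: (@le_trans _ _ (`|C1| * (n.+1%:R * e) * Nphi)).
    by rewrite ler_wpM2r// (le_trans (ler_wpM2r t0 (ler_norm C1)))// ler_wpM2l.
  by rewrite le_eqVlt; apply/orP; left; apply/eqP; ring.
move: HB1; rewrite BBS_dual// => HB1.
set S := \sum_l beta l * _ in HB1; set S' := \sum_l _ in HB1.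
have HS : `|A - S| <= e * \sum_l `|beta l| * K l.
  rewrite /A /S -sumrB mulr_sumr (le_trans (ler_norm_sum _ _ _))//; apply: ler_sum => l _.
  rewrite -mulrBr normrM mulrCA ler_wpM2l//.
  by have [_] := svalP (cid (HK l)); apply.
have HS' : `|A' - S'| <= e * \sum_l K' l.
  rewrite /A' /S' -sumrB mulr_sumr (le_trans (ler_norm_sum _ _ _))//; apply: ler_sum => l _.
  by have [_] := svalP (cid (HK' l)); apply.
rewrite (_ : _ - _ = (-1 * (S - 2^-1 * S') + B v phi) - (A - S) + 2^-1 * (A' - S')); last by ring.
rewrite /M [leRHS]mulrDr [X in _ <= X + _]mulrDr.
apply: (le_trans (ler_normD _ _)); apply: lerD; last first.
  by rewrite normrM ger0_norm// mulrCA ler_wpM2l.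
by apply: (le_trans (ler_normB _ _)); exact: lerD.
Qed.

(** All derivatives are moved onto [k] through [weak_grad]; the minus sign before [beta] is that of
    the adjoint of a first-order operator. *)
Lemma weak_equation v (F : E -> R -> R) (psi : E -> R) : variational_solution gamma r sigma B psi F v ->
  exists w f, [/\ rep v w, L2om om w, rep (fun x => F x (v x)) f, L2om om f &
    forall k, csmooth k ->
      \int[lam]_z (w z * (2^-1 * (\sum_l pd l (pd l k) z) - \sum_l beta l * pd l k z)) =
      \int[lam]_z ((r * w z - f z) * k z)].
Proof.
move=> [[Lv [h sg]] _ LF HB].
have [w [vw Lw]] := L2rho_rep Lv; have [f [Ff Lf]] := L2rho_rep LF.
exists w, f; split=> // k ck.
have oc := om_cont; have og := om_gt0.
have Hg i := L2rho_rep (sg i).1.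
pose g i := sval (cid (Hg i)).
have hg i : rep (h i) (g i) by have [] := svalP (cid (Hg i)).
have Lg i : L2om om (g i) by have [] := svalP (cid (Hg i)).
have wg := weak_grad_rep vw hg sg.
have := HB (dual_test k) (H1rho_xlift (csmooth_dual ck)).
rewrite (B_dual ck vw Lw Lv sg hg Lg).
have rF : rep (fun x => r * v x - F x (v x)) (fun z => r * w z - f z).
  have [mw vw1] := vw; have [mf Ff1] := Ff; split.
    by apply: measurable_funB => //; exact: measurable_funM.
  by apply: filterS2 vw1 Ff1 => z -> ->.
rewrite (ip_rho_rep rF (rep_xlift (csmooth_dual ck))).
have -> : \int[lam]_z ((r * w z - f z) * (k z * (irho2 z * ijac z)) * om z) =
    \int[lam]_z ((r * w z - f z) * k z).
  apply: eq_Rintegral => z _.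
  have ij : ijac z * jac z = 1 by rewrite ijacE mulVf// gt_eqF// jac_gt0.
  by rewrite /om -[RHS]mulr1 -ij -[ijac z in RHS]mul1r -(irho2K z); ring.
move=> <-.
have ckl l := csmooth_pd l ck.
have ckll l := csmooth_pd l (ckl l).
have i1 l := L2om_mul_csmooth oc og Lw (ckl l).
have i2 l := L2om_mul_csmooth oc og Lw (ckll l).
have i3 l : lam.-integrable setT (EFin \o (fun z => 2^-1 * (w z * pd l (pd l k) z))).
  exact: integrableZR.
have i4 l : lam.-integrable setT (EFin \o (fun z => beta l * (w z * pd l k z))).
  exact: integrableZR.
have [j1 j1E] := @integrable_bigsum _ _ _ (index_enum _) _ i3.
have [j2 j2E] := @integrable_bigsum _ _ _ (index_enum _) _ i4.
transitivity (\int[lam]_z ((\sum_l 2^-1 * (w z * pd l (pd l k) z)) -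
    (\sum_l beta l * (w z * pd l k z)))).
  apply: eq_Rintegral => z _; rewrite mulrBr; congr (_ - _).
    by rewrite mulrCA mulr_sumr mulr_sumr; apply: eq_bigr => l _.
  by rewrite mulr_sumr; apply: eq_bigr => l _; rewrite mulrCA.
rewrite RintegralB// j1E j2E.
rewrite addrC; congr (_ + _).
  rewrite -sumrN; apply: eq_bigr => l _.
  by rewrite (RintegralZl _ measurableT (i1 l)) (wg l _ ck) mulrN.
rewrite mulr_sumr -sumrN; apply: eq_bigr => l _.
by rewrite (RintegralZl _ measurableT (i2 l)) (wg l _ (ckl l)) mulrN opprK.
Qed.

End generator.

End weighted_transfer.

(** * The heat kernel with drift and killing *)

Section gaussian.
Context {R : realType} {n : nat}.
Local Notation E := 'rV[R]_n.
Local Notation lam := (leb n).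

Definition nsq (y : E) : R := \sum_i y 0 i ^+ 2.

Lemma nsq_ge0 y : 0 <= nsq y.
Proof. by apply: sumr_ge0 => i _; exact: sqr_ge0. Qed.

(* Written with exp and ln so that joint measurability is immediate; junk for
   [u <= 0]. *)
Definition gk (u x : R) : R := expR (- (ln (2 * pi * u) / 2) - x ^+ 2 * expR (- ln (2 * u))).

Lemma gk_gt0 u x : 0 < gk u x. Proof. exact: expR_gt0. Qed.

Lemma measurable_gk : measurable_fun setT (fun p : R * R => gk p.1 p.2).
Proof.
apply: measurableT_comp => //; apply: measurable_funB.
  apply: measurableT_comp => //; apply: measurable_funM => //.
  by apply: measurableT_comp => //; exact: measurable_funM.
apply: measurable_funM; first exact: measurable_funX.
apply: measurableT_comp => //; apply: measurableT_comp => //.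
by apply: measurableT_comp => //; exact: measurable_funM.
Qed.

Lemma gk_pdf u x : 0 < u -> gk u x = normal_pdf 0 (Num.sqrt u) x.
Proof.
move=> u0; have su : Num.sqrt u != 0 by rewrite gt_eqF// sqrtr_gt0.
have pu : 0 < 2 * pi * u :> R by rewrite !mulr_gt0// pi_gt0.
rewrite /gk normal_pdfE// /normal_peak /normal_fun sqr_sqrtr ?ltW// subr0.
rewrite expRD; congr (_ * _).
  rewrite (_ : u * pi *+ 2 = 2 * pi * u); last by rewrite -mulr_natl; ring.
  rewrite expRN; congr (_^-1); apply/eqP; rewrite -(@eqrXn2 _ 2)// ?sqrtr_ge0 ?expR_ge0//.
  by rewrite sqr_sqrtr ?(ltW pu)// expr2 -expRD -splitr lnK.
by congr expR; rewrite expRN lnK ?posrE ?mulr_gt0// mulNr mulr_natl.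
Qed.

Lemma integral_gk u m : 0 < u -> (\int[lebesgue_measure]_x (gk u (x - m))%:E = 1)%E.
Proof.
move=> u0; rewrite -(integral_normal_pdf m (Num.sqrt u)); apply: eq_integral => x _.
have su : Num.sqrt u != 0 by rewrite gt_eqF// sqrtr_gt0.
by rewrite gk_pdf// !normal_pdfE// /normal_fun subr0.
Qed.

Definition gauss (u : R) (x : E) : R := \prod_i gk u (x 0 i).

Lemma gauss_gt0 u x : 0 < gauss u x.
Proof. by apply: prodr_gt0 => i _; exact: gk_gt0. Qed.

Lemma measurable_gauss : measurable_fun setT (fun p : R * E => gauss p.1 p.2).
Proof.
rewrite /gauss; apply: measurable_prod => i _.
have mc : measurable_fun setT (fun p : R * E => (p.1, p.2 0 i)).
  apply: measurable_fun_pair => //.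
  exact: (measurableT_comp (measurable_coord i) measurable_snd).
exact: (measurableT_comp measurable_gk mc).
Qed.

Lemma gaussE u x : 0 < u ->
  gauss u x = expR (- (n%:R / 2 * ln (2 * pi * u)) - nsq x / (2 * u)).
Proof.
move=> u0; rewrite /gauss /gk -expR_sum; congr expR.
rewrite big_split/= sumr_const card_ord sumrN -mulr_suml -/(nsq x).
by rewrite expRN lnK ?posrE ?mulr_gt0// -mulr_natl; ring.
Qed.

Lemma integral_gauss u (m : E) : 0 < u -> (\int[lam]_x (gauss u (x - m))%:E = 1)%E.
Proof.
move=> u0; rewrite (eq_integral (fun x : E => (\prod_i gk u (x 0 i - m 0 i))%:E)); last first.
  by move=> x _; congr EFin; apply: eq_bigr => i _; rewrite !mxE.
rewrite (leb_integral_prod (g := fun i t => gk u (t - m 0 i))).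
- by rewrite big1// => i _; exact: integral_gk.
- move=> i; have mc : measurable_fun setT (fun t : R => (u, t - m 0 i)).
    by apply: measurable_fun_pair => //; exact: measurable_funB.
  exact: (measurableT_comp measurable_gk mc).
- by move=> i x; rewrite ltW// gk_gt0.
Qed.

(* Completing the square. *)
Lemma gk_mul s u a y : 0 < s -> 0 < u ->
  gk s y * gk u (a - y) = gk (s + u) a * gk (s * u / (s + u)) (y - s * a / (s + u)).
Proof.
move=> s0 u0; have su0 : 0 < s + u by rewrite addr_gt0.
have v0 : 0 < s * u / (s + u) by rewrite divr_gt0// mulr_gt0.
have p0 : 0 < 2 * pi :> R by rewrite mulr_gt0// pi_gt0.
have eln (t : R) : 0 < t -> expR (- ln (2 * t)) = (2 * t)^-1.
  by move=> t0; rewrite expRN lnK// posrE mulr_gt0.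
rewrite /gk -!expRD; congr expR; rewrite !eln//.
have lnp (t : R) : 0 < t -> ln (2 * pi * t) = ln (2 * pi) + ln t by move=> t0; rewrite lnM// posrE.
rewrite (lnp s s0) (lnp u u0) (lnp _ su0) (lnp _ v0).
have -> : ln (s * u / (s + u)) = ln s + ln u - ln (s + u).
  by rewrite lnM ?posrE ?mulr_gt0 ?invr_gt0// lnM ?posrE// lnV ?posrE.
by field; rewrite !gt_eqF.
Qed.

(** By [gk_mul] in each coordinate, [gauss (s + u) a] comes out of the integral and a shifted
    Gaussian density remains. *)
Lemma gauss_conv s u (a : E) : 0 < s -> 0 < u ->
  (\int[lam]_y (gauss s y * gauss u (a - y))%:E = (gauss (s + u) a)%:E)%E.
Proof.
move=> s0 u0; have su0 : 0 < s + u by rewrite addr_gt0.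
have v0 : 0 < s * u / (s + u) by rewrite divr_gt0// mulr_gt0.
rewrite (eq_integral (fun y : E => (gauss (s + u) a)%:E *
    (gauss (s * u / (s + u)) (y - (s / (s + u)) *: a))%:E)%E); last first.
  move=> y _; rewrite -[RHS]EFinM; congr EFin.
  transitivity (\prod_i (gk s (y 0 i) * gk u ((a - y) 0 i))); first by rewrite big_split.
  rewrite /gauss -[RHS]big_split/=; apply: eq_bigr => i _.
  by rewrite !mxE (gk_mul _ _ s0 u0) [s / _ * _]mulrAC.
have mg : measurable_fun setT (fun y : E => gauss (s * u / (s + u)) (y - (s / (s + u)) *: a)).
  have mc : measurable_fun setT (fun y : E => (s * u / (s + u), y - (s / (s + u)) *: a)).
    by apply: measurable_fun_pair => //; exact: measurable_addr.
  exact: (measurableT_comp measurable_gauss mc).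
rewrite ge0_integralZl_EFin//.
- by rewrite integral_gauss// mule1.
- by move=> y _; rewrite lee_fin ltW// gauss_gt0.
- exact/measurable_EFinP.
- by rewrite ltW// gauss_gt0.
Qed.

End gaussian.

Section heat_kernel.
Context {R : realType} {n : nat}.
Local Notation E := 'rV[R]_n.
Local Notation lam := (leb n).
Variables (r : R) (b : 'I_n -> R).
Hypothesis r_gt0 : 0 < r.

Let bv : E := \row_i b i.

(* The density at time u, from z, of a Brownian motion with drift b killed at rate r. *)
Definition hk (u : R) (z y : E) : R := expR (- r * u) * gauss u (y - (z + u *: bv)).

Lemma hk_gt0 u z y : 0 < hk u z y.
Proof. by rewrite mulr_gt0 ?expR_gt0 ?gauss_gt0. Qed.

Lemma measurable_fun_rVB d (T : measurableType d) (f g : T -> E) :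
  measurable_fun setT f -> measurable_fun setT g -> measurable_fun setT (fun t => f t - g t).
Proof.
move=> mf mg; apply: measurable_fun_rVP => i.
rewrite (_ : (fun t => _) = fun t => f t 0 i - g t 0 i); last by apply/funext => t; rewrite !mxE.
by apply: measurable_funB; apply: (measurableT_comp (measurable_coord i)).
Qed.

Lemma measurable_fun_rVD d (T : measurableType d) (f g : T -> E) :
  measurable_fun setT f -> measurable_fun setT g -> measurable_fun setT (fun t => f t + g t).
Proof.
move=> mf mg; apply: measurable_fun_rVP => i.
rewrite (_ : (fun t => _) = fun t => f t 0 i + g t 0 i); last by apply/funext => t; rewrite !mxE.
by apply: measurable_funD; apply: (measurableT_comp (measurable_coord i)).
Qed.

Lemma measurable_fun_rVZ d (T : measurableType d) (f : T -> R) (c : E) :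
  measurable_fun setT f -> measurable_fun setT (fun t => f t *: c).
Proof.
move=> mf; apply: measurable_fun_rVP => i.
rewrite (_ : (fun t => _) = fun t => f t * c 0 i); last by apply/funext => t; rewrite mxE.
exact: measurable_funM.
Qed.

Lemma measurable_hk d (T : measurableType d) (u : T -> R) (z y : T -> E) :
  measurable_fun setT u -> measurable_fun setT z -> measurable_fun setT y ->
  measurable_fun setT (fun t => hk (u t) (z t) (y t)).
Proof.
move=> mu mz my; apply: measurable_funM.
  by apply: measurableT_comp => //; exact: measurable_funM.
have mc : measurable_fun setT (fun t => (u t, y t - (z t + u t *: bv))).
  apply: measurable_fun_pair => //; apply: measurable_fun_rVB => //.
  by apply: measurable_fun_rVD => //; exact: measurable_fun_rVZ.
exact: (measurableT_comp measurable_gauss mc).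
Qed.

(** The Chapman-Kolmogorov equation: the drift and the killing exponent are additive in time. *)
Lemma hk_conv s u z x : 0 < s -> 0 < u ->
  (\int[lam]_y (hk s z y * hk u y x)%:E = (hk (s + u) z x)%:E)%E.
Proof.
move=> s0 u0; pose c := z + s *: bv; pose a := x - (z + (s + u) *: bv).
have mg v (g : E -> E) : measurable_fun setT g -> measurable_fun setT (fun y => gauss v (g y)).
  move=> mg; have mc : measurable_fun setT (fun y => (v, g y)) by exact: measurable_fun_pair.
  exact: (measurableT_comp measurable_gauss mc).
have mgg : measurable_fun setT (fun y : E => (gauss s y * gauss u (a - y))%:E).
  apply/measurable_EFinP; apply: measurable_funM; apply: mg => //.
  exact: measurable_fun_rVB.
rewrite (eq_integral (fun y : E => ((expR (- r * (s + u)))%:E *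
   (gauss s (y - c) * gauss u (a - (y - c)))%:E)%E)); last first.
  move=> y _; rewrite -EFinM /hk mulrDr expRD; congr EFin.
  rewrite (_ : a - (y - c) = x - (y + u *: bv)); first by ring.
  by rewrite /a /c scalerDl; apply/rowP => i; rewrite !mxE; ring.
rewrite ge0_integralZl_EFin ?expR_ge0//; last 2 first.
- by move=> y _; rewrite lee_fin mulr_ge0 ?ltW ?gauss_gt0.
- apply/measurable_EFinP; apply: measurable_funM; apply: mg; first exact: measurable_addr.
  by apply: measurable_fun_rVB => //; exact: measurable_addr.
rewrite (integral_translation (- c) mgg) gauss_conv//.
Qed.

(** Unnormalised Gaussians, the envelopes in all domination arguments in the variable y. *)
Definition gexp (a : R) (y : E) : R := expR (- (a * nsq y)).

Lemma gexp_gauss a y : 0 < a ->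
  gexp a y = expR (n%:R / 2 * ln (2 * pi * (2 * a)^-1)) * gauss (2 * a)^-1 y.
Proof.
move=> a0; have a20 : 0 < 2 * a by rewrite mulr_gt0.
rewrite gaussE ?invr_gt0// -expRD /gexp; congr expR.
by field; rewrite gt_eqF.
Qed.

Lemma measurable_nsq : measurable_fun setT (nsq : E -> R).
Proof.
apply: measurable_sum => i; apply: measurable_funX; exact: measurable_coord.
Qed.

Lemma measurable_gexp a : measurable_fun setT (gexp a).
Proof.
apply: measurableT_comp => //; apply: measurableT_comp => //.
by apply: measurable_funM => //; exact: measurable_nsq.
Qed.

Lemma integrable_gexp a : 0 < a -> lam.-integrable setT (EFin \o gexp a).
Proof.
move=> a0; rewrite (_ : gexp a = fun y => expR (n%:R / 2 * ln (2 * pi * (2 * a)^-1)) * gauss (2 * a)^-1 y).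
  have mc : measurable_fun setT (fun y : E => ((2 * a)^-1, y)) by exact: measurable_fun_pair.
  apply: integrableZR; apply: integrableR_ge0.
  - exact: (measurableT_comp measurable_gauss mc).
  - by move=> y; rewrite ltW// gauss_gt0.
  - rewrite (eq_integral (fun y : E => (gauss (2 * a)^-1 (y - (0 : E)))%:E)).
      by rewrite integral_gauss ?ltry// invr_gt0 mulr_gt0.
    by move=> y _; rewrite subr0.
by apply/funext => y; exact: gexp_gauss.
Qed.

(* [hlog - r] is the u-derivative of [ln hk], and [hx / u] minus its y-gradient. *)
Definition hx (u : R) (z y : E) (l : 'I_n) : R := y 0 l - (z 0 l + u * b l).

Definition hlog (u : R) (z y : E) : R :=
  (\sum_l hx u z y l ^+ 2) / (2 * u ^+ 2) - n%:R / (2 * u) + (\sum_l b l * hx u z y l) / u.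

Lemma nsq_hx u z y : nsq (y - (z + u *: bv)) = \sum_l hx u z y l ^+ 2.
Proof. by apply: eq_bigr => l _; rewrite /hx !mxE. Qed.

Lemma hkE u z y : 0 < u ->
  hk u z y = expR (- r * u - n%:R / 2 * ln (2 * pi * u) - (\sum_l hx u z y l ^+ 2) / (2 * u)).
Proof. by move=> u0; rewrite /hk gaussE// -expRD nsq_hx addrA. Qed.

Lemma is_derive_hk (u : R) (z y : E) : 0 < u ->
  is_derive u 1 (fun v => hk v z y) (hk u z y * (hlog u z y - r)).
Proof.
move=> u0.
pose A := \sum_l (y 0 l - z 0 l) ^+ 2; pose B := \sum_l b l * (y 0 l - z 0 l).
pose C := \sum_l b l ^+ 2.
have S2 v : \sum_l hx v z y l ^+ 2 = A - 2 * v * B + v ^+ 2 * C.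
  rewrite /A /B /C !mulr_sumr -sumrB -big_split; apply: eq_bigr => l _ /=.
  by rewrite /hx; ring.
have S1 v : \sum_l b l * hx v z y l = B - v * C.
  by rewrite /B /C mulr_sumr -sumrB; apply: eq_bigr => l _; rewrite /hx; ring.
pose c1 := - r - C / 2; pose c2 := - (n%:R / 2 : R); pose c3 := - (A / 2).
pose c4 := B - n%:R / 2 * ln (2 * pi).
pose h : R -> R := (c1 \*: id + c2 \*: @ln R) + (c3 \*: (fun v => v^-1) + cst c4).
have hE v : h v = c1 * v + c2 * ln v + (c3 * v^-1 + c4) by [].
have hkh v : 0 < v -> hk v z y = expR (h v).
  move=> v0; rewrite hkE// S2 lnM ?posrE ?mulr_gt0 ?pi_gt0//; congr expR.
  rewrite hE /c1 /c2 /c3 /c4.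
  by field; rewrite gt_eqF.
have dh : is_derive u 1 h (hlog u z y - r).
  have D1 := is_derive1_ln u0; have D2 := is_derive_inv u0.
  have D := is_deriveD (is_deriveD (is_deriveZ c1 (is_derive_id u 1)) (is_deriveZ c2 D1))
    (is_deriveD (is_deriveZ c3 D2) (is_derive_cst c4 u 1)).
  have -> : hlog u z y - r = c1 * 1 + c2 * u^-1 + (c3 * (- u^-1 ^+ 2) + 0).
    by rewrite /hlog S2 S1 /c1 /c2 /c3; field; rewrite gt_eqF.
  exact: D.
have dE : is_derive u 1 (expR \o h) (hk u z y * (hlog u z y - r)).
  rewrite hkh//; have De := is_derive_expR (h u).
  by apply: is_derive_eq; rewrite /GRing.scale/= mulrC.
apply: (near_eq_is_derive _ dE).
near=> v; rewrite /= -hkh//; near: v; exact: lt_nbhsr.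
Unshelve. all: by end_near.
Qed.

(** On a compact interval of positive times a single Gaussian dominates the kernel together with its
    time derivative and its gradient, which permits differentiation under the integral sign. *)
Lemma hk_bound (s t : R) (z : E) : 0 < s -> s <= t -> exists A a : R, [/\ 0 <= A, 0 < a &
  forall u y, s <= u <= t ->
    hk u z y * (1 + `|hlog u z y| + \sum_l `|hx u z y l| / u) <= A * gexp a y].
Proof.
move=> s0 st; have t0 := lt_le_trans s0 st.
pose c := \sum_l (`|z 0 l| + t * `|b l|).
have c0 : 0 <= c by apply: sumr_ge0 => l _; rewrite addr_ge0// mulr_ge0// ltW.
pose nn : R := n%:R.
pose sb := \sum_l `|b l|; have sb0 : 0 <= sb by exact: sumr_ge0.
pose A0 := expR (- (nn / 2 * ln (2 * pi * s))).
pose A1 := 1 + (2 * s ^+ 2)^-1 + nn / (2 * s) + sb / s + nn / s.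
have A10 : 0 <= A1.
  by rewrite !addr_ge0// ?invr_ge0 ?divr_ge0 ?mulr_ge0 ?ler0n ?sqr_ge0 ?(ltW s0).
(* With S the squared norm of y - z - u b, the kernel carries exp (- S / (2 t)). Half of this
   exponent absorbs the factor 1 + S; the other half, through S >= |y|^2 / 2 - n c^2 ([Slow]),
   leaves the rate 1 / (8 t) and the constant exp (n c^2 / (4 t)). *)
pose A := A0 * A1 * (1 + 4 * t) * expR (nn * c ^+ 2 / (4 * t)).
exists A, (8 * t)^-1; split.
- by rewrite !mulr_ge0 ?expR_ge0// addr_ge0// mulr_ge0// ltW.
- by rewrite invr_gt0 mulr_gt0.
move=> u y /andP[su ut]; have u0 := lt_le_trans s0 su.
pose S := \sum_l hx u z y l ^+ 2; have S0 : 0 <= S by apply: sumr_ge0 => l _; exact: sqr_ge0.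
have cl l : `|z 0 l + u * b l| <= c.
  rewrite /c (bigD1 l)//= ler_wpDr//.
    by apply: sumr_ge0 => k _; rewrite addr_ge0// mulr_ge0// ltW.
  rewrite (le_trans (ler_normD _ _))// lerD2l normrM (gtr0_norm u0) ler_wpM2r//.
have Slow : nsq y / 2 - nn * c ^+ 2 <= S.
  rewrite /nsq /S mulr_suml; apply: (@le_trans _ _ (\sum_l (y 0 l ^+ 2 / 2 - c ^+ 2))).
    by rewrite sumrB lerD2l lerN2 sumr_const card_ord /nn mulr_natl.
  apply: ler_sum => l _; rewrite /hx; have := cl l; set k := _ + _ * _ => kc.
  have : k ^+ 2 <= c ^+ 2 by rewrite -[k ^+ 2]real_normK ?num_real// lerXn2r ?nnegrE.
  by have := sqr_ge0 (y 0 l - 2 * k); nra.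
have xS l : `|hx u z y l| <= 1 + S.
  have : hx u z y l ^+ 2 <= S.
    by rewrite /S (bigD1 l)//= lerDl sumr_ge0// => k _; exact: sqr_ge0.
  rewrite -[hx _ _ _ _ ^+ 2]real_normK ?num_real//.
  by have := sqr_ge0 (`|hx u z y l| - 1); have := normr_ge0 (hx u z y l); nra.
have S1 : 1 <= 1 + S by rewrite lerDl.
have us : u^-1 <= s^-1 by rewrite lef_pV2 ?posrE.
have us2 : (2 * u ^+ 2)^-1 <= (2 * s ^+ 2)^-1.
  by rewrite lef_pV2 ?posrE ?mulr_gt0 ?exprn_gt0// ler_pM2l// lerXn2r ?nnegrE ?(ltW s0) ?(ltW u0).
have us1 : (2 * u)^-1 <= (2 * s)^-1.
  by rewrite lef_pV2 ?posrE ?mulr_gt0// ler_pM2l.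
have poly : 1 + `|hlog u z y| + \sum_l `|hx u z y l| / u <= A1 * (1 + S).
  have B1 : `|hlog u z y| <= ((2 * s ^+ 2)^-1 + nn / (2 * s) + sb / s) * (1 + S).
    rewrite /hlog -/S (le_trans (ler_normD _ _))// [leRHS]mulrDl; apply: lerD.
      rewrite (le_trans (ler_normB _ _))// [leRHS]mulrDl; apply: lerD.
        have k0 : 0 <= (2 * u ^+ 2)^-1 by rewrite invr_ge0 mulr_ge0 ?sqr_ge0.
        rewrite ger0_norm ?mulr_ge0// mulrC ler_pM//.
        by rewrite lerDr.
      rewrite ger0_norm ?divr_ge0 ?mulr_ge0 ?ler0n ?(ltW u0)// -[leLHS]mulr1.
      by rewrite ler_pM ?divr_ge0 ?mulr_ge0 ?ler0n ?(ltW u0)// ler_wpM2l ?ler0n.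
    rewrite normrM normfV (gtr0_norm u0) mulrAC ler_pM ?invr_ge0 ?(ltW u0)//.
    rewrite /sb mulr_suml (le_trans (ler_norm_sum _ _ _))//; apply: ler_sum => l _.
    by rewrite normrM ler_wpM2l.
  have B2 : \sum_l `|hx u z y l| / u <= nn / s * (1 + S).
    rewrite [leRHS]mulrAC /nn -[n in leRHS]card_ord -sum1_card natr_sum !mulr_suml.
    by apply: ler_sum => l _; rewrite mul1r ler_pM ?invr_ge0 ?(ltW u0).
  apply: (le_trans (lerD (lerD S1 B1) B2)).
  by rewrite /A1 le_eqVlt; apply/orP; left; apply/eqP; ring.
pose q := S / (4 * t); have q0 : 0 <= q by rewrite divr_ge0// mulr_ge0// ltW.
have hkle : hk u z y <= A0 * expR (- (2 * q)).
  rewrite hkE// -/S -expRD ler_expR.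
  have E1 : - r * u <= 0 by rewrite mulNr oppr_le0 mulr_ge0 ?ltW.
  have E2 : nn / 2 * ln (2 * pi * s) <= nn / 2 * ln (2 * pi * u).
    rewrite ler_wpM2l ?divr_ge0 ?ler0n// ler_ln ?posrE ?mulr_gt0 ?pi_gt0//.
    by rewrite ler_pM2l// mulr_gt0// pi_gt0.
  have E3 : 2 * q <= S / (2 * u).
    rewrite /q (_ : 2 * (S / (4 * t)) = S / (2 * t)); last by field; rewrite gt_eqF.
    by rewrite ler_wpM2l// lef_pV2 ?posrE ?mulr_gt0// ler_pM2l.
  by rewrite -/nn; lra.
have Sq : 1 + S <= (1 + 4 * t) * expR q.
  apply: (@le_trans _ _ ((1 + 4 * t) * (1 + q))); last first.
    by rewrite ler_wpM2l ?expR_ge1Dx// addr_ge0// mulr_ge0// ltW.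
  have -> : S = 4 * t * q by rewrite /q mulrC mulfVK// gt_eqF// mulr_gt0.
  by have := mulr_ge0 (mulr_ge0 (ler0n R 4) (ltW t0)) q0; nra.
apply: (le_trans (ler_pM (ltW (hk_gt0 _ _ _)) _ hkle poly)).
  by rewrite !addr_ge0// sumr_ge0// => l _; rewrite divr_ge0// ltW.
apply: (@le_trans _ _ (A0 * expR (- (2 * q)) * (A1 * ((1 + 4 * t) * expR q)))).
  by rewrite ler_wpM2l ?mulr_ge0 ?expR_ge0// ler_wpM2l.
have -> : A0 * expR (- (2 * q)) * (A1 * ((1 + 4 * t) * expR q)) =
    A0 * A1 * (1 + 4 * t) * (expR (- (2 * q)) * expR q) by ring.
have P0 : 0 <= A0 * A1 * (1 + 4 * t).
  by rewrite !mulr_ge0 ?expR_ge0// addr_ge0// mulr_ge0// ltW.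
rewrite /A -[leRHS]mulrA; apply: ler_wpM2l => //.
rewrite /gexp -!expRD ler_expR.
have t80 : 0 < 8 * t by rewrite mulr_gt0.
rewrite -(ler_pM2l t80) mulrDr mulrDr !mulrN [_ * (_^-1 * _)]mulrA mulfV ?gt_eqF// mul1r.
have -> : 8 * t * (2 * q) = 4 * S by rewrite /q; field; rewrite gt_eqF.
have -> : 8 * t * q = 2 * S by rewrite /q; field; rewrite gt_eqF.
have -> : 8 * t * (nn * c ^+ 2 / (4 * t)) = 2 * (nn * c ^+ 2) by field; rewrite gt_eqF.
by lra.
Qed.

Let qsum (c : 'I_n -> R) (y : E) : R := \sum_l (y 0 l + c l) ^+ 2.

Lemma hk_shape (u : R) (z : E) : 0 < u -> exists K, hk u z =
  fun y => expR (K + (- (2 * u)^-1) * qsum (fun l => - (z 0 l + u * b l)) y).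
Proof.
move=> u0; exists (- r * u - n%:R / 2 * ln (2 * pi * u)); apply/funext => y.
by rewrite hkE// [- _^-1 * _]mulrC mulrN.
Qed.

Let smooth_lin (c : 'I_n -> R) l : smooth (fun y : E => y 0 l + c l).
Proof. by apply: smoothD; [exact: smooth_coord|exact: smooth_cst]. Qed.

Let smooth_qsum c : smooth (qsum c).
Proof.
apply: (@smooth_sum R n _ _ (fun l (y : E) => (y 0 l + c l) ^+ 2)) => l.
by apply: smoothM; exact: smooth_lin.
Qed.

Let pd_lin (c : 'I_n -> R) l k (y : E) : pd k (fun y : E => y 0 l + c l) y = (k == l)%:R.
Proof.
rewrite pdD; [|exact: differentiable_coord|exact: differentiable_cst].
by rewrite pd_coord (_ : pd k _ y = 0) ?addr0//; exact: derive_cst.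
Qed.

Let pd_qsum c k y : pd k (qsum c) y = 2 * (y 0 k + c k).
Proof.
have dl l : differentiable (fun y : E => y 0 l + c l) y := smooth_diff y (smooth_lin c l).
have := (@pd_sum R n _ (index_enum _) k (fun l (y : E) => (y 0 l + c l) ^+ 2) y).
case=> [l|_]; first exact: (differentiableM (dl l) (dl l)).
rewrite -/(qsum c) => ->.
have E1 l : pd k (fun y0 : E => (y0 0 l + c l) ^+ 2) y = 2 * (k == l)%:R * (y 0 l + c l).
  by rewrite (pdM k (dl l) (dl l)) pd_lin; ring.
under eq_bigr do rewrite E1.
rewrite (bigD1 k)//= eqxx big1 ?addr0 ?mulr1// => l lk.
by rewrite eq_sym (negbTE lk) mulr0 mul0r.
Qed.

Lemma smooth_hk u z : 0 < u -> smooth (hk u z).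
Proof.
move=> u0; have [K HK] := hk_shape z u0; rewrite HK.
apply: smooth_exp; apply: smoothD; first exact: smooth_cst.
apply: smoothM; [exact: smooth_cst|exact: smooth_qsum].
Qed.

Lemma pd_hk u z y l : 0 < u -> pd l (hk u z) y = hk u z y * (- (hx u z y l / u)).
Proof.
move=> u0; have [K HK] := hk_shape z u0.
have sq := smooth_qsum (fun l => - (z 0 l + u * b l)).
have sm : smooth (fun y => - (2 * u)^-1 * qsum (fun l => - (z 0 l + u * b l)) y).
  by apply: smoothM => //; exact: smooth_cst.
have dq := smooth_diff y (smoothD (smooth_cst K) sm).
rewrite HK.
rewrite (pd_comp l (is_derive_expR _) dq); congr (_ * _).
rewrite pdD; [|exact: differentiable_cst|exact: smooth_diff].
rewrite pdM; [|exact: differentiable_cst|exact: smooth_diff].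
rewrite pd_qsum (_ : pd l (fun=> K) y = 0); last exact: derive_cst.
rewrite (_ : pd l (fun=> - (2 * u)^-1) y = 0); last exact: derive_cst.
by rewrite /hx mul0r !add0r; field; rewrite gt_eqF.
Qed.

Lemma pd2_hk u z y l : 0 < u ->
  pd l (pd l (hk u z)) y = hk u z y * ((hx u z y l / u) ^+ 2 - u^-1).
Proof.
move=> u0.
have -> : pd l (hk u z) = fun y => hk u z y * (- u^-1 * (y 0 l + - (z 0 l + u * b l))).
  by apply/funext => x; rewrite pd_hk// /hx; congr (_ * _); ring.
have sl := smooth_lin (fun l => - (z 0 l + u * b l)) l.
rewrite pdM; [|exact: smooth_diff (smooth_hk z u0)|].
  rewrite pd_hk// pdM; [|exact: differentiable_cst|exact: smooth_diff].
  rewrite (pd_lin (fun l => - (z 0 l + u * b l)) l l y) eqxx (_ : pd l (fun=> - u^-1) y = 0); last exact: derive_cst.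
  by rewrite (_ : true%:R = 1)// /hx; field; rewrite gt_eqF.
by apply: smooth_diff; apply: smoothM => //; exact: smooth_cst.
Qed.

End heat_kernel.

(** * The weak equation tested with the heat kernel *)

Section heat_equation.
Context {R : realType} {n : nat}.
Local Notation E := 'rV[R]_n.
Local Notation lam := (leb n).
Variables (r : R) (b : 'I_n -> R) (om : E -> R).
Hypothesis r_gt0 : 0 < r.
Hypothesis om_cont : continuous om.
Hypothesis om_gt0 : forall z, 0 < om z.
Hypothesis om_gexp : forall a : R, 0 < a -> lam.-integrable setT (EFin \o (fun y => gexp a y / om y)).
Local Notation hk := (hk r b).
Local Notation hx := (hx b).
Local Notation hlog := (hlog b).

Lemma L2om_gexp w a : L2om om w -> 0 < a -> lam.-integrable setT (EFin \o (fun y => `|w y| * gexp a y)).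
Proof.
move=> Lw a0; have i2 := L2om_integrable2 om_cont om_gt0 Lw.
have ia := om_gexp (mulr_gt0 (ltr0n _ 2) a0).
apply: integrableR_le (integrableDR i2 ia).
  apply: measurable_funM; last exact: measurable_gexp.
  by apply: measurableT_comp => //; case: Lw.
move=> y; have g0 : 0 < gexp a y by exact: expR_gt0.
rewrite normrM normr_id (ger0_norm (ltW g0)).
have -> : gexp (2 * a) y = gexp a y ^+ 2.
  by rewrite /gexp expr2 -expRD; congr expR; ring.
have o0 := om_gt0 y; rewrite -(ler_pM2r o0) mulrDl mulfVK ?gt_eqF//.
rewrite -[w y ^+ 2]real_normK ?num_real//.
by have := sqr_ge0 (`|w y| * om y - gexp a y); have := normr_ge0 (w y); nra.
Qed.

Lemma L2om_le_gexp w (F : E -> R) A a : L2om om w -> measurable_fun setT F -> 0 < a ->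
  (forall y, `|F y| <= A * gexp a y) -> lam.-integrable setT (EFin \o (fun y => w y * F y)).
Proof.
move=> Lw mF a0 FA; apply: integrableR_le (integrableZR A (L2om_gexp Lw a0)).
  by apply: measurable_funM => //; case: Lw.
by move=> y; rewrite normrM mulrCA ler_wpM2l.
Qed.

Lemma cutoff_Rintegral (h : E -> R) : lam.-integrable setT (EFin \o h) ->
  \int[lam]_z (cutoff m z * h z) @[m --> \oo] --> \int[lam]_z h z.
Proof.
move=> ih; have [M M0 HM] := @cutoff_bounded R n.
have mc m : measurable_fun setT (@cutoff R n m) := integrableR_meas (csmooth_integrable (csmooth_cutoff m)).
have mh := integrableR_meas ih.
have [|||||_ _] := @dominated_convergence _ _ _ lam setT measurableT
  (fun m z => (cutoff m z * h z)%:E) (EFin \o h) (fun z => (M * `|h z|)%:E).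
- by move=> m; apply/measurable_EFinP; exact: measurable_funM.
- exact/measurable_EFinP.
- apply: aeW => z _; apply/cvg_EFin; first exact: nearW.
  rewrite -[X in _ --> X]mul1r; apply: cvgM; [exact: cutoff_cvg|exact: cvg_cst].
- by apply: integrableZR; exact: integrable_norm.
- by apply: aeW => z m _; rewrite lee_fin normrM ler_wpM2r.
rewrite RintegralK// => /fine_cvgP[_]; exact.
Qed.

Lemma pd2_cutoff m i z : pd i (pd i (@cutoff R n m)) z =
  m.+1%:R^-1 * (m.+1%:R^-1 * pd i (pd i (@mbump R n)) (m.+1%:R^-1 *: z)).
Proof.
have sb := @smooth_mbump R n.
have -> : pd i (@cutoff R n m) = fun z => m.+1%:R^-1 * pd i (@mbump R n) (m.+1%:R^-1 *: z).
  by apply/funext => y; exact: pd_cutoff.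
have ss : smooth (fun z : E => pd i (@mbump R n) (m.+1%:R^-1 *: z)).
  rewrite (_ : (fun z : E => _) = fun z => m.+1%:R * pd i (@cutoff R n m) z).
    apply: smoothM; first exact: smooth_cst.
    by case: (csmooth_pd i (@csmooth_cutoff R n m)).
  by apply/funext => y; rewrite pd_cutoff mulrA mulfV ?mul1r// pnatr_eq0.
rewrite pdM; [|exact: differentiable_cst|exact: smooth_diff].
rewrite (_ : pd i (fun=> m.+1%:R^-1) z = 0); last exact: derive_cst.
rewrite mul0r add0r pd_scale// => y.
by apply: smooth_diff; exact: smooth_pd.
Qed.

Lemma cutoff_pd_bound : exists2 M : R, 0 <= M & forall m i z,
  `|pd i (@cutoff R n m) z| <= M * m.+1%:R^-1 /\ `|pd i (pd i (@cutoff R n m)) z| <= M * m.+1%:R^-1.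
Proof.
have H i : exists M : R, forall z, `|pd i (@mbump R n) z| <= M /\ `|pd i (pd i (@mbump R n)) z| <= M.
  have [s1 [k1 sk1]] := csmooth_pd i (@csmooth_mbump R n).
  have [s2 [k2 sk2]] := csmooth_pd i (csmooth_pd i (@csmooth_mbump R n)).
  have [M1 HM1] := supported_bounded (smooth_continuous s1) sk1.
  have [M2 HM2] := supported_bounded (smooth_continuous s2) sk2.
  exists (Num.max M1 M2) => z.
  by split; rewrite le_max; [rewrite (HM1 z)|rewrite (HM2 z) orbT].
pose M i := sval (cid (H i)); have HM i z := svalP (cid (H i)) z.
have M0 i : 0 <= M i by apply: le_trans (HM i 0).1.
have le i : M i <= \sum_j M j by rewrite (bigD1 i)//= lerDl sumr_ge0.
exists (\sum_i M i) => [|m i z]; first exact: sumr_ge0.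
have m0 : 0 <= m.+1%:R^-1 :> R by rewrite invr_ge0.
have m1 : m.+1%:R^-1 <= 1 :> R by rewrite invf_le1// ler1n.
rewrite pd_cutoff pd2_cutoff; split.
  rewrite normrM (ger0_norm m0) mulrC ler_wpM2r//; exact: le_trans (HM i _).1 (le i).
rewrite !normrM (ger0_norm m0) mulrC ler_wpM2r//.
rewrite -[leRHS]mul1r ler_pM//; exact: le_trans (HM i _).2 (le i).
Qed.

Section solution.
Variables w f : E -> R.
Hypothesis Lw : L2om om w.
Hypothesis Lf : L2om om f.
Hypothesis weq : forall k, csmooth k ->
  \int[lam]_z (w z * (2^-1 * (\sum_l pd l (pd l k) z) - \sum_l b l * pd l k z)) =
  \int[lam]_z ((r * w z - f z) * k z).

Lemma measurable_hky u z : measurable_fun setT (hk u z).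
Proof. by apply: measurable_hk. Qed.

Lemma measurable_hlog u z : measurable_fun setT (hlog u z).
Proof.
have mx l : measurable_fun setT (fun y => hx u z y l).
  by apply: measurable_funB => //; exact: measurable_coord.
apply: measurable_funD; first apply: measurable_funB => //.
  apply: measurable_funM => //; apply: measurable_sum => l; exact: measurable_funX.
by apply: measurable_funM => //; apply: measurable_sum => l; exact: measurable_funM.
Qed.

Lemma hk_bounds u z : 0 < u -> exists A a : R, [/\ 0 <= A, 0 < a,
   forall y, hk u z y <= A * gexp a y, forall y, `|hk u z y * hlog u z y| <= A * gexp a y &
   forall y l, hk u z y * (`|hx u z y l| / u) <= A * gexp a y].
Proof.
move=> u0; have [A [a [A0 a0 H]]] := hk_bound b r_gt0 z u0 (lexx u).
have uu : u <= u <= u by rewrite lexx.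
have S0 y : 0 <= \sum_l `|hx u z y l| / u by apply: sumr_ge0 => l _; rewrite divr_ge0// ltW.
exists A, a; split=> // y.
- apply: le_trans (H u y uu); rewrite ler_peMr ?(ltW (hk_gt0 _ _ _ _ _))//.
  by rewrite -addrA lerDl addr_ge0.
- apply: le_trans (H u y uu); rewrite normrM ger0_norm ?(ltW (hk_gt0 _ _ _ _ _))//.
  rewrite ler_wpM2l ?(ltW (hk_gt0 _ _ _ _ _))// addrAC.
  by rewrite lerDr addr_ge0.
- move=> l; apply: le_trans (H u y uu).
  rewrite ler_wpM2l ?(ltW (hk_gt0 _ _ _ _ _))//.
  rewrite (bigD1 l)//= addrCA lerDl !addr_ge0//.
  by apply: sumr_ge0 => j _; rewrite divr_ge0// ltW.
Qed.

Lemma integrable_hk v u z : L2om om v -> 0 < u ->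
  lam.-integrable setT (EFin \o (fun y => v y * hk u z y)).
Proof.
move=> Lv u0; have [A [a [A0 a0 H _ _]]] := hk_bounds z u0.
apply: (L2om_le_gexp Lv (measurable_hky u z) a0 (A := A)) => y.
by rewrite ger0_norm// ltW// hk_gt0.
Qed.

(** In the variable y, [hk * hlog] is (1/2 Lap - b . grad) hk. The kernel is not compactly
    supported, so the equation is applied to [cutoff m * hk] and m tends to infinity. *)
Lemma weq_hk u z : 0 < u ->
  \int[lam]_y (w y * (hk u z y * hlog u z y)) = \int[lam]_y ((r * w y - f y) * hk u z y).
Proof.
move=> u0; have [A [a [A0 a0 H1 H2 H3]]] := hk_bounds z u0.
have sH := smooth_hk r b z u0; set H := hk u z in sH H1 H2 H3 *.
have H0 y : 0 <= H y by rewrite ltW// hk_gt0.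
have iwh : lam.-integrable setT (EFin \o (fun y => w y * (H y * hlog u z y))).
  apply: (L2om_le_gexp Lw _ a0 H2).
  by apply: measurable_funM; [exact: measurable_hky|exact: measurable_hlog].
have iw : lam.-integrable setT (EFin \o (fun y => w y * H y)) by exact: integrable_hk.
have iff : lam.-integrable setT (EFin \o (fun y => f y * H y)) by exact: integrable_hk.
have irf : lam.-integrable setT (EFin \o (fun y => (r * w y - f y) * H y)).
  rewrite (_ : (fun y => _) = fun y => r * (w y * H y) - f y * H y).
    by apply: integrableBR => //; exact: integrableZR.
  by apply/funext => y; ring.
have [M M0 HM] := cutoff_pd_bound.
pose nb := \sum_l `|b l|; have nb0 : 0 <= nb by exact: sumr_ge0.
pose K := (n%:R * 2 + nb) * M * A.
have I0 := L2om_gexp Lw a0.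
pose X m := \int[lam]_y (cutoff m y * (w y * (H y * hlog u z y))) -
    \int[lam]_y (cutoff m y * ((r * w y - f y) * H y)).
have cX : X m @[m --> \oo] --> \int[lam]_y (w y * (H y * hlog u z y)) -
    \int[lam]_y ((r * w y - f y) * H y).
  by apply: cvgB; exact: cutoff_Rintegral.
have XM m : `|X m| <= m.+1%:R^-1 * (K * \int[lam]_y (`|w y| * gexp a y)).
  have cc := @csmooth_cutoff R n m; set c := cutoff m in cc *.
  have dc y : differentiable c y by apply: smooth_diff; exact: cc.1.
  have dH y : differentiable H y by exact: smooth_diff.
  have ck : csmooth (fun y => c y * H y) by exact: csmoothM.
  have p1 l : pd l (fun y => c y * H y) = fun y => pd l c y * H y + c y * pd l H y.
    by apply/funext => y; rewrite pdM.
  have dpc l y : differentiable (pd l c) y by apply: smooth_diff; case: (csmooth_pd l cc).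
  have dpH l y : differentiable (pd l H) y by apply: smooth_diff; exact: smooth_pd.
  have p2 l y : pd l (pd l (fun y => c y * H y)) y =
      pd l (pd l c) y * H y + 2 * (pd l c y * pd l H y) + c y * pd l (pd l H) y.
    rewrite p1 pdD; [|exact: differentiableM|exact: differentiableM].
    rewrite (pdM l (dpc l y) (dH y)) (pdM l (dc y) (dpH l y)).
    by rewrite addrA -[X in X + _]addrA -mulr2n -[_ *+ 2]mulr_natl.
  (* The terms with at least one derivative on the cut-off; they are of order 1/(m+1) under the
     Gaussian envelope of the kernel. *)
  pose Rm y := \sum_l (2^-1 * (pd l (pd l c) y * H y) + pd l c y * pd l H y - b l * (pd l c y * H y)).
  have E1 y : 2^-1 * (\sum_l pd l (pd l (fun y => c y * H y)) y) -
      \sum_l b l * pd l (fun y => c y * H y) y = c y * (H y * hlog u z y) + Rm y.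
    have -> : c y * (H y * hlog u z y) =
        \sum_l (2^-1 * (c y * pd l (pd l H) y) - b l * (c y * pd l H y)).
      rewrite /hlog; transitivity (\sum_l (c y * H y) *
          (hx u z y l ^+ 2 / (2 * u ^+ 2) - (2 * u)^-1 + b l * hx u z y l / u)).
        rewrite -mulr_sumr big_split/= sumrB sumr_const card_ord -!mulr_suml mulrA.
        by rewrite -[_^-1 *+ n]mulr_natl.
      apply: eq_bigr => l _; rewrite /H pd2_hk// pd_hk//; move: (c y) (hk u z y) (hx u z y l).
      by move=> x1 x2 x3; field; rewrite gt_eqF.
    rewrite /Rm -big_split mulr_sumr -sumrB; apply: eq_bigr => l _ /=.
    rewrite p2 p1; move: (pd l (pd l c) y) (pd l (pd l H) y) (pd l c y) (pd l H y) (c y) (H y).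
    by move=> x1 x2 x3 x4 x5 x6; field.
  have RmM y : `|Rm y| <= m.+1%:R^-1 * K * gexp a y.
    have g0 : 0 <= A * gexp a y := le_trans (H0 y) (H1 y).
    have m0 : 0 <= m.+1%:R^-1 :> R by rewrite invr_ge0.
    apply: (@le_trans _ _ (\sum_l ((2 + `|b l|) * (M * m.+1%:R^-1 * (A * gexp a y))))); last first.
      rewrite -mulr_suml big_split/= sumr_const card_ord -[2 *+ n]mulr_natl /K -/nb.
      by rewrite le_eqVlt; apply/orP; left; apply/eqP; ring.
    apply: (le_trans (ler_norm_sum _ _ _)); apply: ler_sum => l _.
    have [B1 B2] := HM m l y; rewrite -/c in B1 B2.
    have C1 : `|pd l (pd l c) y * H y| <= M * m.+1%:R^-1 * (A * gexp a y).
      by rewrite normrM (ger0_norm (H0 y)) ler_pM.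
    have C2 : `|pd l c y * H y| <= M * m.+1%:R^-1 * (A * gexp a y).
      by rewrite normrM (ger0_norm (H0 y)) ler_pM.
    have C3 : `|pd l c y * pd l H y| <= M * m.+1%:R^-1 * (A * gexp a y).
      have -> : pd l H y = - (H y * (hx u z y l / u)) by rewrite /H pd_hk// mulrN.
      rewrite normrM ler_pM// normrN normrM (ger0_norm (H0 y)) normrM.
      by rewrite [`|u^-1|]gtr0_norm ?invr_gt0.
    set Z := M * m.+1%:R^-1 * (A * gexp a y) in C1 C2 C3 *.
    have Z0 : 0 <= Z := le_trans (normr_ge0 _) C1.
    rewrite (le_trans (ler_normB _ _))// mulrDl; apply: lerD; last first.
      by rewrite normrM ler_wpM2l.
    rewrite (le_trans (ler_normD _ _))// normrM [`|2^-1|]ger0_norm//.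
    by have := normr_ge0 (pd l (pd l c) y * H y); lra.
  have mRm : measurable_fun setT Rm.
    apply: measurable_sum => l; apply: csmooth_measurable.
    have cH k : csmooth k -> csmooth (fun y => k y * H y) by move=> ?; exact: csmoothM.
    have c1 := cH _ (csmooth_pd l (csmooth_pd l cc)); have c2 := cH _ (csmooth_pd l cc).
    have c3 : csmooth (fun y => pd l c y * pd l H y).
      by apply: csmoothM; [exact: csmooth_pd|exact: smooth_pd].
    apply: csmoothD; last by apply: csmoothN; apply: csmoothMr => //; exact: smooth_cst.
    by apply: csmoothD => //; apply: csmoothMr => //; exact: smooth_cst.
  have iR := L2om_le_gexp Lw mRm a0 RmM.
  have icw : lam.-integrable setT (EFin \o (fun y => c y * (w y * (H y * hlog u z y)))).
    have [Mc Mc0 HMc] := @cutoff_bounded R n.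
    apply: integrableR_le (integrableZR Mc (integrable_norm iwh)).
      apply: measurable_funM; first exact: csmooth_measurable.
      exact: integrableR_meas iwh.
    by move=> y; rewrite normrM ler_wpM2r//; exact: HMc.
  have := weq ck.
  rewrite (_ : \int[lam]_z0 (w z0 * _) =
     \int[lam]_y (c y * (w y * (H y * hlog u z y)) + w y * Rm y)); last first.
    by apply: eq_Rintegral => y _; rewrite E1; ring.
  rewrite RintegralD// => e1.
  have -> : X m = - \int[lam]_y (w y * Rm y).
    rewrite /X -/c (_ : \int[lam]_y (c y * ((r * w y - f y) * H y)) =
        \int[lam]_y ((r * w y - f y) * (c y * H y))); last first.
      by apply: eq_Rintegral => y _; ring.
    by rewrite -e1; ring.
  rewrite normrN (le_trans (le_normr_Rintegral _ _))// mulrA -RintegralZl//.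
  apply: le_Rintegral => //.
  - exact: integrable_norm.
  - exact: integrableZR.
  by move=> y _; rewrite normrM mulrCA ler_wpM2l.
apply/eqP; rewrite -subr_eq0; apply/eqP.
have X0 : X m @[m --> \oo] --> 0.
  apply: norm_cvg0; apply: (@squeeze_cvgr _ _ _ _ (cst 0) _ _ _ _ _ _) ; last first.
  - rewrite -[X in _ --> X](mul0r (K * \int[lam]_y (`|w y| * gexp a y))).
    by apply: cvgM; [exact: cvg_harmonic|exact: cvg_cst].
  - exact: cvg_cst.
  - by apply: nearW => m; rewrite normr_ge0 XM.
by rewrite -(cvg_lim _ cX)// (cvg_lim _ X0).
Qed.

Let Ft z u := \int[lam]_y (w y * hk u z y).
Let ft z u := \int[lam]_y (f y * hk u z y).

(** The factor 1 + r in the constant accounts for the killing term in [hlog - r]. *)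
Lemma hk_bounds_itv (s t : R) z : 0 < s -> s <= t -> exists A a : R, [/\ 0 <= A, 0 < a,
   forall u y, s <= u <= t -> hk u z y <= A * gexp a y &
   forall u y, s <= u <= t -> `|hk u z y * (hlog u z y - r)| <= A * gexp a y].
Proof.
move=> s0 st; have [A [a [A0 a0 H]]] := hk_bound b r_gt0 z s0 st.
have g0 y : 0 < gexp a y by exact: expR_gt0.
exists ((1 + r) * A), a; split=> //; first by rewrite mulr_ge0// addr_ge0// ltW.
  move=> u y sut; have := H u y sut; have u0 : 0 < u by case/andP : sut => /(lt_le_trans s0).
  have h0 := hk_gt0 r b u z y.
  have S0 : 0 <= \sum_l `|hx u z y l| / u by apply: sumr_ge0 => l _; rewrite divr_ge0// ltW.
  set S := \sum_l _ in S0 *; set L := `|_| => HS; have L0 : 0 <= L by exact: normr_ge0.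
  have h1 : hk u z y <= hk u z y * (1 + L + S) by rewrite ler_peMr ?(ltW h0)// -addrA lerDl addr_ge0.
  apply: (le_trans h1); apply: (le_trans HS); rewrite -mulrA ler_peMl//.
    by apply: mulr_ge0 => //; exact: ltW.
  by rewrite lerDl ltW.
move=> u y sut; have := H u y sut; have u0 : 0 < u by case/andP : sut => /(lt_le_trans s0).
have h0 := hk_gt0 r b u z y.
have S0 : 0 <= \sum_l `|hx u z y l| / u by apply: sumr_ge0 => l _; rewrite divr_ge0// ltW.
set S := \sum_l _ in S0 *; set L := hlog u z y => HS.
rewrite normrM (gtr0_norm h0) -[leRHS]mulrA; apply: (@le_trans _ _ ((1 + r) * (hk u z y * (1 + `|L| + S)))).
  rewrite mulrCA ler_wpM2l ?(ltW h0)// (le_trans (ler_normB _ _))// (gtr0_norm r_gt0).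
  have := normr_ge0 L; have := mulr_ge0 (ltW r_gt0) (addr_ge0 (normr_ge0 L) S0); nra.
by rewrite ler_wpM2l// addr_ge0// ltW.
Qed.

Lemma hk_continuous_u z y u : 0 < u -> {for u, continuous (fun v => hk v z y)}.
Proof.
move=> u0; apply: differentiable_continuous; apply/derivable1_diffP.
by have [] := is_derive_hk r b z y u0.
Qed.

Lemma continuous_pairing (v : E -> R) z u : L2om om v -> 0 < u ->
  {for u, continuous (fun u => \int[lam]_y (v y * hk u z y))}.
Proof.
move=> Lv u0; have u20 : 0 < u / 2 by rewrite divr_gt0.
have uu : u / 2 <= u * 2 by lra.
have [A [a [A0 a0 H _]]] := hk_bounds_itv z u20 uu.
have sub x : `]u / 2, u * 2[%classic x -> 0 < x /\ u / 2 <= x <= u * 2.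
  rewrite /= in_itv/= => /andP[x1 x2]; split; first exact: lt_trans x1.
  by rewrite (ltW x1) (ltW x2).
have := @continuity_under_integral R _ _ lam (fun u y => v y * hk u z y) setT measurableT (u / 2) (u * 2)
  _ _ (fun y => A * (`|v y| * gexp a y)) _ _.
have IH : forall x, `]u / 2, u * 2[%classic x -> lam.-integrable setT (EFin \o (fun y => v y * hk x z y)).
  by move=> x /sub [x0 _]; exact: integrable_hk.
have ID : lam.-integrable setT (EFin \o (fun y => A * (`|v y| * gexp a y))).
  by apply: integrableZR; exact: L2om_gexp.
move=> /(_ IH _ ID)/wrap[].
  apply: aeW => y _ x /set_mem/sub [x0 _].
  by apply: cvgM; [exact: cvg_cst|exact: hk_continuous_u].
move=> C; have {}C := C _ u _; apply: C; last first.
  by rewrite inE/= in_itv/=; apply/andP; split; lra.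
move=> x /sub[x0 xI]; apply: aeW => y _.
by rewrite normrM mulrCA ler_wpM2l// ger0_norm ?(ltW (hk_gt0 _ _ _ _ _))//; exact: H.
Qed.

(** The derivative of the kernel is [hk * (hlog - r)]: by [weq_hk] the killing cancels the term
    [r w] of the equation and only - f remains. *)
Lemma is_derive_Ft z (u : R) : 0 < u -> is_derive u 1 (Ft z) (- ft z u).
Proof.
move=> u0; have u20 : 0 < u / 2 by rewrite divr_gt0.
have uu : u / 2 <= u * 2 by lra.
have [A [a [A0 a0 _ H]]] := hk_bounds_itv z u20 uu.
have sub x : `]u / 2, u * 2[%classic x -> 0 < x /\ u / 2 <= x <= u * 2.
  rewrite /= in_itv/= => /andP[x1 x2]; split; first exact: lt_trans x1.
  by rewrite (ltW x1) (ltW x2).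
have Iu : `]u / 2, u * 2[%classic u by rewrite /= in_itv/=; apply/andP; split; lra.
pose fu u y := w y * hk u z y.
have D (x : R) y : 0 < x -> is_derive x 1 (fu^~ y) (w y * (hk x z y * (hlog x z y - r))).
  move=> x0; have Dh := is_derive_hk r b z y x0.
  exact: (is_deriveZ (w y) Dh).
have d1 x y : 0 < x -> partial1of2 fu x y = w y * (hk x z y * (hlog x z y - r)).
  by move=> x0; rewrite partial1of2E; have [_] := D x y x0.
have IH : forall x, `]u / 2, u * 2[%classic x -> lam.-integrable setT (EFin \o fu x).
  by move=> x /sub [x0 _]; exact: integrable_hk.
have DH : forall x y, `]u / 2, u * 2[%classic x -> setT y -> derivable (fu^~ y) x 1.
  by move=> x y /sub[x0 _] _; have [] := D x y x0.
pose G y := A * (`|w y| * gexp a y).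
have G0 y : 0 <= G y by rewrite !mulr_ge0// expR_ge0.
have ID : lam.-integrable setT (EFin \o G) by apply: integrableZR; exact: L2om_gexp.
have GH : forall x y, `]u / 2, u * 2[%classic x -> setT y -> `|partial1of2 fu x y| <= G y.
  move=> x y /sub[x0 xI] _; rewrite d1// normrM /G mulrCA ler_wpM2l//; exact: H.
have dF := derivable_under_integral measurableT Iu IH DH G0 ID GH.
have F' := differentiation_under_integral measurableT Iu IH DH G0 ID GH.
apply: DeriveDef => //; rewrite -derive1E F'.
have E1 : \int[lam]_y (partial1of2 fu u y) = \int[lam]_y (w y * (hk u z y * hlog u z y) - r * (w y * hk u z y)).
  by apply: eq_Rintegral => y _; rewrite d1//; ring.
rewrite E1.
have [B [c [B0 c0 _ HB _]]] := hk_bounds z u0.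
have i1 : lam.-integrable setT (EFin \o (fun y => w y * (hk u z y * hlog u z y))).
  apply: (L2om_le_gexp Lw _ c0 HB).
  by apply: measurable_funM; [exact: measurable_hky|exact: measurable_hlog].
have iw := integrable_hk z Lw u0; have iff := integrable_hk z Lf u0.
rewrite RintegralB//; last exact: integrableZR.
rewrite weq_hk//.
have -> : \int[lam]_y ((r * w y - f y) * hk u z y) = \int[lam]_y (r * (w y * hk u z y) - f y * hk u z y).
  by apply: eq_Rintegral => y _; ring.
rewrite RintegralB//; last exact: integrableZR.
by rewrite /ft addrAC subrr add0r.
Qed.

Lemma evolution z (s t : R) : 0 < s -> s < t ->
  (\int[lebesgue_measure]_(u in `[s, t]) (\int[lam]_y (f y * hk u z y))%:E =
   (\int[lam]_y (w y * hk s z y) - \int[lam]_y (w y * hk t z y))%:E)%E.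
Proof.
move=> s0 st.
have pos x : s <= x -> 0 < x by exact: lt_le_trans.
have cF x : 0 < x -> {for x, continuous (fun u => - Ft z u)}.
  by move=> x0; apply: (@cvgN R R^o); exact: continuous_pairing.
have DN (x : R) : 0 < x -> is_derive x 1 (fun u => - Ft z u) (ft z x).
  by move=> x0; have D := is_derive_Ft z x0; rewrite -[ft z x]opprK; exact: (is_deriveN D).
rewrite (@continuous_FTC2 R (ft z) (fun u => - Ft z u) s t st).
- by rewrite -EFinB opprK addrC.
- apply: continuous_in_subspaceT => x /set_mem/=; rewrite in_itv/= => /andP[sx _].
  by apply: continuous_pairing => //; exact: pos.
- split.
  + by move=> x; rewrite in_itv/= => /andP[sx _]; have [] := DN x (pos x (ltW sx)).
  + by apply: cvg_at_right_filter; apply: cF.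
  + by apply: cvg_at_left_filter; apply: cF; exact: lt_trans st.
- move=> x; rewrite in_itv/= => /andP[sx _]; rewrite derive1E.
  by have [_] := DN x (pos x (ltW sx)).
Qed.

End solution.

End heat_equation.
Lemma measurable_fun_integral d1 d2 (T1 : measurableType d1) (T2 : measurableType d2)
    (R : realType) (m2 : {sigma_finite_measure set T2 -> \bar R}) (f : T1 -> T2 -> \bar R) :
  measurable_fun setT (fun p : T1 * T2 => f p.1 p.2) -> (forall x y, 0 <= f x y)%E ->
  measurable_fun setT (fun x => \int[m2]_y f x y)%E.
Proof.
by move=> mf f0; apply: (measurable_fun_fubini_tonelli_F (fun p : T1 * T2 => f p.1 p.2)).
Qed.

(** * Resolvents *)

Section time_integral.
Context {R : realType}.
Local Notation TR := (measurableTypeR R).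
Local Notation mu := (@lebesgue_measure R).

Lemma ge0_integral_shift (s : R) (f : TR -> \bar R) : measurable_fun setT f ->
  (forall t, 0 <= f t)%E -> (\int[mu]_t f (t + s)%R = \int[mu]_t f t)%E.
Proof.
move=> mf f0.
pose phi (t : TR) : TR := t + s.
have mphi : measurable_fun setT phi by exact: measurable_funD.
have -> : (\int[mu]_t f (t + s)%R = \int[pushforward mu phi]_t f t)%E.
  by rewrite ge0_integral_pushforward// => t _; exact: f0.
apply: eq_measure_integral => A mA _; rewrite /pushforward.
have := @lebesgue_measure_affine R 1 s A ltr01 mA.
rewrite invr1 mul1e => H; apply: etrans H; congr (lebesgue_measure _).
by apply/seteqP; split => t /=; rewrite /phi mul1r.
Qed.

(** Time integrals over (0, oo) are written over the whole line with this factor, so that shifts and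
    Tonelli apply without a change of domain. *)
Definition pos (t : R) : R := (0 < t)%R%:R.

Lemma measurable_pos : measurable_fun setT (pos : TR -> TR).
Proof.
rewrite (_ : pos = \1_`]0, +oo[) ; first exact: measurable_indic.
apply/funext => t; rewrite indicE /pos; case: (ltP 0 t) => t0.
  by rewrite mem_set//= in_itv/= t0.
by rewrite memNset//= in_itv/= andbT; apply/negP; rewrite -leNgt.
Qed.

Lemma pos_ge0 t : 0 <= pos t. Proof. by rewrite ler0n. Qed.

Lemma integral_exp_itv (c t : R) : 0 < c ->
  (c%:E * \int[mu]_s (pos s * pos (t - s) * expR (c * s))%:E = (pos t * (expR (c * t) - 1))%:E)%E.
Proof.
move=> c0; have [t0|t0] := leP t 0.
  rewrite /pos ltNge t0 mul0r integral0_eq ?mule0// => s _; congr EFin.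
  rewrite subr_gt0; case: (ltP 0 s) => s0; last by rewrite !mul0r.
  by rewrite ltNge (le_trans t0 (ltW s0))/= mulr0 mul0r.
rewrite /pos t0 mul1r.
have mE : measurable_fun setT (fun s : TR => (expR (c * s))%:E).
  by apply/measurable_EFinP; apply: measurableT_comp => //; exact: measurable_funM.
have -> : (\int[mu]_s (((0 < s)%R%:R * (0 < t - s)%R%:R * expR (c * s))%:E) =
    \int[mu]_(s in `]0%R, t[) (expR (c * s))%:E)%E.
  rewrite [RHS]integral_mkcond; apply: eq_integral => s _; rewrite patchE subr_gt0.
  have -> : (s \in `]0, t[%classic) = (0 < s) && (s < t) by rewrite mem_setE in_itv.
  by case: (0 < s); case: (s < t) => /=; rewrite ?mul0r ?mulr0 ?mul0r ?mul1r.
have -> : (\int[mu]_(s in `]0%R, t[) (expR (c * s))%:E = \int[mu]_(s in `[0%R, t]) (expR (c * s))%:E)%E.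
  by rewrite [RHS]integral_itv_bndoo//; exact: measurable_funTS.
have dF (x : R) : is_derive x 1 (fun s => c^-1 * expR (c * s)) (expR (c * x)).
  have D1 : is_derive x 1 (fun s : R => c * s) (c * 1) := is_deriveZ c (is_derive_id x 1).
  have D2 := is_derive1_comp (is_derive_expR (c * x)) D1.
  have D3 := is_deriveZ c^-1 D2.
  by apply: is_derive_eq; rewrite mulr1 /GRing.scale/= mulrCA mulVf ?mulr1// gt_eqF.
have cE : continuous (fun s : R => expR (c * s)).
  move=> x; apply: continuous_comp; last exact: continuous_expR.
  by apply: cvgM; [exact: cvg_cst|exact: cvg_id].
have cF : continuous (fun s : R => c^-1 * expR (c * s)).
  by move=> x; apply: cvgM; [exact: cvg_cst|exact: cE].
rewrite (@continuous_FTC2 R (fun s => expR (c * s)) (fun s => c^-1 * expR (c * s)) 0 t t0).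
- by rewrite -EFinB -EFinM mulr0 expR0 mulr1; congr EFin; field; rewrite gt_eqF.
- exact: continuous_subspaceT.
- split.
  + by move=> x _; have [] := dF x.
  + by apply: cvg_at_right_filter; exact: cF.
  + by apply: cvg_at_left_filter; exact: cF.
- by move=> x _; rewrite derive1E; have [_] := dF x.
Qed.

(* Tonelli form of the resolvent equation: [q] stands for t |-> P_t h (z). *)
Lemma double_time (a b : R) (q : TR -> \bar R) : measurable_fun setT q ->
  (forall t, 0 <= q t)%E -> a < b ->
  (\int[mu]_t ((pos t * expR (- b * t))%:E * q t) + (b - a)%:E *
    \int[mu]_s \int[mu]_u ((pos s * pos u * expR (- a * s - b * u))%:E * q (s + u)%R) =
   \int[mu]_t ((pos t * expR (- a * t))%:E * q t))%E.
Proof.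
move=> mq q0 ab; have ba0 : 0 < b - a by rewrite subr_gt0.
have mp2 (f g : TR * TR -> TR) : measurable_fun setT f -> measurable_fun setT g ->
    measurable_fun setT (fun p => (pos (f p) * pos (g p) * expR (- a * f p - b * g p))%:E).
  move=> mf mg; apply/measurable_EFinP; apply: measurable_funM.
    by apply: measurable_funM; apply: (measurableT_comp measurable_pos).
  apply: measurableT_comp => //; apply: measurable_funB; exact: measurable_funM.
have mF : measurable_fun setT (fun p : TR * TR =>
    ((pos p.1 * pos (p.2 - p.1) * expR (- a * p.1 - b * (p.2 - p.1)))%:E * q p.2)%E).
  apply: emeasurable_funM; last exact: measurableT_comp.
  by apply: mp2 => //; exact: measurable_funB.
have -> : (\int[mu]_s \int[mu]_u ((pos s * pos u * expR (- a * s - b * u))%:E * q (s + u)%R) =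
   \int[mu]_s \int[mu]_t ((pos s * pos (t - s) * expR (- a * s - b * (t - s)))%:E * q t))%E.
  apply: eq_integral => s _.
  rewrite -[RHS](ge0_integral_shift s).
  - by apply: eq_integral => u _; rewrite !addrK [(u + s)%R]addrC.
  - have mc : measurable_fun setT (fun t : TR => (s : TR, t)) by exact: measurable_fun_pair.
    exact: (measurableT_comp mF mc).
  - by move=> t; rewrite mule_ge0// lee_fin !mulr_ge0 ?pos_ge0 ?expR_ge0.
rewrite (fubini_tonelli (fun p : TR * TR => ((pos p.1 * pos (p.2 - p.1) * expR (- a * p.1 - b * (p.2 - p.1)))%:E * q p.2)%E))//; last first.
  by move=> t; rewrite mule_ge0// lee_fin !mulr_ge0 ?pos_ge0 ?expR_ge0.
have inner t : (\int[mu]_s ((pos s * pos (t - s) * expR (- a * s - b * (t - s)))%:E * q t) =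
    (expR (- b * t))%:E * q t * \int[mu]_s (pos s * pos (t - s) * expR ((b - a) * s))%:E)%E.
  rewrite -ge0_integralZl//; last 3 first.
  - apply/measurable_EFinP; apply: measurable_funM.
      apply: measurable_funM; first exact: measurable_pos.
      by apply: (measurableT_comp measurable_pos); exact: measurable_funB.
    by apply: measurableT_comp => //; exact: measurable_funM.
  - by move=> s _; rewrite lee_fin !mulr_ge0 ?pos_ge0 ?expR_ge0.
  - by rewrite mule_ge0// lee_fin expR_ge0.
  apply: eq_integral => s _; rewrite muleAC -EFinM; congr (_%:E * _)%E.
  by rewrite mulrCA -expRD; congr (_ * expR _); ring.
rewrite (_ : (\int[mu]_y \int[mu]_x _)%E = (\int[mu]_t ((expR (- b * t))%:E * q t *
    \int[mu]_s (pos s * pos (t - s) * expR ((b - a) * s))%:E))%E); last first.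
  by apply: eq_integral => t _; exact: inner.
have mG : measurable_fun setT (fun t : TR => ((expR (- b * t))%:E * q t *
    \int[mu]_s (pos s * pos (t - s) * expR ((b - a) * s))%:E)%E).
  apply: (eq_measurable_fun (fubini_G mu (fun p : TR * TR =>
    ((pos p.1 * pos (p.2 - p.1) * expR (- a * p.1 - b * (p.2 - p.1)))%:E * q p.2)%E))).
    by move=> t _; exact: inner.
  apply: measurable_fun_fubini_tonelli_G => // p.
  by rewrite mule_ge0// lee_fin !mulr_ge0 ?pos_ge0 ?expR_ge0.
have I0 t : (0 <= \int[mu]_s (pos s * pos (t - s) * expR ((b - a) * s))%:E)%E.
  by apply: integral_ge0 => s _; rewrite lee_fin !mulr_ge0 ?pos_ge0 ?expR_ge0.
rewrite -ge0_integralZl//; last 2 first.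
- by move=> t _; rewrite !mule_ge0// lee_fin expR_ge0.
- by rewrite lee_fin ltW.
have m1 c : measurable_fun setT (fun t : TR => ((pos t * expR (c * t))%:E * q t)%E).
  apply: emeasurable_funM => //; apply/measurable_EFinP; apply: measurable_funM.
    exact: measurable_pos.
  by apply: measurableT_comp => //; exact: measurable_funM.
rewrite -ge0_integralD//; last 3 first.
- by move=> t _; rewrite mule_ge0// lee_fin mulr_ge0 ?pos_ge0 ?expR_ge0.
- by move=> t _; rewrite !mule_ge0 ?lee_fin ?expR_ge0 ?(ltW ba0).
- by apply: emeasurable_funM.
apply: eq_integral => t _.
set I := (\int[mu]_s _)%E; set K := pos t * (expR ((b - a) * t) - 1).
have IK : ((b - a)%:E * I = K%:E)%E by exact: integral_exp_itv.
have K0 : 0 <= K.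
  rewrite /K /pos; have [t0|t0] := ltP 0 t; last by rewrite mul0r.
  rewrite mul1r subr_ge0 -[leLHS]expR0 ler_expR.
  by rewrite mulr_ge0 ?(ltW ba0) ?(ltW t0).
rewrite muleCA IK muleAC -EFinM -ge0_muleDl; last 2 first.
- by rewrite lee_fin mulr_ge0 ?pos_ge0 ?expR_ge0.
- by rewrite lee_fin mulr_ge0 ?expR_ge0.
rewrite -EFinD; congr (_%:E * _)%E.
have -> : expR (- a * t) = expR (- b * t) * expR ((b - a) * t).
  by rewrite -expRD; congr expR; ring.
by rewrite /K; ring.
Qed.

End time_integral.

(** * Heat operators and the resolvent equation *)

Section potential.
Context {R : realType} {n : nat}.
Local Notation E := 'rV[R]_n.
Local Notation lam := (leb n).
Local Notation TR := (measurableTypeR R).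
Local Notation mu := (@lebesgue_measure R).
Variables (r : R) (b : 'I_n -> R).

Local Notation hk := (hk r b).

Definition heat (u : R) (h : E -> \bar R) (z : E) : \bar R :=
  (\int[lam]_y (h y * (hk u z y)%:E))%E.

(** The killing at rate [r] is already contained in [hk], and [a] adds to it: [resolvent 0] is the
    potential operator of the killed motion. *)
Definition resolvent (a : R) (h : E -> \bar R) (z : E) : \bar R :=
  (\int[mu]_u ((pos u * expR (- a * u))%:E * heat u h z))%E.

Definition mge0 (h : E -> \bar R) := measurable_fun setT h /\ forall y, (0 <= h y)%E.

Lemma hk_ge0E u z y : (0 <= (hk u z y)%:E)%E.
Proof. by rewrite lee_fin ltW// hk_gt0. Qed.

Lemma pos_exp_ge0 a u : (0 <= (pos u * expR (- a * u) : R)%:E)%E.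
Proof. by rewrite lee_fin mulr_ge0 ?pos_ge0 ?expR_ge0. Qed.

Lemma measurable_pos_exp a : measurable_fun setT (fun u : TR => (pos u * expR (- a * u))%:E).
Proof.
apply/measurable_EFinP; apply: measurable_funM; first exact: measurable_pos.
by apply: measurableT_comp => //; exact: measurable_funM.
Qed.

Lemma heat_ge0 u h z : (forall y, 0 <= h y)%E -> (0 <= heat u h z)%E.
Proof. by move=> h0; apply: integral_ge0 => y _; rewrite mule_ge0// hk_ge0E. Qed.

Lemma resolvent_ge0 a h z : (forall y, 0 <= h y)%E -> (0 <= resolvent a h z)%E.
Proof. by move=> h0; apply: integral_ge0 => u _; rewrite mule_ge0 ?pos_exp_ge0 ?heat_ge0. Qed.

Lemma measurable_heat2 h : mge0 h -> measurable_fun setT (fun p : TR * E => heat p.1 h p.2).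
Proof.
move=> [mh h0]; apply: (@measurable_fun_integral _ _ _ _ _ lam (fun (p : TR * E) y => (h y * (hk p.1 p.2 y)%:E)%E)).
  apply: emeasurable_funM; first exact: (measurableT_comp mh).
  apply/measurable_EFinP; apply: measurable_hk => //.
    exact: (measurableT_comp measurable_fst measurable_fst).
  exact: (measurableT_comp measurable_snd measurable_fst).
by move=> p y; rewrite mule_ge0// hk_ge0E.
Qed.

Lemma measurable_heatz h u : mge0 h -> measurable_fun setT (heat u h).
Proof.
move=> mh; have mc : measurable_fun setT (fun z : E => (u : TR, z)) by exact: measurable_fun_pair.
exact: (measurableT_comp (measurable_heat2 mh) mc).
Qed.

Lemma measurable_heatu h z : mge0 h -> measurable_fun setT (fun u : TR => heat u h z).
Proof.
move=> mh; have mc : measurable_fun setT (fun u : TR => (u, z)) by exact: measurable_fun_pair.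
exact: (measurableT_comp (measurable_heat2 mh) mc).
Qed.

Lemma mge0_heat u h : mge0 h -> mge0 (heat u h).
Proof. by move=> mh; split; [exact: measurable_heatz|move=> z; apply: heat_ge0; exact: mh.2]. Qed.

Lemma mge0_resolvent a h : mge0 h -> mge0 (resolvent a h).
Proof.
move=> mh; split; last by move=> z; apply: resolvent_ge0; exact: mh.2.
apply: (@measurable_fun_integral _ _ _ _ _ mu (fun (z : E) (u : TR) => ((pos u * expR (- a * u))%:E * heat u h z)%E)).
  apply: emeasurable_funM.
    exact: (measurableT_comp (measurable_pos_exp a) measurable_snd).
  have mc : measurable_fun setT (fun p : E * TR => (p.2, p.1)) by exact: measurable_swap.
  exact: (measurableT_comp (measurable_heat2 mh) mc).
by move=> z u; rewrite mule_ge0 ?pos_exp_ge0 ?heat_ge0//; exact: mh.2.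
Qed.

Lemma heatD u h g z : mge0 h -> mge0 g ->
  heat u (fun y => h y + g y)%E z = (heat u h z + heat u g z)%E.
Proof.
move=> [mh h0] [mg g0]; rewrite /heat -ge0_integralD//.
- by apply: eq_integral => y _; rewrite ge0_muleDl.
- by move=> y _; rewrite mule_ge0// hk_ge0E.
- by apply: emeasurable_funM => //; apply/measurable_EFinP; exact: measurable_hky.
- by move=> y _; rewrite mule_ge0// hk_ge0E.
- by apply: emeasurable_funM => //; apply/measurable_EFinP; exact: measurable_hky.
Qed.

Lemma heatZ u c h z : mge0 h -> 0 <= c -> heat u (fun y => c%:E * h y)%E z = (c%:E * heat u h z)%E.
Proof.
move=> [mh h0] c0; rewrite /heat -ge0_integralZl_EFin//.
- by apply: eq_integral => y _; rewrite muleA.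
- by move=> y _; rewrite mule_ge0// hk_ge0E.
- by apply: emeasurable_funM => //; apply/measurable_EFinP; exact: measurable_hky.
Qed.

(** The transition kernel has a density, so an inequality almost everywhere becomes an inequality at
    every [z]. *)
Lemma le_heat u h g z : (forall y, 0 <= h y)%E -> (forall y, 0 <= g y)%E ->
  {ae lam, forall y, (h y <= g y)%E} -> (heat u h z <= heat u g z)%E.
Proof.
move=> h0 g0 hg; apply: ge0_le_integral_ae.
- by move=> y; rewrite mule_ge0// hk_ge0E.
- by move=> y; rewrite mule_ge0// hk_ge0E.
by move: hg; apply: filterS => y hg; rewrite lee_wpmul2r// hk_ge0E.
Qed.

Lemma le_resolvent a h g z : (forall y, 0 <= h y)%E -> (forall y, 0 <= g y)%E ->
  {ae lam, forall y, (h y <= g y)%E} -> (resolvent a h z <= resolvent a g z)%E.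
Proof.
move=> h0 g0 hg; apply: ge0_le_integral_ae.
- by move=> u; rewrite mule_ge0 ?pos_exp_ge0 ?heat_ge0.
- by move=> u; rewrite mule_ge0 ?pos_exp_ge0 ?heat_ge0.
by apply: aeW => u; rewrite lee_wpmul2l ?pos_exp_ge0// le_heat.
Qed.

Lemma eq_resolvent a h g z : {ae lam, forall y, h y = g y} -> resolvent a h z = resolvent a g z.
Proof.
move=> hg; apply: eq_integral => u _; congr (_ * _)%E.
by apply: ae_eq_integral_nonmeas; move: hg; apply: filterS => y hg _; rewrite hg.
Qed.

Lemma resolventD a h g z : mge0 h -> mge0 g ->
  resolvent a (fun y => h y + g y)%E z = (resolvent a h z + resolvent a g z)%E.
Proof.
move=> mh mg; rewrite /resolvent -ge0_integralD//.
- by apply: eq_integral => u _; rewrite heatD// ge0_muleDr// heat_ge0//; [exact: mh.2|exact: mg.2].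
- by move=> u _; rewrite mule_ge0 ?pos_exp_ge0 ?heat_ge0//; exact: mh.2.
- by apply: emeasurable_funM; [exact: measurable_pos_exp|exact: measurable_heatu].
- by move=> u _; rewrite mule_ge0 ?pos_exp_ge0 ?heat_ge0//; exact: mg.2.
- by apply: emeasurable_funM; [exact: measurable_pos_exp|exact: measurable_heatu].
Qed.

Lemma resolventZ a c h z : mge0 h -> 0 <= c ->
  resolvent a (fun y => c%:E * h y)%E z = (c%:E * resolvent a h z)%E.
Proof.
move=> mh c0; rewrite /resolvent -ge0_integralZl_EFin//.
- by apply: eq_integral => u _; rewrite heatZ// muleCA.
- by move=> u _; rewrite mule_ge0 ?pos_exp_ge0 ?heat_ge0//; exact: mh.2.
- by apply: emeasurable_funM; [exact: measurable_pos_exp|exact: measurable_heatu].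
Qed.

Lemma heat_heat s u h z : 0 < s -> 0 < u -> mge0 h -> heat s (heat u h) z = heat (s + u) h z.
Proof.
move=> s0 u0 [mh h0]; rewrite {1}/heat.
have mF : measurable_fun setT (fun p : E * E => (h p.2 * (hk u p.1 p.2)%:E * (hk s z p.1)%:E)%E).
  apply: emeasurable_funM; last by apply/measurable_EFinP; exact: measurable_hk.
  apply: emeasurable_funM; first exact: (measurableT_comp mh).
  by apply/measurable_EFinP; exact: measurable_hk.
have F0 p : (0 <= h p.2 * (hk u p.1 p.2)%:E * (hk s z p.1)%:E)%E by rewrite !mule_ge0// hk_ge0E.
transitivity (\int[lam]_y \int[lam]_x (h x * (hk u y x)%:E * (hk s z y)%:E))%E.
  apply: eq_integral => y _; rewrite muleC -ge0_integralZl//.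
  - by apply: eq_integral => x _; rewrite muleC.
  - by apply: emeasurable_funM => //; apply/measurable_EFinP; exact: measurable_hky.
  - by move=> x _; rewrite mule_ge0// hk_ge0E.
  - exact: hk_ge0E.
rewrite (fubini_tonelli (fun p : E * E => (h p.2 * (hk u p.1 p.2)%:E * (hk s z p.1)%:E)%E))//.
apply: eq_integral => x _; rewrite -(hk_conv r b z x s0 u0) -ge0_integralZl//.
- by apply: eq_integral => y _; rewrite /= -muleA -EFinM mulrC.
- by apply/measurable_EFinP; apply: measurable_funM; [exact: measurable_hky|exact: measurable_hk].
- by move=> y _; rewrite lee_fin mulr_ge0// ltW// hk_gt0.
Qed.

Lemma heat_resolvent s a h z : 0 < s -> mge0 h ->
  heat s (resolvent a h) z = (\int[mu]_u ((pos u * expR (- a * u))%:E * heat (s + u) h z))%E.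
Proof.
move=> s0 mh; rewrite {1}/heat.
pose F (p : E * TR) : \bar R := ((pos p.2 * expR (- a * p.2))%:E * heat p.2 h p.1 * (hk s z p.1)%:E)%E.
have mF : measurable_fun setT F.
  apply: emeasurable_funM; last by apply/measurable_EFinP; exact: measurable_hk.
  apply: emeasurable_funM.
    exact: (measurableT_comp (measurable_pos_exp a) measurable_snd).
  have mc : measurable_fun setT (fun p : E * TR => (p.2, p.1)) by exact: measurable_swap.
  exact: (measurableT_comp (measurable_heat2 mh) mc).
have F0 p : (0 <= F p)%E.
  by rewrite !mule_ge0 ?hk_ge0E ?pos_exp_ge0 ?heat_ge0//; exact: mh.2.
transitivity (\int[lam]_y \int[mu]_u F (y, u))%E.
  apply: eq_integral => y _; rewrite muleC -ge0_integralZl//.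
  - by apply: eq_integral => x _; rewrite muleC.
  - by apply: emeasurable_funM; [exact: measurable_pos_exp|exact: measurable_heatu].
  - by move=> x _; rewrite mule_ge0 ?pos_exp_ge0 ?heat_ge0//; exact: mh.2.
  - exact: hk_ge0E.
rewrite (fubini_tonelli F)//.
apply: eq_integral => u _; rewrite /F/=.
have [u0|u0] := ltP 0 u; last first.
  have p0 : (pos u * expR (- a * u))%:E = 0%E by rewrite /pos ltNge u0 mul0r.
  move: p0 (heat (s + u) h z) => -> q; rewrite (mul0e q); apply: integral0_eq => x _.
  by rewrite (mul0e (heat u h x)) mul0e.
have c0 : 0 <= pos u * expR (- a * u) by rewrite mulr_ge0 ?pos_ge0 ?expR_ge0.
by apply: etrans (heatZ s z (mge0_heat u mh) c0) _; rewrite (heat_heat z s0 u0 mh).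
Qed.

Lemma resolvent2 a c h z : mge0 h -> resolvent a (resolvent c h) z =
  (\int[mu]_s \int[mu]_u ((pos s * pos u * expR (- a * s - c * u))%:E * heat (s + u) h z))%E.
Proof.
move=> mh; apply: eq_integral => s _.
have [s0|s0] := ltP 0 s; last first.
  have p0 : pos s = 0 by rewrite /pos ltNge s0.
  by rewrite p0 mul0r mul0e [RHS]integral0_eq// => x _; rewrite !mul0r mul0e.
rewrite heat_resolvent// -ge0_integralZl//.
- apply: eq_integral => u _; rewrite muleA -EFinM; congr (_%:E * _)%E.
  by rewrite mulrACA -expRD; congr (_ * expR _); ring.
- apply: emeasurable_funM; first exact: measurable_pos_exp.
  by apply: (measurableT_comp (measurable_heatu z mh)); exact: measurable_funD.
- by move=> x _; rewrite mule_ge0 ?pos_exp_ge0 ?heat_ge0//; exact: mh.2.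
- exact: pos_exp_ge0.
Qed.

Lemma resolvent_comm a c h z : mge0 h ->
  resolvent a (resolvent c h) z = resolvent c (resolvent a h) z.
Proof.
move=> mh; rewrite (resolvent2 a c z mh) (resolvent2 c a z mh).
pose F (p : TR * TR) : \bar R :=
  ((pos p.1 * pos p.2 * expR (- a * p.1 - c * p.2))%:E * heat (p.1 + p.2) h z)%E.
have mF : measurable_fun setT F.
  apply: emeasurable_funM.
    apply/measurable_EFinP; apply: measurable_funM.
      by apply: measurable_funM; apply: (measurableT_comp measurable_pos).
    by apply: measurableT_comp => //; apply: measurable_funB; exact: measurable_funM.
  by apply: (measurableT_comp (measurable_heatu z mh)); exact: measurable_funD.
have F0 p : (0 <= F p)%E.
  by rewrite mule_ge0 ?heat_ge0 ?lee_fin ?mulr_ge0 ?pos_ge0 ?expR_ge0//; exact: mh.2.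
apply: etrans (fubini_tonelli F mF F0) _.
apply: eq_integral => u _; apply: eq_integral => s _; rewrite /F/=.
rewrite (_ : pos s * pos u * _ = pos u * pos s * expR (- c * u - a * s)).
  by rewrite [(s + u)%R]addrC.
by rewrite [pos s * _]mulrC; congr (_ * expR _); ring.
Qed.

(** Written as a sum rather than a difference, so that it remains valid with infinite values. *)
Lemma resolvent_eq a c h z : mge0 h -> a < c ->
  (resolvent a h z = resolvent c h z + (c - a)%:E * resolvent a (resolvent c h) z)%E.
Proof.
move=> mh ac; rewrite resolvent2// /resolvent double_time//.
- exact: measurable_heatu.
- by move=> t; apply: heat_ge0; exact: mh.2.
Qed.

Lemma ereal_cvg_integral_nd d (T : measurableType d) (m : {measure set T -> \bar R})
    (f : T -> \bar R) (F : (T -> \bar R)^nat) :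
  (forall k, measurable_fun setT (F k)) -> (forall k x, 0 <= F k x)%E ->
  (forall x, nondecreasing_seq (F^~ x)) -> (forall x, F^~ x @ \oo --> f x) ->
  (\int[m]_x F k x)%E @[k --> \oo] --> (\int[m]_x f x)%E.
Proof.
move=> mF F0 nF Ff; have -> : f = fun x => limn (F^~ x).
  by apply/funext => x; apply/esym/cvg_lim => //; exact: Ff.
by apply: cvg_monotone_convergence => // x _; exact: nF.
Qed.

Lemma cvg_resolvent a (F : (E -> \bar R)^nat) h z :
  (forall k, mge0 (F k)) -> (forall x, nondecreasing_seq (F^~ x)) ->
  (forall x, F^~ x @ \oo --> h x) -> resolvent a (F k) z @[k --> \oo] --> resolvent a h z.
Proof.
move=> mF nF Fh.
have ndheat u : nondecreasing_seq (fun k => heat u (F k) z).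
  move=> k l kl; apply: le_heat; [exact: (mF k).2|exact: (mF l).2|apply: aeW => y; exact: nF].
apply: ereal_cvg_integral_nd.
- by move=> k; apply: emeasurable_funM; [exact: measurable_pos_exp|exact: measurable_heatu].
- by move=> k u; rewrite mule_ge0 ?pos_exp_ge0 ?heat_ge0//; exact: (mF k).2.
- by move=> u k l kl; rewrite lee_wpmul2l ?pos_exp_ge0// ndheat.
move=> u; apply: cvgeZl => //; apply: ereal_cvg_integral_nd.
- move=> k; apply: emeasurable_funM; first exact: (mF k).1.
  by apply/measurable_EFinP; exact: measurable_hky.
- by move=> k y; rewrite mule_ge0 ?hk_ge0E//; exact: (mF k).2.
- by move=> y k l kl; rewrite lee_wpmul2r ?hk_ge0E// nF.
by move=> y; apply: cvgeZr => //; exact: Fh.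
Qed.

Lemma cvg_resolvent0 h z : mge0 h ->
  resolvent (k.+1%:R^-1) h z @[k --> \oo] --> resolvent 0 h z.
Proof.
move=> mh; apply: ereal_cvg_integral_nd.
- by move=> k; apply: emeasurable_funM; [exact: measurable_pos_exp|exact: measurable_heatu].
- by move=> k u; rewrite mule_ge0 ?pos_exp_ge0 ?heat_ge0//; exact: mh.2.
- move=> u k l kl; apply: lee_wpmul2r; first by apply: heat_ge0; exact: mh.2.
  rewrite lee_fin /pos; have [u0|] := ltP 0 u; last by rewrite !mul0r.
  rewrite !mul1r ler_expR !mulNr lerN2 ler_pM2r// lef_pV2 ?posrE ?ltr0n//.
  by rewrite ler_nat.
move=> u; have [u0|u0] := ltP 0 u; last first.
  have p0 : pos u = 0 by rewrite /pos ltNge u0.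
  rewrite (_ : (fun k => _) = cst 0%E); first by rewrite p0 mul0r mul0e; exact: cvg_cst.
  by apply/funext => k; rewrite p0 mul0r mul0e.
apply: cvgeM; last exact: cvg_cst.
  by rewrite mule_defE eqe gt_eqF ?mulr_gt0 ?expR_gt0 ?/pos ?u0//= andbF.
apply: cvg_EFin; first by near=> k.
rewrite /=; apply: cvgM; first exact: cvg_cst.
apply: continuous_cvg; first exact: continuous_expR.
apply: cvgM; last exact: cvg_cst.
by apply: cvgN; exact: cvg_harmonic.
Unshelve. all: by end_near. Qed.

End potential.

(** * Comparison of potentials *)

Section comparison.
Context {R : realType} {n : nat}.
Local Notation E := 'rV[R]_n.
Local Notation lam := (leb n).
Variables (r : R) (b : 'I_n -> R).
Local Notation U := (resolvent r b).
Local Opaque resolvent.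

Lemma mge0_EFin (h : E -> R) : measurable_fun setT h -> (forall y, 0 <= h y) -> mge0 (EFin \o h).
Proof. by move=> mh h0; split; [exact/measurable_EFinP|move=> y; rewrite lee_fin]. Qed.

Lemma le_resolvent_param a c h z : mge0 h -> a <= c -> (U c h z <= U a h z)%E.
Proof.
move=> mh; rewrite le_eqVlt => /predU1P[->//|ac].
rewrite (resolvent_eq r b z mh ac) leeDl//.
apply: mule_ge0; first by rewrite lee_fin subr_ge0 ltW.
by apply: resolvent_ge0 => y; apply: resolvent_ge0; exact: mh.2.
Qed.

Variables (f1 f2 w1 w2 : E -> R).
Hypothesis mf1 : measurable_fun setT f1.
Hypothesis mf2 : measurable_fun setT f2.
Hypothesis mw1 : measurable_fun setT w1.
Hypothesis mw2 : measurable_fun setT w2.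
Hypothesis f1_ge0 : forall y, 0 <= f1 y.
Hypothesis f2_ge0 : forall y, 0 <= f2 y.
Hypothesis w1_ge0 : forall y, 0 <= w1 y.
Hypothesis w2_ge0 : forall y, 0 <= w2 y.
Hypothesis hw1 : {ae lam, forall y, U 0 (EFin \o f1) y = (w1 y)%:E}.
Hypothesis hw2 : {ae lam, forall y, U 0 (EFin \o f2) y = (w2 y)%:E}.
Hypothesis opp : {ae lam, forall y, f2 y < f1 y -> w1 y < w2 y}.

Let g y := Num.max (w1 y - w2 y) 0.
(* With [l = m + 2] and [k = l * g + ex m], [f1 + l * w1 <= f2 + l * w2 + k];
   since w_i = U_l (f_i + l * w_i) this gives [g <= U_l k], and the resolvent
   equation then lowers [l] to 0, leaving [g <= U_0 (ex m)]. By [opp], [ex m]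
   decreases to 0. *)
Let ex (m : nat) y := if w1 y < w2 y then Num.max (f1 y - f2 y - m.+2%:R * (w2 y - w1 y)) 0 else 0.

Let mg : mge0 (EFin \o g).
Proof.
apply: mge0_EFin; last by move=> y; rewrite le_max lexx orbT.
by apply: measurable_maxr => //; exact: measurable_funB.
Qed.

Let mex m : measurable_fun setT (ex m).
Proof.
apply: measurable_fun_ifT => //; first exact: measurable_fun_ltr.
apply: measurable_maxr => //; apply: measurable_funB; first exact: measurable_funB.
by apply: measurable_funM => //; exact: measurable_funB.
Qed.

Let ex_ge0 m y : 0 <= ex m y.
Proof. by rewrite /ex; case: ifP => // _; rewrite le_max lexx orbT. Qed.

Let ex_le m y : ex m y <= f1 y.
Proof.
rewrite /ex; case: ifP => // wy; rewrite ge_max f1_ge0 andbT.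
have : 0 <= m.+2%:R * (w2 y - w1 y) by rewrite mulr_ge0// subr_ge0 ltW.
by have := f2_ge0 y; lra.
Qed.

Let mE m : mge0 (EFin \o ex m).
Proof. by apply: mge0_EFin. Qed.

Let mF1 : mge0 (EFin \o f1). Proof. exact: mge0_EFin. Qed.
Let mF2 : mge0 (EFin \o f2). Proof. exact: mge0_EFin. Qed.
Let mW1 : mge0 (EFin \o w1). Proof. exact: mge0_EFin. Qed.
Let mW2 : mge0 (EFin \o w2). Proof. exact: mge0_EFin. Qed.

(** The resolvent equation between 0 and [c], with the two resolvents exchanged so that [U 0 f]
    stands inside [U c], where it may be replaced by [w] as they agree almost everywhere. *)
Lemma resolvent0E (f w : E -> R) c z : mge0 (EFin \o f) -> 0 < c ->
  {ae lam, forall y, U 0 (EFin \o f) y = (w y)%:E} ->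
  U 0 (EFin \o f) z = (U c (EFin \o f) z + c%:E * U c (EFin \o w) z)%E.
Proof.
move=> mf c0 hw; rewrite (resolvent_eq r b z mf c0) subr0 (resolvent_comm r b 0 c z mf).
by congr (_ + _ * _)%E; exact: eq_resolvent.
Qed.

Let K m (y : E) : \bar R := ((m.+2%:R)%:E * (g y)%:E + (ex m y)%:E)%E.

Let mK1 m : mge0 (fun y : E => ((m.+2%:R)%:E * (g y)%:E)%E).
Proof.
split; first by apply: measurable_funeM; exact: mg.1.
by move=> y; rewrite mule_ge0 ?lee_fin//; exact: (mg.2 y).
Qed.

Let mK m : mge0 (K m).
Proof.
split; first by apply: emeasurable_funD; [exact: (mK1 m).1|exact: (mE m).1].
by move=> y; apply: adde_ge0; [exact: (mK1 m).2|exact: (mE m).2].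
Qed.

Let UK m a z : U a (K m) z = ((m.+2%:R)%:E * U a (EFin \o g) z + U a (EFin \o ex m) z)%E.
Proof. by rewrite (resolventD r b a z (mK1 m) (mE m)) (resolventZ r b a z mg). Qed.

Lemma excess_le_resolvent m : {ae lam, forall z, ((g z)%:E <= U m.+2%:R (K m) z)%E}.
Proof.
pose l : R := m.+2%:R; have l0 : 0 < l by rewrite ltr0n.
have mlW (w : E -> R) : mge0 (EFin \o w) -> mge0 (fun y : E => (l%:E * (w y)%:E)%E).
  move=> [mw w0]; split; first exact: measurable_funeM.
  by move=> y; rewrite mule_ge0 ?lee_fin ?(ltW l0)//; exact: (w0 y).
have mFW (f w : E -> R) : mge0 (EFin \o f) -> mge0 (EFin \o w) ->
    mge0 (fun y : E => ((f y)%:E + l%:E * (w y)%:E)%E).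
  move=> [mf f0] mw; split; first by apply: emeasurable_funD => //; exact: (mlW _ mw).1.
  by move=> y; apply: adde_ge0; [exact: (f0 y)|exact: (mlW _ mw).2].
have UE (f w : E -> R) z : mge0 (EFin \o f) -> mge0 (EFin \o w) ->
    {ae lam, forall y, U 0 (EFin \o f) y = (w y)%:E} ->
    U 0 (EFin \o f) z = U l (fun y : E => ((f y)%:E + l%:E * (w y)%:E)%E) z.
  move=> mf mw hw; rewrite (resolvent0E z mf l0 hw).
  by rewrite (resolventD r b l z mf (mlW _ mw)) (resolventZ r b l z mw (ltW l0)).
have le z : (U l (fun y : E => ((f1 y)%:E + l%:E * (w1 y)%:E)%E) z <=
             U l (fun y : E => ((f2 y)%:E + l%:E * (w2 y)%:E)%E) z + U l (K m) z)%E.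
  rewrite -(resolventD r b l z (mFW _ _ mF2 mW2) (mK m)).
  apply: le_resolvent; first exact: (mFW _ _ mF1 mW1).2.
    by move=> y; apply: adde_ge0; [exact: (mFW _ _ mF2 mW2).2|exact: (mK m).2].
  (* Where w1 < w2, [ex] is by construction the missing amount; elsewhere [opp] gives f1 <= f2 and
     [g] is w1 - w2. *)
  move: opp; apply: filterS => y oy; rewrite /K /g /ex -/l -!EFinM -!EFinD lee_fin.
  have [w12|w21] := ltP (w1 y) (w2 y).
    rewrite [Num.max (w1 y - w2 y) 0]max_r; last by rewrite subr_le0 ltW.
    have : f1 y - f2 y - l * (w2 y - w1 y) <= Num.max (f1 y - f2 y - l * (w2 y - w1 y)) 0.
      by rewrite le_max lexx.
    by move: (Num.max _ _) => M; lra.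
  rewrite [Num.max (w1 y - w2 y) 0]max_l ?subr_ge0//.
  have : f1 y <= f2 y by rewrite leNgt; apply/negP => /oy; rewrite ltNge w21.
  lra.
move: hw1 hw2; apply: filterS2 => z h1 h2.
move: (le z); rewrite -(UE _ _ z mF1 mW1 hw1) -(UE _ _ z mF2 mW2 hw2) h1 h2.
have := resolvent_ge0 r b l z (mK m).2; rewrite -/l.
case: (resolvent r b l (K m) z) => [x| |]//=; last by move=> *; rewrite leey.
rewrite -EFinD !lee_fin => x0 H; rewrite /g ge_max x0 andbT; lra.
Qed.

(** The quantity [U 0 g] may be infinite, so the parameter is lowered only to [c > 0]. With A = U_c
    g, the previous bound and the resolvent equation give g + (l - c) A <= l A + U_c ex. The surplus
    c A is paid for by c A <= c U_c w1 = w1 - U_c f1, which also shows that A is finite; the term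
    [U_c f1] on the left comes from there. *)
Lemma excess_le_resolvent_param m j : {ae lam, forall z,
  ((g z)%:E + U j.+1%:R^-1 (EFin \o f1) z <= (w1 z)%:E + U 0 (EFin \o ex m) z)%E}.
Proof.
pose l : R := m.+2%:R; pose c : R := j.+1%:R^-1.
have c0 : 0 < c by rewrite invr_gt0 ltr0n.
have cl : c < l.
  apply: (@le_lt_trans _ _ 1); last by rewrite ltr1n.
  by rewrite invf_le1 ?ltr0n// ler1n.
move: hw1 (excess_le_resolvent m); apply: filterS2 => z h1 gz.
have gw z' : ((g z')%:E <= (w1 z')%:E)%E.
  by rewrite lee_fin /g ge_max w1_ge0 andbT gerBl.
set A := U c (EFin \o g) z.
have A0 : (0 <= A)%E by apply: resolvent_ge0; exact: mg.2.
have E1 := resolvent0E z mF1 c0 hw1.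
have Aw : (c%:E * A <= c%:E * U c (EFin \o w1) z)%E.
  apply: lee_wpmul2l; first by rewrite lee_fin ltW.
  by apply: le_resolvent; [exact: mg.2|exact: mW1.2|apply: aeW].
have Ur : (0 <= U c (EFin \o f1) z)%E by apply: resolvent_ge0; exact: mF1.2.
have S1 : (U c (EFin \o f1) z + c%:E * A <= (w1 z)%:E)%E.
  by rewrite -h1 E1 leeD2l.
have S2 : ((g z)%:E + (l - c)%:E * A <= l%:E * A + U c (EFin \o ex m) z)%E.
  rewrite -UK (resolvent_eq r b z (mK m) cl); apply: leeD; first exact: gz.
  apply: lee_wpmul2l; first by rewrite lee_fin subr_ge0 ltW.
  apply: le_resolvent; first exact: mg.2.
    by move=> y; apply: resolvent_ge0; exact: (mK m).2.
  exact: excess_le_resolvent.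
have S3 : (U c (EFin \o ex m) z <= U 0 (EFin \o ex m) z)%E.
  by apply: le_resolvent_param => //; exact: ltW.
apply: le_trans (leeD2l _ S3).
clear Aw E1; clearbody A.
move: (resolvent_ge0 r b c z (mE m).2) S2.
case: (U c (EFin \o ex m) z) => [B| |]//=; last by move=> *; rewrite leey.
have Af : A \is a fin_num.
  rewrite ge0_fin_numE//; rewrite ltNge; apply/negP; rewrite leye_eq => /eqP Ay.
  move: S1; rewrite Ay gt0_muley ?lte_fin// addey ?leye_eq//.
  by case: (U c _ z) Ur.
move: S1; rewrite -(fineK Af); move: Ur; case: (U c (EFin \o f1) z) => [u| |]//.
rewrite -!EFinM -!EFinD !lee_fin.
by move: (fine A) => x; lra.
Qed.

(** As j grows, [U_c f1] tends to [U 0 f1], which almost everywhere is the finite number [w1] and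
    cancels. *)
Lemma excess_le_resolvent0 : {ae lam, forall z, forall m,
  ((g z)%:E <= U 0 (EFin \o ex m) z)%E}.
Proof.
apply: ae_foralln => m.
have : {ae lam, forall z, forall j,
  ((g z)%:E + U j.+1%:R^-1 (EFin \o f1) z <= (w1 z)%:E + U 0 (EFin \o ex m) z)%E}.
  by apply: ae_foralln => j; exact: excess_le_resolvent_param.
move: hw1; apply: filterS2 => z h1 H.
have L : ((g z)%:E + U 0 (EFin \o f1) z <= (w1 z)%:E + U 0 (EFin \o ex m) z)%E.
  apply: (@cvge_le _ \oo%classic _ _ (fun j : nat => ((g z)%:E + U j.+1%:R^-1 (EFin \o f1) z)%E)).
    by apply: nearW => j; exact: H.
  apply: cvgeD; first by [].
    exact: cvg_cst.
  exact: cvg_resolvent0.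
move: L; rewrite h1 addeC; case: (U 0 (EFin \o ex m) z) => [x| |]//=; last by move=> *; rewrite leey.
by rewrite -!EFinD !lee_fin lerD2l.
Qed.

(** As [ex m] decreases to 0 and stays below [f1], the functions f1 - ex m increase to f1. Monotone
    convergence of their potentials, together with the finiteness of U_0 f1 = w1, yields g + w1 <=
    w1. *)
Lemma comparison : {ae lam, forall y, w1 y <= w2 y}.
Proof.
move: hw1 excess_le_resolvent0; apply: filterS2 => z h1 H.
pose h m y := f1 y - ex m y.
have mh m : mge0 (EFin \o h m).
  apply: mge0_EFin; first exact: measurable_funB.
  by move=> y; rewrite subr_ge0.
have nex y : {homo (ex^~ y) : k l / (k <= l)%N >-> l <= k}.
  move=> k l kl; rewrite /ex; case: ifP => // wy.
  rewrite ge_max !le_max lexx orbT andbT lerD2l lerN2.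
  apply/orP; left; apply: ler_wpM2r; first by rewrite subr_ge0 ltW.
  by rewrite ler_nat !ltnS.
have C : U 0 (EFin \o h m) z @[m --> \oo] --> U 0 (EFin \o f1) z.
  apply: cvg_resolvent => // y.
    by move=> k l kl; rewrite lee_fin lerB// nex.
  apply: cvg_EFin; first by apply: nearW.
  rewrite /= -[f1 y in X in _ --> X]subr0; apply: cvgB; first exact: cvg_cst.
  rewrite /ex; case: ltP => wy; last exact: cvg_cst.
  (* Here the strictness in [opp] matters: w2 - w1 > 0, so the excess is 0 as soon as m exceeds (f1
     - f2) / (w2 - w1). *)
  apply: cvg_near_cst; near=> m; apply/max_idPr.
  rewrite subr_le0 -ler_pdivrMr ?subr_gt0//.
  apply: le_trans (ler_norm _) _; apply: ltW.
  apply: (@lt_le_trans _ _ m%:R); last by rewrite ler_nat -addn2 leq_addr.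
  by near: m; exact: nbhs_infty_gtr.
have L : ((g z)%:E + U 0 (EFin \o f1) z <= (w1 z)%:E)%E.
  apply: (@cvge_le _ \oo%classic _ _ (fun m : nat => ((g z)%:E + U 0 (EFin \o h m) z)%E)).
    apply: nearW => m; rewrite -h1.
    rewrite (_ : U 0 (EFin \o f1) z = U 0 (EFin \o ex m) z + U 0 (EFin \o h m) z)%E.
      by rewrite leeD2r.
    apply: etrans (resolventD r b 0 z (mE m) (mh m)); apply: eq_resolvent.
    by apply: aeW => y; rewrite /= -EFinD /h addrC subrK.
  by apply: cvgeD => //; exact: cvg_cst.
move: L; rewrite h1 -EFinD lee_fin gerDr /g ge_max lexx andbT subr_le0//.
Unshelve. all: by end_near. Qed.

End comparison.

(** * Solutions as potentials *)

Section smoothing.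
Context {R : realType} {n : nat}.
Local Notation E := 'rV[R]_n.
Local Notation lam := (leb n).
Variables (r : R) (b : 'I_n -> R).
Hypothesis r_gt0 : 0 < r.

Let bv : E := \row_i b i.
Let kap (s : R) (y : E) : R := gauss s (y - s *: bv).

Let kap_ge0 s y : 0 <= kap s y. Proof. exact: ltW (gauss_gt0 _ _). Qed.

Lemma measurable_gauss_shift (s : R) (c : E) : measurable_fun setT (fun y : E => gauss s (y - c)).
Proof.
have mc : measurable_fun setT (fun y : E => (s, y - c)).
  by apply: measurable_fun_pair => //; exact: measurable_addr.
exact: (measurableT_comp measurable_gauss mc).
Qed.

(** Recentred at [z], the heat operator averages translates of [u] against [kap s], which makes
    [sqdist_tconv] applicable. *)
Lemma heat_tconv (s : R) (u : E -> R) z : measurable_fun setT u -> (forall y, 0 <= u y) ->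
  (\int[lam]_y (u (z + y) * kap s y)%:E < +oo)%E ->
  heat r b s (EFin \o u) z = (expR (- r * s) * tconv u (kap s) z)%:E.
Proof.
move=> mu u0 fin.
have mf : measurable_fun setT (fun y => (expR (- r * s) * (u y * gauss s (y - (z + s *: bv))))%:E).
  apply/measurable_EFinP; apply: measurable_funM => //; apply: measurable_funM => //.
  exact: measurable_gauss_shift.
rewrite /heat (eq_integral (fun y : E => (expR (- r * s) * (u y * gauss s (y - (z + s *: bv))))%:E)); last first.
  by move=> y _; rewrite /= -EFinM /hk mulrCA.
rewrite -(ge0_integral_translation z mf); last first.
  by move=> y; rewrite lee_fin !mulr_ge0 ?expR_ge0// ltW// gauss_gt0.
rewrite (eq_integral (fun y : E => ((expR (- r * s))%:E * (u (z + y) * kap s y)%:E)%E)); last first.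
  move=> y _; rewrite -EFinM [(y + z)%R]addrC; congr (_ * (_ * gauss _ _))%:E.
  by rewrite opprD addrACA subrr add0r.
have mu' : measurable_fun setT (fun y : E => u (z + y) * kap s y).
  apply: measurable_funM; last exact: measurable_gauss_shift.
  by apply: (measurableT_comp mu); exact: measurable_fun_rVD.
have u0' y : 0 <= u (z + y) * kap s y by rewrite mulr_ge0.
rewrite ge0_integralZl_EFin ?expR_ge0//; last 2 first.
- by move=> y _; rewrite lee_fin.
- exact/measurable_EFinP.
by rewrite RintegralK//; exact: integrableR_ge0.
Qed.

Let CK : R := 4 * expR (n%:R / 2 * ln 2).

(** Half of the Gaussian exponent pays for |x|^2, by |x|^2 exp (- |x|^2 / (4 s)) <= 4 s; doubling
    the variance changes the normalisation by 2^(n/2). Hence [CK] = 4 * 2^(n/2). *)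
Lemma nsq_gauss_le (s : R) (x : E) : 0 < s -> nsq x * gauss s x <= CK * s * gauss (2 * s) x.
Proof.
move=> s0; have s20 : 0 < 2 * s by rewrite mulr_gt0.
have pis : 0 < 2 * pi * s :> R by rewrite !mulr_gt0// pi_gt0.
have -> : gauss s x = expR (n%:R / 2 * ln 2) * expR (- (nsq x / (4 * s))) * gauss (2 * s) x.
  rewrite !gaussE// -!expRD; congr expR.
  rewrite (_ : 2 * pi * (2 * s) = 2 * (2 * pi * s)); last by ring.
  rewrite (lnM (x := 2)) ?posrE//; field; rewrite gt_eqF//.
have H : nsq x * expR (- (nsq x / (4 * s))) <= 4 * s.
  rewrite expRN ler_pdivrMr ?expR_gt0//.
  have := expR_ge1Dx (nsq x / (4 * s)).
  rewrite -(@ler_pM2l _ (4 * s)) ?mulr_gt0//; apply: le_trans.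
  rewrite mulrDr mulr1 mulrCA divff ?mulr1 ?gt_eqF ?mulr_gt0//.
  by rewrite lerDr mulr_ge0 ?(ltW s0).
rewrite mulrA ler_wpM2r ?(ltW (gauss_gt0 _ _))// mulrCA /CK.
rewrite [leRHS](_ : _ = expR (n%:R / 2 * ln 2) * (4 * s)); last by ring.
by rewrite ler_wpM2l ?expR_ge0.
Qed.

Lemma gauss_second_moment (s : R) : 0 < s ->
  (\int[lam]_y (nsq y * kap s y)%:E <= (2 * CK * s + 2 * s ^+ 2 * nsq bv)%:E)%E.
Proof.
move=> s0; have s20 : 0 < 2 * s by rewrite mulr_gt0.
have nsqD (x y : E) : nsq (x + y) <= 2 * nsq x + 2 * nsq y.
  rewrite /nsq !mulr_sumr -big_split/=; apply: ler_sum => i _; rewrite mxE.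
  by have := sqr_ge0 (x 0 i - y 0 i); nra.
have nsqZ : nsq (s *: bv) = s ^+ 2 * nsq bv.
  by rewrite /nsq mulr_sumr; apply: eq_bigr => i _; rewrite !mxE exprMn.
have mg (v : R) := @measurable_gauss_shift v (s *: bv).
pose F y : R := 2 * CK * s * gauss (2 * s) (y - s *: bv) + 2 * s ^+ 2 * nsq bv * kap s y.
have CK0 : 0 <= CK by rewrite mulr_ge0 ?expR_ge0.
apply: (@le_trans _ _ (\int[lam]_y (F y)%:E)%E).
  apply: ge0_le_integral_ae.
  - by move=> y; rewrite lee_fin mulr_ge0 ?nsq_ge0.
  - move=> y; rewrite lee_fin addr_ge0// !mulr_ge0 ?nsq_ge0 ?sqr_ge0 ?(ltW s0)//.
    exact: ltW (gauss_gt0 _ _).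
  apply: aeW => y; rewrite lee_fin /F.
  have H := nsq_gauss_le (y - s *: bv) s0.
  have := nsqD (y - s *: bv) (s *: bv); rewrite subrK nsqZ => N.
  have := ler_wpM2r (kap_ge0 s y) N; rewrite /kap; move: H.
  move: (gauss s _) (gauss (2 * s) _) (nsq (y - _)) (nsq bv) (nsq y) => g g2 N1 N2 N3.
  lra.
rewrite /F (eq_integral (fun y : E => ((2 * CK * s)%:E * (gauss (2 * s) (y - s *: bv))%:E +
    (2 * s ^+ 2 * nsq bv)%:E * (kap s y)%:E)%E)); last first.
  by move=> y _; rewrite -!EFinM -EFinD.
have c1 : 0 <= 2 * CK * s by rewrite !mulr_ge0 ?(ltW s0).
have c2 : 0 <= 2 * s ^+ 2 * nsq bv by apply: mulr_ge0; [rewrite mulr_ge0 ?sqr_ge0|exact: nsq_ge0].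
rewrite ge0_integralD//; last 4 first.
- by move=> y _; rewrite mule_ge0 ?lee_fin// ltW// gauss_gt0.
- by apply: measurable_funeM; apply/measurable_EFinP; exact: mg.
- by move=> y _; rewrite mule_ge0 ?lee_fin.
- by apply: measurable_funeM; apply/measurable_EFinP; exact: mg.
have ZE (c v : R) : 0 <= c -> 0 < v ->
    (\int[lam]_y (c%:E * (gauss v (y - s *: bv))%:E) = c%:E)%E.
  move=> c0 v0; rewrite ge0_integralZl_EFin//.
  - by rewrite integral_gauss// mule1.
  - by move=> y _; rewrite lee_fin ltW// gauss_gt0.
  - by apply/measurable_EFinP; exact: mg.
rewrite EFinD; apply: leeD; rewrite le_eqVlt; apply/orP; left; apply/eqP;
  [exact: (ZE _ _ c1 s20)|exact: (ZE _ _ c2 s0)].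
Qed.

(** Small translations are covered by continuity in mean square. For the others some coordinate of y
    exceeds [dl], and the crude bound by 4 times the integral of u^2 is affordable after
    multiplication by |y|^2 / dl^2 >= 1. *)
Lemma sqdist_transl_le (u : E -> R) (e : R) : trcont u -> 0 < e ->
  (\int[lam]_z (u z ^+ 2)%:E < +oo)%E ->
  exists2 K : R, 0 <= K & forall y, (sqdist (transl y u) u <= (e + K * nsq y)%:E)%E.
Proof.
move=> [mu tu] e0 u2; have [dl dl0 H] := tu e e0.
pose S := fine (\int[lam]_z (u z ^+ 2)%:E)%E.
have uS : (\int[lam]_z (u z ^+ 2)%:E)%E = S%:E.
  by rewrite fineK// ge0_fin_numE//; apply: integral_ge0 => z _; rewrite lee_fin sqr_ge0.
have S0 : 0 <= S by apply: fine_ge0; apply: integral_ge0 => z _; rewrite lee_fin sqr_ge0.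
exists (4 * S / dl ^+ 2); first by rewrite divr_ge0 ?sqr_ge0// mulr_ge0.
move=> y; have [/H {}H|yC] := pselect (cube n dl y).
  by apply: le_trans H _; rewrite lee_fin lerDl !mulr_ge0 ?nsq_ge0 ?invr_ge0 ?sqr_ge0.
pose z0 : E -> R := fun=> 0.
have mz0 : measurable_fun setT z0 by exact: measurable_cst.
apply: (le_trans (sqdist_triangle (measurable_transl y mu) mz0 mu)).
have -> : sqdist (transl y u) z0 = S%:E.
  have -> : sqdist (transl y u) z0 = sqdist (transl y u) (transl y z0) by [].
  by rewrite sqdist_transl// -uS; apply: eq_integral => z _; rewrite subr0.
have -> : sqdist z0 u = S%:E.
  by rewrite -uS; apply: eq_integral => z _; rewrite sub0r sqrrN.
have [i yi] : exists i, dl < `|y 0 i|.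
  apply: contrapT => /forallNP yn; apply: yC => i.
  by have /negP := yn i; rewrite -leNgt ler_norml /= in_itv.
have Ny : dl ^+ 2 <= nsq y.
  rewrite /nsq (bigD1 i)//= -[leLHS]addr0 lerD//; last by apply: sumr_ge0 => j _; exact: sqr_ge0.
  by rewrite -[leRHS]real_normK ?num_real// lerXn2r ?nnegrE ?(ltW dl0) ?(ltW yi).
rewrite -EFinM -EFinD lee_fin.
have d20 : 0 < dl ^+ 2 by rewrite exprn_gt0.
have : 4 * S <= 4 * S / dl ^+ 2 * nsq y.
  rewrite -mulrA mulrC mulrC ler_peMr ?mulr_ge0//.
  by rewrite mulrC ler_pdivlMr// mul1r.
lra.
Qed.

(* As s goes to 0 the left-hand side of the hypothesis tends to [u] in mean
   square, because translations are continuous in mean square. *)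
Lemma le_of_heat_le (u : E -> R) (h : E -> \bar R) (k M : R) : 0 < k -> measurable_fun setT u ->
  supported k u -> (forall y, 0 <= u y <= M) -> mge0 h ->
  (forall s z, 0 < s -> (heat r b s (EFin \o u) z <= h z)%E) ->
  {ae lam, forall z, ((u z)%:E <= h z)%E}.
Proof.
move=> k0 mu su uM [mh h0] hu.
have u0 y : 0 <= u y by have /andP[] := uM y.
have M0 : 0 <= M by have /andP[] := uM 0; exact: le_trans.
have u2 : (\int[lam]_z (u z ^+ 2)%:E < +oo)%E.
  apply: (@le_lt_trans _ _ (\int[lam]_z ((M ^+ 2)%:E * (\1_(cube n k) z)%:E))%E).
    apply: ge0_le_integral_ae.
    - by move=> z; rewrite lee_fin sqr_ge0.
    - by move=> z; rewrite mule_ge0 ?lee_fin ?sqr_ge0.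
    apply: aeW => z; rewrite -EFinM lee_fin indicE.
    have [zk|zk] := pselect (cube n k z).
      by rewrite mem_set// mulr1 lerXn2r ?nnegrE//; have /andP[] := uM z.
    by rewrite (supportedP su zk) expr0n/= mulr_ge0 ?sqr_ge0.
  rewrite ge0_integralZl_EFin ?sqr_ge0//; last first.
    by apply/measurable_EFinP; apply: measurable_indic; exact: measurable_cube.
  rewrite integral_indic ?setIT//; last exact: measurable_cube.
  by rewrite lte_mul_pinfty ?lee_fin ?sqr_ge0//; exact: leb_cube_lty.
have tu := trcont_L2 k0 mu su u2.
have mk s : measurable_fun setT (kap s) by exact: measurable_gauss_shift.
have fin s z : 0 < s -> (\int[lam]_y (u (z + y) * kap s y)%:E <= M%:E)%E.
  move=> s0; apply: (@le_trans _ _ (\int[lam]_y (M%:E * (kap s y)%:E))%E).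
    apply: ge0_le_integral_ae.
    - by move=> y; rewrite lee_fin mulr_ge0.
    - by move=> y; rewrite mule_ge0 ?lee_fin.
    by apply: aeW => y; rewrite -EFinM lee_fin ler_wpM2r//; have /andP[] := uM (z + y).
  rewrite ge0_integralZl_EFin//; last exact/measurable_EFinP.
    by rewrite integral_gauss// mule1.
  by move=> y _; rewrite lee_fin.
have tle s z : 0 < s -> 0 <= tconv u (kap s) z <= M.
  move=> s0; apply/andP; split; first by apply: Rintegral_ge0 => y _; rewrite mulr_ge0.
  rewrite -lee_fin -RintegralK; first exact: fin.
  apply: integrableR_ge0.
  - apply: measurable_funM; last exact: mk.
    by apply: (measurableT_comp mu); exact: measurable_fun_rVD.
  - by move=> y; rewrite mulr_ge0.
  - by apply: le_lt_trans (fin s z s0) _; exact: ltry.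
pose A (m : nat) := [set z : E | ((h z + m.+1%:R^-1%:E)%E <= (u z)%:E)%E].
have mA m : measurable (A m).
  rewrite -[A m]setTI; apply: measurable_lee => //; last exact/measurable_EFinP.
  exact: emeasurable_funD.
have A0 m : lam (A m) = 0.
  pose c : R := m.+1%:R^-1.
  have c0 : 0 < c by rewrite invr_gt0 ltr0n.
  (* Chebyshev's inequality: on [A m] the average [tconv u (kap s)] is below u by at least c / 2,
     whereas its squared distance to u is at most 2 e for small s. *)
  have small e : 0 < e -> (((c / 2) ^+ 2)%:E * lam (A m) <= (e + e)%:E)%E.
    move=> e0; have [K K0 HK] := sqdist_transl_le tu e0 u2.
    pose B := K * (2 * CK + 2 * nsq bv).
    have CK0 : 0 <= CK by rewrite mulr_ge0 ?expR_ge0.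
    have B0 : 0 <= B by rewrite mulr_ge0// addr_ge0// mulr_ge0// nsq_ge0.
    (* The bound 1 lets s^2 be replaced by s, the second bound keeps [K] times the second moment
       below e, and the third keeps the loss r s M due to killing below c / 2. *)
    pose s := Num.min 1 (Num.min (e / (B + 1)) (c / (2 * (r * M + 1)))).
    have rM : 0 < r * M + 1 by rewrite ltr_wpDl// mulr_ge0// ltW.
    have B1 : 0 < B + 1 by rewrite ltr_wpDl.
    have s0 : 0 < s by rewrite !lt_min ltr01 !divr_gt0// mulr_gt0.
    have s1 : s <= 1 by rewrite ge_min lexx.
    have sB : s * (B + 1) <= e by rewrite -ler_pdivlMr// !ge_min lexx orbT.
    have sc : s * (2 * (r * M + 1)) <= c.
      by rewrite -ler_pdivlMr ?mulr_gt0// !ge_min lexx !orbT.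
    apply: (@le_trans _ _ (sqdist (tconv u (kap s)) u)).
      rewrite -integral_cst//.
      apply: (@le_trans _ _ (\int[lam]_(z in A m) ((tconv u (kap s) z - u z) ^+ 2)%:E)%E).
        rewrite integral_mkcond [leRHS]integral_mkcond; apply: ge0_le_integral_ae.
        - by apply: erestrict_ge0 => z _; rewrite lee_fin sqr_ge0.
        - by apply: erestrict_ge0 => z _; rewrite lee_fin sqr_ge0.
        apply: aeW; apply: lee_restrict => z Az; rewrite lee_fin.
        have := hu s z s0; rewrite heat_tconv//; last first.
          by apply: le_lt_trans (fin s z s0) _; exact: ltry.
        have /andP[t0 tM] := tle s z s0.
        move: Az (h0 z); rewrite /A/=; case: (h z) => [x| |]//.
        rewrite -EFinD !lee_fin -/c => xu x0 tx.
        have E1 : 1 - r * s <= expR (- r * s).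
          by have := expR_ge1Dx (- r * s); lra.
        have E2 : (1 - r * s) * tconv u (kap s) z <= x.
          by apply: le_trans tx; rewrite ler_wpM2r.
        have E3 : r * s * tconv u (kap s) z <= r * s * M.
          by rewrite ler_wpM2l// mulr_ge0// ltW.
        have E4 : c / 2 <= u z - tconv u (kap s) z by nra.
        rewrite -[leRHS]sqrrN opprB lerXn2r ?nnegrE ?divr_ge0 ?(ltW c0)//.
        by apply: le_trans E4; rewrite divr_ge0 ?(ltW c0).
      rewrite integral_mkcond; apply: ge0_le_integral_ae.
      - by apply: erestrict_ge0 => z _; rewrite lee_fin sqr_ge0.
      - by move=> z; rewrite lee_fin sqr_ge0.
      apply: aeW => z; rewrite patchE; case: ifP => // _.
      by rewrite lee_fin sqr_ge0.
    apply: (le_trans (sqdist_tconv mu (mk s) (kap_ge0 s) _ u2 _)).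
    - exact: integral_gauss.
    - exists (expR (- (n%:R / 2 * ln (2 * pi * s)))) => y.
      rewrite /kap gaussE// ler_expR gerBl divr_ge0 ?nsq_ge0// mulr_ge0// ltW//.
    apply: (@le_trans _ _ (\int[lam]_y (e%:E * (kap s y)%:E + K%:E * (nsq y * kap s y)%:E))%E).
      apply: ge0_le_integral_ae.
      - by move=> y; rewrite mule_ge0 ?sqdist_ge0 ?lee_fin.
      - move=> y; rewrite adde_ge0// mule_ge0 ?lee_fin ?(ltW e0) ?mulr_ge0 ?nsq_ge0//.
      apply: aeW => y; rewrite -!EFinM -EFinD mulrA -mulrDl EFinM.
      by rewrite lee_wpmul2r ?lee_fin.
    have mn : measurable_fun setT (fun y : E => nsq y * kap s y).
      by apply: measurable_funM => //; exact: measurable_nsq.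
    rewrite ge0_integralD//; last 4 first.
    - by move=> y _; rewrite mule_ge0 ?lee_fin ?(ltW e0).
    - by apply: measurable_funeM; exact/measurable_EFinP.
    - by move=> y _; rewrite mule_ge0 ?lee_fin ?mulr_ge0 ?nsq_ge0.
    - by apply: measurable_funeM; exact/measurable_EFinP.
    rewrite !ge0_integralZl_EFin ?(ltW e0)//; last 4 first.
    - by move=> y _; rewrite lee_fin mulr_ge0 ?nsq_ge0.
    - exact/measurable_EFinP.
    - by move=> y _; rewrite lee_fin.
    - exact/measurable_EFinP.
    rewrite integral_gauss// mule1 EFinD leeD2l//.
    have K0E : (0 <= K%:E)%E by rewrite lee_fin.
    apply: (le_trans (lee_wpmul2l K0E (gauss_second_moment s0))).
    rewrite -EFinM lee_fin; apply: le_trans sB.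
    have ss : s ^+ 2 <= s by rewrite expr2 ler_piMl// ltW.
    have := ler_wpM2r (nsq_ge0 bv) ss => ss2.
    rewrite [leRHS](_ : _ = K * (2 * CK * s + 2 * (s * nsq bv)) + s); last by rewrite /B; ring.
    rewrite -[leLHS]addr0 lerD ?(ltW s0)// ler_wpM2l// lerD2l -mulrA.
    by rewrite ler_wpM2l.
  apply/eqP; rewrite eq_le measure_ge0 andbT.
  have c20 : 0 < (c / 2) ^+ 2 by rewrite exprn_gt0// divr_gt0.
  rewrite -(@lee_pmul2l _ ((c / 2) ^+ 2)%:E) ?lte_fin// mule0.
  apply/lee_addgt0Pr => e e0; rewrite add0e.
  by have := small (e / 2) _; rewrite -splitr; apply; rewrite divr_gt0.
apply: (@negligibleS _ _ _ _ (\bigcup_m A m)); last first.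
  by apply: negligible_bigcup => m; exists (A m); split; [exact: mA|exact: A0|exact: subset_refl].
move=> z /= /negP; rewrite -ltNge => hz.
move: (h0 z) hz; case hE : (h z) => [x| |]//.
rewrite !lee_fin lte_fin => x0 xu.
have : 0 < u z - x by rewrite subr_gt0.
move=> d0; have [m _ /(_ m (leqnn m)) Hm] := near_natSinv_le d0.
exists m => //; rewrite /A/= hE -EFinD lee_fin.
rewrite -lerBrDl//.
Qed.

End smoothing.

(** * Identification of a solution with the potential of its source *)

Section representation.
Context {R : realType} {n : nat}.
Local Notation E := 'rV[R]_n.
Local Notation lam := (leb n).
Local Notation TR := (measurableTypeR R).
Local Notation mu := (@lebesgue_measure R).
Variables (r : R) (b : 'I_n -> R) (om : E -> R).
Hypothesis r_gt0 : 0 < r.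
Hypothesis om_cont : continuous om.
Hypothesis om_gt0 : forall z, 0 < om z.
Hypothesis om_gexp : forall a : R, 0 < a -> lam.-integrable setT (EFin \o (fun y => gexp a y / om y)).
Variables w f : E -> R.
Hypothesis Lw : L2om om w.
Hypothesis Lf : L2om om f.
Hypothesis weq : forall k, csmooth k ->
  \int[lam]_z (w z * (2^-1 * (\sum_l pd l (pd l k) z) - \sum_l b l * pd l k z)) =
  \int[lam]_z ((r * w z - f z) * k z).
Hypothesis w_ge0 : forall y, 0 <= w y.
Hypothesis f_ge0 : forall y, 0 <= f y.
Hypothesis wlim : forall z, \int[lam]_y (w y * hk r b t z y) @[t --> +oo] --> (0 : R).

Local Opaque resolvent.

Let mW : mge0 (EFin \o w). Proof. by apply: mge0_EFin => //; case: Lw. Qed.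
Let mF : mge0 (EFin \o f). Proof. by apply: mge0_EFin => //; case: Lf. Qed.

Lemma heatE v u z : L2om om v -> 0 < u ->
  heat r b u (EFin \o v) z = (\int[lam]_y (v y * hk r b u z y))%:E.
Proof. by move=> Lv u0; rewrite -(RintegralK (integrable_hk b r_gt0 om_cont om_gt0 om_gexp z Lv u0)). Qed.

Lemma heat_evolution s z : 0 < s ->
  heat r b s (EFin \o w) z = (\int[mu]_(u in `[s, +oo[) heat r b u (EFin \o f) z)%E.
Proof.
move=> s0; pose S (k : nat) : set TR := `[s, s + k.+1%:R]%classic.
have mS k : measurable (S k) by exact: measurable_itv.
have ndS : nondecreasing_seq S.
  move=> k l kl; apply/subsetPset; apply: subset_itvl; rewrite bnd_simp lerD2l ler_nat ltnS//.
have US : \bigcup_k S k = `[s, +oo[%classic.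
  apply/seteqP; split=> [u [k _]|u]; first by rewrite /S /= !in_itv/= andbT => /andP[].
  rewrite /= in_itv/= andbT => su.
  have us0 : 0 <= u - s by rewrite subr_ge0.
  exists (Num.truncn (u - s)) => //; rewrite /S /= in_itv/= su/= -lerBlDl ltW//.
  by have /andP[] := truncn_itv us0.
have C1 := @ge0_nondecreasing_set_cvg_integral _ _ _ S (fun u => heat r b u (EFin \o f) z) mu ndS mS
  (fun k => measurable_funTS (measurable_heatu r b z mF)) (fun k u _ => heat_ge0 r b u z mF.2).
rewrite US in C1.
pose F t := \int[lam]_y (w y * hk r b t z y).
have ES k : (\int[mu]_(u in S k) heat r b u (EFin \o f) z = (F s - F (s + k.+1%:R))%:E)%E.
  rewrite -(evolution r_gt0 om_cont om_gt0 om_gexp Lw Lf weq z s0); last by rewrite ltrDl ltr0n.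
  apply: eq_integral => u /set_mem; rewrite /S/= in_itv/= => /andP[su _].
  by rewrite heatE//; exact: lt_le_trans su.
rewrite heatE// -/(F s); apply/esym; apply: (cvg_unique _ C1) => //.
rewrite (_ : (fun k => _) = fun k => (F s - F (s + k.+1%:R))%:E); last by apply/funext.
apply: cvg_EFin; first by apply: nearW.
rewrite /= -[F s in X in _ --> X]subr0; apply: cvgB; first exact: cvg_cst.
apply: (cvg_comp _ F _ (wlim z)).
apply/cvgryPge => A; near=> k.
have : A <= k%:R by near: k; exact: nbhs_infty_ger.
rewrite -addn1 natrD; have := ltW s0; move: (k%:R : R) => x; lra.
Unshelve. all: by end_near. Qed.

(** Both sides are the integral of [heat u f] over times u beyond s, by the semigroup property on
    the left and by [heat_evolution] on the right. *)
Lemma heat_resolvent0 s z : 0 < s ->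
  heat r b s (resolvent r b 0 (EFin \o f)) z = heat r b s (EFin \o w) z.
Proof.
move=> s0; rewrite heat_resolvent// heat_evolution//.
have mh : measurable_fun setT (fun u : TR => heat r b u (EFin \o f) z) by exact: measurable_heatu.
rewrite -integral_itv_obnd_cbnd; last exact: measurable_funTS.
rewrite [RHS]integral_mkcond.
have mr : measurable_fun setT ((fun u : TR => heat r b u (EFin \o f) z) \_ `]s, +oo[).
  by apply/(measurable_restrictT _ _).1 => //; exact: measurable_funTS.
rewrite -[RHS](ge0_integral_shift s mr); last first.
  by apply: erestrict_ge0 => u _; apply: heat_ge0; exact: mF.2.
apply: eq_integral => u _; rewrite patchE mem_setE in_itv/= andbT ltrDr /pos oppr0 mul0r expR0 mulr1.
rewrite [(s + u)%R]addrC; move: (heat _ _ _ _ _) => q.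
by case: (0 < u); rewrite ?mul1e ?mul0e.
Qed.

Lemma resolvent0_ge_heat s z : 0 < s ->
  (heat r b s (EFin \o w) z <= resolvent r b 0 (EFin \o f) z)%E.
Proof.
move=> s0; rewrite heat_evolution// integral_mkcond.
apply: ge0_le_integral_ae.
- by apply: erestrict_ge0 => u _; apply: heat_ge0; exact: mF.2.
- by move=> u; rewrite mule_ge0 ?pos_exp_ge0 ?heat_ge0//; exact: mF.2.
apply: aeW => u; rewrite patchE mem_setE in_itv/= andbT oppr0 mul0r expR0 mulr1.
case: ifPn => su; first by rewrite /pos (lt_le_trans s0 su) mul1e.
by rewrite mule_ge0 ?lee_fin ?pos_ge0 ?heat_ge0//; exact: mF.2.
Qed.

(** [le_of_heat_le] asks for bounded functions of compact support; it is applied to the truncations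
    [u M], which lie below [w] and equal it at any given point once M is large. *)
Lemma le_resolvent0 : {ae lam, forall z, ((w z)%:E <= resolvent r b 0 (EFin \o f) z)%E}.
Proof.
pose u (M : nat) z := Num.min (w z) M.+1%:R * \1_(cube n M.+1%:R) z.
have mw : measurable_fun setT w by case: Lw.
have uw M z : 0 <= u M z <= w z.
  rewrite /u; have m0 : 0 <= Num.min (w z) M.+1%:R by rewrite le_min w_ge0 ler0n.
  rewrite mulr_ge0//= indicE; case: (_ \in _); rewrite ?mulr1 ?mulr0//.
  by rewrite ge_min lexx.
have H M : {ae lam, forall z, ((u M z)%:E <= resolvent r b 0 (EFin \o f) z)%E}.
  apply: (@le_of_heat_le _ _ r b r_gt0 (u M) _ M.+1%:R M.+1%:R).
  - by rewrite ltr0n.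
  - apply: measurable_funM; first by apply: measurable_minr.
    by apply: measurable_indic; exact: measurable_cube.
  - by apply: supportedI => z zM; rewrite /u indicE memNset// mulr0.
  - move=> z; have /andP[-> _] := uw M z; rewrite /u indicE.
    by case: (_ \in _); rewrite ?mulr0 ?mulr1 ?ler0n// ge_min lexx orbT.
  - exact: mge0_resolvent.
  move=> s z s0; apply: le_trans (resolvent0_ge_heat z s0).
  apply: le_heat; [move=> y|exact: mW.2|apply: aeW => y]; rewrite lee_fin.
    by have /andP[] := uw M y.
  by have /andP[] := uw M y.
have := ae_foralln H; apply: filterS => z Hz.
have [k _ zk] : (\bigcup_k cube n k%:R) z by rewrite bigcup_cube.
pose M := maxn k (Num.truncn (w z)).
have wM : w z <= M.+1%:R.
  have /andP[_ /ltW tw] := truncn_itv (w_ge0 z).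
  by apply: le_trans tw _; rewrite ler_nat ltnS leq_maxr.
have := Hz M; rewrite /u indicE mem_set ?mulr1.
  by rewrite (min_idPl wM).
apply: (subset_cube _ zk); rewrite ler_nat; apply: leqW; exact: leq_maxl.
Qed.

(* Both sides have the same finite heat transform at time 1, and the heat
   kernel is positive. *)
Lemma resolvent0_eq : {ae lam, forall z, resolvent r b 0 (EFin \o f) z = (w z)%:E}.
Proof.
pose h := resolvent r b 0 (EFin \o f).
have mh : mge0 h by exact: mge0_resolvent.
have h1 := heat_resolvent0 0 ltr01; rewrite -/h in h1.
have fin : (heat r b 1 h 0 < +oo)%E by rewrite h1 heatE// ltry.
pose g (y : E) : \bar R := (h y * (hk r b 1 0 y)%:E)%E.
pose g' (y : E) : \bar R := ((w y)%:E * (hk r b 1 0 y)%:E)%E.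
have mhk : measurable_fun setT (fun y : E => (hk r b 1 0 y)%:E).
  by apply/measurable_EFinP; exact: measurable_hky.
have mg : measurable_fun setT g by apply: emeasurable_funM => //; exact: mh.1.
have mg' : measurable_fun setT g' by apply: emeasurable_funM => //; exact: mW.1.
have ig : lam.-integrable setT g.
  apply/integrableP; split=> //; rewrite (eq_integral g)// => y _.
  by rewrite gee0_abs// mule_ge0 ?hk_ge0E//; exact: mh.2.
have ig' : lam.-integrable setT g'.
  apply/integrableP; split=> //; rewrite (eq_integral g').
    by rewrite -[X in (X < _)%E]h1.
  by move=> y _; rewrite gee0_abs// mule_ge0 ?hk_ge0E//; exact: mW.2.
have gg' : {ae lam, forall y, (g' y <= g y)%E}.
  by move: le_resolvent0; apply: filterS => y H; rewrite lee_wpmul2r ?hk_ge0E.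
have E0 : (\int[lam]_y (g y - g' y) = 0)%E.
  rewrite integralB// -[X in (X - _)%E]/(heat r b 1 h 0) h1 subee// heatE//.
have /ae_eq_integral_abs H : (\int[lam]_y `|g y - g' y| = 0)%E.
  rewrite -[RHS]E0; apply: ae_eq_integral_nonmeas; move: gg'; apply: filterS => y gy _.
  by rewrite gee0_abs// suber_ge0 // /g' -EFinM.
have {}H : ae_eq lam setT (fun y => g y - g' y)%E (cst 0%E).
  by apply: H => //; exact: emeasurable_funB.
move: H; apply: filterS => y /(_ Logic.I)/=.
rewrite /g -/h; have := hk_gt0 r b 1 0 y; have := mh.2 y.
case: (h y) => [x| |]// x0 k0.
  rewrite -EFinM -EFinD => -[] /eqP; rewrite -mulrBl mulf_eq0 (gt_eqF k0) orbF subr_eq0.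
  by move=> /eqP ->.
by rewrite gt0_mulye.
Qed.

End representation.

(** * Growth of the inverse weight *)

Section weight_bound.
Context {R : realType} {n : nat}.
Local Notation E := 'rV[R]_n.
Local Notation lam := (leb n).
Variables (sigma : 'M[R]_n) (C gamma : R).
Hypothesis C0 : 0 < C.
Hypothesis gamma_ge0 : 0 <= gamma.

Let l1 (y : E) : R := \sum_j `|y 0 j|.

Let l1_ge0 y : 0 <= l1 y. Proof. exact: sumr_ge0. Qed.

(** The weight is a power of 1 + |Theta y|^2 times an exponential Jacobian, and [Theta] is itself
    exponential: the inverse weight grows at most exponentially in y. *)
Lemma inv_weight_le : exists K L : R, [/\ 0 <= K, 0 <= L &
  forall y, (om sigma C gamma y)^-1 <= K * expR (L * l1 y)].
Proof.
pose S : R := \sum_i \sum_j `|sigma i j|.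
have S0 : 0 <= S by apply: sumr_ge0 => i _; exact: sumr_ge0.
have slin_le i (y : E) : `|slin sigma y 0 i| <= S * l1 y.
  rewrite /slin mxE; apply: (le_trans (ler_norm_sum _ _ _)).
  rewrite /l1 mulr_sumr; apply: ler_sum => j _; rewrite mxE normrM mulrC ler_wpM2r//.
  rewrite /S (bigD1 i)//= (bigD1 j)//= -!addrA lerDl addr_ge0//.
    by apply: sumr_ge0.
  by apply: sumr_ge0 => k _; exact: sumr_ge0.
have irho_le y : irho2 sigma gamma y <= (n.+1%:R `^ (2 * gamma)) * expR (4 * gamma * S * l1 y).
  rewrite /irho2.
  have -> : expR (4 * gamma * S * l1 y) = expR (2 * S * l1 y) `^ (2 * gamma).
    by rewrite /powR gt_eqF ?expR_gt0// expRK; congr expR; ring.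
  rewrite -powRM ?expR_ge0//; apply: ge0_ler_powR; rewrite ?nnegrE ?mulr_ge0 ?expR_ge0//.
    by rewrite addr_ge0// sumr_ge0// => i _; exact: sqr_ge0.
  have E1 : 1 <= expR (2 * S * l1 y).
    by rewrite -[leLHS]expR0 ler_expR !mulr_ge0.
  rewrite -natr1 mulrDl mul1r addrC lerD//.
  apply: (@le_trans _ _ (\sum_(i < n) expR (2 * S * l1 y))); last first.
    by rewrite sumr_const card_ord [leRHS]mulr_natl.
  apply: ler_sum => i _; rewrite -expRM_natl ler_expR -mulrA ler_wpM2l//.
  by apply: le_trans (slin_le i y); exact: ler_norm.
have ijac_le y : ijac sigma C y <= C^-1 * expR (n%:R * S * l1 y).
  rewrite /ijac ler_wpM2l ?invr_ge0 ?(ltW C0)// ler_expR.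
  apply: le_trans (ler_norm _) _; rewrite normrN /sumslin.
  apply: (le_trans (ler_norm_sum _ _ _)).
  apply: (@le_trans _ _ (\sum_(i < n) S * l1 y)); first by apply: ler_sum => i _.
  by rewrite sumr_const card_ord -mulrA [leRHS]mulr_natl.
exists (n.+1%:R `^ (2 * gamma) * C^-1), (4 * gamma * S + n%:R * S); split.
- by rewrite mulr_ge0 ?powR_ge0 ?invr_ge0 ?(ltW C0).
- by rewrite addr_ge0 ?mulr_ge0.
move=> y; have -> : (om sigma C gamma y)^-1 = irho2 sigma gamma y * ijac sigma C y.
  rewrite ijacE// /om invfM; congr (_ * _).
  have rn : rho gamma (Theta sigma y) ^+ 2 != 0 by rewrite gt_eqF// exprn_gt0// rho_gt0.
  by apply: (mulfI rn); rewrite divff// irho2K.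
rewrite (mulrDl (4 * gamma * S)) expRD mulrACA ler_pM//.
- exact: powR_ge0.
- by rewrite mulr_ge0 ?expR_ge0 ?invr_ge0 ?(ltW C0).
Qed.

Lemma integrable_gexp_weight (a : R) : 0 < a ->
  lam.-integrable setT (EFin \o (fun y => gexp a y / om sigma C gamma y)).
Proof.
move=> a0; have [K [L [K0 L0 H]]] := inv_weight_le.
have a20 : 0 < a / 2 by rewrite divr_gt0.
(* In each coordinate L x <= a x^2 / 2 + c, by completing the square; half of the Gaussian rate
   remains. *)
pose c : R := L ^+ 2 / (2 * a).
apply: integrableR_le (integrableZR (K * expR (n%:R * c)) (integrable_gexp a20)).
  apply: measurable_funM; first exact: measurable_gexp.
  by apply: continuous_rV_measurable; apply: om_contV; [exact: om_cont|exact: om_gt0].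
move=> y; rewrite ger0_norm; last by rewrite divr_ge0 ?expR_ge0 ?ltW// om_gt0.
rewrite mulrC; apply: (le_trans (ler_wpM2r (expR_ge0 _) (H y))).
rewrite -!mulrA ler_wpM2l// /gexp -!expRD ler_expR.
have -> : n%:R * c = \sum_(i < n) c.
  by rewrite sumr_const card_ord mulr_natl.
rewrite /l1 /nsq !mulr_sumr -!sumrN -!big_split/=; apply: ler_sum => i _.
rewrite -[y 0 i ^+ 2]real_normK ?num_real//; set x := `|y 0 i|.
rewrite -subr_ge0 (_ : _ - _ = (a * x - L) ^+ 2 / (2 * a)); last by rewrite /c; field; rewrite gt_eqF.
by rewrite divr_ge0 ?sqr_ge0// mulr_ge0// ltW.
Qed.

End weight_bound.

(** * Integration against a measure with a density *)

Section change_of_density.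
Context d (T : measurableType d) (R : realType).
Variables (mu m : {measure set T -> \bar R}) (g : T -> R).
Hypothesis mg : measurable_fun setT g.
Hypothesis g_ge0 : forall x, 0 <= g x.
Hypothesis mE : forall A, measurable A -> m A = (\int[mu]_(x in A) (g x)%:E)%E.

Lemma ge0_integral_density (F : T -> \bar R) : measurable_fun setT F ->
  (forall x, 0 <= F x)%E -> (\int[m]_x F x = \int[mu]_x (F x * (g x)%:E))%E.
Proof.
move=> mF F0; have mgE : measurable_fun setT (EFin \o g) by exact/measurable_EFinP.
have simple (h : {nnsfun T >-> R}) :
    (\int[m]_x (h x)%:E = \int[mu]_x ((h x)%:E * (g x)%:E))%E.
  rewrite integralT_nnsfun sintegralE.
  have mI y : measurable (h @^-1` [set y]) by exact: measurable_funPTI.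
  have h0 y : range h y -> 0 <= y by move=> [x _ <-].
  transitivity (\sum_(y \in range h) \int[mu]_x ((y%:E * (\1_(h @^-1` [set y]) x)%:E) * (g x)%:E))%E.
    apply: eq_fsbigr => y /set_mem/h0 y0; rewrite mE// integral_mkcond.
    rewrite -ge0_integralZl_EFin//.
    - apply: eq_integral => x _; rewrite patchE indicE.
      by case: ifP => xy; rewrite ?mule1// ?mule0 ?mul0e.
    - by move=> x _; apply: erestrict_ge0 => {}x _; rewrite lee_fin.
    - by apply/(measurable_restrictT _ _).1 => //; exact: measurable_funTS.
  rewrite -ge0_integral_fsum//.
  - apply: eq_integral => x _; rewrite [in RHS](fimfunE h) -fsumEFin//.
    rewrite ge0_mule_fsuml//.
    move=> y; rewrite lee_fin indicE.
    by case: (boolP (x \in _)) => [/set_mem/= <-|_]; rewrite ?mulr1 ?mulr0.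
  - move=> y; apply: emeasurable_funM => //; apply: measurable_funeM.
    by apply/measurable_EFinP; exact: measurable_indic.
  - move=> y x _; rewrite mule_ge0 ?lee_fin// indicE.
    by case: (boolP (x \in _)) => [/set_mem/= <-|_]; rewrite ?mulr1 ?mulr0.
pose h := nnsfun_approx measurableT mF.
have Fh x : (h k x)%:E @[k --> \oo] --> F x by apply: cvg_nnsfun_approx.
have nd x : nondecreasing_seq (fun k => (h k x)%:E).
  by move=> k l kl; rewrite lee_fin; move/lefP : (nd_nnsfun_approx measurableT mF kl) => /(_ x).
have C1 := ereal_cvg_integral_nd (m := m) (fun k => _ : measurable_fun setT (fun x => (h k x)%:E))
  (fun k x => _ : (0 <= (h k x)%:E)%E) nd Fh.
have C2 : (\int[mu]_x ((h k x)%:E * (g x)%:E))%E @[k --> \oo] --> (\int[mu]_x (F x * (g x)%:E))%E.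
  apply: ereal_cvg_integral_nd.
  - by move=> k; apply: emeasurable_funM => //; exact/measurable_EFinP.
  - by move=> k x; rewrite mule_ge0 ?lee_fin.
  - by move=> x k l kl; apply: lee_wpmul2r; [rewrite lee_fin|exact: nd].
  - by move=> x; apply: cvgeZr.
have {}C1 : (\int[m]_x (h k x)%:E)%E @[k --> \oo] --> (\int[m]_x F x)%E.
  apply: C1 => [k|k x]; last by rewrite lee_fin.
  exact/measurable_EFinP.
rewrite (_ : (fun k => _) = (fun k => \int[m]_x (h k x)%:E)%E) in C2; last first.
  by apply/funext => k; rewrite simple.
exact: (cvg_unique _ C1 C2).
Qed.

End change_of_density.

(** * Wiener process and semigroup *)

Section wiener_marginal.
Context {R : realType} {n : nat}.
Local Notation E := 'rV[R]_n.
Local Notation lam := (leb n).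

Definition gauss_measure (t : R) (A : set E) : \bar R := (\int[lam]_(y in A) (gauss t y)%:E)%E.

Let measurable_gaussy t : measurable_fun setT (fun y : E => (gauss t y)%:E).
Proof.
have mc : measurable_fun setT (fun y : E => (t, y)) by exact: measurable_fun_pair.
by apply/measurable_EFinP; exact: (measurableT_comp measurable_gauss mc).
Qed.

Let gauss_measure0 t : gauss_measure t set0 = 0%E.
Proof. by rewrite /gauss_measure integral_set0. Qed.

Let gauss_measure_ge0 t A : (0 <= gauss_measure t A)%E.
Proof. by apply: integral_ge0 => y _; rewrite lee_fin ltW// gauss_gt0. Qed.

Let gauss_measure_sigma_additive t : semi_sigma_additive (gauss_measure t).
Proof.
apply: semi_sigma_additive_nng_induced; first exact: measurable_gaussy.
by move=> y; rewrite lee_fin ltW// gauss_gt0.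
Qed.

HB.instance Definition _ t := isMeasure.Build _ _ _ (gauss_measure t)
  (gauss_measure0 t) (gauss_measure_ge0 t) (@gauss_measure_sigma_additive t).

HB.instance Definition _ t := isMeasurableFun.Build _ _ _ _ (@canonical_process R n t)
  (@measurable_canonical_process R n t).

Context disp (T : measurableType disp) (P : probability T R).
Variable W : {RV P >-> path_space R n}.
Hypothesis hW : wiener_process W.

Let X (t : R) : {mfun T >-> E} := @canonical_process R n t \o W.

Lemma wiener_box t (A : 'I_n -> set R) : 0 < t -> (forall i, measurable (A i)) ->
  P (X t @^-1` box A) = (\prod_(i < n) normal_prob 0 (Num.sqrt t) (A i))%E.
Proof.
move=> t0 mA; have [W0 Wn Wi] := hW.
(* A single time interval is used, m = 1, so only the times 0 and t enter; independence is then that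
   of the coordinates. *)
pose tt (k : nat) : R := if k is 0 then 0 else t.
have := Wi 1%N tt (fun _ j => A j) (lexx 0) _ (fun _ j => mA j).
have htt : {homo tt : k l / (k <= l)%N >-> k <= l}.
  by move=> [|k] [|l] //= _; exact: ltW.
move=> /(_ htt); rewrite big_ord1 /= => H.
rewrite [RHS](eq_bigr (fun j => P [set w | A j (canonical_process t (W w) 0 j -
  canonical_process 0 (W w) 0 j)])); last first.
  by move=> j _; rewrite (Wn j 0 t (A j) (lexx 0) t0 (mA j)) subr0.
rewrite -H; pose S := [set w | forall j, A j (canonical_process t (W w) 0 j -
    canonical_process 0 (W w) 0 j)].
have -> : [set w | forall (k : 'I_1) j, A j (canonical_process t (W w) 0 j -
    canonical_process (tt k) (W w) 0 j)] = S.
  apply/seteqP; split=> w /= Hw; first by move=> j; exact: (Hw ord0 j).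
  by move=> k j; rewrite (ord1 k); exact: Hw.
have mX s : measurable_fun setT (fun w => canonical_process s (W w)).
  exact: (measurableT_comp (@measurable_canonical_process R n s) (measurable_funPT W)).
have mC s (j : 'I_n) : measurable_fun setT (fun w => canonical_process s (W w) 0 j).
  exact: (measurableT_comp (measurable_coord j) (mX s)).
have mL : measurable S.
  have -> : S = \bigcap_(j in [set: 'I_n])
      ((fun w => canonical_process t (W w) 0 j - canonical_process 0 (W w) 0 j) @^-1` A j).
    by apply/seteqP; split=> w /= Hw => [j _|j]; exact: Hw.
  apply: fin_bigcap_measurable => // j _; rewrite -[X in measurable X]setTI.
  by apply: (measurable_funB (mC t j) (mC 0 j)).
have mB : measurable (X t @^-1` box A).
  by rewrite -[Y in measurable Y]setTI; exact: (mX t _ _ (measurable_box mA)).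
have eW w : canonical_process 0 (W w) = 0 ->
    (X t @^-1` box A) w <-> S w.
  by move=> w0; split=> /= Hw j; have := Hw j; rewrite /X/= w0 mxE subr0.
(* The position and the increment from time 0 agree only almost surely, W starting at 0 outside a
   null set; the probabilities are therefore compared as integrals of indicators. *)
have -> : P (X t @^-1` box A) = (\int[P]_(w in X t @^-1` box A) 1%E)%E by rewrite integral_cst// mul1e.
rewrite -[RHS]mul1e -integral_cst// [LHS]integral_mkcond [RHS]integral_mkcond.
apply: ae_eq_integral_nonmeas; move: W0; apply: filterS => w /eW w0 _; rewrite !patchE.
have [w1 w2] := w0.
have [B1|B1] := boolP (w \in X t @^-1` box A).
  by rewrite mem_set//; apply: w1; exact/set_mem.
by rewrite memNset// => /w2 Bw; move/negP : B1; apply; exact/mem_set.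
Qed.

Lemma wiener_law t (A : set E) : 0 < t -> measurable A ->
  distribution P (X t) A = (\int[lam]_(y in A) (gauss t y)%:E)%E.
Proof.
move=> t0 mA.
apply: (@rV_measure_unique R n (distribution P (X t)) (gauss_measure t) _ _ A mA).
  move=> B mB; apply: (etrans (wiener_box t0 mB)).
  apply/esym; transitivity (\int[lam]_(y in box B) (gauss t y)%:E)%E; first by [].
  rewrite integral_mkcond.
  rewrite (eq_integral (fun y : E => (\prod_i (\1_(B i) (y 0 i) * gk t (y 0 i)))%:E)); last first.
    move=> y _; rewrite patchE; case: ifPn => [/set_mem yB|/negP yB].
      by congr EFin; apply: eq_bigr => i _; rewrite indicE mem_set ?mul1r//; exact: yB.
    have [i Bi] : exists i, ~ B i (y 0 i).
      by apply: contrapT => /forallNP H; apply: yB; apply/mem_set => i; apply: contrapT; exact: H.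
    by rewrite (bigD1 i)//= indicE memNset// !mul0r.
  have mgk : measurable_fun setT (gk t).
    have mc : measurable_fun setT (fun y : R => (t, y)) by exact: measurable_fun_pair.
    exact: (measurableT_comp measurable_gk mc).
  rewrite (leb_integral_prod (g := fun i x => \1_(B i) x * gk t x)).
  - apply: eq_bigr => i _; rewrite /normal_prob [RHS]integral_mkcond; apply: eq_integral => x _.
    by rewrite patchE indicE gk_pdf//; case: (x \in B i); rewrite ?mul1r ?mul0r.
  - by move=> i; apply: measurable_funM => //; exact: measurable_indic.
  - by move=> i x; rewrite mulr_ge0// ltW// gk_gt0.
move=> k; apply: (@le_lt_trans _ _ (distribution P (X t) setT)).
  by apply: le_measure; rewrite ?inE//; exact: measurable_cube.
by rewrite probability_setT ltry.
Qed.

Lemma ge0_integral_wiener t (F : E -> \bar R) : 0 < t -> measurable_fun setT F ->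
  (forall y, 0 <= F y)%E ->
  (\int[P]_w F (canonical_process t (W w)) = \int[lam]_y (F y * (gauss t y)%:E))%E.
Proof.
move=> t0 mF F0.
rewrite -(ge0_integral_density (m := distribution P (X t)) _ _ (fun A => wiener_law t0) mF F0).
- by rewrite (ge0_integral_distribution (X t)).
- by apply/measurable_EFinP; exact: measurable_gaussy.
- by move=> y; rewrite ltW// gauss_gt0.
Qed.

End wiener_marginal.

(** * The semigroup in logarithmic coordinates *)

Section semigroup.
Context {R : realType} {n : nat}.
Local Notation E := 'rV[R]_n.
Local Notation D := (@orthant R n).
Local Notation lam := (leb n).
Variables (sigma : 'M[R]_n) (r : R) (delta : 'I_n -> R).
Hypothesis sigmaU : sigma \in unitmx.
Local Notation Th := (Theta sigma).
Local Notation lg := (logT sigma).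
Local Notation b := (beta sigma r delta).

Let bv : E := \row_i b i.

(** The logarithm of the process is affine in t and W, and [slin] carries the vector [beta] to r -
    delta_i - a_ii / 2, because sigma times its inverse cancels. *)
Lemma canonical_gbm t z0 (p : path_space R n) : 0 <= t ->
  canonical_process t (gbm r delta sigma (Th z0) p) = Th (z0 + t *: bv + canonical_process t p).
Proof.
move=> t0.
transitivity (gbm_val r delta sigma (Th z0) (set_val (nonneg_time t)) (canonical_process t p)).
  by [].
have -> : set_val (nonneg_time t) = t by rewrite /=; apply/max_idPr.
apply/rowP => i; rewrite [LHS]mxE [RHS]mxE [Th z0 0 i]mxE -expRD; congr expR.
have slinZ (c : R) (y : E) : slin sigma (c *: y) = c *: slin sigma y by rewrite /slin scalemxAl.
rewrite !slinD slinZ [RHS]mxE [X in _ = X + _]mxE [X in _ = _ + X + _]mxE -[RHS]addrA; congr (_ + (_ + _)).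
  rewrite mulrC; congr (_ * _).
  have -> : bv = (\row_j (r - delta j - (sigma *m sigma^T) j j / 2)) *m (invmx sigma)^T.
    by apply/rowP => l; rewrite !mxE; apply: eq_bigr => j _; rewrite !mxE mulrC.
  by rewrite /slin -mulmxA -trmx_mul mulmxV// trmx1 mulmx1 [RHS]mxE.
by rewrite mxE; apply: eq_bigr => j _; rewrite !mxE mulrC.
Qed.

Context disp (T : measurableType disp) (P : probability T R).
Variable W : {RV P >-> path_space R n}.
Hypothesis hW : wiener_process W.
Local Notation Px := (gbm_law W r delta sigma).

Lemma ge0_integral_gbm t z0 (F : E -> \bar R) : 0 < t -> measurable_fun setT F ->
  (forall y, 0 <= F y)%E ->
  (\int[Px (Th z0)]_p F (lg (canonical_process t p)) =
   \int[lam]_y (F y * (gauss t (y - (z0 + t *: bv)))%:E))%E.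
Proof.
move=> t0 mF F0; pose c := z0 + t *: bv.
have mlg : measurable_fun setT (fun p : path_space R n => lg (canonical_process t p)).
  exact: (measurableT_comp (measurable_logT sigma) (measurable_canonical_process t)).
rewrite (ge0_integral_distribution (gbm r delta sigma (Th z0) \o W)); last 2 first.
- exact: (measurableT_comp mF mlg).
- by [].
have mFc : measurable_fun setT (fun y : E => F (c + y)).
  by apply: (measurableT_comp mF); exact: measurable_fun_rVD.
transitivity (\int[P]_w (F (c + canonical_process t (W w))%R))%E.
  apply: eq_integral => w _; congr F; apply: etrans (ThetaK sigmaU _); congr (lg _).
  exact: canonical_gbm z0 (W w) (ltW t0).
rewrite (ge0_integral_wiener hW t0 mFc (fun y => F0 _)).
have mG : measurable_fun setT (fun y : E => (F y * (gauss t (y - c))%:E)%E).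
  by apply: emeasurable_funM => //; apply/measurable_EFinP; exact: measurable_gauss_shift.
rewrite -[RHS](ge0_integral_translation c mG); last first.
  by move=> y; rewrite mule_ge0// lee_fin ltW// gauss_gt0.
by apply: eq_integral => y _; rewrite addrK addrC.
Qed.

(** [v] coincides with [w \o logT] only off a null set of the orthant. The law of X_t charges
    neither this set, since it has a density in the coordinates z, nor the complement of the
    orthant. *)
Lemma semigroup_heat t z0 (v w : E -> R) : 0 < t -> rep sigma v w -> (forall y, 0 <= w y) ->
  ((expR (- r * t))%:E * semigroup Px t v (Th z0) = heat r b t (EFin \o w) z0)%E.
Proof.
move=> t0 [mw [N [mN N0 HN]]] w0; pose c := z0 + t *: bv.
have mc (A : set E) : measurable A -> measurable (canonical_process t @^-1` A : set (path_space R n)).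
  by move=> mA; rewrite -[X in measurable X]setTI; exact: measurable_canonical_process.
have mlN : measurable (lg @^-1` N).
  by rewrite -[X in measurable X]setTI; exact: measurable_logT.
have nullN : Px (Th z0) (canonical_process t @^-1` (lg @^-1` N)) = 0%E.
  have mi : measurable_fun setT (fun y : E => (\1_N y)%:E : \bar R).
    by apply/measurable_EFinP; exact: measurable_indic.
  have := ge0_integral_gbm z0 t0 mi (fun y => ltac:(by rewrite lee_fin)).
  have -> : (\int[lam]_y ((\1_N y)%:E * (gauss t (y - (z0 + t *: bv)))%:E) = 0)%E.
    rewrite (ae_eq_integral_nonmeas (g := fun=> 0%E)); first exact: integral0.
    exists N; split=> // y /= H; apply: contrapT => yN; apply: H => _.
    by rewrite indicE memNset// mul0e.
  move=> <-; rewrite (_ : (fun p => _) = (fun p : path_space R n =>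
     (\1_(canonical_process t @^-1` (lg @^-1` N)) p)%:E)).
    by rewrite integral_indic ?setIT//; exact: mc.
  by apply/funext => p; rewrite !indicE.
have nullD : Px (Th z0) (canonical_process t @^-1` (~` D)) = 0%E.
  have e : (gbm r delta sigma (Th z0) \o W) @^-1` (canonical_process t @^-1` (~` D)) = set0.
    apply/seteqP; split=> // w1 H; apply: H.
    have e := canonical_gbm z0 (W w1) (ltW t0).
    change (D (canonical_process t (gbm r delta sigma (Th z0) (W w1)))).
    by rewrite e; exact: Theta_orthant.
  transitivity (P ((gbm r delta sigma (Th z0) \o W) @^-1` (canonical_process t @^-1` (~` D)))).
    by [].
  by rewrite e measure0.
rewrite /semigroup unlock.
rewrite (ae_eq_integral_nonmeas (g := fun p => (w (lg (canonical_process t p)))%:E)); last first.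
  apply: (@negligibleS _ _ _ _ ((canonical_process t @^-1` (lg @^-1` N)) `|`
    (canonical_process t @^-1` (~` D)))).
    move=> p /= H; apply: contrapT => /not_orP[pN /contrapT pD]; apply: H => _.
    congr EFin; rewrite -[in v _](logTK sigmaU pD); apply: contrapT => vw.
    by apply: pN; exact: HN.
  apply: negligibleU.
    by exists (canonical_process t @^-1` (lg @^-1` N)); split=> //; exact: mc.
  exists (canonical_process t @^-1` (~` D)); split=> //; apply: mc.
  by apply: measurableC; exact: measurable_orthant.
have mwE : measurable_fun setT (EFin \o w) by exact/measurable_EFinP.
rewrite (ge0_integral_gbm z0 t0 mwE); last by move=> y; rewrite lee_fin.
rewrite /heat -ge0_integralZl_EFin ?expR_ge0//.
- by apply: eq_integral => y _; rewrite /= -!EFinM /hk mulrCA.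
- by move=> y _; rewrite mule_ge0// lee_fin// ltW// gauss_gt0.
- by apply: emeasurable_funM => //; apply/measurable_EFinP; exact: measurable_gauss_shift.
Qed.

End semigroup.

(** * From variational solutions to potentials *)

Section potential_representation.
Context {R : realType} {n : nat}.
Local Notation E := 'rV[R]_n.
Local Notation D := (@orthant R n).
Local Notation lam := (leb n).
Variables (sigma : 'M[R]_n) (C gamma r : R) (delta : 'I_n -> R).
Hypothesis sigmaU : sigma \in unitmx.
Hypothesis C0 : 0 < C.
Hypothesis intTh : forall F : E -> \bar R, measurable_fun D F ->
    (forall x, D x -> 0 <= F x)%E ->
    (\int[leb n]_(x in D) F x =
     \int[leb n]_z (F (Theta sigma z) * (C * expR (sumslin sigma z))%:E))%E.
Hypothesis gamma_ge0 : 0 <= gamma.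
Hypothesis r_gt0 : 0 < r.
Context disp (T : measurableType disp) (P : probability T R).
Variable W : {RV P >-> path_space R n}.
Hypothesis hW : wiener_process W.
Variable B : (E -> R) -> (E -> R) -> R.
Hypothesis hB : is_BBS gamma r delta sigma B.
Local Notation b := (beta sigma r delta).

Lemma solution_potential psi F v : variational_solution gamma r sigma B psi F v ->
  (forall x, 0 <= psi x) -> (forall x y, 0 <= F x y) ->
  (forall x, orthant x ->
    ((expR (- r * t))%:E * semigroup (gbm_law W r delta sigma) t v x)%E
      @[t --> +oo] --> 0%E) ->
  exists w f, [/\ rep sigma v w, rep sigma (fun x => F x (v x)) f,
    forall y, 0 <= w y, forall y, 0 <= f y &
    {ae lam, forall z, resolvent r b 0 (EFin \o f) z = (w z)%:E}].
Proof.
move=> sv psi0 F0 hlim.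
have [w0 [f0 [[mw0 vw0] Lw0 [mf0 Ff0] Lf0 weq0]]] := weak_equation sigmaU C0 intTh hB sv.
have vpsi : {ae lam, forall z, psi (Theta sigma z) <= v (Theta sigma z)}.
  by apply/(ae_Theta sigmaU C0 intTh (fun x => psi x <= v x)); case: sv.
(* Since v >= psi >= 0 and F >= 0, taking positive parts alters the representatives on null sets
   only, and makes nonnegativity hold at every point. *)
pose w z := Num.max (w0 z) 0; pose f z := Num.max (f0 z) 0.
have ww0 : {ae lam, forall z, w z = w0 z}.
  move: vw0 vpsi; apply: filterS2 => z e vp; rewrite /w -e.
  by apply/max_idPl; exact: le_trans vp.
have ff0 : {ae lam, forall z, f z = f0 z}.
  by move: Ff0; apply: filterS => z e; rewrite /f -e; apply/max_idPl.
have mw : measurable_fun setT w by exact: measurable_maxr.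
have mf : measurable_fun setT f by exact: measurable_maxr.
have L2E (g g0 : E -> R) : measurable_fun setT g -> {ae lam, forall z, g z = g0 z} ->
    L2om (om sigma C gamma) g0 -> L2om (om sigma C gamma) g.
  move=> mg gg0 [_ g2]; split=> //.
  rewrite (ae_eq_integral_nonmeas (g := fun z => (g0 z ^+ 2 * om sigma C gamma z)%:E))//.
  by move: gg0; apply: filterS => z ->.
have Lw := L2E _ _ mw ww0 Lw0; have Lf := L2E _ _ mf ff0 Lf0.
have w_ge0 z : 0 <= w z by rewrite le_max lexx orbT.
have f_ge0 z : 0 <= f z by rewrite le_max lexx orbT.
have vw : rep sigma v w by split=> //; move: vw0 ww0; apply: filterS2 => z -> ->.
have Ff : rep sigma (fun x => F x (v x)) f.
  by split=> //; move: Ff0 ff0; apply: filterS2 => z -> ->.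
exists w, f; split=> //.
have oc : continuous (om sigma C gamma) by exact: om_cont.
have og z : 0 < om sigma C gamma z by exact: om_gt0.
have oe := @integrable_gexp_weight _ _ sigma C gamma C0 gamma_ge0.
apply: (resolvent0_eq r_gt0 oc og oe Lw Lf) => //.
- move=> k ck; transitivity (\int[lam]_z (w0 z * (2^-1 * (\sum_l pd l (pd l k) z) - \sum_l b l * pd l k z))).
    rewrite /Rintegral; congr fine; apply: ae_eq_integral_nonmeas.
    by move: ww0; apply: filterS => z -> _.
  rewrite weq0// /Rintegral; congr fine; apply: ae_eq_integral_nonmeas.
  by move: ww0 ff0; apply: filterS2 => z -> ->.
move=> z; have := hlim _ (@Theta_orthant R n sigma z) => /fine_cvg.
apply: cvg_trans; apply: near_eq_cvg; near=> t.
have t0 : 0 < t by near: t; exact: nbhs_pinfty_gt.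
rewrite /= (semigroup_heat r delta sigmaU hW z t0 vw w_ge0).
by rewrite (heatE b r_gt0 oc og oe z Lw t0).
Unshelve. all: by end_near. Qed.

End potential_representation.

(** * Uniqueness of the variational solution *)

Lemma positive_form_unitmx (R : realType) n (sigma : 'M[R]_n) :
  (forall x : 'rV[R]_n, x != 0 -> 0 < (x *m (sigma *m sigma^T) *m x^T) 0 0) ->
  sigma \in unitmx.
Proof.
move=> ha; rewrite -row_free_unit -kermx_eq0; apply: contraT => /rowV0Pn[x /sub_kermxP xs /ha].
by rewrite mulmxA xs !mul0mx mxE ltxx.
Qed.

Lemma Phi_lt (R : realType) n (r : R) (delta : 'I_n -> R) sigma psi N Dpsi D2psi x (y1 y2 : R) :
  Phi r delta sigma psi N Dpsi D2psi x y2 < Phi r delta sigma psi N Dpsi D2psi x y1 -> y1 < y2.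
Proof.
have Psi0 : 0 <= Psi_minus r delta sigma psi N Dpsi D2psi x by rewrite le_max lexx orbT.
rewrite /Phi !indicE !mem_setE !in_itv/= => H; rewrite ltNge; apply/negP => y21; move: H.
case: (leP y1 (psi x)) => y1p; first by rewrite (le_trans y21 y1p) ltxx.
by rewrite mulr0 ltNge mulr_ge0.
Qed.

Theorem proposition3p9 (R : realType) (d : nat) (hd : (1 <= d)%N)
  (r : R) (hr : 0 < r)
  (delta : 'I_d -> R) (hdelta : forall i, 0 <= delta i)
  (sigma : 'M[R]_d)
  (ha : forall x : 'rV[R]_d,
    x != 0 -> 0 < (x *m (sigma *m sigma^T) *m x^T) 0 0)
  (disp : measure_display) (T : measurableType disp) (P : probability T R)
  (W : {RV P >-> path_space R d}) (hW : wiener_process W)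
  (psi : 'rV[R]_d -> R) (hA1 : assumption_A1 psi)
  (N : set 'rV[R]_d) (hN : (lebesgue_rV d).-negligible N)
  (Dpsi : 'rV[R]_d -> 'rV[R]_d) (D2psi : 'rV[R]_d -> 'M[R]_d)
  (hpsi : forall x, ~ N x ->
    alexandrov_derivatives psi x (Dpsi x) (D2psi x))
  (hA2 : assumption_A2 r delta sigma psi N Dpsi D2psi
           (gbm_law W r delta sigma))
  (hgrowth : exists2 c : R, 0 < c & forall x, orthant x ->
    Psi_minus r delta sigma psi N Dpsi D2psi x <= c * (1 + enorm x))
  (gamma : R) (hgamma : (2 + d%:R) / 4 < gamma)
  (B : ('rV[R]_d -> R) -> ('rV[R]_d -> R) -> R)
  (hB : is_BBS gamma r delta sigma B)
  (v1 v2 : 'rV[R]_d -> R)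
  (hv1 : variational_solution gamma r sigma B psi
           (Phi r delta sigma psi N Dpsi D2psi) v1)
  (hlim1 : forall x, orthant x ->
    ((expR (- r * t))%:E * semigroup (gbm_law W r delta sigma) t v1 x)%E
      @[t --> +oo] --> 0%E)
  (hv2 : variational_solution gamma r sigma B psi
           (Phi r delta sigma psi N Dpsi D2psi) v2)
  (hlim2 : forall x, orthant x ->
    ((expR (- r * t))%:E * semigroup (gbm_law W r delta sigma) t v2 x)%E
      @[t --> +oo] --> 0%E) :
  ae_eq (lebesgue_rV d) orthant v1 v2.
Proof.
have sigmaU := positive_form_unitmx ha.
have [C C0 intTh] := integral_Theta sigmaU.
have gamma0 : 0 <= gamma.
  by apply: le_trans (ltW hgamma); rewrite divr_ge0// addr_ge0.
have psi0 x : 0 <= psi x by case: hA1.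
have Phi0 x y : 0 <= Phi r delta sigma psi N Dpsi D2psi x y.
  by rewrite mulr_ge0 ?indicE ?ler0n// le_max lexx orbT.
have [w1 [f1 [[mw1 vw1] [mf1 Ff1] w1_ge0 f1_ge0 E1]]] :=
  solution_potential sigmaU C0 intTh gamma0 hr hW hB hv1 psi0 Phi0 hlim1.
have [w2 [f2 [[mw2 vw2] [mf2 Ff2] w2_ge0 f2_ge0 E2]]] :=
  solution_potential sigmaU C0 intTh gamma0 hr hW hB hv2 psi0 Phi0 hlim2.
have vw : {ae leb d, forall z, v1 (Theta sigma z) = w1 z /\ v2 (Theta sigma z) = w2 z}.
  by apply: filterS2 vw1 vw2 => z.
have o12 : {ae leb d, forall y, f2 y < f1 y -> w1 y < w2 y}.
  by apply: filterS3 vw Ff1 Ff2 => z [<- <-] <- <-; exact: Phi_lt.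
have o21 : {ae leb d, forall y, f1 y < f2 y -> w2 y < w1 y}.
  by apply: filterS3 vw Ff1 Ff2 => z [<- <-] <- <-; exact: Phi_lt.
have w12 := comparison mf1 mf2 mw1 mw2 f1_ge0 f2_ge0 w1_ge0 w2_ge0 E1 E2 o12.
have w21 := comparison mf2 mf1 mw2 mw1 f2_ge0 f1_ge0 w2_ge0 w1_ge0 E2 E1 o21.
rewrite /ae_eq; change {ae leb d, forall x, orthant x -> v1 x = v2 x}.
apply/(ae_Theta sigmaU C0 intTh (fun x => v1 x = v2 x)).
by apply: filterS3 vw w12 w21 => z [-> ->] h12 h21; apply/le_anti; rewrite h12 h21.
Qed.
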